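(* Let $p$ be a prime. Let $\widetilde{A}$ be the ring of sparse algebraic generalized Laurent series over $\bar{\mathbb{F}}_p$, let $\widetilde{C}$ be the smallest non-trivial $\bar{\mathbb{F}}_p$-subalgebra of $\bar{\mathbb{F}}_p((t^{\mathbb{Q}}))$ that is Artin–Schreier closed in $\bar{\mathbb{F}}_p((t^{\mathbb{Q}}))$, and let $B$ be the set of generalized Laurent series $G(t)\in\bar{\mathbb{F}}_p((t^{\mathbb{Q}}))$ such that for some $j\ge 0$, $G(t^{p^j})\in L_0$ and $G(t^{p^j})$ is integral over $R$. Then $\widetilde{A}=B=\widetilde{C}$.
   Context: $\bar{\mathbb{F}}_p((t^{\mathbb{Q}}))$ is the (algebraically closed) field of generalized Laurent series $\sum_{\alpha\in\mathbb{Q}}f(\alpha)t^\alpha$, $f\colon\mathbb{Q}\to\bar{\mathbb{F}}_p$ with well-ordered support; for $c\in\mathbb{Q}_{>0}$, $F(t^c):=\sum f(\alpha)t^{c\alpha}$. $S_p=\{m/p^n\colon m,n\in\mathbb{Z}_{\ge0}\}$. A valid base-$p$ expansion is a word $u=u_1\cdots u_n$ ($n\ge1$) over $\{0,\dots,p-1,\bullet\}$ with $u_1\ne0$, $u_n\ne0$ and exactly one letter equal to the radix point $\bullet$ (say $u_j$); its value is $[u]_p=\sum_{i<j}u_ip^{j-1-i}+\sum_{i>j}u_ip^{j-i}$. Every element of $S_p$ has a unique valid base-$p$ expansion. A simple sparse subset of $S_p$ is a set $\{[u_1w_1^{n_1}u_2w_2^{n_2}\cdots w_s^{n_s}u_{s+1}]_p\colon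 n_1,\dots,n_s\ge0\}$, where $u_i$ are (possibly empty) words and $w_i$ are nonempty words such that every word $u_1w_1^{n_1}\cdots w_s^{n_s}u_{s+1}$ is a valid base-$p$ expansion; a sparse subset of $S_p$ is a finite union of simple sparse subsets. A generalized Laurent series $F$ with support $S$ is a sparse algebraic generalized Laurent series if it is algebraic over $\bar{\mathbb{F}}_p(t)$ and there are integers $a>0$, $b$ with $aS+b\subseteq S_p$ and $aS+b$ a sparse subset of $S_p$. Artin–Schreier closed: for subalgebras $B'\subseteq C'$ of $\bar{\mathbb{F}}_p((t^{\mathbb{Q}}))$, $B'$ is Artin–Schreier closed in $C'$ if (P1) whenever $F\in B'$ and $G\in C'$ satisfies $G^p-G+F=0$, then $G\in B'$; (P2) if $F(t)\in B'$ and $\alpha\in\bar{\mathbb{F}}_p$ then $F(\alpha t)\in B'$; (P3) if $F(t)\in B'$, $c\in\mathbb{Q}_{>0}$, $d\in\mathbb{Q}$ and $t^dF(t^c)\in C'$ then $t^dF(t^c)\in B'$. $K=\bar{\mathbb{F}}_p(t^{1/n}\colon n\ge1,p\nmid n)$, $R=\mathbb{F}_p[t^{\pm1/n}\colon n\ge1,p\nmid n]$, all inside $\bar{\mathbb{F}}_p((t^{\mathbb{Q}}))$. For $\lambda\in\bar{\mathbb{F}}_p^*$, $\nu_\lambda$ is the unique extension to $K$ (value group $\mathbb{Z}$) of the order-of-vanishing valuation at $t=\lambda$ on $\bar{\mathbb{F}}_p(t)$. A finite extension $E/K$ is unramified outside $0$ and $\infty$ if for every $\lambda\in\bar{\mathbb{F}}_p^*$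 every extension of $\nu_\lambda$ to $E$ has value group $\mathbb{Z}$. $L$ is the compositum of all finite Galois extensions of $K$ of degree a power of $p$, and $L_0$ is the set of $G\in L$ such that $K(G)/K$ is unramified outside $0$ and $\infty$. *)

(* Defs.v *)
From HB Require Import structures.
From mathcomp Require Import all_boot all_order all_algebra all_field.
From mathcomp Require Import mathcomp_extra boolp classical_sets cardinality.
From mathcomp Require Import fsbigop wochoice.
From mathcomp Require Import lra.

Set Implicit Arguments.
Unset Strict Implicit.
Unset Printing Implicit Defensive.
Import Order.TTheory GRing.Theory Num.Theory.
Local Open Scope classical_set_scope.
Local Open Scope ring_scope.

Section WellOrdered.
Implicit Types (A B T S : set rat) (q : rat).

Definition wo A := forall T, T `<=` A -> T !=set0 ->
  exists2 m, T m & forall x, T x -> m <= x.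

Lemma wo_chainP (P : {pred rat}) : wo_chain <=%R P <-> wo [set x | x \in P].
Proof.
split=> [Pwo T TP [x Tx]|Pwo].
  have sTP : sub_mem (mem (fun y => `[< T y >])) (mem P).
    by move=> y /asboolP /TP.
  have [|m [[/asboolP Tm mT] _]] := Pwo (fun y => `[< T y >]) sTP.
    by exists x; apply/asboolP.
  by exists m => // y Ty; apply: mT; apply/asboolP.
apply: antisymmetric_wo_chain => [x y _ _|]; first exact: le_anti.
move=> T TP [x Tx]; have [||m Tm mT] := Pwo [set y | y \in T].
- by move=> y; apply: TP.
- by exists x.
- by exists m; split.
Qed.

Lemma wo_sub A B : A `<=` B -> wo B -> wo A.
Proof. by move=> AB Bwo T /subset_trans /(_ AB); apply: Bwo. Qed.

Lemma woU A B : wo A -> wo B -> wo (A `|` B).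
Proof.
move=> Awo Bwo T TAB T0.
have [[x [Tx Ax]]|nA] := pselect ((T `&` A) !=set0); last first.
  apply: Bwo => // x Tx; case: (TAB _ Tx) => // Ax.
  by case: nA; exists x.
have [|a [Ta Aa] amin] := Awo (T `&` A) (@subIsetr _ _ _); first by exists x.
have [[y [Ty By]]|nB] := pselect ((T `&` B) !=set0); last first.
  apply: Awo => // z Tz; case: (TAB _ Tz) => // Bz.
  by case: nB; exists z.
have [|b [Tb Bb] bmin] := Bwo (T `&` B) (@subIsetr _ _ _); first by exists y.
exists (Order.min a b); first by rewrite minElt; case: ifP.
move=> z Tz; rewrite ge_min; case: (TAB _ Tz) => Hz.
  by rewrite amin.
by rewrite (bmin z) ?orbT.
Qed.

Lemma wo0 : wo set0.
Proof. by move=> T T0 [x /T0]. Qed.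

Lemma wo1 q : wo [set q].
Proof.
move=> T Tq [x Tx]; exists x => // y Ty.
by rewrite (Tq _ Tx) (Tq _ Ty).
Qed.

Lemma woD A B : wo A -> wo B -> wo [set a + b | a in A & b in B].
Proof.
move=> Awo Bwo.
pose P T b := exists a, [/\ A a, B b, T (a + b),
  (forall a' b', A a' -> B b' -> T (a' + b') -> a <= a') &
  (forall b', B b' -> T (a + b') -> b <= b')].
have Pex T : T `<=` [set a + b | a in A & b in B] -> T !=set0 -> exists b, P T b.
  move=> TAB [t Tt].
  have [|a [Aa [b0 Bb0 Tab0]] amin] :=
      Awo [set a | A a /\ exists2 b, B b & T (a + b)] (fun _ => @proj1 _ _).
    have [a Aa [b Bb abt]] := TAB _ Tt.
    by exists a; split=> //; exists b => //; rewrite abt.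
  have [|b [Bb Tab] bmin] := Bwo [set b | B b /\ T (a + b)] (fun _ => @proj1 _ _).
    by exists b0.
  exists b, a; split=> // [a' b' Aa' Bb' Tab'|b' Bb' Tab'].
    by apply: amin; split=> //; exists b'.
  exact: bmin.
apply: contrapT => /existsNP[T /not_implyP[TAB /not_implyP[T0 nomin]]].
pose bad b := exists T, [/\ T `<=` [set a + b | a in A & b in B], T !=set0,
  ~ (exists2 m, T m & forall x, T x -> m <= x) & P T b].
have [b Pb] := Pex _ TAB T0.
have [|b0 [T' [T'AB T'0 nomin' [a [Aa Bb0 Tab amin bmin]]]] b0min] :=
    Bwo [set b | bad b] _ (ex_intro _ b (ex_intro _ T (And4 TAB T0 nomin Pb))).
  by move=> c /= [T' [_ _ _ [a []]]].
pose U := T' `&` [set x | x < a + b0].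
have UAB : U `<=` [set a + b | a in A & b in B].
  by move=> x [/T'AB].
have U0 : U !=set0.
  apply: contrapT => U0; apply: nomin'; exists (a + b0) => // x Tx.
  by rewrite leNgt; apply/negP => ltx; apply: U0; exists x.
have [c [d [Ad Bc [Tdc dclt] dmin cmin]]] := Pex _ UAB U0.
suff : b0 <= c.
  by have := amin d c Ad Bc Tdc; move: dclt => /=; lra.
apply: b0min; exists U; split=> //; last by exists d; split.
move=> [m [Tm mlt] mmin]; apply: nomin'; exists m => // x Tx.
have [xlt|xge] := ltP x (a + b0); first exact: mmin.
by apply: le_trans xge; apply: ltW.
Qed.

Lemma wo_finite A B q : wo A -> wo B -> finite_set [set a | A a /\ B (q - a)].
Proof.
move=> Awo Bwo; set S := [set a | _].
have Smin T : T `<=` S -> T !=set0 -> exists2 m, T m & forall x, T x -> m <= x.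
  by move=> TS; apply: Awo => x /TS[].
have Smax T : T `<=` S -> T !=set0 -> exists2 m, T m & forall x, T x -> x <= m.
  move=> TS [t Tt].
  have [||m Tm mmin] := Bwo [set b | T (q - b)].
  - by move=> b /TS[_]; rewrite opprB addrC subrK.
  - by exists (q - t); rewrite /= opprB addrC subrK.
  - exists (q - m) => // x Tx.
    have : m <= q - x by apply: mmin; rewrite /= opprB addrC subrK.
    lra.
apply: contrapT => Sinf.
have S0 : S !=set0 by apply/set0P/eqP => S0; apply: Sinf; rewrite S0.
pose I x := S `&` [set y | y <= x].
have [M SM Mmax] := Smax S (@subset_refl _ _) S0.
have [||m [Sm Im] mmin] := Smin [set x | S x /\ ~ finite_set (I x)].
- by move=> x [].
- exists M; split=> //; suff -> : I M = S by [].
  by apply/seteqP; split=> [x []//|x Sx]; split=> //; apply: Mmax.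
pose J := S `&` [set y | y < m].
have ImE : I m = J `|` [set m].
  apply/seteqP; split=> [x [Sx /=]|x].
    by rewrite le_eqVlt => /orP[/eqP->|]; [right|left].
  by case=> [[Sx /= /ltW]|->]; split=> //=.
have Jinf : ~ finite_set J.
  by move=> Jfin; apply: Im; rewrite ImE finite_setU; split.
have J0 : J !=set0 by apply/set0P/eqP => J0; apply: Jinf; rewrite J0.
have [n [Sn /= nm] nmax] := Smax J (@subIsetl _ _ _) J0.
suff : m <= n by rewrite leNgt nm.
apply: mmin; split=> //; suff -> : I n = J by [].
apply/seteqP; split=> [x [Sx /= xn]|x Jx].
  by split=> //=; apply: le_lt_trans nm.
by split; [case: Jx|apply: nmax].
Qed.

Lemma wo_seq A B q : wo A -> wo B ->
  exists2 s : seq rat, uniq s & forall r, r \in s <-> A r /\ B (q - r).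
Proof.
move=> Awo Bwo; have /finite_seqP[s sE] := wo_finite q Awo Bwo.
exists (undup s) => [|r]; first exact: undup_uniq.
by have /(congr1 (fun S : set rat => S r)) /= -> := sE; rewrite mem_undup.
Qed.

Fixpoint nsum A n : set rat :=
  if n is n'.+1 then [set a + b | a in A & b in nsum A n'] else [set 0].

Lemma wo_nsum A n : wo A -> wo (nsum A n).
Proof. by move=> Awo; elim: n => [|n IH] /=; [apply: wo1|apply: woD]. Qed.

Lemma nsum_ge A (e : rat) n x : (forall a, A a -> e <= a) ->
  nsum A n x -> e *+ n <= x.
Proof.
move=> Ae; elim: n x => [|n IH] x /=; first by move=> ->.
by move=> [a Aa [b /IH nb <-]]; rewrite mulrS lerD ?Ae.
Qed.

Lemma archi_mulrn (e q : rat) : 0 < e -> exists n, q < e *+ n.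
Proof.
move=> e0; exists (Num.bound `|q / e|).
rewrite -mulr_natr mulrC -ltr_pdivrMr //.
by apply: le_lt_trans (ler_norm _) _; apply: archi_boundP.
Qed.

Lemma wo_nsums A (e : rat) : 0 < e -> (forall a, A a -> e <= a) -> wo A ->
  wo (\bigcup_n nsum A n).
Proof.
move=> e0 Ae Awo T TA [t Tt].
have [N tN] := archi_mulrn t e0.
have Nwo : wo (\big[setU/set0]_(n < N) nsum A n).
  apply: big_ind => [|B C|n _]; first exact: wo0.
    exact: woU.
  exact: wo_nsum.
have [||m [Tm mt] mmin] := Nwo (T `&` [set x | x <= t]).
- move=> x [Tx /= xt]; have [n _ nx] := TA _ Tx.
  rewrite -bigcup_mkord; exists n => //=.
  rewrite ltnNge; apply/negP => Nn; have := nsum_ge Ae nx.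
  rewrite leNgt; apply/negP; rewrite negbK (le_lt_trans xt) // (lt_le_trans tN) //.
  by rewrite -[e *+ N]mulr_natr -[e *+ n]mulr_natr ler_pM2l // ler_nat.
- by exists t; split=> /=.
- exists m => // x Tx; have [xt|/ltW tx] := leP x t; first exact: mmin.
  exact: le_trans tx.
Qed.

End WellOrdered.

Record glaurent (k : fieldType) := Glaurent {
  gcoef :> rat -> k;
  _ : wo_chain <=%R (support gcoef)
}.

Section GLaurent.
Variable k : fieldType.
Implicit Types (F G H : glaurent k) (a : k) (q : rat).

HB.instance Definition _ := gen_eqMixin (glaurent k).
HB.instance Definition _ := gen_choiceMixin (glaurent k).

Definition gsupp F : set rat := [set q | F q != 0].

Lemma gsupp_wo F : wo (gsupp F).
Proof. by case: F => f wf; apply/(wo_chainP (support f)). Qed.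

Lemma glaurentP F G : F =1 G -> F = G.
Proof.
case: F G => [f wf] [g wg] /= /funext fg; rewrite fg in wf *.
by congr Glaurent; apply: Prop_irrelevance.
Qed.

Definition mkglaurent (f : rat -> k) (fwo : wo [set q | f q != 0]) :
  glaurent k := Glaurent ((wo_chainP (support f)).2 fwo).

Fact gzero_subproof : wo [set q | (0 : k) != 0].
Proof. by apply: wo_sub wo0 => q /=; rewrite eqxx. Qed.
Definition gzero := mkglaurent gzero_subproof.

(* The monomial a t^d. *)
Fact gmono_subproof d a : wo [set q | (if q == d then a else 0) != 0].
Proof. by apply: wo_sub (@wo1 d) => q /=; case: (q =P d) => //; rewrite eqxx. Qed.
Definition gmono d a := mkglaurent (@gmono_subproof d a).

Fact gopp_subproof F : wo [set q | - F q != 0].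
Proof. by apply: wo_sub (@gsupp_wo F) => q /=; rewrite oppr_eq0. Qed.
Definition gopp F := mkglaurent (@gopp_subproof F).

Fact gadd_subproof F G : wo [set q | F q + G q != 0].
Proof.
apply: wo_sub (woU (@gsupp_wo F) (@gsupp_wo G)) => q /= FG0.
have [F0|] := eqVneq (F q) 0; last by left.
by right; move: FG0; rewrite F0 add0r.
Qed.
Definition gadd F G := mkglaurent (@gadd_subproof F G).

Fact gscale_subproof a F : wo [set q | a * F q != 0].
Proof.
apply: (@wo_sub _ (gsupp F)); last exact: gsupp_wo.
by move=> q /=; apply: contra_neq => ->; rewrite mulr0.
Qed.
Definition gscale a F := mkglaurent (@gscale_subproof a F).

Definition conv F G q := \sum_(r \in [set: rat]) F r * G (q - r).

Lemma convE F G q (s : seq rat) : uniq s ->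
  (forall r, F r != 0 -> G (q - r) != 0 -> r \in s) ->
  conv F G q = \sum_(r <- s) F r * G (q - r).
Proof.
move=> us sP; rewrite /conv (@fsbigE _ _ _ _ _ s _ us) //; first by apply: eq_bigl => r; rewrite in_setT.
move=> r _ rs; apply/eqP; rewrite mulf_eq0; apply: contraNT rs.
by rewrite negb_or => /andP[]; apply: sP.
Qed.

Lemma conv_seq F G q :
  exists2 s, uniq s & forall r, (r \in s) = (F r != 0) && (G (q - r) != 0).
Proof.
have [s us sP] := wo_seq q (@gsupp_wo F) (@gsupp_wo G).
by exists s => // r; apply/idP/andP => /sP.
Qed.

Lemma conv_neq0 F G q : conv F G q != 0 ->
  exists2 r, F r != 0 & G (q - r) != 0.
Proof.
have [s us sP] := conv_seq F G q; rewrite (convE us); last first.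
  by move=> r Fr Gr; rewrite sP Fr.
case: s us sP => [|r s] us sP; first by rewrite big_nil eqxx.
by have := sP r; rewrite mem_head => /esym/andP[? ?] _; exists r.
Qed.

Fact gmul_subproof F G : wo [set q | conv F G q != 0].
Proof.
apply: wo_sub (woD (@gsupp_wo F) (@gsupp_wo G)) => q /conv_neq0[r Fr Gr].
by exists r => //; exists (q - r) => //; rewrite addrC subrK.
Qed.
Definition gmul F G := mkglaurent (@gmul_subproof F G).

Fact gaddA : associative gadd.
Proof. by move=> F G H; apply: glaurentP => q /=; rewrite addrA. Qed.
Fact gaddC : commutative gadd.
Proof. by move=> F G; apply: glaurentP => q /=; rewrite addrC. Qed.
Fact gadd0 : left_id gzero gadd.
Proof. by move=> F; apply: glaurentP => q /=; rewrite add0r. Qed.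
Fact gaddN : left_inverse gzero gopp gadd.
Proof. by move=> F; apply: glaurentP => q /=; rewrite addNr. Qed.

HB.instance Definition _ :=
  GRing.isZmodule.Build (glaurent k) gaddA gaddC gadd0 gaddN.

Fact gmulC : commutative gmul.
Proof.
move=> F G; apply: glaurentP => q /=.
have [s us sP] := conv_seq F G q.
rewrite (convE us) => [|r Fr Gr]; last by rewrite sP Fr.
rewrite (convE (s := map (fun r => q - r) s)) => [|| r Gr Fr].
- rewrite big_map; apply: eq_bigr => r _.
  by rewrite subKr mulrC.
- by rewrite map_inj_uniq // => x y /addrI/oppr_inj.
- apply/mapP; exists (q - r); last by rewrite subKr.
  by rewrite sP Fr subKr.
Qed.

Fact gmulA : associative gmul.
Proof.
move=> F G H; apply: glaurentP => q /=.
pose FGwo := woD (@gsupp_wo F) (@gsupp_wo G).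
pose GHwo := woD (@gsupp_wo G) (@gsupp_wo H).
have [A uA AE] := wo_seq q (@gsupp_wo F) GHwo.
have [C uC CE] := wo_seq q FGwo (@gsupp_wo H).
have AP r : r \in A <-> F r != 0 /\ exists b, G b != 0 /\ H (q - r - b) != 0.
  split=> [/AE[Fr [b Gb [c Hc bcE]]]|[Fr [b [Gb Hb]]]].
    by split=> //; exists b; split=> //; rewrite -bcE addrAC subrr add0r.
  by apply/AE; split=> //; exists b => //; exists (q - r - b) => //; rewrite addrC subrK.
have CP r : r \in C <-> H (q - r) != 0 /\ exists a : rat, F a != 0 /\ G (r - a) != 0.
  split=> [/CE[[a Fa [b Gb abE]] Hr]|[Hr [a [Fa Gr]]]].
    by split=> //; exists a; split=> //; rewrite -abE addrAC subrr add0r.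
  by apply/CE; split=> //; exists a => //; exists (r - a) => //; rewrite addrC subrK.
rewrite (convE uA) => [|r Fr /conv_neq0[b Gb Hb]]; last first.
  by apply/AP; split=> //; exists b.
rewrite [RHS](convE uC) => [|r /conv_neq0[a Fa Ga] Hr]; last first.
  by apply/CP; split=> //; exists a.
transitivity (\sum_(r <- A) \sum_(c <- C) F r * (G (c - r) * H (q - c))).
  apply: eq_big_seq => r /AP[Fr _] /=.
  rewrite (convE (s := [seq c - r | c <- C])) => [|| b Gb Hb].
  - rewrite big_map mulr_sumr; apply: eq_bigr => c _.
    by rewrite opprB addrA subrK.
  - by rewrite map_inj_uniq ?uC // => x y /addIr.
  - apply/mapP; exists (b + r); last by rewrite addrK.
    apply/CP; split; first by rewrite [b + r]addrC opprD addrA.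
    by exists r; split=> //; rewrite addrK.
rewrite exchange_big; apply: eq_big_seq => c /CP[Hc _] /=.
rewrite (convE uA) => [|r Fr Gr]; last first.
  apply/AP; split=> //; exists (c - r); split=> //.
  by rewrite opprB addrA subrK.
by rewrite mulr_suml; apply: eq_bigr => r _; rewrite mulrA.
Qed.

Lemma gmul_mono d a F q : gmul (gmono d a) F q = a * F (q - d).
Proof.
rewrite /= (convE (s := [:: d])) //= => [|r].
  by rewrite big_seq1 eqxx.
by rewrite inE; case: (r =P d) => //; rewrite eqxx.
Qed.

Definition gone := gmono 0 1.

Fact gmul1 : left_id gone gmul.
Proof. by move=> F; apply: glaurentP => q; rewrite gmul_mono mul1r subr0. Qed.

Fact gmulDl : left_distributive gmul gadd.
Proof.
move=> F G H; apply: glaurentP => q /=.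
have [s1 us1 s1P] := conv_seq F H q; have [s2 us2 s2P] := conv_seq G H q.
have us : uniq (undup (s1 ++ s2)) by rewrite undup_uniq.
rewrite !(convE us) => [|r Gr Hr|r Fr Hr|r FGr Hr].
- by rewrite -big_split; apply: eq_bigr => r _; rewrite /= mulrDl.
- by rewrite mem_undup mem_cat s2P Gr Hr orbT.
- by rewrite mem_undup mem_cat s1P Fr Hr.
- rewrite mem_undup mem_cat s1P s2P Hr !andbT.
  by move: FGr => /=; apply: contraNT; rewrite negb_or !negbK => /andP[/eqP-> /eqP->]; rewrite addr0.
Qed.

Fact gone_neq0 : gone != 0.
Proof.
apply/eqP => /(congr1 (fun F : glaurent k => F 0)) /=.
by move/eqP; rewrite oner_eq0.
Qed.

HB.instance Definition _ := GRing.Zmodule_isComNzRing.Build (glaurent k)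
  gmulA gmulC gmul1 gmulDl gone_neq0.

Fact gscaleA a b F : gscale a (gscale b F) = gscale (a * b) F.
Proof. by apply: glaurentP => q /=; rewrite mulrA. Qed.
Fact gscale1 : left_id 1 gscale.
Proof. by move=> F; apply: glaurentP => q /=; rewrite mul1r. Qed.
Fact gscaleDr : right_distributive gscale +%R.
Proof. by move=> a F G; apply: glaurentP => q /=; rewrite mulrDr. Qed.
Fact gscaleDl F : {morph gscale^~ F : a b / a + b}.
Proof. by move=> a b; apply: glaurentP => q /=; rewrite mulrDl. Qed.

HB.instance Definition _ := GRing.Zmodule_isLmodule.Build k (glaurent k)
  gscaleA gscale1 gscaleDr gscaleDl.

Lemma gscaleE a F : gscale a F = gmul (gmono 0 a) F.
Proof. by apply: glaurentP => q; rewrite gmul_mono subr0. Qed.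

Fact gscaleAl a F G : a *: (F * G) = (a *: F) * G.
Proof. by rewrite /GRing.scale /= !gscaleE; apply: mulrA. Qed.

HB.instance Definition _ :=
  GRing.Lmodule_isLalgebra.Build k (glaurent k) gscaleAl.
HB.instance Definition _ :=
  GRing.Lalgebra_isComAlgebra.Build k (glaurent k).

Lemma gcoef0 q : (0 : glaurent k) q = 0. Proof. by []. Qed.
Lemma gcoefN F q : (- F) q = - F q. Proof. by []. Qed.
Lemma gcoefD F G q : (F + G) q = F q + G q. Proof. by []. Qed.
Lemma gcoefB F G q : (F - G) q = F q - G q. Proof. by []. Qed.
Lemma gcoefZ a F q : (a *: F) q = a * F q. Proof. by []. Qed.
Lemma gcoef1 q : (1 : glaurent k) q = if q == 0 then 1 else 0. Proof. by []. Qed.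
Lemma gcoefM F G q : (F * G) q = conv F G q. Proof. by []. Qed.
Lemma gcoef_sum I (r : seq I) (P : pred I) (E : I -> glaurent k) q :
  (\sum_(i <- r | P i) E i) q = \sum_(i <- r | P i) E i q.
Proof. by elim/big_rec2 : _ => // i x y _ <-. Qed.
Lemma gmonoM d a F q : (gmono d a * F) q = a * F (q - d).
Proof. exact: gmul_mono. Qed.

Section Geometric.
Variables (F : glaurent k) (e : rat).
Hypotheses (e0 : 0 < e) (Fe : forall q, F q != 0 -> e <= q).

Lemma gexp_nsum n q : (F ^+ n) q != 0 -> nsum (gsupp F) n q.
Proof.
elim: n q => [|n IH] q; first by rewrite expr0 gcoef1; case: (q =P 0) => //; rewrite eqxx.
rewrite exprS gcoefM => /conv_neq0[r Fr Fnr] /=.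
by exists r => //; exists (q - r); [apply: IH|rewrite addrC subrK].
Qed.

Lemma gexp_eq0 n q : q < e *+ n -> (F ^+ n) q = 0.
Proof.
move=> qn; apply/eqP; apply: contraTT qn => /gexp_nsum/nsum_ge.
by rewrite -leNgt; apply.
Qed.

Definition gbound q := xchoose (archi_mulrn q e0).
Lemma gboundP q : q < e *+ gbound q. Proof. exact: (xchooseP (archi_mulrn q e0)). Qed.

Definition geom q := \sum_(n < gbound q) (F ^+ n) q.

Lemma geomE N q : q < e *+ N -> geom q = \sum_(n < N) (F ^+ n) q.
Proof.
have aux m n : (m <= n)%N -> q < e *+ m ->
    \sum_(i < m) (F ^+ i) q = \sum_(i < n) (F ^+ i) q.
  move=> mn qm; rewrite -(subnKC mn) big_split_ord /=.
  rewrite [X in _ = _ + X]big1 ?addr0 // => i _; apply: gexp_eq0.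
  apply: lt_le_trans qm _; rewrite mulrnDr lerDl mulrn_wge0 //; exact: ltW.
move=> qN; have := gboundP q; rewrite /geom.
by have [Nb|/ltnW bN] := leqP N (gbound q) => qb; [rewrite (aux _ _ Nb)|rewrite (aux _ _ bN)].
Qed.

Fact ggeom_subproof : wo [set q | geom q != 0].
Proof.
apply: wo_sub (wo_nsums e0 Fe (@gsupp_wo F)) => q /=.
apply: contra_neqP => nq; rewrite /geom big1 // => n _.
apply/eqP; apply: contra_notT nq => /gexp_nsum; exists n => //.
Qed.
Definition ggeom := mkglaurent ggeom_subproof.

Lemma ggeomP : (1 - F) * ggeom = 1.
Proof.
apply: glaurentP => q.
have [N qN] := archi_mulrn q e0.
have -> : ggeom = \sum_(n < N) F ^+ n + (ggeom - \sum_(n < N) F ^+ n).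
  by rewrite addrC subrK.
have tel : (1 - F) * \sum_(n < N) F ^+ n = 1 - F ^+ N.
  by rewrite -opprB mulNr -subrX1 opprB.
rewrite mulrDr tel.
set D := ggeom - _.
have D0 r : r < e *+ N -> D r = 0.
  by move=> rN; rewrite gcoefB gcoef_sum /= (geomE rN) subrr.
rewrite gcoefD gcoefB (gexp_eq0 qN) subr0 -[RHS]addr0; congr (_ + _).
apply/eqP; rewrite gcoefM; apply: contraTT qN => /conv_neq0[r Fr Dr].
have r0 : 0 <= r.
  move: Fr; rewrite gcoefB gcoef1; case: (r =P 0) => [-> //|_].
  by rewrite sub0r oppr_eq0 => /Fe; apply: le_trans; apply: ltW.
rewrite -leNgt; apply: le_trans (_ : q - r <= _); last by rewrite lerBlDr lerDl.
by rewrite leNgt; apply: contraNN Dr => /D0 ->.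
Qed.

End Geometric.

Lemma ginv_exists F : F != 0 -> exists G, G * F = 1.
Proof.
move=> F0.
have [|v Fv vmin] := @gsupp_wo _ _ (@subset_refl _ (gsupp F)).
  apply: contrapT => nF; case/eqP: F0; apply: glaurentP => q.
  by apply/eqP; apply: contrapT => /negP Fq; apply: nF; exists q.
pose U := 1 - gmono (- v) (F v)^-1 * F.
have UE q : U q = (if q == 0 then 1 else 0) - (F v)^-1 * F (q + v).
  by rewrite gcoefB gmonoM opprK.
have Uq q : U q != 0 -> 0 < q.
  rewrite UE; case: (q =P 0) => [->|/eqP q0].
    by rewrite add0r mulVf // subrr eqxx.
  rewrite sub0r oppr_eq0 mulf_eq0 negb_or => /andP[_ /vmin].
  by rewrite -subr_ge0 addrK le_eqVlt eq_sym (negPf q0).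
have [e e0 Ue] : exists2 e, 0 < e & forall q, U q != 0 -> e <= q.
  have [U0|nU] := pselect (gsupp U !=set0).
    have [e Ue emin] := @gsupp_wo _ _ (@subset_refl _ (gsupp U)) U0.
    by exists e => //; apply: Uq.
  by exists 1 => // q Uq'; case: nU; exists q.
exists (ggeom e0 Ue * gmono (- v) (F v)^-1).
by rewrite -mulrA mulrC -[gmono _ _ * _](subKr 1) ggeomP.
Qed.

Definition ginv F : glaurent k :=
  if pselect (exists G, G * F = 1) is left FV then projT1 (cid FV) else 0.

Fact gmulV F : F != 0 -> ginv F * F = 1.
Proof.
move=> F0; rewrite /ginv; case: pselect => [FV|[]]; last exact: ginv_exists.
by case: (cid _).
Qed.

Fact ginv0 : ginv 0 = 0.
Proof.
rewrite /ginv; case: pselect => // FV; exfalso.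
by case: FV => G /eqP; rewrite mulr0 eq_sym oner_eq0.
Qed.

HB.instance Definition _ :=
  GRing.ComNzRing_isField.Build (glaurent k) gmulV ginv0.

(* F(t^c) for c > 0, and the junk value 0 for c <= 0. *)
Fact gsubst_subproof c F :
  wo [set q | (if 0 < c then F (q / c) else 0) != 0].
Proof.
case: ltP => [c0|_]; last by apply: wo_sub wo0 => q /=; rewrite eqxx.
move=> T TF [x Tx].
have [||m Tm mmin] := @gsupp_wo F [set q | T (c * q)].
- by move=> q /TF /=; rewrite mulrC mulKf // gt_eqF.
- by exists (x / c); rewrite /= mulrC divfK // gt_eqF.
- exists (c * m) => // y Ty; rewrite mulrC -ler_pdivlMr //.
  by apply: mmin; rewrite /= mulrC divfK // gt_eqF.
Qed.
Definition gsubst c F := mkglaurent (@gsubst_subproof c F).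

(* Multiplication of the coefficient of t^q by chi q, for every q. *)
Fact gtwist_subproof (chi : rat -> k) F : wo [set q | F q * chi q != 0].
Proof.
apply: (@wo_sub _ (gsupp F)); last exact: gsupp_wo.
by move=> q /=; apply: contra_neq => ->; rewrite mul0r.
Qed.
Definition gtwist chi F := mkglaurent (@gtwist_subproof chi F).

Definition tpow (d : rat) : glaurent k := gmono d 1.

Definition gconst : set (glaurent k) := range (in_alg (glaurent k)).

End GLaurent.

Arguments gsupp_wo {k} F.
Arguments gconst k _ : clear implicits.
Arguments tpow k d : clear implicits.

Section Generated.
Variable M : fieldType.
Implicit Types (X E : set M) (v : M -> rat).

Definition gen_subring X : set M :=
  smallest (fun S => subring_closed (mem S)) X.

Definition gen_subfield X : set M :=
  smallest (fun S => divring_closed (mem S)) X.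

Lemma gen_subring_closed X : subring_closed (mem (gen_subring X)).
Proof.
split=> [|x y /set_mem Sx /set_mem Sy|x y /set_mem Sx /set_mem Sy];
  apply/mem_set => S [[S1 SB SM] XS].
- exact/set_mem/S1.
- by apply/set_mem/SB; apply/mem_set; [apply: Sx|apply: Sy].
- by apply/set_mem/SM; apply/mem_set; [apply: Sx|apply: Sy].
Qed.

Lemma gen_subfield_closed X : divring_closed (mem (gen_subfield X)).
Proof.
split=> [|x y /set_mem Sx /set_mem Sy|x y /set_mem Sx /set_mem Sy];
  apply/mem_set => S [[S1 SB SM] XS].
- exact/set_mem/S1.
- by apply/set_mem/SB; apply/mem_set; [apply: Sx|apply: Sy].
- by apply/set_mem/SM; apply/mem_set; [apply: Sx|apply: Sy].
Qed.

Definition subring_of X := {x : M | x \in gen_subring X}.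
Definition subfield_of X := {x : M | x \in gen_subfield X}.

HB.instance Definition _ X := SubChoice.on (subring_of X).
HB.instance Definition _ X :=
  GRing.SubChoice_isSubComNzRing.Build M (mem (gen_subring X)) (subring_of X)
    (@gen_subring_closed X).

HB.instance Definition _ X := SubChoice.on (subfield_of X).
HB.instance Definition _ X :=
  GRing.SubChoice_isSubIntegralDomain.Build M (mem (gen_subfield X))
    (subfield_of X) (@gen_subfield_closed X).
HB.instance Definition _ X :=
  GRing.SubIntegralDomain_isSubField.Build M (mem (gen_subfield X))
    (subfield_of X) (frefl _).

(* Rational-valued valuations on a subfield E of M; the values outside E and   *)
(* at 0 are irrelevant.                                                        *)
Definition valuation_on E v :=
  (forall x y, E x -> E y -> x != 0 -> y != 0 -> v (x * y) = v x + v y) /\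
  (forall x y, E x -> E y -> x != 0 -> y != 0 -> x + y != 0 ->
     Num.min (v x) (v y) <= v (x + y)).

Definition value_group E v : set rat := v @` [set x | E x /\ x != 0].

Definition extends_valuation E v w :=
  forall x, E x -> x != 0 -> w x = v x :> rat.

End Generated.

Section Sparse.
Variable p : nat.

Definition Sp : set rat := [set q | exists m n : nat, q = m%:R / p%:R ^+ n].

(* None is the radix point. *)
Definition letter := option 'I_p.
Definition word := seq letter.

Definition digit (c : letter) : nat := if c is Some d then d else 0.
Definition zero_digit (c : letter) : bool :=
  if c is Some d then d == 0%N :> nat else false.

Definition valid_expansion (u : word) : bool :=
  [&& ~~ zero_digit (head None u), ~~ zero_digit (last None u) &
      count_mem None u == 1%N].

Definition expansion_value (u : word) : rat :=
  let j := index None u in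
  \sum_(0 <= i < j) (digit (nth None u i))%:R * p%:R ^+ (j - 1 - i) +
  \sum_(j.+1 <= i < size u) (digit (nth None u i))%:R * p%:R ^- (i - j).

(* u_0 w_0^(n_0) u_1 w_1^(n_1) ... u_(s-1) w_(s-1)^(n_(s-1)) u_s *)
Definition pump (s : nat) (u w : nat -> word) (n : nat -> nat) : word :=
  flatten [seq u i ++ flatten (nseq (n i) (w i)) | i <- iota 0 s] ++ u s.

Definition simple_sparse (S : set rat) := exists s (u w : nat -> word),
  [/\ forall i, (i < s)%N -> w i != [::],
      forall n, valid_expansion (pump s u w n) &
      S = range (fun n => expansion_value (pump s u w n))].

Definition sparse (S : set rat) := S `<=` Sp /\
  exists m (Y : 'I_m -> set rat),
    (forall i, simple_sparse (Y i)) /\ S = \bigcup_i Y i.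

End Sparse.

Section Rings.
Variables (p : nat) (k : fieldType).
Implicit Types (F G : glaurent k) (E : set (glaurent k)).

Definition kt_gens : set (glaurent k) := gconst k `|` [set tpow k 1].

Definition sparse_algebraic : set (glaurent k) :=
  [set F | algebraicOver (val : subfield_of kt_gens -> glaurent k) F /\
     exists a b : int, 0 < a /\
       sparse p [set a%:~R * q + b%:~R | q in gsupp F]].

(* chi q is a power alpha^q, for a choice of compatible roots of alpha. *)
Definition rat_power (alpha : k) (chi : rat -> k) :=
  chi 1 = alpha /\ forall q r, chi (q + r) = chi q * chi r.

(* F(alpha t) depends on the choice of the fractional powers of alpha; closure *)
(* is required for all choices. It is undefined for alpha = 0.                 *)
Definition AS_closed (B C : set (glaurent k)) :=
  [/\ B `<=` C,
      forall F G, B F -> C G -> G ^+ p - G + F = 0 -> B G,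
      forall F (alpha : k) chi, B F -> alpha != 0 -> rat_power alpha chi ->
        B (gtwist chi F) &
      forall F (c d : rat), B F -> 0 < c -> C (tpow k d * gsubst c F) ->
        B (tpow k d * gsubst c F)].

Definition nontrivial_AS_closed_subalg (S : set (glaurent k)) :=
  [/\ subalg_closed (mem S), S <> [set 0], S <> gconst k & AS_closed S setT].

Definition Ctilde : set (glaurent k) :=
  smallest nontrivial_AS_closed_subalg set0.

Lemma Ctilde_closed : nontrivial_AS_closed_subalg Ctilde.
Proof.
have sub1 : Ctilde 1 by move=> S [[[/set_mem]]].
have subt : Ctilde (tpow k 1).
  move=> S [[[/set_mem S1 _ _] _ _ [_ _ _ SP3]] _].
  have /= := SP3 1 1 1 S1 ltr01 I; congr (S _).
  by apply: glaurentP => q; rewrite gmonoM mul1r /= divr1 subr_eq0.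
split.
- split=> [|a x y /set_mem Sx /set_mem Sy|x y /set_mem Sx /set_mem Sy];
    apply/mem_set => // S HS; have [[[S1 SL SM] _ _ _] _] := HS.
    by apply/set_mem/SL; apply/mem_set; [apply: Sx|apply: Sy].
  by apply/set_mem/SM; apply/mem_set; [apply: Sx|apply: Sy].
- by move=> C0; move: sub1; rewrite C0 => /eqP; rewrite oner_eq0.
- move=> CE; move: subt; rewrite CE => -[a _].
  move/(congr1 (fun F : glaurent k => F 1)); rewrite /= mulr0 => /esym/eqP.
  by rewrite oner_eq0.
- split=> // [F G CF _ FG|F alpha chi CF a0 chiP|F c d CF c0 _] S HS;
    have [[_ _ _ [_ P1 P2 P3]] _] := HS.
  + by apply: P1 FG; first exact: CF.
  + by apply: P2 chiP; first exact: CF.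
  + by apply: P3; first exact: CF.
Qed.

Definition prime_to_p : set nat := [set n | (0 < n)%N /\ ~~ (p %| n)%N].

Definition K_gens : set (glaurent k) :=
  gconst k `|` [set tpow k n%:R^-1 | n in prime_to_p].

Definition K_set : set (glaurent k) := gen_subfield K_gens.

Definition R_gens : set (glaurent k) :=
  [set tpow k n%:R^-1 | n in prime_to_p] `|`
  [set tpow k (- n%:R^-1) | n in prime_to_p].

(* The subfields of k((t^Q)) that are finite Galois over K of p-power degree. *)
Definition galois_p_extension E :=
  exists (N : splittingFieldType (subfield_of K_gens))
         (j : {rmorphism N -> glaurent k}),
    [/\ forall a, j a%:A = val a, galois 1 {:N},
        exists n, \dim {:N} = (p ^ n)%N & E = range j].

Definition L_set : set (glaurent k) :=
  gen_subfield (K_set `|` \bigcup_(E in galois_p_extension) E).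

(* The valuations of K with value group Z that extend the order of vanishing   *)
(* at t = lambda on k(t). There is one for each compatible choice of roots     *)
(* lambda^(1/n); unramifiedness is required above all of them.                 *)
Definition nu (lambda : k) (v : glaurent k -> rat) :=
  [/\ valuation_on K_set v,
      forall f g : {poly k}, f != 0 -> g != 0 ->
        v (horner_alg (tpow k 1) f / horner_alg (tpow k 1) g) =
          (mup lambda f)%:R - (mup lambda g)%:R &
      value_group K_set v = range (intr : int -> rat)].

Definition unramified_outside_0_oo E :=
  forall (lambda : k) v w, lambda != 0 -> nu lambda v ->
    valuation_on E w -> extends_valuation K_set v w ->
    value_group E w = range (intr : int -> rat).

Definition L0 : set (glaurent k) := [set G | L_set G /\
  unramified_outside_0_oo (gen_subfield (K_set `|` [set G]))].

Definition Bset : set (glaurent k) := [set G | exists j : nat,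
  L0 (gsubst (p ^ j)%:R G) /\
  integralOver (val : subring_of R_gens -> glaurent k) (gsubst (p ^ j)%:R G)].

End Rings.

Arguments sparse_algebraic p k _ : clear implicits.
Arguments Bset p k _ : clear implicits.
Arguments Ctilde p k _ : clear implicits.

(* Main.v *)
(** Write C for the smallest closed algebra and M for the field k((t^Q)).

    Sparse algebraic series form C.  An algebraic series F satisfies an additive
    relation, and after division by a polynomial and t -> t^(p^j) it satisfies
    G = sum_(i > 0) B_i G^(p^i).  Hence the pieces of F cut out of all F^(p^m) by unit
    intervals span a finite-dimensional space, and so do the columns of F along the
    cosets of Z: F is read by a finite automaton, whose states are such pieces.
    When the support of F has only polynomially many points at each scale, no state
    lies on two loops, and induction along the loops writes F with solutions of
    x = y + t^A x^(p^l), which belong to C.  The same absence of double loops turns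
    the language of the support into a finite union of pumped words.  Conversely,
    the support of an Artin-Schreier root consists of p^n-multiples of the support,
    so that algebraicity and polynomial growth are inherited by all of C.

    Series integral and unramified form C.  Let O be the smallest ring that contains
    k[t^(1/n), t^(-1/n)] for n prime to p and all Artin-Schreier roots of its elements;
    then C consists of the F with F(t^(p^j)) in O for some j.  A p-extension of K is
    a subfield of an Artin-Schreier tower, by additive Hilbert 90, and the
    homomorphisms of a tower to M with t -> lambda (1 + t) play the role of its places
    above lambda.  An element of a tower is in O as soon as all its images are power
    series in t: it is a fraction g/u with g in O and u in k[t^(1/n)] because O/(u)
    is perfect, so that poles of order divisible by p can be lowered, and then u
    divides g.  At an unramified integral element all images are power series.
    Conversely, an element of O stays, in every extension of a valuation v of K, as
    close as desired to one of finitely many elements of K, so that its value is a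
    value of v. *)

Require Import Defs.
From HB Require Import structures.
From mathcomp Require Import all_boot all_order all_fingroup all_algebra all_solvable all_field.
From mathcomp Require Import mathcomp_extra boolp classical_sets cardinality.
From mathcomp Require Import fsbigop wochoice.
From mathcomp Require Import lra ring zify.

Set Implicit Arguments.
Unset Strict Implicit.
Unset Printing Implicit Defensive.
Import Order.TTheory GRing.Theory Num.Theory.
Local Open Scope classical_set_scope.
Local Open Scope ring_scope.

(** * Arithmetic of generalized series *)

(** That [k] is algebraic over ['F_p] enters the theory of automata through one fact: each element
    is fixed by a power of the Frobenius. A finite-dimensional space of pieces is infinite, but the
    finitely many scalars that describe the starting pieces and the semilinear digit operators lie
    in one finite field, and the combinations with coefficients there form a finite set of states.
    Two automata are required: digits before the radix point are consumed from the last one, by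
    Cartier operators on columns, and digits after it from the first one, by magnifying unit
    intervals. Sparse sets have no visible closure under sums; their growth, counted at a resolution
    that becomes finer as the range grows, is stable under all operations that generate C.
    Completions and ramification theory are replaced by homomorphisms to k((t^Q)) itself: every
    Artin-Schreier equation is solvable there, so homomorphisms extend along towers, and the
    exponents that occur in an image show whether a place ramifies or carries a pole. *)

Section SeriesArithmetic.
Variable k : fieldType.
Implicit Types (F G : glaurent k) (a : k) (q d : rat).

Lemma gmonoE d a q : gmono d a q = if q == d then a else 0. Proof. by []. Qed.

Lemma gmonoMmono d e a b : gmono d a * gmono e b = gmono (d + e) (a * b) :> glaurent k.
Proof.
apply: glaurentP => q; rewrite gmonoM !gmonoE subr_eq addrC.
by case: eqP; rewrite ?mulr0.
Qed.

Lemma gmonoX d a n : gmono d a ^+ n = gmono (d *+ n) (a ^+ n) :> glaurent k.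
Proof.
elim: n => [|n IHn]; first by rewrite !expr0 mulr0n.
by rewrite !exprS IHn gmonoMmono mulrS.
Qed.

Lemma gcoefMn F n q : (F *+ n) q = F q *+ n.
Proof. by elim: n => [|n IH]; rewrite ?mulr0n // !mulrS gcoefD IH. Qed.

Lemma tpowD d e : tpow k (d + e) = tpow k d * tpow k e.
Proof. by rewrite /tpow gmonoMmono mulr1. Qed.

Lemma tpow0 : tpow k 0 = 1. Proof. by []. Qed.

Lemma tpow_neq0 d : tpow k d != 0.
Proof.
apply/eqP => /(congr1 (fun F : glaurent k => F d)); rewrite gmonoE eqxx => /eqP.
by rewrite oner_eq0.
Qed.

Lemma tpowN d : tpow k (- d) = (tpow k d)^-1.
Proof. by apply: (mulIf (tpow_neq0 d)); rewrite mulVf ?tpow_neq0 // -tpowD addNr. Qed.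

Lemma tpowX d n : tpow k d ^+ n = tpow k (d *+ n).
Proof. by rewrite /tpow gmonoX expr1n. Qed.

Lemma tpowM d F q : (tpow k d * F) q = F (q - d).
Proof. by rewrite gmonoM mul1r. Qed.

Lemma gneq0P F : F != 0 -> exists q, F q != 0.
Proof.
move=> F0; apply: contrapT => nF; case/eqP: F0; apply: glaurentP => q.
by apply/eqP; apply: contrapT => /negP Fq; apply: nF; exists q.
Qed.

Lemma nsum_sub A B n : A `<=` B -> nsum A n `<=` nsum B n.
Proof.
move=> AB; elim: n => //= n IH x [a Aa [b nb <-]].
by exists a; [apply: AB|exists b => //; apply: IH].
Qed.

(** A coefficient of a power involves finitely many coefficients of [F]. Additivity of the Frobenius
    can thus be applied to a finite sum of monomials that agrees with [F] at the exponents
    concerned. *)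
Lemma gexp_local F n q : exists R : seq rat, forall G,
  (forall r, r \in R -> G r = F r) -> (forall r, G r != 0 -> F r != 0) ->
  (G ^+ n) q = (F ^+ n) q.
Proof.
elim: n q => [|n IH] q; first by exists [::].
have [s us sP] := wo_seq q (gsupp_wo F) (@wo_nsum _ n (gsupp_wo F)).
have [R RP] := choice IH.
exists (s ++ flatten [seq R (q - r) | r <- s]) => G GF GsF.
have GnF : gsupp G `<=` gsupp F by move=> r; apply: GsF.
rewrite !exprS !gcoefM !(convE us).
- apply: eq_big_seq => r rs; rewrite GF ?mem_cat ?rs //; congr (_ * _).
  apply: RP => // r' r'R; apply: GF; rewrite mem_cat; apply/orP; right.
  by apply/flattenP; exists (R (q - r)) => //; apply/mapP; exists r.
- by move=> r Fr /gexp_nsum Fnr; apply/sP.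
- move=> r /GsF Gr /gexp_nsum Gnr; apply/sP; split=> //.
  exact: nsum_sub GnF _ Gnr.
Qed.

Definition gpoly (R : seq rat) F := \sum_(r <- R) gmono r (F r).

Lemma gpolyE R F q : uniq R -> gpoly R F q = if q \in R then F q else 0.
Proof.
move=> uR; rewrite gcoef_sum; case: ifPn => qR.
  rewrite (bigD1_seq q) //= eqxx big1 ?addr0 // => r rq.
  by rewrite eq_sym (negPf rq).
rewrite big1_seq // => r /andP[_ rR] /=; case: eqP => // qr.
by move: qR; rewrite qr rR.
Qed.

Section Frobenius.
Variable p : nat.
Hypothesis pchark : p \in [pchar k].

Let p_pr : prime p. Proof. exact: pcharf_prime pchark. Qed.
Let p0 : (p%:R : rat) != 0.
Proof. by rewrite pnatr_eq0 -lt0n prime_gt0. Qed.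

Lemma expr0pn (R : nzRingType) n : (0 : R) ^+ (p ^ n) = 0.
Proof. by rewrite expr0n expn_eq0 -[p == 0%N]negbK -lt0n prime_gt0. Qed.

Lemma pchar_glaurent : p \in [pchar (glaurent k)].
Proof.
rewrite inE p_pr; apply/eqP; apply: glaurentP => q.
by rewrite gcoefMn gcoef1; case: eqP; rewrite ?mul0rn // (pcharf0 pchark).
Qed.

Lemma gfrobE F q : (F ^+ p) q = F (q / p%:R) ^+ p.
Proof.
have [R RP] := gexp_local F p q.
(* The exponent [q / p] is included so that the only monomial whose p-th power reaches [q] can be
   singled out. *)
pose R' := undup (q / p%:R :: R); have uR : uniq R' by rewrite undup_uniq.
rewrite -(RP (gpoly R' F)) => [|r rR|r]; last 2 first.
- by rewrite gpolyE // mem_undup inE rR orbT.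
- by rewrite gpolyE //; case: ifP => //; rewrite eqxx.
have -> : gpoly R' F ^+ p = \sum_(r <- R') gmono r (F r) ^+ p.
  exact: (rmorph_sum (pFrobenius_aut pchar_glaurent)).
rewrite gcoef_sum (bigD1_seq (q / p%:R)) ?mem_undup ?mem_head //=.
rewrite gmonoX gmonoE -[_ / _ *+ _]mulr_natr divfK // eqxx big1 ?addr0 // => r rq.
rewrite gmonoX gmonoE; case: eqP => // qE; case/eqP: rq.
by rewrite qE -[r *+ p]mulr_natr mulfK.
Qed.

Lemma gfrobXE n F q : (F ^+ (p ^ n)) q = F (q / p%:R ^+ n) ^+ (p ^ n).
Proof.
elim: n q => [|n IH] q; first by rewrite expn0 !expr1 expr0 divr1.
by rewrite expnS mulnC exprM gfrobE IH exprM exprS invfM mulrA.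
Qed.

Lemma gfrobD n F G : (F + G) ^+ (p ^ n) = F ^+ (p ^ n) + G ^+ (p ^ n).
Proof.
elim: n => [|n IH]; first by rewrite expn0 !expr1.
by rewrite expnS mulnC !exprM IH -!(pFrobenius_autE pchar_glaurent) rmorphD.
Qed.

Lemma gfrobB n F G : (F - G) ^+ (p ^ n) = F ^+ (p ^ n) - G ^+ (p ^ n).
Proof. by apply: (addIr (G ^+ (p ^ n))); rewrite -gfrobD !subrK. Qed.

Lemma frobD n (a b : k) : (a + b) ^+ (p ^ n) = a ^+ (p ^ n) + b ^+ (p ^ n).
Proof.
elim: n => [|n IH]; first by rewrite expn0 !expr1.
by rewrite expnS mulnC !exprM IH -!(pFrobenius_autE pchark) rmorphD.
Qed.

Lemma frob_inj n : injective (fun a : k => a ^+ (p ^ n)).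
Proof.
move=> a b ab; have : (a - b) ^+ (p ^ n) = 0.
  by apply: (addIr (b ^+ (p ^ n))); rewrite -frobD subrK add0r.
by move/eqP; rewrite expf_eq0 subr_eq0 => /andP[_ /eqP].
Qed.

Lemma frob_sum n I (r : seq I) (P : pred I) (E : I -> k) :
  (\sum_(i <- r | P i) E i) ^+ (p ^ n) = \sum_(i <- r | P i) E i ^+ (p ^ n).
Proof.
elim/big_rec2 : _ => [|i x y _ <-]; last by rewrite frobD.
by rewrite expr0n; case: eqP => // /eqP; rewrite expn_eq0 -[p == 0%N]negbK -lt0n prime_gt0.
Qed.

Lemma gfrob_sum n I (r : seq I) (P : pred I) (E : I -> glaurent k) :
  (\sum_(i <- r | P i) E i) ^+ (p ^ n) = \sum_(i <- r | P i) E i ^+ (p ^ n).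
Proof.
elim/big_rec2 : _ => [|i x y _ <-]; last by rewrite gfrobD.
by rewrite expr0n; case: eqP => // /eqP; rewrite expn_eq0 -[p == 0%N]negbK -lt0n prime_gt0.
Qed.

End Frobenius.

Fact gmask_subproof (P : set rat) F :
  wo [set q | (if `[< P q >] then F q else 0) != 0].
Proof. by apply: (@wo_sub _ (gsupp F)) (gsupp_wo F) => q /=; case: ifP; rewrite ?eqxx. Qed.
Definition gmask (P : set rat) F := mkglaurent (@gmask_subproof P F).

Lemma gmaskE P F q : gmask P F q = if `[< P q >] then F q else 0. Proof. by []. Qed.

Lemma gmaskD P F G : gmask P (F + G) = gmask P F + gmask P G.
Proof. by apply: glaurentP => q; rewrite gcoefD !gmaskE gcoefD; case: ifP; rewrite ?addr0. Qed.

Lemma gmaskZ P a F : gmask P (a *: F) = a *: gmask P F.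
Proof. by apply: glaurentP => q; rewrite gcoefZ !gmaskE gcoefZ; case: ifP; rewrite ?mulr0. Qed.

Lemma gmask0 P : gmask P 0 = 0.
Proof. by apply: glaurentP => q; rewrite gmaskE if_same. Qed.

Section Substitution.

Lemma gsubstE c F q : 0 < c -> gsubst c F q = F (q / c).
Proof. by move=> c0 /=; rewrite c0. Qed.

Lemma gsubstD c F G : gsubst c (F + G) = gsubst c F + gsubst c G.
Proof. by apply: glaurentP => q; rewrite gcoefD /=; case: ifP; rewrite ?addr0. Qed.

Lemma gsubstZ c a F : gsubst c (a *: F) = a *: gsubst c F.
Proof. by apply: glaurentP => q; rewrite gcoefZ /=; case: ifP; rewrite ?mulr0. Qed.

Lemma gsubst0 c : gsubst c 0 = 0 :> glaurent k.
Proof. by apply: glaurentP => q /=; rewrite if_same. Qed.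

Lemma gsubstN c F : gsubst c (- F) = - gsubst c F.
Proof. by apply: (addIr (gsubst c F)); rewrite addNr -gsubstD addNr gsubst0. Qed.

Lemma gsubst_mono c d a : 0 < c -> gsubst c (gmono d a) = gmono (c * d) a.
Proof.
move=> c0; apply: glaurentP => q; rewrite gsubstE // !gmonoE.
by rewrite [c * d]mulrC (can2_eq (divfK (lt0r_neq0 c0)) (mulfK (lt0r_neq0 c0))).
Qed.

Lemma gsubst1 c : 0 < c -> gsubst c 1 = 1 :> glaurent k.
Proof. by move=> c0; rewrite -[1]tpow0 /tpow gsubst_mono // mulr0. Qed.

Lemma gsubstM c F G : 0 < c -> gsubst c (F * G) = gsubst c F * gsubst c G.
Proof.
move=> c0; have c0' : c != 0 by rewrite gt_eqF.
apply: glaurentP => q; rewrite gsubstE // !gcoefM.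
have [s us sP] := conv_seq F G (q / c).
rewrite (convE us) => [|r Fr Gr]; last by rewrite sP Fr.
rewrite (convE (s := map (fun r => r * c) s)) => [|| r Fr Gr].
- rewrite big_map; apply: eq_bigr => r _.
  by rewrite !gsubstE // mulfK // mulrBl mulfK.
- by rewrite map_inj_uniq // => x y /(mulIf c0').
- apply/mapP; exists (r / c); last by rewrite divfK.
  by move: Fr Gr; rewrite !gsubstE // mulrBl sP => -> ->.
Qed.

Lemma gsubstX c F n : 0 < c -> gsubst c (F ^+ n) = gsubst c F ^+ n.
Proof. by move=> c0; elim: n => [|n IH]; rewrite ?expr0 ?gsubst1 // !exprS gsubstM // IH. Qed.

Lemma gsubst_comp c d F : 0 < c -> 0 < d -> gsubst c (gsubst d F) = gsubst (c * d) F.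
Proof.
move=> c0 d0; apply: glaurentP => q; rewrite !gsubstE ?mulr_gt0 //.
by rewrite invfM mulrA.
Qed.

Lemma gsubst_id F : gsubst 1 F = F.
Proof. by apply: glaurentP => q; rewrite gsubstE // divr1. Qed.

End Substitution.

Section Twist.
Variable chi : rat -> k.
Hypothesis chiD : forall q r, chi (q + r) = chi q * chi r.

Lemma gtwistE F q : gtwist chi F q = F q * chi q. Proof. by []. Qed.

Lemma gtwistD F G : gtwist chi (F + G) = gtwist chi F + gtwist chi G.
Proof. by apply: glaurentP => q; rewrite gcoefD !gtwistE gcoefD mulrDl. Qed.

Lemma gtwistZ a F : gtwist chi (a *: F) = a *: gtwist chi F.
Proof. by apply: glaurentP => q; rewrite gcoefZ !gtwistE gcoefZ mulrA. Qed.

Lemma gtwist0 : gtwist chi 0 = 0.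
Proof. by apply: glaurentP => q; rewrite gtwistE mul0r. Qed.

Lemma gtwistM F G : gtwist chi (F * G) = gtwist chi F * gtwist chi G.
Proof.
apply: glaurentP => q; rewrite gtwistE !gcoefM.
have [s us sP] := conv_seq F G q.
rewrite (convE us) => [|r Fr Gr]; last by rewrite sP Fr.
rewrite (convE us) => [|r]; last first.
  rewrite !gtwistE !mulf_eq0 !negb_or => /andP[Fr _] /andP[Gr _].
  by rewrite sP Fr.
rewrite mulr_suml; apply: eq_bigr => r _; rewrite !gtwistE.
have -> : chi q = chi r * chi (q - r) by rewrite -chiD addrC subrK.
by rewrite mulrACA.
Qed.

Lemma gtwist_mono d a : gtwist chi (gmono d a) = gmono d (a * chi d).
Proof. by apply: glaurentP => q; rewrite gtwistE !gmonoE; case: eqP => [->|]; rewrite ?mul0r. Qed.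

Hypothesis chi1 : chi 1 != 0.

Lemma chi_0 : chi 0 = 1.
Proof. by apply: (mulfI chi1); rewrite -chiD addr0 mulr1. Qed.

Lemma chi_neq0 q : chi q != 0.
Proof.
apply/eqP => q0; have := chi_0; rewrite -(subrr q) chiD q0 mul0r => /eqP.
by rewrite eq_sym oner_eq0.
Qed.

Lemma gtwist1 : gtwist chi 1 = 1.
Proof. by rewrite -[1]tpow0 /tpow gtwist_mono mul1r chi_0. Qed.

Lemma gtwistX F n : gtwist chi (F ^+ n) = gtwist chi F ^+ n.
Proof. by elim: n => [|n IH]; rewrite ?expr0 ?gtwist1 // !exprS gtwistM IH. Qed.

Lemma gtwist_eq0 F : (gtwist chi F == 0) = (F == 0).
Proof.
apply/eqP/eqP => [F0|->]; last by rewrite gtwist0.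
apply: glaurentP => q; apply: (mulIf (chi_neq0 q)).
by rewrite gcoef0 mul0r -gtwistE F0.
Qed.

Lemma gtwistV F : gtwist chi F^-1 = (gtwist chi F)^-1.
Proof.
have [->|F0] := eqVneq F 0; first by rewrite invr0 gtwist0 invr0.
have F0' : gtwist chi F != 0 by rewrite gtwist_eq0.
by apply: (mulIf F0'); rewrite mulVf // -gtwistM mulVf // gtwist1.
Qed.

End Twist.

End SeriesArithmetic.

(** * Artin-Schreier equations in k((t^Q)) *)

Lemma wo_bigcup_local (A : nat -> set rat) :
  (forall n, wo (A n)) ->
  (forall x n, A n x -> exists N, forall y m, A m y -> y <= x -> (m < N)%N) ->
  wo (\bigcup_n A n).
Proof.
move=> Awo Aloc T TA [t Tt]; have [n _ Ant] := TA _ Tt.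
have [N NP] := Aloc _ _ Ant.
have Nwo : wo (\big[setU/set0]_(n < N) A n).
  apply: big_ind => [|B C|i _]; [exact: wo0|exact: woU|exact: Awo].
have [||m [Tm mt] mmin] := Nwo (T `&` [set x | x <= t]).
- move=> x [Tx /= xt]; have [i _ ix] := TA _ Tx.
  by rewrite -bigcup_mkord; exists i => //=; apply: NP ix xt.
- by exists t; split=> /=.
- exists m => // x Tx; have [xt|/ltW tx] := leP x t; first exact: mmin.
  exact: le_trans tx.
Qed.

Lemma wo_decr (A : set rat) (f : nat -> rat) : wo A ->
  (forall n, f n.+1 < f n) -> exists N, forall n, (N <= n)%N -> ~ A (f n).
Proof.
move=> Awo fdec; have fdec' m n : (m < n)%N -> f n < f m.
  elim: n => // n IH; rewrite ltnS leq_eqVlt => /orP[/eqP->//|/IH].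
  exact: lt_trans.
have [[n An]|nA] := pselect (exists n, A (f n)); last first.
  by exists 0%N => n _ An; apply: nA; exists n.
have [||m [Am [i im]] mmin] := Awo [set x | A x /\ exists i, x = f i].
- by move=> x [].
- by exists (f n); split=> //; exists n.
exists i.+1 => j ij Aj; have := mmin (f j) (conj Aj (ex_intro _ j erefl)).
by rewrite im leNgt (fdec' i j).
Qed.

Section ArtinSchreier.
Variables (k : closedFieldType) (p : nat).
Hypothesis pchark : p \in [pchar k].
Implicit Types (F G : glaurent k) (e : rat).

Let p_pr : prime p. Proof. exact: pcharf_prime pchark. Qed.
Let p_gt1 : (1 < p)%N. Proof. exact: prime_gt1. Qed.
Let p_gt0 : (0 < p)%N. Proof. exact: prime_gt0. Qed.
Let pr : rat := p%:R.
Let pr_gt1 : 1 < pr. Proof. by rewrite /pr ltr1n. Qed.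
Let pr_gt0 : 0 < pr. Proof. by rewrite /pr ltr0n. Qed.
Let pr_neq0 : pr != 0. Proof. by rewrite gt_eqF. Qed.
Let prX_gt0 n : 0 < pr ^+ n. Proof. exact: exprn_gt0. Qed.
Let prX_neq0 n : pr ^+ n != 0. Proof. by rewrite gt_eqF. Qed.

Lemma exists_proot n (x : k) : exists y, y ^+ (p ^ n) = x.
Proof.
have pn0 : (0 < p ^ n)%N by rewrite expn_gt0 p_gt0.
have [y yE] := solve_monicpoly (fun i => if i == 0%N then x else 0) pn0.
exists y; rewrite yE -(prednK pn0) big_ord_recl /= mulr1 big1 ?addr0 // => i _.
by rewrite mul0r.
Qed.

Definition proot n (x : k) : k := projT1 (cid (exists_proot n x)).

Lemma prootK n x : proot n x ^+ (p ^ n) = x.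
Proof. by rewrite /proot; case: cid. Qed.

Lemma frobK n x : proot n (x ^+ (p ^ n)) = x.
Proof. by apply: (frob_inj pchark (n := n)); rewrite /= prootK. Qed.

Lemma proot0 n : proot n 0 = 0.
Proof. by rewrite -[RHS](frobK n) expr0n expn_eq0 -[p == 0%N]negbK -lt0n p_gt0. Qed.

Lemma proot_id x : proot 0 x = x.
Proof. by rewrite -[LHS]expr1 -(expn0 p) prootK. Qed.

Lemma prootS n x : proot n.+1 x ^+ p = proot n x.
Proof. by apply: (frob_inj pchark (n := n)); rewrite /= prootK -exprM -expnS prootK. Qed.

Fact groot_subproof n F : wo [set q | proot n (F (q * pr ^+ n)) != 0].
Proof.
apply: (@wo_sub _ (gsupp (gsubst (pr ^- n) F))) (gsupp_wo _) => q /= q0.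
suff : gsubst (pr ^- n) F q != 0 by [].
by rewrite gsubstE ?invr_gt0 // invrK; apply: contra_neq q0 => ->; exact: proot0.
Qed.
Definition groot n F := mkglaurent (@groot_subproof n F).

Lemma grootE n F q : groot n F q = proot n (F (q * pr ^+ n)). Proof. by []. Qed.

Lemma grootK n F : groot n F ^+ (p ^ n) = F.
Proof.
by apply: glaurentP => q; rewrite (gfrobXE pchark) grootE prootK divfK.
Qed.

Lemma gfrob_inj n : injective (fun F : glaurent k => F ^+ (p ^ n)).
Proof.
move=> F G /= FG; have : (F - G) ^+ (p ^ n) == 0 by rewrite (gfrobB pchark) FG subrr.
by rewrite expf_eq0 subr_eq0 => /andP[_ /eqP].
Qed.

Lemma AS_coefE F G e : G ^+ p - G + F = 0 -> G (e / pr) ^+ p - G e + F e = 0.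
Proof.
by move/(congr1 (fun H : glaurent k => H e)); rewrite gcoefD gcoefB (gfrobE pchark).
Qed.

(** The equation links the coefficients of [G] at e and e / p. If [F] vanished at all the exponents
    named, nonvanishing of [G] would propagate along e / p^n for e > 0, or along e p^n for e < 0;
    both sequences decrease, against the well-ordering of the support. *)
Lemma AS_supp F G e : G ^+ p - G + F = 0 -> G e != 0 ->
  [\/ e = 0, 0 < e /\ exists n, F (e / pr ^+ n) != 0 |
      e < 0 /\ exists n, F (e * pr ^+ n.+1) != 0].
Proof.
move=> FG Ge; have [e0|e0|->] := ltrgtP e 0; last by constructor 1.
- constructor 3; split=> //; apply: contrapT => nF.
  have F0 n : F (e * pr ^+ n.+1) = 0.
    by apply/eqP; apply: contra_notT nF => ?; exists n.
  have GX n : G (e * pr ^+ n) != 0.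
    elim: n => [|n IH]; first by rewrite expr0 mulr1.
    have := AS_coefE (e * pr ^+ n.+1) FG; rewrite F0 addr0 exprSr mulrA mulfK //.
    by apply: contra_eqN => /eqP->; rewrite subr0 expf_eq0 p_gt0.
  have [n|N NP] := wo_decr (f := fun n => e * pr ^+ n) (gsupp_wo G).
    by rewrite ltr_nM2l // ltr_eXn2l.
  exact: NP (leqnn N) (GX N).
- constructor 2; split=> //; apply: contrapT => nF.
  have F0 n : F (e / pr ^+ n) = 0.
    by apply/eqP; apply: contra_notT nF => ?; exists n.
  have GX n : G (e / pr ^+ n) != 0.
    elim: n => [|n IH]; first by rewrite expr0 divr1.
    have := AS_coefE (e / pr ^+ n) FG; rewrite F0 addr0 => /eqP.
    rewrite subr_eq0 exprSr invfM mulrA => /eqP GE; move: IH; rewrite -GE.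
    by rewrite expf_eq0 p_gt0.
  have [n|N NP] := wo_decr (f := fun n => e / pr ^+ n) (gsupp_wo G).
    by rewrite ltr_pM2l // ltf_pV2 ?posrE // ltr_eXn2l.
  exact: NP (leqnn N) (GX N).
Qed.

Lemma natr_le_expr n : n%:R <= pr ^+ n.
Proof. by rewrite -natrX ler_nat ltnW // ltn_expl. Qed.

Lemma archi_expr (x y : rat) : 0 < y -> exists N, x < y * pr ^+ N.
Proof.
move=> y0; have [n xn] := archi_mulrn x y0; exists n; apply: lt_le_trans xn _.
by rewrite -mulr_natr ler_pM2l // natr_le_expr.
Qed.

(** Multiplication by p^n pushes the least element of [S], which is positive, beyond any given x, so
    only finitely many dilates of [S] have points up to x. *)
Lemma wo_scale_pos (S : set rat) : wo S -> (forall s, S s -> 0 < s) ->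
  wo (\bigcup_n [set x | S (x / pr ^+ n)]).
Proof.
move=> Swo S0; apply: wo_bigcup_local => [n T TS [x Tx]|x n /= Sx].
  have [||m Tm mmin] := Swo [set y | T (y * pr ^+ n)].
  - by move=> y /TS /=; rewrite mulfK.
  - by exists (x / pr ^+ n); rewrite /= divfK.
  - exists (m * pr ^+ n) => // y Ty; rewrite -ler_pdivlMr //.
    by apply: mmin; rewrite /= divfK.
have [m Sm mmin] := Swo S (@subset_refl _ _) (ex_intro _ _ Sx).
have [N xN] := archi_expr x (S0 _ Sm); exists N => y i Sy yx.
rewrite -(ltr_eXn2l (x := pr)) // -(ltr_pM2l (S0 _ Sm)).
apply: le_lt_trans xN; apply: le_trans yx.
by rewrite -ler_pdivlMr // mmin.
Qed.

Lemma wo_scale_neg (S : set rat) : wo S -> (forall s, S s -> s < 0) ->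
  wo (\bigcup_n [set x | S (x * pr ^+ n)]).
Proof.
move=> Swo S0; apply: wo_bigcup_local => [n T TS [x Tx]|x n /= Sx].
  have [||m Tm mmin] := Swo [set y | T (y / pr ^+ n)].
  - by move=> y /TS /=; rewrite divfK.
  - by exists (x * pr ^+ n); rewrite /= mulfK.
  - exists (m / pr ^+ n) => // y Ty; rewrite ler_pdivrMr //.
    by apply: mmin; rewrite /= mulfK.
have [m Sm mmin] := Swo S (@subset_refl _ _) (ex_intro _ _ Sx).
have x0 : 0 < - x by rewrite oppr_gt0 -(pmulr_llt0 _ (prX_gt0 n)) S0.
have [N xN] := archi_expr (- m) x0; exists N => y i Sy yx.
rewrite -(ltr_eXn2l (x := pr)) // -(ltr_pM2l x0).
apply: le_lt_trans xN; rewrite mulNr lerN2.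
apply: le_trans (mmin _ Sy) _.
by rewrite ler_pM2r.
Qed.

Lemma exists_AS_const (a : k) : exists c, c ^+ p - c + a = 0.
Proof.
have [c cE] := solve_monicpoly (fun i => if i == 0%N then - a else (i == 1%N)%:R) p_gt0.
exists c; rewrite cE; have p1 : (p.-1.-1.+1 = p.-1)%N by have := p_gt1; lia.
rewrite -(prednK p_gt0) -p1 !big_ord_recl /= mulr1 expr1 mul1r big1 ?addr0 => [|i _].
  by rewrite addrK addNr.
by rewrite mul0r.
Qed.

(** The root is explicit. At e > 0 it is the sum of the F(e / p^n)^(p^n) for n >= 0, at e < 0 minus
    the sum of the p^n-th roots of F(e p^n) for n >= 1, and at 0 a root of the equation over [k].
    Well-ordering makes the sums finite; [P e] and [N e] bound the indices of their nonzero
    terms. *)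
Lemma exists_AS_root F : exists G, G ^+ p - G + F = 0.
Proof.
have [c cE] := exists_AS_const (F 0).
have Pex e : exists N, 0 < e -> forall n, (N <= n)%N -> F (e / pr ^+ n) = 0.
  have [e0|] := ltP 0 e; last by exists 0%N.
  have [n|N NP] := wo_decr (f := fun n => e / pr ^+ n) (gsupp_wo F).
    by rewrite ltr_pM2l // ltf_pV2 ?posrE // ltr_eXn2l.
  by exists N => _ n /NP /negP; rewrite negbK => /eqP.
have Nex e : exists N, e < 0 -> forall n, (N <= n)%N -> F (e * pr ^+ n.+1) = 0.
  have [e0|] := ltP e 0; last by exists 0%N.
  have [n|N NP] := wo_decr (f := fun n => e * pr ^+ n.+1) (gsupp_wo F).
    by rewrite ltr_nM2l // ltr_eXn2l.
  by exists N => _ n /NP /negP; rewrite negbK => /eqP.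
have [P PP] := choice Pex; have [N NP] := choice Nex.
pose pos m e := \sum_(n < m) F (e / pr ^+ n) ^+ (p ^ n).
pose neg m e := \sum_(n < m) proot n.+1 (F (e * pr ^+ n.+1)).
have posE m e : 0 < e -> (P e <= m)%N -> pos m e = pos (P e) e.
  move=> e0 Pm; rewrite /pos -(subnKC Pm) big_split_ord /= [X in _ + X]big1 ?addr0 // => i _.
  by rewrite PP ?leq_addr // expr0n expn_eq0 -[p == 0%N]negbK -lt0n p_gt0.
have negE m e : e < 0 -> (N e <= m)%N -> neg m e = neg (N e) e.
  move=> e0 Nm; rewrite /neg -(subnKC Nm) big_split_ord /= [X in _ + X]big1 ?addr0 // => i _.
  by rewrite NP ?leq_addr // proot0.
pose g e := if 0 < e then pos (P e) e else if e < 0 then - neg (N e) e else c.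
have gwo : wo [set e | g e != 0].
  have Swo Q : wo (gsupp F `&` Q) by apply: wo_sub (gsupp_wo F) => ? [].
  have W1 := wo_scale_pos (Swo [set e | 0 < e]) (fun s => @proj2 _ _).
  have W2 := wo_scale_neg (Swo [set e | e < 0]) (fun s => @proj2 _ _).
  apply: wo_sub (woU (woU W1 W2) (@wo1 0)) => e /=; rewrite /g.
  have [e0 ge|e0 ge|->] := ltrgtP 0 e; last by right.
  - left; left; apply: contrapT => nF; case/eqP: ge; apply: big1 => n _.
    rewrite (_ : F _ = 0) ?expr0n ?expn_eq0 -1?[p == 0%N]negbK -1?lt0n ?p_gt0 //.
    apply/eqP; apply: contra_notT nF => Fn; exists n => //; split=> //=.
    by rewrite divr_gt0.
  - left; right; apply: contrapT => nF; case/eqP: ge; rewrite /neg big1 ?oppr0 // => n _.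
    rewrite (_ : F _ = 0) ?proot0 //.
    apply/eqP; apply: contra_notT nF => Fn; exists n.+1 => //; split=> //=.
    by rewrite pmulr_llt0.
exists (mkglaurent gwo); apply: glaurentP => e.
rewrite gcoefD gcoefB (gfrobE pchark) /= -/pr /g.
have [e0|e0|<-] := ltrgtP 0 e.
- have e0' : 0 < e / pr by rewrite divr_gt0.
  rewrite e0'; pose m := maxn (P e) (P (e / pr)).
  rewrite -(posE m.+1 e) ?leqW ?leq_maxl // -(posE m (e / pr)) ?leq_maxr //.
  rewrite {2}/pos big_ord_recl expr0 divr1 expn0 expr1 /pos.
  have -> : (\sum_(n < m) F (e / pr / pr ^+ n) ^+ (p ^ n)) ^+ p =
     \sum_(n < m) F (e / pr / pr ^+ n) ^+ (p ^ n.+1).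
    rewrite -[X in _ ^+ X]expn1 (frob_sum pchark); apply: eq_bigr => i _.
    by rewrite -exprM expn1 expnSr.
  rewrite opprD addrCA addrC -!addrA.
  rewrite (_ : \sum_(n < m) _ = \sum_(i < m) F (e / pr ^+ lift ord0 i) ^+ (p ^ lift ord0 i)).
    by rewrite addrA subrr add0r addrC subrr.
  by apply: eq_bigr => i _; rewrite lift0 [pr ^+ _.+1]exprS invfM mulrA.
- have e0' : e / pr < 0 by rewrite pmulr_llt0 ?invr_gt0.
  rewrite ltNge (ltW e0') /= e0'; pose m := maxn (N e) (N (e / pr)).
  rewrite -(negE m e) ?leq_maxl // -(negE m.+1 (e / pr)) ?leqW ?leq_maxr //.
  rewrite exprNn.
  have -> : (- 1) ^+ p = -1 :> k.
    by rewrite -[LHS](pFrobenius_autE pchark) rmorphN1.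
  rewrite mulN1r opprK -[X in neg m.+1 _ ^+ X]expn1 /neg (frob_sum pchark) expn1.
  rewrite big_ord_recl /= expr1 divfK // prootS proot_id.
  rewrite (_ : \sum_(i < m) _ = \sum_(n < m) proot n.+1 (F (e * pr ^+ n.+1))).
    by ring.
  by apply: eq_bigr => i _; rewrite prootS [pr ^+ _.+1]exprS mulrA divfK.
- by rewrite mul0r ltxx.
Qed.

End ArtinSchreier.

(** * Closure properties of C *)

Section CtildeTheory.
Variables (k : closedFieldType) (p : nat).
Hypothesis pchark : p \in [pchar k].
Implicit Types (F G x y : glaurent k) (e : rat) (S : set (glaurent k)).

Let p_pr : prime p. Proof. exact: pcharf_prime pchark. Qed.
Let p_gt1 : (1 < p)%N. Proof. exact: prime_gt1. Qed.
Let p_gt0 : (0 < p)%N. Proof. exact: prime_gt0. Qed.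

Section ASClosedSubalgebra.
Variable S : set (glaurent k).
Hypothesis HS : nontrivial_AS_closed_subalg p S.

Lemma AScl1 : S 1.
Proof. by case: HS => -[S1 _ _] _ _ _; apply: set_mem S1. Qed.

Lemma AScl_lin a x y : S x -> S y -> S (a *: x + y).
Proof.
case: HS => -[_ SL _] _ _ _ Sx Sy; apply: set_mem.
by apply: SL; apply: mem_set.
Qed.

Lemma AScl0 : S 0.
Proof. by have := AScl_lin (-1) AScl1 AScl1; rewrite scaleN1r addNr. Qed.

Lemma AScl_scale a x : S x -> S (a *: x).
Proof. by move=> Sx; have := AScl_lin a Sx AScl0; rewrite addr0. Qed.

Lemma AScl_add x y : S x -> S y -> S (x + y).
Proof. by move=> Sx Sy; have := AScl_lin 1 Sx Sy; rewrite scale1r. Qed.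

Lemma AScl_opp x : S x -> S (- x).
Proof. by move=> Sx; rewrite -scaleN1r; apply: AScl_scale. Qed.

Lemma AScl_sub x y : S x -> S y -> S (x - y).
Proof. by move=> Sx Sy; apply: AScl_add => //; apply: AScl_opp. Qed.

Lemma AScl_mul x y : S x -> S y -> S (x * y).
Proof.
case: HS => -[_ _ SM] _ _ _ Sx Sy; apply: set_mem.
by apply: SM; apply: mem_set.
Qed.

Lemma AScl_exp x n : S x -> S (x ^+ n).
Proof. by move=> Sx; elim: n => [|n IH]; rewrite ?exprS; [apply: AScl1|apply: AScl_mul]. Qed.

Lemma AScl_sum I (r : seq I) (P : pred I) (E : I -> glaurent k) :
  (forall i, P i -> S (E i)) -> S (\sum_(i <- r | P i) E i).
Proof. by move=> SE; elim/big_ind: _ => //; [apply: AScl0|apply: AScl_add]. Qed.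

Lemma AScl_AS F G : S F -> G ^+ p - G + F = 0 -> S G.
Proof. by case: HS => _ _ _ [_ P1 _ _] SF; apply: P1. Qed.

Lemma AScl_subst F c d : 0 < c -> S F -> S (tpow k d * gsubst c F).
Proof. by case: HS => _ _ _ [_ _ _ P3] c0 SF; apply: P3. Qed.

Lemma AScl_gsubst F c : 0 < c -> S F -> S (gsubst c F).
Proof. by move=> c0 /(AScl_subst 0 c0); rewrite tpow0 mul1r. Qed.

Lemma AScl_tpow d : S (tpow k d).
Proof. by have := AScl_subst d ltr01 AScl1; rewrite gsubst_id mulr1. Qed.

Lemma AScl_shift d x : S (tpow k d * x) <-> S x.
Proof.
split=> [Sx|]; last by apply: AScl_mul; apply: AScl_tpow.
by rewrite -[x](mulKf (tpow_neq0 k d)) -tpowN; apply: AScl_mul => //; apply: AScl_tpow.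
Qed.

Lemma AScl_twist F chi alpha : S F -> alpha != 0 -> rat_power alpha chi ->
  S (gtwist chi F).
Proof. by case: HS => _ _ _ [_ _ P2 _]; apply: P2. Qed.

End ASClosedSubalgebra.

Let C := Ctilde p k.
Let HC : nontrivial_AS_closed_subalg p C. Proof. exact: Ctilde_closed. Qed.

Lemma Ctilde_min S : nontrivial_AS_closed_subalg p S -> C `<=` S.
Proof. by move=> HS x Cx; apply: Cx; split. Qed.

Lemma AS_closed_nontrivial S :
  subalg_closed (mem S) ->
  (forall F G, S F -> G ^+ p - G + F = 0 -> S G) ->
  (forall F alpha chi, S F -> alpha != 0 -> rat_power alpha chi -> S (gtwist chi F)) ->
  (forall F (c d : rat), S F -> 0 < c -> S (tpow k d * gsubst c F)) ->
  nontrivial_AS_closed_subalg p S.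
Proof.
move=> Ssub P1 P2 P3; have [/set_mem S1 _ _] := Ssub.
have St : S (tpow k 1) by have := P3 _ 1 1 S1 ltr01; rewrite gsubst_id mulr1.
split=> //.
- by move=> S0; move: S1; rewrite S0 => /eqP; rewrite oner_eq0.
- move=> SE; move: St; rewrite SE => -[a _].
  move/(congr1 (fun F : glaurent k => F 1)); rewrite gcoefZ gcoef1 gmonoE eqxx.
  by rewrite oner_eq0 mulr0 => /esym/eqP; rewrite oner_eq0.
- split=> // [F G SF _|F c d SF c0 _]; [exact: P1|exact: P3].
Qed.

(** The p-th powers of elements of C form a nontrivial Artin-Schreier closed subalgebra, which
    contains C by minimality. Hence C is perfect. *)
Lemma Ctilde_frobenius_image : C `<=` [set F | exists2 G, C G & G ^+ p = F].
Proof.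
apply: Ctilde_min; apply: AS_closed_nontrivial.
- split=> [|a x y /set_mem[x1 Cx <-] /set_mem[y1 Cy <-]
           |x y /set_mem[x1 Cx <-] /set_mem[y1 Cy <-]]; apply/mem_set.
  + by exists 1; [exact: (AScl1 HC)|rewrite expr1n].
  + exists (proot pchark 1 a *: x1 + y1); first exact: (AScl_lin HC).
    by have := gfrobD pchark 1 (proot pchark 1 a *: x1) y1; rewrite expn1 => ->; rewrite exprZn -{2}(expn1 p) prootK.
  + by exists (x1 * y1); [apply: (AScl_mul HC)|rewrite exprMn].
- move=> F G [F1 CF <-] FG.
  pose G1 := groot pchark 1 G; have GE : G = G1 ^+ p by rewrite -[in RHS](expn1 p) grootK.
  exists G1 => //; apply: (AScl_AS HC CF).
  apply: (gfrob_inj pchark (n := 1)); rewrite /= expn1 expr0n -[p == 0%N]negbK -lt0n p_gt0 /=.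
  have := gfrobD pchark 1; rewrite expn1 => ->.
  by have := gfrobB pchark 1; rewrite expn1 => ->; rewrite -GE.
- move=> F alpha chi [F1 CF <-] a0 chiP.
  exists (gtwist chi F1); first exact: (AScl_twist HC CF a0 chiP).
  by rewrite gtwistX //; case: chiP => // ->.
- move=> F c d [F1 CF <-] c0.
  exists (tpow k (d / p%:R) * gsubst c F1); first exact: (AScl_subst HC).
  by rewrite exprMn tpowX -[_ / _ *+ _]mulr_natr divfK ?pnatr_eq0 -?lt0n // gsubstX.
Qed.

Lemma Ctilde_root n F : C (F ^+ (p ^ n)) -> C F.
Proof.
elim: n F => [|n IH] F; first by rewrite expr1.
rewrite expnSr exprM => /Ctilde_frobenius_image[G CG GE]; apply: IH.
by rewrite (_ : F ^+ (p ^ n) = G) //; apply: (gfrob_inj pchark (n := 1)); rewrite /= expn1 GE.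
Qed.

Lemma exists_prim_root n : n%:R != 0 :> k -> exists z : k, n.-primitive_root z.
Proof.
move=> nk0; have n0 : (0 < n)%N.
  by rewrite lt0n; apply: contra_neq nk0 => ->.
have [rs rsE] := closed_field_poly_normal ('X^n - 1 : {poly k}).
have m1 : ('X^n - 1 : {poly k}) \is monic by rewrite monicXnsubC.
rewrite (monicP m1) scale1r in rsE.
have urs : uniq rs by rewrite -separable_prod_XsubC -rsE separable_Xn_sub_1.
have /hasP[z _ zP] : has n.-primitive_root rs; last by exists z.
apply: has_prim_root => //.
  apply/allP => z zrs; rewrite /root_of_unity rsE root_prod_XsubC //.
have : size ('X^n - 1 : {poly k}) = n.+1 by rewrite size_XnsubC.
by rewrite rsE size_prod_XsubC => -[->].
Qed.

(* With [z] a primitive root of unity of order [p^l - 1], [x] is minus the sum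
   of the [z^-a sigma(z^a x)], where [sigma u] is the sum of the [u^(p^i)] for
   [i < l]; and [sigma(z^a x)] is a root of the Artin-Schreier equation
   attached to [z^a (x - x^(p^l))]. *)
Lemma Ctilde_ASl l x : (0 < l)%N -> C (x - x ^+ (p ^ l)) -> C x.
Proof.
move=> l0 Cy; set q := (p ^ l)%N.
have q0 : (0 < q)%N by rewrite expn_gt0 p_gt0.
have q1k : q.-1%:R = -1 :> k.
  apply/eqP; rewrite -subr_eq0 opprK natr1 prednK // natrX (pcharf0 pchark).
  by rewrite expr0n gtn_eqF.
have [|z zP] := @exists_prim_root q.-1; first by rewrite q1k oppr_eq0 oner_eq0.
have z0 : z != 0.
  apply/eqP => z0; have := prim_expr_order zP.
  by rewrite z0 expr0n gtn_eqF ?(prim_order_gt0 zP) // => /esym/eqP; rewrite oner_eq0.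
have zq : z ^+ q = z by rewrite -(prednK q0) exprS (prim_expr_order zP) mulr1.
pose sigma u := \sum_(i < l) (u : glaurent k) ^+ (p ^ i).
have Csig a : C (sigma (z ^+ a *: x)).
  apply: (AScl_AS HC (AScl_scale HC (z ^+ a) Cy)).
  have -> : sigma (z ^+ a *: x) ^+ p = \sum_(i < l) (z ^+ a *: x) ^+ (p ^ i.+1).
    rewrite -{1}(expn1 p) (gfrob_sum pchark); apply: eq_bigr => i _.
    by rewrite -exprM expn1 expnSr.
  rewrite /sigma -sumrB.
  rewrite -(big_mkord xpredT (fun i => (z ^+ a *: x) ^+ (p ^ i.+1) - (z ^+ a *: x) ^+ (p ^ i))).
  rewrite (telescope_sumr (fun i => (z ^+ a *: x) ^+ (p ^ i))) //.
  by rewrite expn0 expr1 exprZn -exprM mulnC exprM zq scalerBr addrA subrK subrr.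
have -> : x = - \sum_(a < q.-1) z ^- a *: sigma (z ^+ a *: x).
  have -> : \sum_(a < q.-1) z ^- a *: sigma (z ^+ a *: x) =
      \sum_(i < l) (\sum_(a < q.-1) (z ^+ (p ^ i).-1) ^+ a) *: x ^+ (p ^ i).
    rewrite /sigma; under eq_bigr do rewrite scaler_sumr.
    rewrite exchange_big /=; apply: eq_bigr => i _; rewrite scaler_suml.
    apply: eq_bigr => a _; rewrite exprZn scalerA; congr (_ *: _).
    rewrite -!exprM; have pi0 : (0 < p ^ i)%N by rewrite expn_gt0 p_gt0.
    by rewrite -{1}(prednK pi0) mulnS exprD mulKf ?expf_neq0 // mulnC.
  rewrite -(prednK l0) big_ord_recl /= expn0 expr0 expr1.
  rewrite (eq_bigr (fun=> 1)) => [|a _]; last by rewrite expr1n.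
  rewrite sumr_const card_ord q1k scaleN1r big1 ?addr0 ?opprK // => i _.
  set m := (p ^ _).-1.
  have zm1 : z ^+ m != 1.
    have il : (bump 0 i < l)%N by rewrite /bump; have := ltn_ord i; lia.
    have m0 : (1 < p ^ bump 0 i)%N by rewrite -{1}(expn0 p) ltn_exp2l.
    have mq : (p ^ bump 0 i < q)%N by rewrite ltn_exp2l.
    by rewrite -(prim_order_dvd zP) gtnNdvd // /m; lia.
  suff /eqP : (z ^+ m - 1) * (\sum_(a < q.-1) (z ^+ m) ^+ a) = 0.
    by rewrite mulf_eq0 subr_eq0 (negPf zm1) /= => /eqP->; rewrite scale0r.
  by rewrite -subrX1 -exprM mulnC exprM (prim_expr_order zP) expr1n subrr.
apply: (AScl_opp HC) => //; apply: (AScl_sum HC) => // a _.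
exact: (AScl_scale HC).
Qed.

(** The exponent c = A / (p^l - 1) satisfies c + A = p^l c, so t^c x solves the equation without the
    factor t^A. *)
Lemma Ctilde_twist l A x y : (0 < l)%N -> C y ->
  x = y + tpow k A * x ^+ (p ^ l) -> C x.
Proof.
move=> l0 Cy xE; pose P : rat := (p ^ l)%:R.
have P1 : P - 1 != 0.
  by rewrite subr_eq0 pnatr_eq1 gtn_eqF // -{1}(expn0 p) ltn_exp2l.
pose c := A / (P - 1); apply/(AScl_shift HC c); apply: (Ctilde_ASl l0).
rewrite exprMn tpowX -/P (_ : _ - _ = tpow k c * y); first exact/(AScl_shift HC).
rewrite {1}xE mulrDr mulrA -tpowD (_ : c + A = c *+ (p ^ l)) ?addrK //.
by rewrite -mulr_natr -/P /c; field.
Qed.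

Lemma Ctilde_twist_root l A x y : (0 < l)%N -> C y ->
  x ^+ (p ^ l) = tpow k A * x + y -> C x.
Proof.
move=> l0 Cy xE; apply: (@Ctilde_twist l (- A) x (- (tpow k (- A) * y))) => //.
  by apply: (AScl_opp HC) => //; apply/(AScl_shift HC).
rewrite xE mulrDr mulrA -tpowD addNr tpow0 mul1r addrC addrK //.
Qed.

End CtildeTheory.

(** * Polynomials in t^d, generated subfields, linear dependence of powers *)

Section MonomialEvaluation.
Variable k : fieldType.
Implicit Types (F G : glaurent k) (f g : {poly k}) (d e : rat).

Definition teval d : {poly k} -> glaurent k := horner_alg (tpow k d).
HB.instance Definition _ d := GRing.LRMorphism.copy (teval d) (horner_alg (tpow k d)).

Lemma tevalE d f : teval d f = \sum_(i < size f) f`_i *: tpow k (d *+ i).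
Proof.
rewrite /teval /horner_alg /horner_morph horner_coef size_map_poly.
by apply: eq_bigr => i _; rewrite coef_map /= tpowX mulr_algl.
Qed.

Lemma teval_wide d f n : (size f <= n)%N ->
  teval d f = \sum_(i < n) f`_i *: tpow k (d *+ i).
Proof.
move=> fn; rewrite tevalE -(subnKC fn) [RHS]big_split_ord /= [X in _ + X]big1 ?addr0 // => i _.
by rewrite nth_default ?scale0r // leq_addr.
Qed.

Lemma teval_coef d f n : d != 0 -> teval d f (d *+ n) = f`_n.
Proof.
move=> d0; rewrite (@teval_wide _ _ (maxn (size f) n.+1)) ?leq_maxl // gcoef_sum.
have nlt : (n < maxn (size f) n.+1)%N by rewrite leq_max ltnSn orbT.
rewrite (bigD1 (Ordinal nlt)) //= eqxx mulr1 big1 ?addr0 // => i ni.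
case: eqP => [E|]; last by rewrite mulr0.
case/eqP: ni; apply: val_inj => /=; apply/eqP; move/eqP: E.
by rewrite -[d *+ n]mulr_natr -[d *+ i]mulr_natr (inj_eq (mulfI d0)) eqr_nat eq_sym.
Qed.

Lemma teval_eq0 d f : d != 0 -> (teval d f == 0) = (f == 0).
Proof.
move=> d0; apply/eqP/eqP => [f0|->]; last exact: rmorph0.
by apply/polyP => i; rewrite coef0 -(teval_coef f i d0) f0.
Qed.

Lemma tevalC d a : teval d a%:P = a%:A. Proof. exact: horner_algC. Qed.
Lemma tevalX d : teval d 'X = tpow k d. Proof. exact: horner_algX. Qed.

Lemma teval_comp d f n : teval d (f \Po 'X^n) = teval (d *+ n) f.
Proof.
rewrite comp_polyE rmorph_sum tevalE; apply: eq_bigr => i _.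
by rewrite -mul_polyC rmorphM /= tevalC mulr_algl -exprM rmorphXn /= tevalX tpowX mulrnA.
Qed.

Lemma gsubst_teval c d f : 0 < c -> gsubst c (teval d f) = teval (c * d) f.
Proof.
move=> c0; rewrite !tevalE; elim/big_rec2: _ => [|i x y _ <-]; first exact: gsubst0.
by rewrite gsubstD gsubstZ /tpow gsubst_mono // mulrnAr.
Qed.

Definition fraction_set d : set (glaurent k) :=
  [set x | exists f g, g != 0 /\ x = teval d f / teval d g].

Lemma fraction_set_closed d : d != 0 -> divring_closed (mem (fraction_set d)).
Proof.
move=> d0; split=> [|x y /set_mem[f1 [g1 [g10 ->]]] /set_mem[f2 [g2 [g20 ->]]]
                    |x y /set_mem[f1 [g1 [g10 ->]]] /set_mem[f2 [g2 [g20 ->]]]]; apply/mem_set.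
- by exists 1, 1; rewrite oner_eq0 !rmorph1 divr1.
- exists (f1 * g2 - f2 * g1), (g1 * g2); rewrite mulf_neq0 //; split=> //.
  by rewrite rmorphB !rmorphM /= -[- (_ / _)]mulNr addf_div ?teval_eq0 // mulNr.
- have [->|f20] := eqVneq f2 0.
    by exists 0, 1; rewrite oner_eq0 !rmorph0 !mul0r invr0 mulr0.
  exists (f1 * g2), (g1 * f2); rewrite mulf_neq0 //; split=> //.
  by rewrite !rmorphM /= invf_div mulf_div.
Qed.

End MonomialEvaluation.

Lemma gen_subfield_min (M : fieldType) (X S : set M) :
  divring_closed (mem S) -> X `<=` S -> gen_subfield X `<=` S.
Proof. by move=> Sd XS x; apply. Qed.

Lemma gen_subfield_sub (M : fieldType) (X : set M) : X `<=` gen_subfield X.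
Proof. by move=> x Xx S [_]; apply. Qed.

Section GenSubfield.
Variables (M : fieldType) (X : set M).
Let E := gen_subfield X.

Lemma gsf1 : E 1. Proof. by have [/set_mem] := gen_subfield_closed X. Qed.
Lemma gsfB x y : E x -> E y -> E (x - y).
Proof.
have [_ EB _] := gen_subfield_closed X => Ex Ey.
by apply: set_mem; apply: EB; apply: mem_set.
Qed.
Lemma gsf_div x y : E x -> E y -> E (x / y).
Proof.
have [_ _ EV] := gen_subfield_closed X => Ex Ey.
by apply: set_mem; apply: EV; apply: mem_set.
Qed.
Lemma gsf0 : E 0. Proof. by rewrite -(subrr 1); apply: gsfB gsf1 gsf1. Qed.
Lemma gsfN x : E x -> E (- x). Proof. by rewrite -sub0r; apply: gsfB gsf0. Qed.
Lemma gsfD x y : E x -> E y -> E (x + y).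
Proof. by move=> Ex Ey; rewrite -[y]opprK; apply: gsfB => //; apply: gsfN. Qed.
Lemma gsfV x : E x -> E x^-1. Proof. by rewrite -div1r; apply: gsf_div gsf1. Qed.
Lemma gsfM x y : E x -> E y -> E (x * y).
Proof. by move=> Ex Ey; rewrite -[y]invrK; apply: gsf_div => //; apply: gsfV. Qed.
Lemma gsfX x n : E x -> E (x ^+ n).
Proof. by move=> Ex; elim: n => [|n IH]; rewrite ?exprS; [apply: gsf1|apply: gsfM]. Qed.
Lemma gsf_sum I (r : seq I) (P : pred I) (f : I -> M) :
  (forall i, P i -> E (f i)) -> E (\sum_(i <- r | P i) f i).
Proof. by move=> Ef; elim/big_ind: _ => //; [apply: gsf0|apply: gsfD]. Qed.
End GenSubfield.

(** The residues of the ['X^(e i)] modulo [P] are vectors of length deg P; one more of them than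
    that length gives a nonzero vector in the kernel of their matrix. *)
Lemma algebraic_powers_dependent (E M : fieldType) (f : {rmorphism E -> M}) (x : M)
    (e : nat -> nat) : algebraicOver f x ->
  exists n (v : 'I_n.+1 -> E), (exists i, v i != 0) /\ \sum_i f (v i) * x ^+ e i = 0.
Proof.
move=> [P P0 rP]; pose n := (size P).-1.
pose X : 'M[E]_(n.+1, n) := \matrix_(i < n.+1) poly_rV ('X^(e i) %% P).
have : kermx X != 0.
  rewrite kermx_eq0 /row_free ltn_eqF // ltnS.
  exact: rank_leq_col.
move/rowV0Pn => [v /sub_kermxP vX v0].
have div : P %| \sum_(i < n.+1) v 0 i *: 'X^(e i).
  have modsum m (a : 'I_m -> {poly E}) : (\sum_i a i) %% P = \sum_i (a i %% P).
    elim: m a => [|m IH] a; first by rewrite !big_ord0 mod0p.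
    by rewrite !big_ord_recl modpD IH.
  apply/eqP; rewrite modsum.
  have szX i : (size ('X^(e i) %% P : {poly E})%R <= n)%N.
    by rewrite -ltnS (leq_trans (ltn_modpN0 _ P0)) // leqSpred.
  transitivity (rVpoly (v *m X)); last by rewrite vX linear0.
  rewrite mulmx_sum_row linear_sum; apply: eq_bigr => i _.
  by rewrite linearZ /= rowK poly_rV_K // modpZl.
have /dvdpP[Q QE] := div.
exists n, (v 0); split; first exact/rV0Pn.
have E0 : (map_poly f (\sum_(i < n.+1) v 0 i *: 'X^(e i))).[x] = 0.
  by rewrite QE rmorphM hornerM (rootP rP) mulr0.
rewrite -[RHS]E0 rmorph_sum horner_sum; apply: eq_bigr => i _.
by rewrite /= map_polyZ /= hornerZ map_polyXn hornerXn.
Qed.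

(** * Additive relations *)

Section Ore.
Variables (k : closedFieldType) (p : nat).
Hypothesis pchark : p \in [pchar k].
Implicit Types (F G : glaurent k).

Let p_pr : prime p. Proof. exact: pcharf_prime pchark. Qed.
Let p_gt1 : (1 < p)%N. Proof. exact: prime_gt1. Qed.
Let p_gt0 : (0 < p)%N. Proof. exact: prime_gt0. Qed.
Let E := subfield_of (@kt_gens k).
Notation algt := (algebraicOver (val : E -> glaurent k)).

Lemma kt_fraction x : gen_subfield (@kt_gens k) x -> fraction_set 1 x.
Proof.
apply: gen_subfield_min; first exact: fraction_set_closed.
move=> y [[a _ <-]|->].
  by exists a%:P, 1; rewrite oner_eq0 tevalC rmorph1 divr1.
by exists 'X, 1; rewrite oner_eq0 tevalX rmorph1 divr1.
Qed.

Lemma common_denominator n (v : 'I_n -> E) :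
  exists g (f : 'I_n -> {poly k}), g != 0 /\ forall i, val (v i) * teval 1 g = teval 1 (f i).
Proof.
have /choice[fg fgP] i : exists fg : {poly k} * {poly k},
    fg.2 != 0 /\ val (v i) = teval 1 fg.1 / teval 1 fg.2.
  have [f [g [g0 vE]]] := kt_fraction (set_mem (valP (v i))).
  by exists (f, g).
exists (\prod_i (fg i).2), (fun i => (fg i).1 * \prod_(j | j != i) (fg j).2).
split=> [|i]; first by apply/prodf_neq0 => i _; case: (fgP i).
have [g0 vE] := fgP i; have g0' : teval 1 (fg i).2 != 0 by rewrite teval_eq0 ?oner_eq0.
rewrite (bigD1 i) //= rmorphM [RHS]rmorphM mulrA; congr (_ * _).
by rewrite [X in X * _]vE divfK.
Qed.

Lemma Ore_relation F : algt F -> exists d (A : nat -> {poly k}),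
  (exists2 i, (i <= d)%N & A i != 0) /\
  \sum_(i < d.+1) teval 1 (A i) * F ^+ (p ^ i) = 0.
Proof.
move=> /(algebraic_powers_dependent (fun i => p ^ i)%N)[n [v [[i vi] rel]]].
have [g [f [g0 fP]]] := common_denominator v.
exists n, (fun i => if insub i is Some j then f j else 0); split.
  exists (nat_of_ord i); first by rewrite -ltnS ltn_ord.
  rewrite (valK i); apply: contra_neq vi => fi0; apply: val_inj; rewrite rmorph0.
  have := fP i; rewrite fi0 rmorph0 => /eqP; rewrite mulf_eq0 teval_eq0 ?oner_eq0 //.
  by rewrite (negPf g0) orbF => /eqP.
have g0' : teval 1 g != 0 by rewrite teval_eq0 ?oner_eq0.
transitivity (0 * teval 1 g); last by rewrite mul0r.
rewrite -[X in _ = X * _]rel mulr_suml.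
by apply: eq_bigr => j _; rewrite (valK j) -fP mulrAC.
Qed.

Lemma teval_frob n (A : {poly k}) :
  teval 1 (map_poly (proot pchark n) A) ^+ (p ^ n) = gsubst (p ^ n)%:R (teval 1 A).
Proof.
have pn0 : 0 < (p ^ n)%:R :> rat by rewrite ltr0n expn_gt0 p_gt0.
rewrite (@teval_wide _ _ _ (size A)) ?size_poly // (gfrob_sum pchark).
rewrite gsubst_teval // mulr1 tevalE; apply: eq_bigr => i _.
rewrite coef_map_id0 ?proot0 // exprZn prootK tpowX; congr (_ *: tpow _ _).
by rewrite -mulrnA mulnC mulrnA.
Qed.

(** Let A_j be the first nonzero coefficient of an additive relation. After t -> t^(p^j) all
    coefficients are p^j-th powers, because [k] is perfect, and the p^j-th root of the relation
    starts with the series itself. *)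
Lemma Ore_relation_normalized F : algt F -> exists j d (A : nat -> {poly k}),
  A 0%N != 0 /\ \sum_(i < d.+1) teval 1 (A i) * gsubst (p ^ j)%:R F ^+ (p ^ i) = 0.
Proof.
move=> /Ore_relation[d [A [[i id Ai] rel]]].
have exA : exists i, A i != 0 by exists i.
case: (ex_minnP exA) => j Aj jmin.
have jd : (j <= d)%N := leq_trans (jmin _ Ai) id.
have pj0 : 0 < (p ^ j)%:R :> rat by rewrite ltr0n expn_gt0 p_gt0.
exists j, (d - j)%N, (fun i => map_poly (proot pchark j) (A (j + i)%N)); split.
  apply: contra_neq Aj => A0; apply/polyP => l.
  have := congr1 (fun q : {poly k} => q`_l) A0; rewrite addn0 coef_map_id0 ?proot0 // !coef0 => E0.
  by rewrite -[LHS](prootK pchark j) E0 expr0n expn_eq0 -[p == 0%N]negbK -lt0n p_gt0.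
apply: (gfrob_inj pchark (n := j)).
rewrite /= (gfrob_sum pchark) expr0n expn_eq0 -[p == 0%N]negbK -lt0n p_gt0 /=.
transitivity (gsubst (p ^ j)%:R (0 : glaurent k)); last exact: gsubst0.
rewrite -[X in _ = gsubst _ X]rel -[in RHS](subnKC jd) -addnS big_split_ord /=.
rewrite gsubstD [X in gsubst _ X + _]big1 => [|i' _]; last first.
  have Ai0 : A i' = 0.
    by apply/eqP; apply: contraT => Ai'; have := jmin _ Ai'; rewrite leqNgt ltn_ord.
  by rewrite Ai0 rmorph0 mul0r.
rewrite gsubst0 add0r; elim/big_rec2: _ => [|i' x y _ ->]; first by rewrite gsubst0.
rewrite gsubstD; congr (_ + _).
by rewrite exprMn teval_frob gsubstM // gsubstX // -exprM -expnD addnC.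
Qed.

End Ore.

(** * Spans, and the windows of the Frobenius powers of a series *)

Section Span.
Variables (k : fieldType) (V : lmodType k).
Implicit Types (s : seq V) (x y : V).

Definition inspan s x := exists c : nat -> k, x = \sum_(i < size s) c i *: s`_i.

Lemma inspan0 s : inspan s 0.
Proof. by exists (fun=> 0); rewrite big1 // => i _; rewrite scale0r. Qed.

Lemma inspanD s x y : inspan s x -> inspan s y -> inspan s (x + y).
Proof.
move=> [c ->] [b ->]; exists (fun i => c i + b i).
by rewrite -big_split; apply: eq_bigr => i _; rewrite scalerDl.
Qed.

Lemma inspanZ s a x : inspan s x -> inspan s (a *: x).
Proof.
move=> [c ->]; exists (fun i => a * c i); rewrite scaler_sumr.
by apply: eq_bigr => i _; rewrite scalerA.
Qed.

Lemma inspanN s x : inspan s x -> inspan s (- x).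
Proof. by rewrite -scaleN1r; apply: inspanZ. Qed.

Lemma inspan_sum s I (r : seq I) (P : pred I) (E : I -> V) :
  (forall i, P i -> inspan s (E i)) -> inspan s (\sum_(i <- r | P i) E i).
Proof. by move=> sE; elim/big_ind: _ => //; [apply: inspan0|apply: inspanD]. Qed.

Lemma mem_inspan s x : x \in s -> inspan s x.
Proof.
move=> xs; exists (fun i => (i == index x s)%:R).
have xi : (index x s < size s)%N by rewrite index_mem.
rewrite (bigD1 (Ordinal xi)) //= eqxx scale1r nth_index // big1 ?addr0 // => i.
by rewrite -val_eqE /= => /negPf->; rewrite scale0r.
Qed.

Lemma inspan_trans s t x : inspan s x -> (forall y, y \in s -> inspan t y) -> inspan t x.
Proof.
move=> [c ->] st; apply: inspan_sum => i _; apply: inspanZ; apply: st.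
exact: mem_nth.
Qed.

End Span.

Lemma int_shift (J : int) (b : nat) : J <= b%:Z -> - b%:Z <= J ->
  exists2 l, (l < (b + b).+1)%N & J = l%:Z - b%:Z.
Proof. by move=> J1 J2; exists `|(J + b%:Z)%R|%N; lia. Qed.

Lemma int_window_uniq (x : rat) (i j : int) :
  i%:~R <= x < i%:~R + 1 -> j%:~R <= x < j%:~R + 1 -> i = j.
Proof.
move=> /andP[i1 i2] /andP[j1 j2]; apply/eqP.
have ij : i < j + 1 by rewrite -(ltr_int rat) intrD; apply: le_lt_trans j2.
have ji : j < i + 1 by rewrite -(ltr_int rat) intrD; apply: le_lt_trans i2.
lia.
Qed.

Section Windows.
Variables (k : closedFieldType) (p : nat).
Hypothesis pchark : p \in [pchar k].
Implicit Types (F G : glaurent k) (J E : int) (m n : nat) (s e : rat).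

Let p_pr : prime p. Proof. exact: pcharf_prime pchark. Qed.
Let p_gt1 : (1 < p)%N. Proof. exact: prime_gt1. Qed.
Let p_gt0 : (0 < p)%N. Proof. exact: prime_gt0. Qed.
Let pr : rat := p%:R.
Let pr_gt1 : 1 < pr. Proof. by rewrite /pr ltr1n. Qed.
Let pr_gt0 : 0 < pr. Proof. by rewrite /pr ltr0n. Qed.
Let prX_gt0 n : 0 < pr ^+ n. Proof. exact: exprn_gt0. Qed.
Let prX_neq0 n : pr ^+ n != 0. Proof. by rewrite gt_eqF. Qed.
Let prX_ge1 n : 1 <= pr ^+ n. Proof. by rewrite exprn_ege1 // ltW. Qed.

Definition unit_interval : set rat := [set x | 0 <= x < 1].

(** The part of F^(p^m) on [J, J + 1), moved to the unit interval; in terms of [F], it shows the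
    support points between J / p^m and (J + 1) / p^m. *)
Definition window m J F : glaurent k :=
  gmask unit_interval (tpow k (- J%:~R) * F ^+ (p ^ m)).

Lemma windowE m J F (x : rat) :
  window m J F x = if 0 <= x < 1 then F ((x + J%:~R) / pr ^+ m) ^+ (p ^ m) else 0.
Proof. by rewrite gmaskE tpowM opprK (gfrobXE pchark) /unit_interval /= asboolb. Qed.

Definition in_window m J s := J%:~R <= pr ^+ m * s < J%:~R + 1.

Lemma window_neq0 m J F : window m J F != 0 -> exists2 s, gsupp F s & in_window m J s.
Proof.
move/gneq0P => [x]; rewrite windowE; case: ifP => [x01 Fx|_]; last by rewrite eqxx.
exists ((x + J%:~R) / pr ^+ m).
  by apply: contra_neq Fx => ->; rewrite (expr0pn pchark).
by rewrite /in_window mulrC divfK // addrC lerDl ltrD2l.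
Qed.

Section Relation.
Variables (F : glaurent k) (d h : nat) (A : nat -> {poly k}).
Hypothesis Ah : forall i, (i <= d)%N -> (size (A i) <= h)%N.
Hypothesis rel : \sum_(i < d.+1) teval 1 (A i) * F ^+ (p ^ i) = 0.
Let S := gsupp F.

Lemma relation_coef e :
  \sum_(i < d.+1) \sum_(j < h) (A i)`_j * F ((e - j%:R) / pr ^+ i) ^+ (p ^ i) = 0.
Proof.
transitivity ((0 : glaurent k) e); last by [].
rewrite -[X in _ = gcoef X _]rel gcoef_sum; apply: eq_bigr => i _.
have id : (i <= d)%N by rewrite -ltnS ltn_ord.
rewrite (teval_wide _ (Ah id)) mulr_suml gcoef_sum; apply: eq_bigr => j _.
by rewrite -scalerAl gcoefZ tpowM (gfrobXE pchark).
Qed.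

(** The p^n-th power of the relation, shifted by E and cut to the unit interval. The factor t^j
    becomes t^(j p^n), which moves the window to the left by j p^n. *)
Lemma relation_window n E :
  \sum_(i < d.+1) \sum_(j < h)
    (A i)`_j ^+ (p ^ n) *: window (n + i) (E - (j * p ^ n)%:Z) F = 0.
Proof.
apply: glaurentP => x; rewrite gcoef_sum gcoef0.
under eq_bigr do rewrite gcoef_sum.
have [x01|x01] := boolP (0 <= x < 1); last first.
  by rewrite big1 // => i _; rewrite big1 // => j _; rewrite gcoefZ windowE (negPf x01) mulr0.
have := relation_coef ((x + E%:~R) / pr ^+ n).
move/(congr1 (fun a => a ^+ (p ^ n))).
rewrite (frob_sum pchark) (expr0pn pchark) => E0.
apply: (etrans _ E0); apply: eq_bigr => i _; rewrite (frob_sum pchark); apply: eq_bigr => j _.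
rewrite gcoefZ windowE x01 exprMn -exprM -expnD addnC; congr (_ * F _ ^+ _).
rewrite intrD mulrNz -pmulrn natrM natrX exprD -/pr.
by field; rewrite !prX_neq0.
Qed.

Lemma gap c : exists m, forall s, S s -> c < s -> c + pr ^- m <= s.
Proof.
have [[s [Ss cs]]|nS] := pselect (exists s, S s /\ c < s); last first.
  by exists 0%N => s Ss cs; case: nS; exists s.
have [||s0 [Ss0 cs0] smin] := gsupp_wo F (S `&` [set s | c < s]).
- by move=> ? [].
- by exists s.
have cs0' : 0 < s0 - c by rewrite subr_gt0.
have [m mP] := archi_expr pchark 1 cs0'.
exists m => t St ct; apply: le_trans (smin t (conj St ct)).
rewrite addrC -lerBrDr -[X in X <= _]mul1r ler_pdivrMr //; exact: ltW.
Qed.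

(* The s at which p^i s + j and p^i' s + j' agree. *)
Definition tie (i i' j j' : nat) : rat := (j%:R - j'%:R) / (pr ^+ i' - pr ^+ i).

(** There are finitely many ties, and each has a gap on its right because the support is
    well-ordered. The condition [d <= m1] makes the exponent m - i of the Frobenius below a natural
    number as soon as m >= m1. *)
Lemma ties_gap : exists m1, (d <= m1)%N /\
  forall i i' j j' s, (i <= d)%N -> (i' <= d)%N -> (j < h)%N -> (j' < h)%N ->
    S s -> tie i i' j j' < s -> tie i i' j j' + pr ^- m1 <= s.
Proof.
have [f fP] := choice (fun x : 'I_d.+1 * 'I_d.+1 * ('I_h * 'I_h) =>
  gap (tie x.1.1 x.1.2 x.2.1 x.2.2)).
exists (maxn d (\max_x f x)); split=> [|i i' j j' s id i'd jh j'h Ss ts].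
  exact: leq_maxl.
pose x := ((Ordinal (id : (i < d.+1)%N), Ordinal (i'd : (i' < d.+1)%N)),
          (Ordinal jh, Ordinal j'h)).
apply: le_trans (fP x _ Ss ts); rewrite lerD2l lef_pV2 ?posrE //.
rewrite ler_eXn2l //; apply: leq_trans (leq_maxr _ _).
exact: (leq_bigmax x).
Qed.

Lemma supp_lower_bound : exists B : nat, forall s, S s -> - B%:R <= s.
Proof.
have [[s Ss]|nS] := pselect (exists s, S s); last first.
  by exists 0%N => s Ss; case: nS; exists s.
have [||s0 Ss0 smin] := gsupp_wo F S; [by []|by exists s|].
exists (Num.bound `|s0|) => t St; apply: le_trans (smin t St).
rewrite lerNl; apply: le_trans (ltW (archi_boundP (normr_ge0 _))).
by rewrite -normrN ler_norm.
Qed.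

Hypothesis A0 : A 0%N != 0.

(** By minimal counterexample. Among the windows outside the span of the finite list [base], one
    whose least support point s is minimal, and then m minimal for this s, is expressed by the
    relation through other windows. One of these is bad as well, and every position it can have
    contradicts one of the minimalities or the gap at ties. *)
Theorem windows_finite : exists s : seq (glaurent k), forall m J, inspan s (window m J F).
Proof.
have [m1 [dm1 gapP]] := ties_gap; have [B BP] := supp_lower_bound.
(* For m < m1 and s < h + 2 the number p^m s lies between - p^m1 B and p^m1 (h + 2), so all these
   windows belong to [base]; the successor covers the rounding from p^m s to J. *)
pose bnd := (p ^ m1 * (h + 2 + B)).+1.
pose base := [seq window m (l%:Z - bnd%:Z) F | m <- iota 0 m1, l <- iota 0 (bnd + bnd).+1].
exists base => m0 J0; apply: contrapT => bad0.
pose bad m J := ~ inspan base (window m J F).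
pose least m J s := [/\ S s, in_window m J s & forall s', S s' -> in_window m J s' -> s <= s'].
have badP m J : bad m J -> exists s, least m J s.
  move=> b; have /window_neq0[s Ss sI] : window m J F != 0.
    by apply: contra_notN b => /eqP->; apply: inspan0.
  have [||s0 [Ss0 s0I] smin] := gsupp_wo F (S `&` [set s | in_window m J s]).
  - by move=> ? [].
  - by exists s.
  by exists s0; split=> // s' Ss' s'I; apply: smin.
have [||s [m' [J' [b' l']]] smin] := gsupp_wo F [set s | exists m J, bad m J /\ least m J s].
- by move=> s [m [J [_ []]]].
- by have [s ls] := badP _ _ bad0; exists s, m0, J0.
have exm : exists m, `[< exists J, bad m J /\ least m J s >].
  by exists m'; apply/asboolP; exists J'.
case: (ex_minnP exm) => m /asboolP[J [badJ [Ss sI sleast]]] mmin {exm m' J' b' l'}.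
have sm : (m1 <= m)%N \/ h%:R + 2 <= s.
  have [|mm1] := leqP m1 m; [by left|right]; rewrite leNgt; apply/negP => sh.
  apply: badJ; apply: mem_inspan; apply/allpairsP.
  have /andP[J1 J2] := sI; have Bs := BP _ Ss.
  have pm : pr ^+ m <= pr ^+ m1 by rewrite ler_eXn2l // ltnW.
  have bndE : (bnd%:Z)%:~R = pr ^+ m1 * (h%:R + 2 + B%:R) + 1 :> rat.
    by rewrite /bnd -pmulrn -[LHS]natr1 natrM natrX !natrD.
  have hB : 0 <= h%:R + 2 + B%:R :> rat by rewrite !addr_ge0 ?ler0n.
  have le1 : pr ^+ m * (h%:R + 2 + B%:R) <= pr ^+ m1 * (h%:R + 2 + B%:R).
    exact: ler_wpM2r.
  have b1 : J <= bnd%:Z.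
    rewrite -(ler_int rat) bndE; apply: le_trans J1 _; apply: le_trans (_ : _ <= pr ^+ m1 * (h%:R + 2 + B%:R)) _; last lra.
    apply: le_trans le1; rewrite ler_pM2l //; have : 0 <= B%:R :> rat by exact: ler0n.
    lra.
  have b2 : - bnd%:Z <= J.
    rewrite -(ler_int rat) mulrNz bndE.
    have : pr ^+ m * (- s) <= pr ^+ m1 * (h%:R + 2 + B%:R).
      apply: le_trans le1; rewrite ler_pM2l //; have : 0 <= h%:R :> rat by exact: ler0n.
      lra.
    rewrite mulrN; lra.
  have [l lb ->] := int_shift b1 b2.
  by exists (m, l); split=> //; rewrite mem_iota add0n.
pose mu (x : 'I_d.+1 * 'I_h) : rat := x.2%:R + pr ^+ x.1 * s.
pose P (x : 'I_d.+1 * 'I_h) := (A x.1)`_x.2 != 0.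
have [x0 Px0 x00] : exists2 x0, P x0 & x0.1 = 0%N :> nat.
  have lh : ((size (A 0%N)).-1 < h)%N.
    by apply: leq_trans (Ah (leq0n d)); rewrite prednK // lt0n size_poly_eq0.
  exists (ord0, Ordinal lh) => //.
  by rewrite /P /= -lead_coefE lead_coef_eq0.
(* The term t^j F^(p^i) of the relation carries s to mu = j + p^i s. The term z has mu minimal and,
   among the terms that attain this minimum, i maximal. *)
case: (@Order.TotalTheory.arg_minP _ rat _ x0 P mu Px0) => y Py ymin.
pose P2 (x : 'I_d.+1 * 'I_h) := P x && (mu x == mu y).
have P2y : P2 y by rewrite /P2 Py eqxx.
case: (@arg_maxnP _ y P2 (fun x => x.1 : nat) P2y) => z /andP[Pz /eqP zy] zmax {P2y}.
have zmin x : P x -> mu z <= mu x by rewrite zy; apply: ymin.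
have {}zmax x : P x -> mu x = mu z -> (x.1 <= z.1)%N.
  by move=> Px xz; apply: zmax; rewrite /P2 Px xz zy eqxx.
have hs : h%:R + 2 <= s -> z.1 = 0%N :> nat.
  move=> hs; apply: contrapT => /eqP z0; have := zmin _ Px0.
  rewrite /mu x00 expr0 mul1r leNgt => /negP; apply.
  have p2s : 2 * s <= pr ^+ z.1 * s.
    rewrite ler_wpM2r //; first by have : 0 <= h%:R :> rat by []; lra.
    case: (z.1 : nat) z0 => // n _; rewrite exprS.
    apply: le_trans (_ : pr * 1 <= _); last by rewrite ler_pM2l.
    by rewrite mulr1 ler_nat.
  have x0h : x0.2%:R <= h%:R :> rat by rewrite ler_nat ltnW.
  have : 0 <= z.2%:R :> rat by [].
  lra.
have zm : (z.1 <= m)%N.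
  case: sm => [m1m|/hs -> //]; apply: leq_trans m1m; apply: leq_trans dm1.
  by rewrite -ltnS.
(* With these n and E the bad window is the term z of the relation. *)
pose n := (m - z.1)%N; pose E : int := J + (z.2 * p ^ n)%:Z.
have := relation_window n E; rewrite pair_big /= (bigD1 z) //=.
have -> : window (n + z.1) (E - (z.2 * p ^ n)%:Z) F = window m J F by rewrite subnK // addrK.
move=> relE.
have [x [xz Px badx]] :
    exists x, [/\ x != z, P x & bad (n + x.1)%N (E - (x.2 * p ^ n)%:Z)].
  apply: contrapT => nx; apply: badJ.
  have az : (A z.1)`_z.2 ^+ (p ^ n) != 0 by rewrite expf_neq0.
  move/eqP: relE; rewrite addr_eq0 => /eqP relE.
  rewrite -[window m J F](scalerK az) relE; apply: inspanZ; apply: inspanN.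
  apply: inspan_sum => x xz; have [Px|/negbNE/eqP->] := boolP (P x).
    by apply: inspanZ; apply: contrapT => bx; apply: nx; exists x.
  by rewrite (expr0pn pchark) scale0r; apply: inspan0.
have [s' l'] := badP _ _ badx; have [Ss' s'I s'least] := l'.
have ss' : s <= s' by apply: smin; exists (n + x.1)%N, (E - (x.2 * p ^ n)%:Z).
have mm' : s = s' -> (m <= n + x.1)%N.
  by move=> sE; apply: mmin; apply/asboolP; exists (E - (x.2 * p ^ n)%:Z); rewrite sE.
have prm : pr ^+ m = pr ^+ n * pr ^+ z.1 by rewrite -exprD subnK.
have := zmin _ Px; rewrite /mu; set a : rat := x.2%:R; set b : rat := z.2%:R => zx.
have EE : (E - (x.2 * p ^ n)%:Z)%:~R = J%:~R + (b - a) * pr ^+ n.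
  by rewrite intrD mulrNz /E intrD -!pmulrn !natrM !natrX -/pr -/a -/b; ring.
move: s'I sI; rewrite /in_window EE exprD prm => /andP[s'1 s'2] /andP[s1 s2].
have le1 : pr ^+ n * (b + pr ^+ z.1 * s) <= pr ^+ n * (a + pr ^+ x.1 * s).
  by rewrite ler_pM2l.
(* Minimality of mu z puts s at or to the right of the left end of the window of x. If s were beyond
   the right end, then s' < s. *)
have [Y1|Y1] := ltP (pr ^+ n * pr ^+ x.1 * s) (J%:~R + (b - a) * pr ^+ n + 1); last first.
  have : pr ^+ n * pr ^+ x.1 * s' < pr ^+ n * pr ^+ x.1 * s by lra.
  by rewrite ltr_pM2l ?mulr_gt0 // ltNge ss'.
have s's : s' <= s.
  by apply: s'least => //; rewrite /in_window EE exprD; apply/andP; split; lra.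
have {}sE : s = s' by apply/eqP; rewrite eq_le ss'.
(* Since s is also the least point of the window of x, minimality of m gives [z.1 <= x.1]. With
   equality the two windows coincide and x = z. *)
have := mm' sE; rewrite -{1}(subnK zm) -/n leq_add2l leq_eqVlt => /orP[/eqP ij|ij].
  have EJ : J = E - (x.2 * p ^ n)%:Z.
    apply: (@int_window_uniq (pr ^+ n * pr ^+ z.1 * s)); first by rewrite s1.
    by rewrite EE {1}sE ij s'1.
  have xz2 : (x.2 * p ^ n = z.2 * p ^ n)%N.
    by move: EJ; rewrite /E; move: (x.2 * _)%N (z.2 * _)%N => u v; clear; lia.
  case/eqP: xz; rewrite [x]surjective_pairing [z]surjective_pairing.
  congr (_, _); apply: val_inj => //=.
  by move/eqP: xz2; rewrite eqn_pmul2r ?expn_gt0 ?p_gt0 // => /eqP.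
have lt1 : pr ^+ n * (b + pr ^+ z.1 * s) < pr ^+ n * (a + pr ^+ x.1 * s).
  rewrite lt_neqAle le1 andbT; apply/eqP => /(mulfI (prX_neq0 n)) eqmu.
  by have := zmax _ Px (esym eqmu); rewrite leqNgt ij.
have [x1d z1d] : (x.1 <= d)%N /\ (z.1 <= d)%N by split; rewrite -ltnS ltn_ord.
pose D := pr ^+ x.1 - pr ^+ z.1.
have D1 : pr ^+ z.1 <= D.
  rewrite /D lerBrDr -mulr2n -mulr_natl; apply: le_trans (_ : pr * pr ^+ z.1 <= _).
    by rewrite ler_pM2r // /pr ler_nat.
  by rewrite -exprS ler_eXn2l.
have D0 : 0 < D by apply: lt_le_trans D1.
(* In the remaining case s is strictly to the right of the tie (b - a) / D, at a distance below p^-n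
   / D <= p^-m. For m >= m1 this is excluded by the gap, and for s >= h + 2 the quantity bounded
   here is at least 2. *)
have up : pr ^+ n * (D * s - (b - a)) < 1.
  by rewrite /D; lra.
have lo : 0 < pr ^+ n * (D * s - (b - a)).
  by rewrite /D; lra.
case: sm => [m1m|hs2].
  have := gapP z.1 x.1 z.2 x.2 s z1d x1d (ltn_ord _) (ltn_ord _) Ss.
  rewrite /tie -/a -/b -/D ltr_pdivrMr // => gs.
  have : (b - a) / D + pr ^- m1 <= s.
    by apply: gs; move: lo; rewrite pmulr_rgt0 // [s * D]mulrC; lra.
  apply/negP; rewrite -ltNge -(ltr_pM2r D0) mulrDl divfK ?gt_eqF //.
  have le2 : pr ^- m <= pr ^- m1 by rewrite lef_pV2 ?posrE // ler_eXn2l.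
  apply: lt_le_trans (_ : b - a + pr ^- m * D <= _); last by rewrite lerD2l ler_pM2r.
  rewrite -ltrBlDl -(ltr_pM2l (prX_gt0 n)).
  apply: lt_le_trans (_ : 1 <= _); first by move: up; rewrite [s * D]mulrC.
  have -> : pr ^+ n * (pr ^- m * D) = D / pr ^+ z.1 by rewrite prm; field; rewrite !prX_neq0.
  by rewrite ler_pdivlMr // mul1r.
have {}D1 : 1 <= D by move: D1; rewrite (hs hs2) expr0.
have ab : b - a <= h%:R by have : z.2%:R <= h%:R :> rat; [rewrite ler_nat ltnW|have : 0 <= a by []; rewrite -/b; lra].
have Ds : s <= D * s.
  by rewrite -[X in X <= _]mul1r ler_pM2r //; have : 0 <= h%:R :> rat by []; lra.
have D2 : 2 <= D * s - (b - a) by lra.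
have : 2 <= pr ^+ n * (D * s - (b - a)).
  apply: le_trans (_ : 1 * (D * s - (b - a)) <= _); first by rewrite mul1r.
  by rewrite ler_pM2r //; apply: lt_le_trans D2.
by move=> le2; have := le_lt_trans le2 up.
Qed.

End Relation.
End Windows.

(** Elimination on the length of [t]. The spanning elements are taken from [X] itself, so that they
    are windows or columns again and the digit operators map them into the span. *)
Lemma inspan_basis (k : fieldType) (V : lmodType k) (t : seq V) (X : set V) :
  (forall x, X x -> inspan t x) ->
  exists s, (forall x, x \in s -> X x) /\ forall x, X x -> inspan s x.
Proof.
elim: t X => [|t0 t IH] X Xt.
  by exists [::]; split=> // x /Xt[c]; rewrite /= !big_ord0 => ->; apply: inspan0.
have split0 x : X x -> exists a y, inspan t y /\ x = a *: t0 + y.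
  move=> /Xt[c ->]; rewrite /= big_ord_recl; exists (c 0%N), (\sum_(i < size t) c i.+1 *: t`_i).
  by split=> //; exists (fun i => c i.+1).
have [[x0 [Xx0 [a [y [ty [a0 x0E]]]]]]|nX] :=
    pselect (exists x, X x /\ exists a y, inspan t y /\ (a != 0 /\ x = a *: t0 + y)).
  have [|s [sX Xs]] := IH [set z | inspan t z /\ exists x b, X x /\ z = x - b *: x0].
    by move=> z [].
  have [f fP] : exists f, forall z, z \in s -> X (f z) /\ exists b, z = f z - b *: x0.
    have /choice[f fP] z : exists w, z \in s -> X w /\ exists b, z = w - b *: x0.
      by have [/sX[_ [w [b [Xw ->]]]]|] := boolP (z \in s); [exists w => _; split=> //; exists b|exists 0].
    by exists f.
  exists (x0 :: map f s); split=> [x|x Xx].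
    by rewrite inE => /orP[/eqP->//|/mapP[z /fP[Xz _] ->]].
  have [b [z [tz xE]]] := split0 _ Xx.
  have : inspan s (x - (b / a) *: x0).
    apply: Xs; split; last by exists x, (b / a).
    rewrite xE x0E scalerDr scalerA divfK // opprD addrACA subrr add0r.
    by apply: inspanD => //; apply: inspanN; apply: inspanZ.
  move=> xs; rewrite -[x](subrK ((b / a) *: x0)); apply: inspanD; last first.
    by apply: inspanZ; apply: mem_inspan; rewrite mem_head.
  apply: inspan_trans xs _ => w ws; have [_ [c wE]] := fP _ ws.
  rewrite wE; apply: inspanD.
    by apply: mem_inspan; rewrite inE map_f ?orbT.
  by apply: inspanN; apply: inspanZ; apply: mem_inspan; rewrite mem_head.
apply: IH => x Xx; have [b [z [tz xE]]] := split0 _ Xx.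
have [b0|b0] := eqVneq b 0; first by rewrite xE b0 scale0r add0r.
by case: nX; exists x; split=> //; exists b, z.
Qed.

Lemma wo_int (S : set rat) (B : nat) :
  (forall x, S x -> exists2 z : int, x = z%:~R & - B%:Z <= z) -> wo S.
Proof.
move=> SZ T TS [x Tx].
pose P n := `[< T ((n%:Z - B%:Z)%:~R) >].
have toP y : T y -> exists2 n, P n & y = (n%:Z - B%:Z)%:~R.
  move=> Ty; have [z zE zB] := SZ _ (TS _ Ty); have nE : z = `|(z + B%:Z)%R|%N%:Z - B%:Z by lia.
  by exists `|(z + B%:Z)%R|%N; rewrite ?/P -nE -zE //; apply/asboolP.
have exP : exists n, P n by have [n Pn _] := toP _ Tx; exists n.
case: (ex_minnP exP) => n /asboolP Tn nmin; exists (n%:Z - B%:Z)%:~R => // y /toP[m Pm ->].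
by rewrite ler_int; have := nmin _ Pm; lia.
Qed.

(** * Columns of a series along the cosets of Z, and the digit operators *)

Section Columns.
Variables (k : closedFieldType) (p : nat).
Hypothesis pchark : p \in [pchar k].
Implicit Types (F G z : glaurent k) (J : int) (m n i j c : nat) (e x : rat).

Let p_pr : prime p. Proof. exact: pcharf_prime pchark. Qed.
Let p_gt1 : (1 < p)%N. Proof. exact: prime_gt1. Qed.
Let p_gt0 : (0 < p)%N. Proof. exact: prime_gt0. Qed.
Let pr : rat := p%:R.
Let pr_gt1 : 1 < pr. Proof. by rewrite /pr ltr1n. Qed.
Let pr_gt0 : 0 < pr. Proof. by rewrite /pr ltr0n. Qed.
Let pr_neq0 : pr != 0. Proof. by rewrite gt_eqF. Qed.

Definition intset : set rat := [set x | exists z : int, x = z%:~R].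

Definition column e F : glaurent k := gmask intset (tpow k (- e) * F).

Lemma columnE e F x : column e F x = if `[< intset x >] then F (x + e) else 0.
Proof. by rewrite gmaskE tpowM opprK. Qed.

Lemma columnD e F G : column e (F + G) = column e F + column e G.
Proof. by rewrite /column mulrDr gmaskD. Qed.

Lemma columnZ e a F : column e (a *: F) = a *: column e F.
Proof. by rewrite /column -scalerAr gmaskZ. Qed.

Lemma column_sum e I (r : seq I) (P : pred I) (E : I -> glaurent k) :
  column e (\sum_(i <- r | P i) E i) = \sum_(i <- r | P i) column e (E i).
Proof.
elim/big_rec2: _ => [|i x y _ <-]; last by rewrite columnD.
by rewrite /column mulr0 gmask0.
Qed.

(** The Cartier operator of index j: a series z supported on Z is the sum over j < p of t^j times
    the p-th power of [cartier j z]. *)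
Definition cartier j z : glaurent k := gmask intset (groot pchark 1 (tpow k (- j%:R) * z)).

Lemma cartierE j z x :
  cartier j z x = if `[< intset x >] then proot pchark 1 (z (x * pr + j%:R)) else 0.
Proof. by rewrite gmaskE grootE tpowM opprK expr1. Qed.

Lemma prootD n a b : proot pchark n (a + b) = proot pchark n a + proot pchark n b.
Proof. by apply: (frob_inj pchark (n := n)); rewrite /= (frobD pchark) !prootK. Qed.

Lemma prootM n a b : proot pchark n (a * b) = proot pchark n a * proot pchark n b.
Proof. by apply: (frob_inj pchark (n := n)); rewrite /= exprMn !prootK. Qed.

Lemma cartierD j z w : cartier j (z + w) = cartier j z + cartier j w.
Proof.
apply: glaurentP => x; rewrite gcoefD !cartierE gcoefD prootD.
by case: ifP; rewrite ?addr0.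
Qed.

Lemma cartierZ j a z : cartier j (a *: z) = proot pchark 1 a *: cartier j z.
Proof.
apply: glaurentP => x; rewrite gcoefZ !cartierE gcoefZ prootM.
by case: ifP; rewrite ?mulr0.
Qed.

Lemma cartier0 j : cartier j 0 = 0.
Proof. by apply: glaurentP => x; rewrite cartierE gcoef0 proot0 if_same. Qed.

Lemma cartier_sum j I (r : seq I) (P : pred I) (E : I -> glaurent k) :
  cartier j (\sum_(i <- r | P i) E i) = \sum_(i <- r | P i) cartier j (E i).
Proof. by elim/big_rec2: _ => [|i x y _ <-]; rewrite ?cartier0 ?cartierD. Qed.

(** Reads one base p digit after the radix point: the part of the support of z in [j / p, (j + 1) /
    p) is stretched to [0, 1). *)
Definition zoom j z : glaurent k := gmask unit_interval (tpow k (- j%:R) * z ^+ p).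

Lemma zoomE j z x : zoom j z x = if 0 <= x < 1 then z ((x + j%:R) / pr) ^+ p else 0.
Proof. by rewrite gmaskE tpowM opprK (gfrobE pchark) /unit_interval /= asboolb. Qed.

Lemma zoomD j z w : zoom j (z + w) = zoom j z + zoom j w.
Proof. by rewrite /zoom -[p]expn1 (gfrobD pchark) mulrDr gmaskD. Qed.

Lemma zoomZ j a z : zoom j (a *: z) = a ^+ p *: zoom j z.
Proof. by rewrite /zoom exprZn -scalerAr gmaskZ. Qed.

Lemma zoom_window j m J F : (j < p)%N ->
  zoom j (window p m J F) = window p m.+1 (J * p%:Z + j%:Z) F.
Proof.
move=> jp; apply: glaurentP => x; rewrite zoomE !(windowE pchark).
case: ifP => // /andP[x0 x1].
have jp' : j%:R + 1 <= pr by rewrite natr1 ler_nat.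
have j0 : 0 <= j%:R :> rat by [].
have -> : 0 <= (x + j%:R) / pr < 1.
  apply/andP; split; first by apply: divr_ge0; [apply: addr_ge0|apply: ltW].
  by rewrite ltr_pdivrMr // mul1r; lra.
rewrite -exprM -expnSr; congr (F _ ^+ _); rewrite intrD intrM -!pmulrn -/pr exprS.
by field; rewrite expf_neq0 // pr_neq0.
Qed.

Section ColumnsFinite.
Variables (G : glaurent k) (d h : nat) (B : nat -> {poly k}) (ys : seq (glaurent k)).
Hypothesis Bh : forall i, (size (B i) <= h)%N.
Hypothesis GE : G = \sum_(i < d) teval 1 (B i) * G ^+ (p ^ i.+1).
Hypothesis ysP : forall m J, inspan ys (window p m J G).
(** A shift c < H + h satisfies c <= 2 (H - 1) <= p (H - 1), so that division by p brings it below H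
    again. *)
Let H := h.+2.

Definition column_gens : set (glaurent k) := [set z | exists e c i,
  [/\ 0 <= e < 1, (c < H)%N, (i <= d)%N & z = column e (tpow k c%:R * G ^+ (p ^ i))]].

(** Finite row rank implies finite column rank. The rows are the windows, indexed by J; their
    coordinates with respect to [ys] are functions on Z, and a column is a combination of shifts of
    these with the coefficients of the [ys] at e as scalars. *)
Lemma column_gens_finite : exists t, forall z, column_gens z -> inspan t z.
Proof.
(* The coordinates of a zero window are chosen to be 0. The coordinate functions then vanish for J
   below some bound, hence are series. *)
have /choice[f fP] (mJ : nat * int) : exists f : nat -> k,
    window p mJ.1 mJ.2 G = \sum_(b < size ys) f b *: ys`_b /\
    (window p mJ.1 mJ.2 G = 0 -> forall b, f b = 0).
  have [w0|/eqP w0] := eqVneq (window p mJ.1 mJ.2 G) 0.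
    by exists (fun=> 0); split=> //; rewrite w0 big1 // => b _; rewrite scale0r.
  by have [c cE] := ysP mJ.1 mJ.2; exists c.
have [C CP] : exists C : nat, forall i J, (i <= d)%N -> window p i J G <> 0 -> - C%:Z <= J.
  have /choice[g gP] i := @supp_lower_bound _ (G ^+ (p ^ i)).
  exists (\max_(i < d.+1) g i).+1 => i J id /eqP/gneq0P[x].
  rewrite (windowE pchark); case: ifP => [/andP[x0 x1]|_]; last by rewrite eqxx.
  rewrite -(gfrobXE pchark) => /gP gx.
  have gi : (g i <= \max_(i < d.+1) g i)%N by rewrite (leq_bigmax (Ordinal (id : i < d.+1)%N)).
  have : - ((\max_(i < d.+1) g i).+1%:Z)%:~R <= J%:~R :> rat.
    rewrite -pmulrn -natr1; have : (g i)%:R <= (\max_(i < d.+1) g i)%:R :> rat by rewrite ler_nat.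
    lra.
  by rewrite -mulrNz ler_int.
have phi_wo i b : (i <= d)%N -> wo [set x : rat |
    (if `[< intset x >] then f (i, Num.floor x) b else 0) != 0].
  move=> id; apply: (@wo_int _ C) => x /=.
  case: asboolP => [[J ->]|_]; last by rewrite eqxx.
  rewrite intrKfloor => fJ; exists J => //; apply: CP id _ => w0.
  by have [_ /(_ w0 b) f0] := fP (i, J); rewrite f0 eqxx in fJ.
pose phi i b : glaurent k := if pselect (i <= d)%N is left id then mkglaurent (phi_wo i b id) else 0.
have phiE i b J : (i <= d)%N -> phi i b J%:~R = f (i, J) b.
  move=> id; rewrite /phi; case: pselect => // id' /=.
  by rewrite asboolT ?intrKfloor //; exists J.
have phi0 i b x : ~ intset x -> phi i b x = 0.
  by move=> nx; rewrite /phi; case: pselect => // id /=; rewrite asboolF.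
exists [seq tpow k ic.2%:R * phi ic.1 b | ic <- [seq (i, c) | i <- iota 0 d.+1, c <- iota 0 H], b <- iota 0 (size ys)].
move=> _ [e [c [i [e01 cH id ->]]]].
have -> : column e (tpow k c%:R * G ^+ (p ^ i)) =
    \sum_(b < size ys) (ys`_b) e *: (tpow k c%:R * phi i b).
  apply: glaurentP => x; rewrite columnE gcoef_sum tpowM.
  have [[J ->]|nx] := asboolP (intset x); last first.
    rewrite big1 // => b _; rewrite gcoefZ tpowM phi0 ?mulr0 // => -[z zE].
    by apply: nx; exists (z + c%:Z); rewrite intrD -zE -pmulrn subrK.
  have JcE : (J - c%:Z)%:~R = J%:~R - c%:R :> rat by rewrite intrD mulrNz -pmulrn.
  have -> : J%:~R + e - c%:R = e + (J - c%:Z)%:~R by rewrite JcE; ring.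
  have : window p i (J - c%:Z) G e = (G ^+ (p ^ i)) (e + (J - c%:Z)%:~R).
    by rewrite (windowE pchark) e01 (gfrobXE pchark).
  move=> <-; have [-> _] := fP (i, J - c%:Z); rewrite gcoef_sum; apply: eq_bigr => b _.
  by rewrite !gcoefZ tpowM -JcE phiE // mulrC.
apply: inspan_sum => b _; apply: inspanZ; apply: mem_inspan; apply/allpairsP.
exists ((i, c), (b : nat)); split=> //; last by rewrite mem_iota add0n /= ltn_ord.
by apply/allpairsP; exists (i, c); split=> //; rewrite mem_iota add0n ?ltnS /=.
Qed.

(** The operator cancels one Frobenius and leaves the coefficient of G^(p^i) at x + y. The floor of
    y gives the new shift, which is minus an integer below H, and its fractional part the new
    column. *)
Lemma cartier_gen_pos e c i j : 0 <= e < 1 -> (c < H + h)%N -> (i < d)%N -> (j < p)%N ->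
  column_gens (cartier j (column e (tpow k c%:R * G ^+ (p ^ i.+1)))).
Proof.
move=> /andP[e0 e1] cH id jp; pose y := (j%:R + e - c%:R) / pr.
pose e' := y - (Num.floor y)%:~R.
have jp' : j%:R + 1 <= pr by rewrite natr1 ler_nat.
have j0 : 0 <= j%:R :> rat by [].
have c0 : 0 <= c%:R :> rat by [].
have fl := floor_itv y; have /andP[fl1 fl2] := fl.
have fl0 : Num.floor y <= 0.
  rewrite -ltzD1 -(ltr_int rat); apply: le_lt_trans fl1 _.
  by rewrite ltr_pdivrMr // add0r mul1r; lra.
have flc : - (H.-1)%:Z <= Num.floor y.
  rewrite -ltzD1 -(ltr_int rat); apply: le_lt_trans fl2.
  rewrite ler_pdivlMr // mulrNz -pmulrn.
  have : (c <= p * H.-1)%N.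
    apply: leq_trans (_ : 2 * H.-1 <= _)%N; last by rewrite leq_mul2r p_gt1 orbT.
    by move: cH; rewrite /H /=; clear; lia.
  by rewrite -(ler_nat rat) natrM -/pr mulNr mulrC; lra.
exists e', `|Num.floor y|%N, i; split=> //.
- by rewrite /e'; apply/andP; split; move: fl2; rewrite intrD; lra.
- by move: flc fl0; rewrite /H /=; move: (Num.floor y) => f; clear; lia.
- exact: ltnW.
apply: glaurentP => x; rewrite cartierE !columnE.
have [[J ->]|//] := asboolP (intset x).
rewrite asboolT; last by exists (J * p%:Z + j%:Z); rewrite intrD intrM -!pmulrn.
rewrite !tpowM expnSr exprM (gfrobE pchark) -[X in _ ^+ X](expn1 p) frobK.
congr (_ _); rewrite /e'.
have -> : `|Num.floor y|%N%:R = - (Num.floor y)%:~R :> rat.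
  by rewrite pmulrn -mulrNz; congr (_%:~R); move: (Num.floor y) fl0 => f; clear; lia.
by rewrite /y -/pr; field.
Qed.

Lemma column_gens_cartier z j : column_gens z -> (j < p)%N ->
  exists s, (forall w, w \in s -> column_gens w) /\ inspan s (cartier j z).
Proof.
move=> [e [c [i [e01 cH id ->]]]] jp; case: i id => [|i] id.
  (* There is no Frobenius to cancel here, so G is first replaced by its expression through its
     proper Frobenius powers; the coefficients [B i] raise the shift c by less than h. *)
  rewrite expr1 [X in column e (_ * X)]GE mulr_sumr column_sum cartier_sum.
  exists [seq cartier j (column e (tpow k (c + l)%:R * G ^+ (p ^ i.+1))) | i <- iota 0 d, l <- iota 0 h].
  split=> [w /allpairsP[[i l] /= [+ + ->]]|].
    rewrite !mem_iota !add0n => /andP[_ id'] /andP[_ lh].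
    by apply: cartier_gen_pos => //; rewrite -addnS leq_add // ltnW.
  apply: inspan_sum => i _; rewrite (teval_wide _ (Bh i)) mulr_suml mulr_sumr.
  rewrite column_sum cartier_sum; apply: inspan_sum => l _.
  rewrite -scalerAl -scalerAr columnZ cartierZ; apply: inspanZ; apply: mem_inspan.
  apply/allpairsP; exists (i : nat, l : nat); split; rewrite ?mem_iota ?add0n ?ltn_ord //=.
  by rewrite mulrA -tpowD natrD.
exists [:: cartier j (column e (tpow k c%:R * G ^+ (p ^ i.+1)))]; split=> [w|].
  by rewrite inE => /eqP ->; apply: cartier_gen_pos => //; rewrite ltn_addr.
by apply: mem_inspan; rewrite mem_head.
Qed.

End ColumnsFinite.
End Columns.

(** * Loops and finite orbits *)

Section LoopInduction.
Variables (A : eqType) (T : eqType) (delta : T -> A -> T).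
Implicit Types (q : T) (w : seq A) (a b : A).

Definition run q w := foldl delta q w.

Lemma run_cat q w1 w2 : run q (w1 ++ w2) = run (run q w1) w2.
Proof. exact: foldl_cat. Qed.

Lemma run_rcons q w a : run q (rcons w a) = delta (run q w) a.
Proof. exact: foldl_rcons. Qed.

Variables (Q : seq T) (live P : T -> Prop).
Hypothesis Qcl : forall q a, q \in Q -> delta q a \in Q.
Hypothesis simple_loops : forall q w w', q \in Q -> live q -> size w = size w' ->
  run q w = q -> run q w' = q -> w = w'.
Hypothesis Pdead : forall q, q \in Q -> ~ live q -> P q.
Hypothesis Pstep : forall q, q \in Q -> live q -> (forall a, P (delta q a)) -> P q.
Hypothesis Ploop : forall q w, q \in Q -> live q -> w != [::] -> run q w = q ->
  (forall w1 a w2 b, w = w1 ++ a :: w2 -> b != a -> P (run q (rcons w1 b))) -> P q.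

Lemma run_mem q w : q \in Q -> run q w \in Q.
Proof. by elim: w q => //= a w IH q Qq; apply: IH; apply: Qcl. Qed.

Let reach q := [pred q' : T | `[< exists w, run q w = q' >]].
Let mu q := count (reach q) (undup Q).

Let mu_lt q q' : q \in Q -> (exists w, run q w = q') -> ~ (exists w, run q' w = q) ->
  (mu q' < mu q)%N.
Proof.
move=> Qq [w qq'] nq; have sub : subpred (reach q') (reach q).
  by move=> x /asboolP[w' <-]; apply/asboolP; exists (w ++ w'); rewrite run_cat qq'.
rewrite /mu; have : q \in undup Q by rewrite mem_undup.
case/splitPr => s1 s2; rewrite !count_cat /=.
have -> : `[< exists w, run q' w = q >] = false by apply/asboolP.
have -> : `[< exists w, run q w = q >] = true by apply/asboolP; exists [::].
by rewrite /= add0n add1n addnS ltnS leq_add // sub_count.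
Qed.

(** Induction on the number of reachable states. The successors of a state on no loop cannot return
    to it and reach fewer states. On a loop w the same holds for a path that leaves w: if it
    returned to q, closing a loop u, then w u and u w would be loops of equal length at q, hence
    equal, although u departs from w at some letter. *)
Lemma loop_induction q : q \in Q -> P q.
Proof.
have [n] := ubnP (mu q); elim: n q => // n IH q; rewrite ltnS => qn Qq.
have [lq|] := pselect (live q); last exact: Pdead.
have [[w [w0 ww]]|nw] := pselect (exists w, w != [::] /\ run q w = q); last first.
  apply: Pstep => // a; apply: IH; last exact: Qcl.
  apply: leq_trans qn; apply: mu_lt => //; first by exists [:: a].
  by move=> [w aw]; apply: nw; exists (a :: w).
apply: (Ploop Qq lq w0 ww) => w1 a w2 b wE ba.
apply: IH; last exact: run_mem.
apply: leq_trans qn; apply: mu_lt => //; first by exists (rcons w1 b).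
move=> [w3 w3q]; case/eqP: ba; pose u := rcons w1 b ++ w3.
have uq : run q u = q by rewrite run_cat.
have : w ++ u = u ++ w.
  apply: (simple_loops Qq lq); first by rewrite !size_cat addnC.
    by rewrite run_cat ww.
  by rewrite run_cat uq.
rewrite wE /u cat_rcons -!catA => /eqP; rewrite eqseq_cat // => /andP[_ /eqP].
by case.
Qed.

End LoopInduction.

Section FiniteOrbits.
Variables (k : closedFieldType) (p : nat).
Hypothesis pchark : p \in [pchar k].
Hypothesis kfin : forall x : k, exists r, (0 < r)%N /\ x ^+ (p ^ r) = x.
Implicit Types (r n : nat).

Let p_pr : prime p. Proof. exact: pcharf_prime pchark. Qed.
Let p_gt1 : (1 < p)%N. Proof. exact: prime_gt1. Qed.
Let p_gt0 : (0 < p)%N. Proof. exact: prime_gt0. Qed.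

Definition frob_fixed r (x : k) := x ^+ (p ^ r) = x.

Lemma frob_fixedM r n x : frob_fixed r x -> frob_fixed (n * r) x.
Proof.
rewrite /frob_fixed => xr; elim: n => [|n IH]; first by rewrite mul0n expr1.
by rewrite mulSn expnD exprM xr IH.
Qed.

Lemma frob_fixed_seq (s : seq k) : exists r, (0 < r)%N /\ forall x, x \in s -> frob_fixed r x.
Proof.
elim: s => [|a s [r [r0 rP]]]; first by exists 1%N.
have [r' [r'0 ar']] := kfin a; exists (r * r')%N; rewrite muln_gt0 r0 r'0; split=> // x.
rewrite inE => /orP[/eqP->|/rP]; first exact: frob_fixedM.
by rewrite mulnC; apply: frob_fixedM.
Qed.

Lemma frob_fixedD r x y : frob_fixed r x -> frob_fixed r y -> frob_fixed r (x + y).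
Proof. by rewrite /frob_fixed (frobD pchark) => -> ->. Qed.
Lemma frob_fixed_mul r x y : frob_fixed r x -> frob_fixed r y -> frob_fixed r (x * y).
Proof. by rewrite /frob_fixed exprMn => -> ->. Qed.
Lemma frob_fixed0 r : frob_fixed r 0. Proof. exact: expr0pn pchark _ _. Qed.
Lemma frob_fixed_sum r I (s : seq I) (P : pred I) (E : I -> k) :
  (forall i, P i -> frob_fixed r (E i)) -> frob_fixed r (\sum_(i <- s | P i) E i).
Proof. by move=> fE; elim/big_ind: _ => //; [apply: frob_fixed0|apply: frob_fixedD]. Qed.
Lemma frob_fixedX r n x : frob_fixed r x -> frob_fixed r (x ^+ n).
Proof. by rewrite /frob_fixed -exprM mulnC exprM => ->. Qed.
Lemma frob_fixed_proot r n x : frob_fixed r x -> frob_fixed r (proot pchark n x).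
Proof.
move=> xr; apply: (frob_inj pchark (n := n)).
by rewrite /= -exprM mulnC exprM prootK.
Qed.

Lemma frob_fixed_finite r : (0 < r)%N -> exists s : seq k, forall x, frob_fixed r x -> x \in s.
Proof.
move=> r0; have pr1 : (1 < p ^ r)%N by rewrite -{1}(expn0 p) ltn_exp2l.
have [s sE] := closed_field_poly_normal ('X^(p ^ r) - 'X : {poly k}).
have szP : size ('X^(p ^ r) - 'X : {poly k}) = (p ^ r).+1.
  by rewrite size_polyDl size_polyXn // size_polyN size_polyX ltnS.
have P0 : ('X^(p ^ r) - 'X : {poly k}) != 0 by rewrite -size_poly_eq0 szP.
exists s => x xr; have : root ('X^(p ^ r) - 'X) x by rewrite rootE !hornerE xr subrr.
by rewrite sE rootZ ?lead_coef_eq0 // root_prod_XsubC.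
Qed.

Section Lmod.
Variable V : lmodType k.
Implicit Types (bs : seq V).

(** The combinations with coefficients in the field of p^r elements. There are finitely many, and
    for suitable r they contain given elements of the span and are stable under the digit
    operators. *)
Definition fixspan r bs (x : V) :=
  exists c : nat -> k, (forall i, frob_fixed r (c i)) /\ x = \sum_(i < size bs) c i *: bs`_i.

Lemma fixspanD r bs x y : fixspan r bs x -> fixspan r bs y -> fixspan r bs (x + y).
Proof.
move=> [c [cr ->]] [b [br ->]]; exists (fun i => c i + b i); split=> [i|].
  exact: frob_fixedD.
by rewrite -big_split; apply: eq_bigr => i _; rewrite scalerDl.
Qed.

Lemma fixspanZ r bs a x : frob_fixed r a -> fixspan r bs x -> fixspan r bs (a *: x).
Proof.
move=> ar [c [cr ->]]; exists (fun i => a * c i); split=> [i|].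
  exact: frob_fixed_mul.
by rewrite scaler_sumr; apply: eq_bigr => i _; rewrite scalerA.
Qed.

Lemma fixspan_sum r bs I (s : seq I) (P : pred I) (E : I -> V) :
  (forall i, P i -> fixspan r bs (E i)) -> fixspan r bs (\sum_(i <- s | P i) E i).
Proof.
move=> fE; elim/big_ind: _ => //; last exact: fixspanD.
exists (fun=> 0); split=> [i|]; first exact: frob_fixed0.
by rewrite big1 // => i _; rewrite scale0r.
Qed.

Lemma fixspan_finite r bs : (0 < r)%N -> exists Q : seq V, forall x, fixspan r bs x -> x \in Q.
Proof.
move=> /frob_fixed_finite[s sP]; elim: bs => [|b bs [Q QP]].
  by exists [:: 0] => x [c [_ ->]]; rewrite big_ord0 inE.
exists [seq a *: b + y | a <- s, y <- Q] => x [c [cr ->]].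
rewrite /= big_ord_recl; apply: allpairs_f; first exact: sP.
by apply: QP; exists (fun i => c i.+1).
Qed.

Lemma inspan_fixspan (xs bs : seq V) (cs : seq k) : (forall x, x \in xs -> inspan bs x) ->
  exists r, [/\ (0 < r)%N, forall c, c \in cs -> frob_fixed r c &
    forall x, x \in xs -> fixspan r bs x].
Proof.
move=> xsP; have [C CP] : exists C : V -> nat -> k,
    forall x, x \in xs -> x = \sum_(i < size bs) C x i *: bs`_i.
  have /choice[C CP] x : exists c : nat -> k, x \in xs -> x = \sum_(i < size bs) c i *: bs`_i.
    have [/xsP[c ->]|] := boolP (x \in xs); [by exists c|by exists (fun=> 0)].
  by exists C.
have [r [r0 rP]] := frob_fixed_seq (cs ++ [seq C x i | x <- xs, i <- iota 0 (size bs)]).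
exists r; split=> // [c cs_c|x xs_x]; first by apply: rP; rewrite mem_cat cs_c.
exists (fun i => if (i < size bs)%N then C x i else 0); split=> [i|].
  case: ifP => ib; last exact: frob_fixed0.
  by apply: rP; rewrite mem_cat; apply/orP; right; apply: allpairs_f; rewrite // mem_iota add0n.
by rewrite [LHS]CP //; apply: eq_bigr => i _; rewrite ltn_ord.
Qed.

(* [psi] is the Frobenius of [k] or its inverse. *)
Lemma semilinear_fixspan (I : finType) (delta : I -> V -> V) (psi : k -> k) (bs xs : seq V)
    (cs : seq k) :
  (forall j x y, delta j (x + y) = delta j x + delta j y) ->
  (forall j a x, delta j (a *: x) = psi a *: delta j x) ->
  (forall r a, frob_fixed r a -> frob_fixed r (psi a)) ->
  (forall j b, b \in bs -> inspan bs (delta j b)) ->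
  (forall x, x \in xs -> inspan bs x) ->
  exists r, [/\ (0 < r)%N, forall c, c \in cs -> frob_fixed r c,
    forall x, x \in xs -> fixspan r bs x &
    forall j x, fixspan r bs x -> fixspan r bs (delta j x)].
Proof.
move=> dD dZ psir dbs xsP.
have [|r [r0 csr rP]] := @inspan_fixspan (xs ++ [seq delta j b | j <- enum I, b <- bs]) bs cs.
  by move=> x; rewrite mem_cat => /orP[/xsP//|/allpairsP[[j b] /= [_ bb ->]]]; apply: dbs.
exists r; split=> // [x xs_x|j x [c [cr ->]]]; first by apply: rP; rewrite mem_cat xs_x.
have d0 : delta j 0 = 0 by apply: (addIr (delta j 0)); rewrite -dD addr0 add0r.
have -> : delta j (\sum_(i < size bs) c i *: bs`_i) = \sum_(i < size bs) psi (c i) *: delta j bs`_i.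
  by elim/big_rec2: _ => [|i x1 x2 _ <-]; rewrite ?d0 // dD dZ.
apply: fixspan_sum => i _; apply: fixspanZ; first exact: psir.
by apply: rP; rewrite mem_cat; apply/orP; right; apply: allpairs_f; rewrite ?mem_enum ?mem_nth.
Qed.

End Lmod.

End FiniteOrbits.

Definition poly_bounded (f : nat -> nat) :=
  exists C d, forall M, (f M <= C * M.+1 ^ d)%N.

Lemma poly_bounded_add f g : poly_bounded f -> poly_bounded g ->
  poly_bounded (fun M => f M + g M)%N.
Proof.
move=> [C [d fC]] [D [e gD]]; exists (C + D)%N, (d + e)%N => M.
rewrite mulnDl leq_add //.
  by apply: leq_trans (fC M) _; rewrite leq_mul2l expnD leq_pmulr ?orbT // expn_gt0.
by apply: leq_trans (gD M) _; rewrite leq_mul2l expnD leq_pmull ?orbT // expn_gt0.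
Qed.

Lemma poly_bounded_mul f g : poly_bounded f -> poly_bounded g ->
  poly_bounded (fun M => f M * g M)%N.
Proof.
move=> [C [d fC]] [D [e gD]]; exists (C * D)%N, (d + e)%N => M.
by rewrite expnD mulnACA leq_mul.
Qed.

Lemma poly_bounded_affine f a b : poly_bounded f ->
  poly_bounded (fun M => f (a * M + b))%N.
Proof.
move=> [C [d fC]]; exists (C * (a + b).+1 ^ d)%N, d => M.
apply: leq_trans (fC _) _; rewrite -mulnA leq_mul2l -expnMn; apply/orP; right.
have le : ((a * M + b).+1 <= (a + b).+1 * M.+1)%N by nia.
by case: (d) => // d'; rewrite leq_exp2r.
Qed.

Lemma poly_bounded_linear a b : poly_bounded (fun M => a * M + b)%N.
Proof. by exists (a + b)%N, 1%N => M; rewrite expn1 mulnS; nia. Qed.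

Lemma poly_bounded_const a : poly_bounded (fun=> a).
Proof. by exists a, 0%N => M; rewrite expn0 muln1. Qed.

Lemma poly_bounded_not_exp f : poly_bounded f -> exists n, (f n < 2 ^ n)%N.
Proof.
move=> [C [d fC]]; suff [n nP] : exists n, (C * n.+1 ^ d < 2 ^ n)%N.
  by exists n; apply: leq_ltn_trans (fC n) nP.
(* The witness n is chosen with n + 1 a power of 2, so that only the exponents C + 2 j d and n
   remain to be compared. *)
pose j := (C + 2 * d + 4)%N; exists (2 ^ (2 * j)).-1.
have e0 : (0 < 2 ^ (2 * j))%N by rewrite expn_gt0.
rewrite prednK // -expnM.
have C1 : (C < 2 ^ C)%N by exact: ltn_expl.
have lt1 : (C * 2 ^ (2 * j * d) < 2 ^ (C + 2 * j * d))%N.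
  by rewrite expnD ltn_pmul2r // expn_gt0.
apply: leq_trans lt1 _; rewrite leq_exp2l // -ltnS prednK //.
have -> : (2 ^ (2 * j) = 2 ^ j * 2 ^ j)%N by rewrite -expnD addnn mul2n.
have j2 : (j.+1 <= 2 ^ j)%N by exact: ltn_expl.
apply: leq_trans (_ : (j.+1 * j.+1 <= _))%N; last by rewrite leq_mul.
by rewrite /j; nia.
Qed.

(** * Supports of polynomial growth *)

Section Cover.
Variables (k : closedFieldType) (p : nat).
Hypothesis pchark : p \in [pchar k].

Let p_pr : prime p. Proof. exact: pcharf_prime pchark. Qed.
Let p_gt1 : (1 < p)%N. Proof. exact: prime_gt1. Qed.
Let p_gt0 : (0 < p)%N. Proof. exact: prime_gt0. Qed.
Let pr : rat := p%:R.
Let pr_gt1 : 1 < pr. Proof. by rewrite /pr ltr1n. Qed.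
Let pr_ge1 : 1 <= pr. Proof. exact: ltW. Qed.
Let pr_gt0 : 0 < pr. Proof. by rewrite /pr ltr0n. Qed.
Let prX_gt0 n : 0 < pr ^+ n. Proof. exact: exprn_gt0. Qed.
Let prX_neq0 n : pr ^+ n != 0. Proof. by rewrite gt_eqF. Qed.
Let prX_ge1 n : 1 <= pr ^+ n. Proof. exact: exprn_ege1. Qed.
Let ler_prX m n : (m <= n)%N -> pr ^+ m <= pr ^+ n.
Proof. by move=> mn; rewrite ler_eXn2l. Qed.
Let ler_prV m n : (m <= n)%N -> pr ^- n <= pr ^- m.
Proof. by move=> mn; rewrite lef_pV2 ?posrE // ler_prX. Qed.

(* [S] has polynomially many points up to [p^M], at the resolution [p^-M]. *)
Definition slim (S : set rat) := exists2 f, poly_bounded f & forall M, exists2 L : seq rat,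
  (size L <= f M)%N & forall e, S e -> e <= pr ^+ M -> exists2 x, x \in L & `|e - x| <= pr ^- M.

Lemma slim_sub S T : S `<=` T -> slim T -> slim S.
Proof.
move=> ST [f fb fP]; exists f => // M; have [L Lf LP] := fP M.
by exists L => // e /ST; apply: LP.
Qed.

Lemma slimU S T : slim S -> slim T -> slim (S `|` T).
Proof.
move=> [f fb fP] [g gb gP]; exists (fun M => f M + g M)%N => [|M].
  exact: poly_bounded_add.
have [L Lf LP] := fP M; have [L' Lg L'P] := gP M.
exists (L ++ L') => [|e [/LP|/L'P] H eM]; first by rewrite size_cat leq_add.
  by have [x xL ex] := H eM; exists x; rewrite // mem_cat xL.
by have [x xL ex] := H eM; exists x; rewrite // mem_cat xL orbT.
Qed.

Lemma slim1 q : slim [set q].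
Proof.
exists (fun=> 1%N) => [|M]; first exact: poly_bounded_const.
exists [:: q] => // e -> _; exists q; first exact: mem_head.
by rewrite subrr normr0 invr_ge0 ltW.
Qed.

Lemma slim0 : slim set0.
Proof. exact: slim_sub (@sub0set _ [set 0]) (slim1 0). Qed.

(** If a + b <= p^M, then a and b are at most p^(M + h), because both sets are bounded below; and
    two errors p^-(M + h) add up to at most p^-M. *)
Lemma slimD S T : wo S -> wo T -> slim S -> slim T -> slim [set a + b | a in S & b in T].
Proof.
move=> Swo Two [f fb fP] [g gb gP].
have lb (A : set rat) : wo A -> exists h : nat, forall a, A a -> - h%:R <= a.
  move=> Awo; have [[s As]|nA] := pselect (A !=set0); last first.
    by exists 0%N => a Aa; case: nA; exists a.
  have [||s0 As0 smin] := Awo A; [by []|by exists s|].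
  exists (Num.bound `|s0|) => t At; apply: le_trans (smin t At).
  rewrite lerNl; apply: le_trans (ltW (archi_boundP (normr_ge0 _))).
  by rewrite -normrN ler_norm.
have [h1 h1P] := lb _ Swo; have [h2 h2P] := lb _ Two; pose h := (h1 + h2).+1.
have big (x y : rat) M (i : nat) : (i <= h)%N -> x + y <= pr ^+ M -> - i%:R <= y -> x <= pr ^+ (M + h).
  move=> ih xy yi; apply: le_trans (_ : pr ^+ M * (1 + i%:R) <= _).
    have : 0 <= (pr ^+ M - 1) * i%:R by rewrite mulr_ge0 ?subr_ge0 ?ler0n.
    rewrite mulrDr mulr1; lra.
  rewrite exprD ler_pM2l // addrC natr1 -natrX ler_nat.
  by apply: leq_trans (_ : i < p ^ i)%N _; [exact: ltn_expl|rewrite leq_exp2l].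
exists (fun M => f (1 * M + h) * g (1 * M + h))%N => [|M].
  by apply: poly_bounded_mul; apply: poly_bounded_affine.
rewrite mul1n; have [L Lf LP] := fP (M + h)%N; have [L' Lg L'P] := gP (M + h)%N.
exists [seq x + y | x <- L, y <- L'] => [|_ [a Sa [b Tb <-]] abM].
  by rewrite size_allpairs leq_mul.
have [|x xL ax] := LP _ Sa.
  by apply: (big _ b _ h2) => //; [rewrite /h; clear; lia|exact: h2P].
have [|y yL by'] := L'P _ Tb.
  by apply: (big _ a _ h1) => //; [rewrite /h; clear; lia|rewrite addrC|exact: h1P].
exists (x + y); first by apply/allpairsP; exists (x, y).
rewrite opprD addrACA; apply: le_trans (ler_normD _ _) _.
apply: le_trans (lerD ax by') _; apply: le_trans (_ : pr ^- M.+1 + pr ^- M.+1 <= _).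
  by rewrite lerD // ler_prV // /h; clear; lia.
rewrite -mulr2n -mulr_natl exprS invfM mulrA -[X in _ <= X]mul1r ler_pM2r ?invr_gt0 //.
by rewrite ler_pdivrMr // mul1r ler_nat.
Qed.

Lemma slim_scale S c : 0 < c -> slim S -> slim [set e | S (e / c)].
Proof.
move=> c0 [f fb fP].
have [h1 c1] := archi_expr pchark c ltr01; have [h2 c2] := archi_expr pchark c^-1 ltr01.
rewrite mul1r in c1; rewrite mul1r in c2.
exists (fun M => f (1 * M + (h1 + h2)))%N => [|M]; first exact: poly_bounded_affine.
have [L Lf LP] := fP (1 * M + (h1 + h2))%N; rewrite mul1n in Lf LP *.
exists [seq c * x | x <- L] => [|e Se eM]; first by rewrite size_map.
have [|x xL ex] := LP _ Se.
  apply: le_trans (_ : pr ^+ M * c^-1 <= _); first by rewrite ler_pM2r ?invr_gt0.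
  apply: le_trans (_ : pr ^+ M * pr ^+ h2 <= _); first by rewrite ler_pM2l // ltW.
  by rewrite -exprD ler_prX // leq_add2l leq_addl.
exists (c * x); first exact: map_f.
rewrite -(divfK (lt0r_neq0 c0) e) mulrC -mulrBr normrM (gtr0_norm c0).
apply: le_trans (_ : pr ^+ h1 * pr ^- (M + (h1 + h2)) <= _).
  by rewrite ler_pM // ltW.
by rewrite ler_pdivrMr // [pr ^+ (M + _)]exprD mulrA mulVf // mul1r ler_prX // leq_addr.
Qed.

(** For e > 0 the least positive element of [S] bounds the power of p by M + h1, and a finer
    resolution compensates for the dilation. For e < 0 the lower bound of [S] puts the points
    obtained by dividing by a large power within p^-M of 0, and few powers remain. *)
Lemma slim_AS S T : wo S -> slim S ->
  (forall e, T e -> [\/ e = 0, 0 < e /\ exists n, S (e / pr ^+ n) |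
                        e < 0 /\ exists n, S (e * pr ^+ n.+1)]) -> slim T.
Proof.
move=> Swo [f fb fP] TS.
have [h1 h1P] : exists h, forall s, S s -> 0 < s -> pr ^- h <= s.
  have [[s [Ss s0]]|nS] := pselect (exists s, S s /\ 0 < s); last first.
    by exists 0%N => s Ss s0; case: nS; exists s.
  have [||s1 [Ss1 s10] smin] := Swo (S `&` [set s | 0 < s]); [by move=> ? []|by exists s|].
  have [h hP] := archi_expr pchark 1 s10; exists h => t St t0.
  apply: le_trans (smin t (conj St t0)).
  by rewrite -[X in X <= _]mul1r ler_pdivrMr //; exact: ltW.
have [h2 h2P] : exists h, forall s, S s -> - pr ^+ h <= s.
  have [[s Ss]|nS] := pselect (exists s, S s); last first.
    by exists 0%N => s Ss; case: nS; exists s.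
  have [||s1 Ss1 smin] := Swo S; [by []|by exists s|].
  have [h hP] := archi_expr pchark (- s1) ltr01; rewrite mul1r in hP.
  by exists h => t St; apply: le_trans (smin t St); lra.
pose h := (h1 + h2)%N.
exists (fun M => 1 + ((1 * M + h.+1) * f (2 * M + h) + (1 * M + h.+1) * f (1 * M + 0)))%N => [|M].
  apply: poly_bounded_add; first exact: poly_bounded_const.
  apply: poly_bounded_add.
    exact: poly_bounded_mul (poly_bounded_linear _ _) (poly_bounded_affine _ _ fb).
  exact: poly_bounded_mul (poly_bounded_linear _ _) (poly_bounded_affine _ _ fb).
have [L Lf LP] := fP (2 * M + h)%N; have [L' Lf' LP'] := fP M.
exists (0 :: [seq x * pr ^+ n | n <- iota 0 (M + h.+1), x <- L] ++
             [seq x / pr ^+ n.+1 | n <- iota 0 (M + h.+1), x <- L']) => [|e Te eM].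
  rewrite /= size_cat !size_allpairs !size_iota !mul1n addn0 add1n ltnS.
  by rewrite leq_add // leq_mul.
case: (TS _ Te) => [->|[e0 [n Sn]]|[e0 [n Sn]]].
- by exists 0; rewrite ?mem_head // subrr normr0 invr_ge0 ltW.
- pose a := e / pr ^+ n; have eE : e = a * pr ^+ n by rewrite divfK.
  have a0 : 0 < a by rewrite divr_gt0.
  have nM : (n <= M + h1)%N.
    rewrite -(ler_eXn2l (x := pr)) // exprD -ler_pdivrMr //; apply: le_trans eM.
    by rewrite eE mulrC ler_pM2r // h1P.
  have [|x xL ax] := LP a Sn.
    apply: le_trans (_ : e <= _); last by apply: le_trans eM _; rewrite ler_prX //; clear; lia.
    by rewrite eE ler_peMr // ltW.
  exists (x * pr ^+ n).
    rewrite inE mem_cat; apply/orP; right; apply/orP; left; apply/allpairsP.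
    by exists (n, x); split=> //=; rewrite mem_iota add0n /h; clear -nM; lia.
  rewrite eE -mulrBl normrM (gtr0_norm (prX_gt0 n)) -ler_pdivlMr // -invfM -exprD.
  by apply: le_trans ax _; rewrite ler_prV // /h; clear -nM; lia.
- have [nM|nM] := leqP (M + h2) n.+1.
    exists 0; first exact: mem_head.
    rewrite subr0 ltr0_norm // -(mulfK (prX_neq0 n.+1) e) -mulNr ler_pdivrMr //.
    apply: le_trans (_ : pr ^+ h2 <= _); first by rewrite lerNl h2P.
    by rewrite mulrC ler_pdivlMr // -exprD ler_prX // addnC.
  have [|x xL ex] := LP' _ Sn.
    by apply: le_trans (ltW (prX_gt0 M)); rewrite ltW // pmulr_llt0.
  exists (x / pr ^+ n.+1).
    rewrite inE mem_cat; apply/orP; right; apply/orP; right; apply/allpairsP.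
    by exists (n, x); split=> //=; rewrite mem_iota add0n /h; clear -nM; lia.
  have V0 : 0 < pr ^- n.+1 by rewrite invr_gt0.
  rewrite -[e](mulfK (prX_neq0 n.+1)) -mulrBl normrM (gtr0_norm V0).
  by apply: le_trans _ ex; rewrite ler_piMr // invf_le1.
Qed.

(** At a resolution finer than the separation, distinct points have distinct approximants, so the
    approximating lists would have at least 2^n elements. *)
Lemma slim_separated S c : slim S -> ~ (forall n, exists X : seq rat,
  [/\ uniq X, size X = (2 ^ n)%N, forall x, x \in X -> S x /\ x <= pr ^+ (c * n.+1) &
     forall x y, x \in X -> y \in X -> x != y -> pr ^- (c * n.+1) <= `|x - y|]).
Proof.
move=> [f fb fP] SX.
have [n nP] := poly_bounded_not_exp (poly_bounded_affine c (c + 2) fb).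
(* M = c (n + 1) + 2: the sum of two errors p^-M stays below the separation p^-(c (n + 1)), as 2 <
   p^2. *)
have [X [uX szX XS Xsep]] := SX n; pose M := (c * n + (c + 2))%N.
have cM : (c * n.+1 + 2 = M)%N by rewrite /M; clear; nia.
have [L Lf LP] := fP M.
have /choice[g gP] x : exists y, x \in X -> y \in L /\ `|x - y| <= pr ^- M.
  have [/XS[Sx xM]|] := boolP (x \in X); last by exists 0.
  have [|y yL xy] := LP _ Sx; last by exists y.
  by apply: le_trans xM _; rewrite ler_prX // -cM leq_addr.
have uXg : uniq (map g X).
  rewrite map_inj_in_uniq // => x y xX yX gxy; apply/eqP; apply: contraT => xy.
  have := Xsep _ _ xX yX xy; rewrite leNgt => /negP; case.
  have [_ gx] := gP _ xX; have [_ gy] := gP _ yX; rewrite -gxy in gy.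
  apply: le_lt_trans (_ : pr ^- M + pr ^- M < _).
    have -> : x - y = (x - g x) - (y - g x) by rewrite opprB addrA subrK.
    by apply: le_trans (ler_normB _ _) _; apply: lerD.
  rewrite -mulr2n -mulr_natl -cM exprD invfM mulrCA -[X in _ < X]mulr1 ltr_pM2l ?invr_gt0 //.
  rewrite ltr_pdivrMr // mul1r -natrX ltr_nat.
  by rewrite -{1}(expn1 2) (leq_trans (_ : 2 ^ 1 < 2 ^ 2)%N) // leq_exp2r.
have := uniq_leq_size uXg (s2 := L); rewrite size_map szX => le.
have : (2 ^ n <= size L)%N.
  by apply: le => z /mapP[x xX ->]; have [] := gP _ xX.
by rewrite leqNgt (leq_ltn_trans Lf nP).
Qed.

End Cover.

(** * Values of digit strings, and the words composed of two loops *)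

Section WordValues.
Variable p : nat.
Hypothesis p_gt1 : (1 < p)%N.
Implicit Types (w : seq 'I_p) (a : 'I_p).

Definition wval w := foldl (fun v (a : 'I_p) => v * p + a)%N 0%N w.

Lemma wval_rcons w a : wval (rcons w a) = (wval w * p + a)%N.
Proof. exact: foldl_rcons. Qed.

Lemma wval_cat w1 w2 : wval (w1 ++ w2) = (wval w1 * p ^ size w2 + wval w2)%N.
Proof.
elim/last_ind: w2 => [|w2 a IH]; first by rewrite cats0 muln1 addn0.
by rewrite -rcons_cat !wval_rcons IH size_rcons expnSr mulnDl -addnA mulnA.
Qed.

Lemma wval_lt w : (wval w < p ^ size w)%N.
Proof.
elim/last_ind: w => [|w a IH]; first by rewrite expn0.
rewrite wval_rcons size_rcons expnSr.
apply: leq_trans (_ : wval w * p + p <= _)%N; first by rewrite ltn_add2l.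
by rewrite -mulSnr leq_mul2r IH orbT.
Qed.

Lemma wval_inj w w' : size w = size w' -> wval w = wval w' -> w = w'.
Proof.
elim/last_ind: w w' => [|w a IH] w'; first by move/esym/size0nil.
elim/last_ind: w' => [|w' a' _]; first by move/size0nil.
rewrite !size_rcons !wval_rcons => -[szw] E.
have p0 : (0 < p)%N by apply: ltnW.
have aE : a = a' :> nat.
  by rewrite -(modn_small (ltn_ord a)) -(modn_small (ltn_ord a')) -(modnMDl (wval w)) E modnMDl.
rewrite (IH w') //; last by apply/eqP; rewrite -(eqn_pmul2r p0) -(eqn_add2r a) E aE.
by congr rcons; apply: val_inj.
Qed.

End WordValues.

Section LoopWords.
Variables (A : eqType) (w w' : seq A).

Fixpoint loop_words n : seq (seq A) :=
  if n is n'.+1 then map (cat w) (loop_words n') ++ map (cat w') (loop_words n') else [:: [::]].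

Lemma size_loop_words n : size (loop_words n) = (2 ^ n)%N.
Proof. by elim: n => //= n IH; rewrite size_cat !size_map IH addnn -mul2n expnS. Qed.

Hypothesis szw : size w = size w'.

Lemma loop_words_size n u : u \in loop_words n -> size u = (n * size w)%N.
Proof.
elim: n u => [|n IH] u /=; first by rewrite inE => /eqP ->.
rewrite mem_cat => /orP[] /mapP[v /IH szv ->]; rewrite size_cat szv mulSn //.
by rewrite -szw.
Qed.

Lemma loop_words_uniq n : w != w' -> uniq (loop_words n).
Proof.
move=> ww'; elim: n => //= n IH.
rewrite cat_uniq !map_inj_uniq ?IH /=; try by move=> x y /eqP; rewrite eqseq_cat // => /andP[_ /eqP].
rewrite andbT; apply/hasPn => _ /mapP[u _ ->]; apply/mapP => -[v _ /eqP].
by rewrite eqseq_cat // eq_sym (negPf ww').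
Qed.

Lemma run_loop_words (T : eqType) (delta : T -> A -> T) q n u :
  run delta q w = q -> run delta q w' = q -> u \in loop_words n -> run delta q u = q.
Proof.
move=> qw qw'; elim: n u => [|n IH] u /=; first by rewrite inE => /eqP ->.
by rewrite mem_cat => /orP[] /mapP[v /IH qv ->]; rewrite run_cat ?qw ?qw'.
Qed.

End LoopWords.

Section FiniteState.
Variables (k : closedFieldType) (p : nat).
Hypothesis pchark : p \in [pchar k].
Hypothesis kfin : forall x : k, exists r, (0 < r)%N /\ x ^+ (p ^ r) = x.
Implicit Types (F G z : glaurent k) (J : int) (m n r : nat) (e y : rat).

Let p_pr : prime p. Proof. exact: pcharf_prime pchark. Qed.
Let p_gt1 : (1 < p)%N. Proof. exact: prime_gt1. Qed.
Let p_gt0 : (0 < p)%N. Proof. exact: prime_gt0. Qed.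
Let pr : rat := p%:R.
Let pr_gt1 : 1 < pr. Proof. by rewrite /pr ltr1n. Qed.
Let pr_gt0 : 0 < pr. Proof. by rewrite /pr ltr0n. Qed.
Let pr_neq0 : pr != 0. Proof. by rewrite gt_eqF. Qed.
Let prX_gt0 n : 0 < pr ^+ n. Proof. exact: exprn_gt0. Qed.
Let prX_neq0 n : pr ^+ n != 0. Proof. by rewrite gt_eqF. Qed.
Let prX_ge1 n : 1 <= pr ^+ n. Proof. by apply: exprn_ege1; apply: ltW. Qed.
Let C := Ctilde p k.
Let HC : nontrivial_AS_closed_subalg p C. Proof. exact: Ctilde_closed. Qed.

Lemma slim_loops (S : set rat) (A : eqType) (w w' : seq A) c (phi : nat -> seq A -> rat) :
  size w = size w' -> w != w' -> slim p S ->
  (forall n u, u \in loop_words w w' n -> S (phi n u) /\ phi n u <= pr ^+ (c * n.+1)) ->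
  (forall n u v, u \in loop_words w w' n -> v \in loop_words w w' n -> u != v ->
     pr ^- (c * n.+1) <= `|phi n u - phi n v|) -> False.
Proof.
move=> szw ww' Ss H1 H2; apply: (slim_separated pchark (c := c) Ss) => n.
have inj : {in loop_words w w' n &, injective (phi n)}.
  move=> u v uL vL puv; apply/eqP; apply: contraT => uv.
  by have := H2 n u v uL vL uv; rewrite puv subrr normr0 leNgt invr_gt0 prX_gt0.
exists (map (phi n) (loop_words w w' n)); split.
- by rewrite (map_inj_in_uniq inj) loop_words_uniq.
- by rewrite size_map size_loop_words.
- by move=> _ /mapP[u uL ->]; apply: H1.
- move=> _ _ /mapP[u uL ->] /mapP[v vL ->] uv; apply: H2 => //.
  by apply: contra_neq uv => ->.
Qed.

Let dz (z : glaurent k) (a : 'I_p) := zoom p a z.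

Lemma zoom_run z w (x : rat) : 0 <= x < 1 ->
  run dz z w x = (if w is [::] then z x
    else z ((x + (wval w)%:R) / pr ^+ size w) ^+ (p ^ size w)).
Proof.
move=> x01; have -> : run dz z w x = z ((x + (wval w)%:R) / pr ^+ size w) ^+ (p ^ size w).
  elim/last_ind: w x x01 => [|w a IH] x x01; first by rewrite /= addr0 divr1 expr1.
  rewrite run_rcons /dz (zoomE pchark) x01 IH.
    rewrite -exprM -expnSr size_rcons wval_rcons natrD natrM exprS; congr (z _ ^+ _).
    by rewrite -/pr; field; rewrite ?pr_neq0 ?prX_neq0.
  have /andP[x0 x1] := x01; have a0 : 0 <= a%:R :> rat by [].
  have ap : a%:R + 1 <= pr by rewrite natr1 ler_nat.
  apply/andP; split; first by rewrite divr_ge0 ?addr_ge0 // ltW.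
  by rewrite ltr_pdivrMr // mul1r; lra.
by case: w => //; rewrite /= addr0 divr1 expr1.
Qed.

Lemma zoom_decomp z : gmask unit_interval z = z ->
  z ^+ p = \sum_(j < p) tpow k j%:R * zoom p j z.
Proof.
move=> zE; apply: glaurentP => x; rewrite (gfrobE pchark) gcoef_sum.
have zs y : ~~ (0 <= y < 1) -> z y = 0.
  by move=> y01; rewrite -zE gmaskE asboolF // => /= y01'; rewrite y01' in y01.
under eq_bigr do rewrite tpowM (zoomE pchark) subrK.
have [/andP[x0 x1]|xn] := boolP (0 <= x < pr).
  have /andP[f1 f2] := floor_itv x.
  have f0 : 0 <= Num.floor x by rewrite -ltzD1 -(ltr_int rat); apply: le_lt_trans f2.
  have fp : (`|Num.floor x| < p)%N.
    have : Num.floor x < p%:Z by rewrite -(ltr_int rat) -pmulrn; apply: le_lt_trans x1.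
    by move: (Num.floor x) f0; clear; lia.
  have fE : (`|Num.floor x|%N)%:R = (Num.floor x)%:~R :> rat.
    by rewrite pmulrn; congr (_%:~R); move: (Num.floor x) f0; clear; lia.
  rewrite (bigD1 (Ordinal fp)) //= fE big1 ?addr0 => [|i /negP ni].
    by rewrite intrD in f2; rewrite (_ : 0 <= _ < 1) //; apply/andP; split; lra.
  case: ifP => // /andP[i1 i2]; case: ni; apply/eqP/val_inj => /=.
  have : (i : int) = Num.floor x.
    rewrite intrD in f2; apply: (@int_window_uniq x); last by rewrite f1.
    by rewrite -pmulrn; apply/andP; split; lra.
  by move: (Num.floor x); clear; lia.
rewrite big1 => [|i _].
  rewrite zs ?expr0n ?gtn_eqF //; apply: contra xn => /andP[y0 y1].
  by rewrite -(divfK pr_neq0 x) mulr_ge0 ?(ltW pr_gt0) //= -[X in _ < X]mul1r ltr_pM2r.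
case: ifP => // /andP[y0 y1]; case/negP: xn.
have i0 : 0 <= i%:R :> rat by []; have ip : i%:R + 1 <= pr by rewrite natr1 ler_nat.
by apply/andP; split; lra.
Qed.

(** Let a < a' be the values of the two words and K = p^l with l their length. The support of z is
    stable under x -> (x + a) / K and x -> (x + a') / K. The second map leads to a point beyond the
    fixed point a / (K - 1) of the first, and iterating the first from there is an infinite descent
    in a well-ordered set. *)
Lemma zoom_simple_loops z (w w' : seq 'I_p) : gmask unit_interval z = z -> z <> 0 ->
  size w = size w' -> run dz z w = z -> run dz z w' = z -> w = w'.
Proof.
move=> zE /eqP/gneq0P[x0 zx0] szw zw zw'; apply: contrapT => /eqP ww'.
wlog lt : w w' szw zw zw' ww' / (wval w < wval w')%N.
  move=> H; have := ww'; case: (ltngtP (wval w) (wval w')) => [lt|lt|/wval_inj eq] ww.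
  - exact: H szw zw zw' ww' lt.
  - by apply: H (esym szw) zw' zw _ lt; rewrite eq_sym.
  - by rewrite eq ?eqxx in ww.
have zs y : z y != 0 -> 0 <= y < 1.
  by rewrite -zE gmaskE; case: asboolP => //; rewrite eqxx.
set a := wval w in lt; set a' := wval w' in lt; pose K : rat := (p ^ size w)%:R.
have a'K : (a' < p ^ size w)%N by rewrite szw; apply: wval_lt.
have l0 : (0 < size w)%N by rewrite lt0n; apply: contraTneq a'K => ->; rewrite -leqNgt expn0; case: (a') lt.
have K2 : a%:R + 2 <= K.
  by rewrite -natrD ler_nat addn2; apply: leq_trans a'K; rewrite ltnS.
have a0 : 0 <= a%:R :> rat by [].
have K0 : 0 < K by lra.
have cl (u : seq 'I_p) x : run dz z u = z -> u != [::] -> z x != 0 ->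
    z ((x + (wval u)%:R) / pr ^+ size u) != 0.
  move=> zu u0 zx; have := zoom_run z u (zs _ zx); rewrite zu; case: u u0 {zu} => // b u _ E.
  by apply: contra_neq zx => E0; rewrite E E0 (expr0pn pchark).
have KE : pr ^+ size w = K by rewrite /K natrX.
pose f x := (x + a%:R) / K.
have zf x : z x != 0 -> z (f x) != 0.
  by move=> zx; rewrite /f -KE; apply: cl => //; rewrite -size_eq0 -lt0n.
have x1s : z ((x0 + a'%:R) / K) != 0.
  by rewrite -KE szw; apply: cl => //; rewrite -size_eq0 -szw -lt0n.
set x1 := (_ / K) in x1s; pose xs := a%:R / (K - 1).
have K1 : 0 < K - 1 by lra.
have x1xs : xs < x1.
  have /andP[x00 _] := zs _ zx0.
  have aa' : a%:R + 1 <= a'%:R :> rat by rewrite natr1 ler_nat.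
  rewrite /xs /x1 ltr_pdivrMr // mulrAC ltr_pdivlMr //.
  by nra.
have fdec x : xs < x -> xs < f x /\ f x < x.
  rewrite /xs ltr_pdivrMr // => h; split.
    rewrite /f ltr_pdivrMr // mulrAC ltr_pdivlMr //; nra.
  by rewrite /f ltr_pdivrMr //; nra.
have it n : xs < iter n f x1 /\ z (iter n f x1) != 0.
  by elim: n => //= n [h1 h2]; split; [case: (fdec _ h1)|apply: zf].
have [n|N NP] := wo_decr (f := fun n => iter n f x1) (gsupp_wo z).
  by have [h _] := it n; have [] := fdec _ h.
by apply: (NP N (leqnn N)); have [] := it N.
Qed.

End FiniteState.

(** * Automatic series *)

Section AutomaticSeries.
Variables (k : closedFieldType) (p : nat).
Hypothesis pchark : p \in [pchar k].
Hypothesis kfin : forall x : k, exists r, (0 < r)%N /\ x ^+ (p ^ r) = x.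
Implicit Types (F G z : glaurent k) (J : int) (m n r : nat) (e y : rat).

Let p_pr : prime p. Proof. exact: pcharf_prime pchark. Qed.
Let p_gt1 : (1 < p)%N. Proof. exact: prime_gt1. Qed.
Let p_gt0 : (0 < p)%N. Proof. exact: prime_gt0. Qed.
Let pr : rat := p%:R.
Let pr_gt1 : 1 < pr. Proof. by rewrite /pr ltr1n. Qed.
Let pr_gt0 : 0 < pr. Proof. by rewrite /pr ltr0n. Qed.
Let pr_neq0 : pr != 0. Proof. by rewrite gt_eqF. Qed.
Let prX_gt0 n : 0 < pr ^+ n. Proof. exact: exprn_gt0. Qed.
Let prX_neq0 n : pr ^+ n != 0. Proof. by rewrite gt_eqF. Qed.
Let prX_ge1 n : 1 <= pr ^+ n. Proof. by apply: exprn_ege1; apply: ltW. Qed.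
Let C := Ctilde p k.
Let HC : nontrivial_AS_closed_subalg p C. Proof. exact: Ctilde_closed. Qed.
Let dz (z : glaurent k) (a : 'I_p) := zoom p a z.
Let dc (z : glaurent k) (a : 'I_p) := cartier pchark a z.

Lemma gmask_id P F : gmask P (gmask P F) = gmask P F.
Proof. by apply: glaurentP => q; rewrite !gmaskE; case: (`[< P q >]). Qed.

Section ZoomOrbit.
Variable ys : seq (glaurent k).
Hypothesis ys_unit : forall z, z \in ys -> gmask unit_interval z = z.
Hypothesis ys_zoom : forall (j : 'I_p) z, z \in ys -> inspan ys (zoom p j z).

Let fixspan_unit r z : fixspan p r ys z -> gmask unit_interval z = z.
Proof.
move=> [c [_ ->]]; elim/big_ind: _ => [|x y xE yE|i _]; first exact: gmask0.
  by rewrite gmaskD xE yE.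
by rewrite gmaskZ ys_unit ?mem_nth.
Qed.

Lemma zoom_orbit_finite (xs : seq (glaurent k)) : (forall z, z \in xs -> inspan ys z) ->
  exists Q : seq (glaurent k), [/\ {subset xs <= Q},
    forall z, z \in Q -> gmask unit_interval z = z &
    forall z (j : 'I_p), z \in Q -> zoom p j z \in Q].
Proof.
move=> xsP.
have [r [r0 _ xsr dr]] := @semilinear_fixspan k p pchark kfin _ 'I_p (fun j z => zoom p j z) (fun a => a ^+ p) ys xs [::]
  (fun j z w => zoomD pchark j z w) (fun j a z => zoomZ p j a z)
  (fun r a => @frob_fixedX k p r p a) ys_zoom xsP.
have [Q QP] := @fixspan_finite k p pchark _ r ys r0.
exists [seq z <- Q | `[< fixspan p r ys z >]]; split.
- by move=> z /xsr zr; rewrite mem_filter QP // andbT; apply/asboolP.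
- by move=> z; rewrite mem_filter => /andP[/asboolP/fixspan_unit].
- move=> z j; rewrite !mem_filter => /andP[/asboolP/(dr j) zr _].
  by rewrite QP // andbT; apply/asboolP.
Qed.

(** Every digit that leaves the path w leads into C. Collecting these terms in the successive p-th
    powers leaves only the end of the path; when w is a loop, this is the equation solved by
    [Ctilde_twist_root]. *)
Lemma zoom_path z (w : seq 'I_p) : gmask unit_interval z = z ->
  (forall w1 a w2 b, w = w1 ++ a :: w2 -> b != a -> C (run dz z (rcons w1 b))) ->
  exists A z0, C z0 /\ z ^+ (p ^ size w) = tpow k A * run dz z w + z0.
Proof.
elim: w z => [|a w IH] z zE zC.
  by exists 0, 0; rewrite expr1 tpow0 mul1r addr0; split=> //; apply: (AScl0 HC).
have [|w1 b w2 c wE cb|A [z0 [Cz0 E]]] := IH (dz z a).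
- exact: gmask_id.
- by have := zC (a :: w1) b w2 c; rewrite wE => /(_ erefl cb).
have [z1 Cz1 z1E] : exists2 z1, C z1 & z ^+ p = tpow k a%:R * zoom p a z + z1.
  exists (\sum_(j < p | j != a) tpow k j%:R * zoom p j z); last first.
    by rewrite (zoom_decomp pchark zE) (bigD1 a).
  apply: (AScl_sum HC) => j ja; apply/(AScl_shift HC).
  exact: (zC [::] a w j).
exists (a%:R *+ (p ^ size w) + A), (tpow k (a%:R *+ (p ^ size w)) * z0 + z1 ^+ (p ^ size w)).
split; first by apply: (AScl_add HC); [apply/(AScl_shift HC)|apply: (AScl_exp HC)].
by rewrite /= expnS exprM z1E (gfrobD pchark) exprMn tpowX E tpowD; ring.
Qed.

Lemma zoom_orbit_Ctilde z : inspan ys z -> C z.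
Proof.
move=> zs; have [|Q [zQ Qu Qz]] := @zoom_orbit_finite [:: z].
  by move=> x; rewrite inE => /eqP ->.
have {}zQ : z \in Q by apply: zQ; rewrite mem_head.
apply: (@loop_induction _ _ dz Q (fun x => x <> 0) C) zQ => {z zs}.
- by move=> z a zQ; apply: Qz.
- by move=> z w w' zQ z0 szw zw zw'; apply: (zoom_simple_loops pchark (Qu _ zQ) z0 szw zw zw').
- by move=> z zQ /contrapT ->; apply: (AScl0 HC).
- move=> z zQ z0 zC; apply: (@Ctilde_root k p pchark 1); rewrite expn1.
  rewrite (zoom_decomp pchark (Qu _ zQ)); apply: (AScl_sum HC) => j _.
  by apply/(AScl_shift HC); apply: zC.
- move=> z w zQ z0 w0 zw zC; have [A [z1 [Cz1 E]]] := zoom_path (Qu _ zQ) zC.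
  apply: (Ctilde_twist_root pchark _ Cz1 (l := size w) (A := A)).
    by rewrite lt0n size_eq0.
  by rewrite E zw.
Qed.

End ZoomOrbit.

Section CartierOrbit.
Variable bs : seq (glaurent k).
Hypothesis bs_int : forall z, z \in bs -> gmask intset z = z.
Hypothesis bs_cartier : forall (j : 'I_p) z, z \in bs -> inspan bs (cartier pchark j z).

Let fixspan_int r z : fixspan p r bs z -> gmask intset z = z.
Proof.
move=> [c [_ ->]]; elim/big_ind: _ => [|x y xE yE|i _]; first exact: gmask0.
  by rewrite gmaskD xE yE.
by rewrite gmaskZ bs_int ?mem_nth.
Qed.

Lemma cartier_decomp z : gmask intset z = z ->
  z = \sum_(j < p) tpow k j%:R * cartier pchark j z ^+ p.
Proof.
move=> zE; apply: glaurentP => x; rewrite gcoef_sum.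
have E (j : 'I_p) : (tpow k j%:R * cartier pchark j z ^+ p) x =
    if `[< intset ((x - j%:R) / pr) >] then z x else 0.
  rewrite tpowM (gfrobE pchark) cartierE -/pr; case: ifP => _.
    by rewrite -[X in _ ^+ X](expn1 p) prootK divfK // subrK.
  by rewrite -[X in _ ^+ X](expn1 p) (expr0pn pchark).
under eq_bigr do rewrite E.
have [[J ->]|nx] := asboolP (intset x); last first.
  have zx0 : z x = 0 by rewrite -zE gmaskE asboolF.
  by rewrite zx0 big1 // => j _; rewrite if_same.
have pJ : (0 < p%:Z) by rewrite ltz_nat.
have mp : (`|(J %% p%:Z)%Z| < p)%N.
  have := ltz_pmod J pJ; have : (0 <= (J %% p%:Z)%Z) by rewrite modz_ge0 // gt_eqF.
  by move: (_ %% _)%Z; clear; lia.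
have mE : (`|(J %% p%:Z)%Z|%N : int) = (J %% p%:Z)%Z.
  have : (0 <= (J %% p%:Z)%Z) by rewrite modz_ge0 // gt_eqF.
  by move: (_ %% _)%Z; clear; lia.
rewrite (bigD1 (Ordinal mp)) //= asboolT; last first.
  exists (J %/ p%:Z)%Z; rewrite pmulrn mE -intrB {1}(divz_eq J p%:Z) addrK intrM -pmulrn.
  by rewrite mulfK.
rewrite big1 ?addr0 // => i /negP ni; rewrite asboolF // => -[q qE]; case: ni.
apply/eqP/val_inj => /=.
have JE : J = q * p%:Z + i%:Z.
  apply/eqP; rewrite -(eqr_int rat) intrD intrM -!pmulrn -/pr -qE divfK //.
  by rewrite subrK.
have : (J %% p%:Z)%Z = i%:Z by rewrite JE modzMDl modz_small // ltz_nat ltn_ord.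
by move=> ->.
Qed.

(** Cartier operators consume the least significant digit first, so the digits appended to J are
    those of the reversed word. *)
Lemma cartier_run z (w : seq 'I_p) J : gmask intset z = z ->
  run dc z w J%:~R ^+ (p ^ size w) = z (J%:~R * pr ^+ size w + (wval (rev w))%:R).
Proof.
move=> zE; elim/last_ind: w J => [|w a IH] J; first by rewrite /= expr1 expr0 mulr1 addr0.
rewrite run_rcons /dc cartierE asboolT; last by exists J.
rewrite size_rcons expnS exprM -[X in _ ^+ X ^+ _](expn1 p) prootK.
have := IH (J * p%:Z + a%:Z); rewrite intrD intrM -!pmulrn -/pr => ->.
rewrite rev_rcons -cat1s wval_cat size_rev /wval /= mul0n add0n natrD natrM natrX -/pr.
by congr (z _); rewrite exprS; ring.
Qed.

Lemma cartier_orbit_finite (xs : seq (glaurent k)) (cs : seq k) : (forall z, z \in xs -> inspan bs z) ->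
  exists r (Q : seq (glaurent k)), [/\ (0 < r)%N,
    (forall c, c \in cs -> frob_fixed p r c) /\ {subset xs <= Q},
    forall z, z \in Q <-> fixspan p r bs z,
    forall z, z \in Q -> gmask intset z = z &
    forall z (j : 'I_p), z \in Q -> cartier pchark j z \in Q].
Proof.
move=> xsP.
have [r [r0 csr xsr dr]] := @semilinear_fixspan k p pchark kfin _ 'I_p (fun j z => cartier pchark j z) (proot pchark 1) bs xs cs
  (fun j z w => cartierD pchark j z w) (fun j a z => cartierZ pchark j a z)
  (fun r a => @frob_fixed_proot k p pchark r 1 a) bs_cartier xsP.
have [Q QP] := @fixspan_finite k p pchark _ r bs r0.
have Q'P z : z \in [seq z <- Q | `[< fixspan p r bs z >]] <-> fixspan p r bs z.
  by rewrite mem_filter; split=> [/andP[/asboolP]|zr] //; rewrite QP // andbT; apply/asboolP.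
exists r, [seq z <- Q | `[< fixspan p r bs z >]]; split=> //.
- by split=> // z /xsr/Q'P.
- by move=> z /Q'P/fixspan_int.
- by move=> z j /Q'P/(dr j)/Q'P.
Qed.

Lemma cartier_path z (w : seq 'I_p) : gmask intset z = z ->
  (forall w1 a w2 b, w = w1 ++ a :: w2 -> b != a -> C (run dc z (rcons w1 b))) ->
  exists A z0, C z0 /\ z = z0 + tpow k A * run dc z w ^+ (p ^ size w).
Proof.
elim: w z => [|a w IH] z zE zC.
  by exists 0, 0; rewrite expr1 tpow0 mul1r add0r; split=> //; apply: (AScl0 HC).
have [|w1 b w2 c wE cb|A [z0 [Cz0 E]]] := IH (dc z a).
- exact: gmask_id.
- by have := zC (a :: w1) b w2 c; rewrite wE => /(_ erefl cb).
have [z1 Cz1 z1E] : exists2 z1, C z1 & z = tpow k a%:R * cartier pchark a z ^+ p + z1.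
  exists (\sum_(j < p | j != a) tpow k j%:R * cartier pchark j z ^+ p); last first.
    by rewrite {1}(cartier_decomp zE) (bigD1 a).
  apply: (AScl_sum HC) => j ja; apply/(AScl_shift HC); apply: (AScl_exp HC).
  exact: (zC [::] a w j).
exists (a%:R + A *+ p), (tpow k a%:R * z0 ^+ p + z1).
split; first by apply: (AScl_add HC) => //; apply/(AScl_shift HC); apply: (AScl_exp HC).
rewrite {1}z1E -/(dc z a) {1}E -[X in _ ^+ X](expn1 p) (gfrobD pchark) !expn1 exprMn tpowX -exprM.
by rewrite /= expnSr tpowD; ring.
Qed.

Variable F : glaurent k.
Hypothesis F_slim : slim p (gsupp F).
Hypothesis F_column : forall e, 0 <= e < 1 -> inspan bs (column e F).

(** The word u leads from a column of F to the state z, so that running through two loops n times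
    produces support points of F. There would be 2^n of them, of size at most p^(c (n + 1)) and
    differing by nonzero integers, against slimness. *)
Lemma cartier_simple_loops e (u w w' : seq 'I_p) : 0 <= e < 1 ->
  let z := run dc (column e F) u in z <> 0 -> gmask intset z = z ->
  size w = size w' -> run dc z w = z -> run dc z w' = z -> w = w'.
Proof.
move=> /andP[e0 e1] z /eqP/gneq0P[x zx] zE szw zw zw'; apply/eqP; apply: contraT => ww'.
have zcol : gmask intset (column e F) = column e F.
  exact: gmask_id.
have [J xE] : intset x by move: zx; rewrite -zE gmaskE; case: asboolP => //; rewrite eqxx.
subst x; have val n (v : seq 'I_p) : v \in loop_words w w' n ->
    F (J%:~R * pr ^+ size (u ++ v) + (wval (rev (u ++ v)))%:R + e) != 0.
  move=> /(run_loop_words zw zw') zv; apply: contra_neq zx => F0.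
  have := cartier_run (u ++ v) J zcol; rewrite run_cat zv columnE.
  rewrite asboolT; last first.
    exists (J * (p%:Z ^+ size (u ++ v)) + (wval (rev (u ++ v)))%:Z).
    by rewrite intrD intrM rmorphXn /= -!pmulrn -/pr.
  by rewrite F0 => /eqP; rewrite expf_eq0 => /andP[_ /eqP].
(* The factor p^B absorbs the leading part J and the offset e; the lengths of u and w enter the
   constant c below. *)
have [B BP] := archi_expr pchark (`|J|%:~R + 2) ltr01; rewrite mul1r -/pr in BP.
exfalso; apply: (slim_loops pchark szw ww' F_slim (c := (B + size u + size w)%N)
  (phi := fun n v => J%:~R * pr ^+ size (u ++ v) + (wval (rev (u ++ v)))%:R + e)).
  move=> n v vL; split; first exact: val vL.
  have szv := loop_words_size szw vL; set s := size (u ++ v).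
  have vlt : (wval (rev (u ++ v)))%:R + 1 <= pr ^+ s.
    by rewrite natr1 -natrX ler_nat /s -(size_rev (u ++ v)) wval_lt.
  apply: le_trans (_ : (`|J|%:~R + 2) * pr ^+ s <= _).
    have JJ : J%:~R * pr ^+ s <= `|J|%:~R * pr ^+ s by rewrite ler_pM2r // ler_int ler_norm.
    have := prX_ge1 s; lra.
  apply: le_trans (_ : pr ^+ B * pr ^+ s <= _); first by rewrite ler_pM2r // ltW.
  by rewrite -exprD ler_eXn2l // /s size_cat szv addnA mulnDl leq_add ?leq_pmulr // mulnC leq_mul2l leqnSn orbT.
move=> n v1 v2 v1L v2L v12; rewrite !size_cat (loop_words_size szw v1L) (loop_words_size szw v2L).
set X := _ * pr ^+ _; rewrite (_ : X + _ + e - _ = (wval (rev (u ++ v1)))%:Z%:~R - (wval (rev (u ++ v2)))%:Z%:~R); last first.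
  by rewrite -!pmulrn; ring.
rewrite -intrB -intr_norm; apply: le_trans (_ : 1 <= _); first by rewrite invf_le1.
rewrite -[X in X <= _]/(1%:~R) ler_int; apply: contraT; rewrite -ltNge => lt1.
have : wval (rev (u ++ v1)) = wval (rev (u ++ v2)).
  by move: lt1; move: (wval (rev (u ++ v1))) (wval (rev (u ++ v2))) => a b; clear; lia.
move/(wval_inj p_gt1); rewrite !size_rev !size_cat (loop_words_size szw v1L) (loop_words_size szw v2L).
move=> /(_ erefl) /(can_inj revK) /eqP; rewrite eqseq_cat // eqxx /= => /eqP v12'.
by rewrite v12' eqxx in v12.
Qed.

Lemma cartier_orbit_Ctilde e : 0 <= e < 1 -> C (column e F).
Proof.
move=> e01; have [|r [Q [_ [_ zQ] _ Qi Qc]]] := @cartier_orbit_finite [:: column e F] [::].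
  by move=> x; rewrite inE => /eqP ->; apply: F_column.
have {}zQ : column e F \in Q by apply: zQ; rewrite mem_head.
(* The absence of double loops is derived from the support of F, hence at the states that are
   reached from the column. *)
pose Q' := [seq z <- Q | `[< exists u, run dc (column e F) u = z >]].
have Q'Q z : z \in Q' -> z \in Q by rewrite mem_filter => /andP[].
have Q'u z : z \in Q' -> exists u, run dc (column e F) u = z.
  by rewrite mem_filter => /andP[/asboolP].
have zQ' : column e F \in Q' by rewrite mem_filter zQ andbT; apply/asboolP; exists [::].
apply: (@loop_induction _ _ dc Q' (fun x => x <> 0) C) zQ'.
- move=> z a zQ1; rewrite mem_filter Qc ?Q'Q // andbT; apply/asboolP.
  by have [u <-] := Q'u _ zQ1; exists (rcons u a); rewrite run_rcons.
- move=> z w w' zQ1 z0 szw zw zw'; have [u uE] := Q'u _ zQ1.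
  apply: (@cartier_simple_loops e u) => //; rewrite uE //.
  exact: Qi (Q'Q _ zQ1).
- by move=> z _ /contrapT ->; apply: (AScl0 HC).
- move=> z zQ1 z0 zC; rewrite (cartier_decomp (Qi _ (Q'Q _ zQ1))); apply: (AScl_sum HC) => j _.
  by apply/(AScl_shift HC); apply: (AScl_exp HC); apply: zC.
- move=> z w zQ1 z0 w0 zw zC; have [A [z1 [Cz1 E]]] := cartier_path (Qi _ (Q'Q _ zQ1)) zC.
  apply: (Ctilde_twist pchark _ Cz1 (l := size w) (A := A)).
    by rewrite lt0n size_eq0.
  by rewrite {1}E zw.
Qed.

End CartierOrbit.

End AutomaticSeries.

(** * Membership in C from rows and columns *)

Section AutomaticTheorem.
Variables (k : closedFieldType) (p : nat).
Hypothesis pchark : p \in [pchar k].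
Hypothesis kfin : forall x : k, exists r, (0 < r)%N /\ x ^+ (p ^ r) = x.
Implicit Types (F G z : glaurent k) (J : int) (m n r : nat) (e y : rat).

Let p_pr : prime p. Proof. exact: pcharf_prime pchark. Qed.
Let p_gt1 : (1 < p)%N. Proof. exact: prime_gt1. Qed.
Let p_gt0 : (0 < p)%N. Proof. exact: prime_gt0. Qed.
Let C := Ctilde p k.
Let HC : nontrivial_AS_closed_subalg p C. Proof. exact: Ctilde_closed. Qed.

Section Relation.
Variables (F : glaurent k) (d : nat) (A : nat -> {poly k}).
Hypothesis A0 : A 0%N != 0.
Hypothesis rel : \sum_(i < d.+1) teval 1 (A i) * F ^+ (p ^ i) = 0.

Lemma window_states : exists ys : seq (glaurent k),
  [/\ forall z, z \in ys -> gmask unit_interval z = z,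
      forall (j : 'I_p) z, z \in ys -> inspan ys (zoom p j z) &
      forall m J, inspan ys (window p m J F)].
Proof.
have Ah i : (i <= d)%N -> (size (A i) <= \max_(i < d.+1) size (A i))%N.
  by move=> id; rewrite (leq_bigmax (Ordinal (id : i < d.+1)%N)).
have [t tP] := windows_finite pchark Ah rel A0.
have [|s [sw ws]] := @inspan_basis _ _ t [set z | exists m J, z = window p m J F].
  by move=> _ [m [J ->]].
exists s; split=> [z /sw[m [J ->]]|j z /sw[m [J ->]]|m J]; first exact: gmask_id.
  by apply: ws; rewrite (zoom_window pchark) //; exists m.+1, (J * p%:Z + j%:Z).
by apply: ws; exists m, J.
Qed.

Lemma column_states : exists bs : seq (glaurent k),
  [/\ forall z, z \in bs -> gmask intset z = z,
      forall (j : 'I_p) z, z \in bs -> inspan bs (cartier pchark j z) &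
      forall e, 0 <= e < 1 -> inspan bs (column e F)].
Proof.
pose a := teval 1 (A 0%N); have a0 : a != 0 by rewrite teval_eq0 ?oner_eq0.
have [G FE] : exists G, F = a * G by exists (F / a); rewrite mulrC divfK.
(* The substitution F = A_0 G and a division by A_0^2 give the relation the coefficient 1 at G, so
   that G is a polynomial combination of its proper Frobenius powers. *)
pose A' i := if i == 0%N then 1 else A i * A 0%N ^+ (p ^ i - 2).
have relG : \sum_(i < d.+1) teval 1 (A' i) * G ^+ (p ^ i) = 0.
  apply: (mulfI (expf_neq0 2 a0)); rewrite mulr0 mulr_sumr; apply: (etrans _ rel).
  apply: eq_bigr => -[[|i] /= ilt] _.
    by rewrite /A' eqxx rmorph1 mul1r FE expn0 !expr1 expr2 mulrA.
  have p2 : (2 <= p ^ i.+1)%N by apply: leq_trans p_gt1 _; rewrite -{1}(expn1 p) leq_exp2l.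
  rewrite /A' /= rmorphM rmorphXn /= -/a FE [(a * G) ^+ _]exprMn.
  have -> : a ^+ (p ^ i.+1) = a ^+ 2 * a ^+ (p ^ i.+1 - 2) by rewrite -exprD subnKC.
  by ring.
have A'0 : A' 0%N != 0 by rewrite /A' eqxx oner_eq0.
have A'h i : (i <= d)%N -> (size (A' i) <= \max_(i < d.+1) size (A' i))%N.
  by move=> id; rewrite (leq_bigmax (Ordinal (id : i < d.+1)%N)).
have [ys ysP] := windows_finite pchark A'h relG A'0.
pose B i := if (i < d)%N then - A' i.+1 else 0.
pose h := maxn (size (A 0%N)) (\max_(i < d) size (B i)).
have Bh i : (size (B i) <= h)%N.
  rewrite /h leq_max; apply/orP; right; have [id|id] := ltnP i d.
    by rewrite (leq_bigmax (Ordinal id)).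
  by rewrite /B ltnNge id size_poly0.
have GE : G = \sum_(i < d) teval 1 (B i) * G ^+ (p ^ i.+1).
  move: relG; rewrite big_ord_recl /= rmorph1 mul1r expn0 expr1 => /eqP.
  rewrite addr_eq0 => /eqP GE; rewrite [LHS]GE -sumrN; apply: eq_bigr => i _.
  by rewrite /B ltn_ord rmorphN mulNr.
have [t tP] := column_gens_finite pchark d h ysP.
have [s [sg gs]] := inspan_basis tP.
exists s; split=> [z /sg[e [c [i [_ _ _ ->]]]]|j z /sg zg|e e01]; first exact: gmask_id.
  have [s' [s'g zs']] := column_gens_cartier pchark Bh GE zg (ltn_ord j).
  by apply: inspan_trans zs' _ => w /s'g/gs.
rewrite FE /a tevalE mulr_suml column_sum; apply: inspan_sum => l _.
rewrite -scalerAl columnZ; apply: inspanZ; apply: gs.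
exists e, l, 0%N; split=> //; by rewrite ltnS (leq_trans (ltnW (ltn_ord l))) // leqW // leq_maxl.
Qed.

End Relation.

Section RankFactorization.

Lemma int_unit_decomp (x : rat) : x = (Num.floor x)%:~R + (x - (Num.floor x)%:~R) /\
  0 <= x - (Num.floor x)%:~R < 1.
Proof.
have /andP[f1 f2] := floor_itv x; rewrite intrD in f2; split; first by ring.
by apply/andP; split; lra.
Qed.

(** A rational number is an integer plus an element of [0, 1) in one way only, so the convolution
    has a single term. In these coordinates the product is a matrix of rank one. *)
Lemma int_unit_mulE kappa eta J e : gmask intset kappa = kappa ->
  gmask unit_interval eta = eta -> 0 <= e < 1 ->
  (kappa * eta : glaurent k) (J%:~R + e) = kappa J%:~R * eta e.
Proof.
move=> kE eE e01; rewrite gcoefM (convE (s := [:: J%:~R])) //.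
  by rewrite big_seq1 addrC addKr.
move=> r; rewrite -kE gmaskE; case: asboolP => [[J' ->] _|]; last by rewrite eqxx.
rewrite -eE gmaskE; case: asboolP => [|]; last by rewrite eqxx.
rewrite /unit_interval /= inE => /andP[h1 h2] _; apply/eqP; congr (_%:~R).
have /andP[e0 e1] := e01.
apply/esym; apply: (@int_window_uniq (J%:~R + e)); apply/andP; split; lra.
Qed.

Lemma window0E J G e : 0 <= e < 1 -> window p 0 J G e = G (J%:~R + e).
Proof. by move=> e01; rewrite (windowE pchark) e01 expr0 divr1 expn0 expr1 addrC. Qed.

Lemma column_intE J e G : column e G J%:~R = G (J%:~R + e).
Proof. by rewrite columnE asboolT //; exists J. Qed.

(** G is viewed as a matrix with rows indexed by Z and columns by [0, 1). At a nonzero entry (J0,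
    e0) the product of column e0 and row J0, divided by the entry, belongs to C; subtracting it
    lowers the number of series needed to span the rows. *)
Lemma Ctilde_of_rows_columns n G :
  (exists2 s : seq (glaurent k), (size s <= n)%N & forall J, inspan s (window p 0 J G)) ->
  (forall J, C (window p 0 J G)) -> (forall e, 0 <= e < 1 -> C (column e G)) -> C G.
Proof.
elim: n G => [|n IH] G [s sn sG] Cw Cc.
  have -> : G = 0; last exact: (AScl0 HC).
  apply: glaurentP => x; have [xE x01] := int_unit_decomp x.
  rewrite xE -(window0E _ _ x01); have [c ->] := sG (Num.floor x).
  by rewrite gcoef_sum big1 // => i _; case: i; case: s sn {sG}.
have [->|/gneq0P[x0 Gx0]] := eqVneq G 0; first exact: (AScl0 HC).
pose J0 := Num.floor x0; pose e0 : rat := x0 - J0%:~R.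
have [x0E e01] := int_unit_decomp x0; rewrite -/J0 -/e0 in x0E e01.
pose g := G x0; pose N := column e0 G * window p 0 J0 G.
have NE J e : 0 <= e < 1 -> N (J%:~R + e) = G (J%:~R + e0) * G (J0%:~R + e).
  by move=> ?; rewrite int_unit_mulE ?gmask_id // column_intE window0E.
pose G' := G - g^-1 *: N.
have CN : C N by apply: (AScl_mul HC); [apply: Cc|apply: Cw].
rewrite -(subrK (g^-1 *: N) G) -/G'; apply: (AScl_add HC); last exact: (AScl_scale HC).
have G'E J e : 0 <= e < 1 ->
    G' (J%:~R + e) = G (J%:~R + e) - g^-1 * (G (J%:~R + e0) * G (J0%:~R + e)).
  by move=> e01'; rewrite /G' gcoefB gcoefZ NE.
have wG' J : window p 0 J G' = window p 0 J G - (g^-1 * G (J%:~R + e0)) *: window p 0 J0 G.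
  apply: glaurentP => e; rewrite gcoefB gcoefZ; have [e01'|e01'] := boolP (0 <= e < 1).
    by rewrite !window0E // G'E // mulrA.
  by rewrite !(windowE pchark) (negPf e01') mulr0 subr0.
have cG' e : 0 <= e < 1 -> column e G' = column e G - (g^-1 * G (J0%:~R + e)) *: column e0 G.
  move=> e01'; apply: glaurentP => x; rewrite gcoefB gcoefZ.
  have [[J ->]|nx] := pselect (intset x).
    by rewrite !column_intE G'E // mulrAC mulrA.
  by rewrite !columnE asboolF // mulr0 subr0.
apply: IH => [|J|e e01']; last 2 first.
- by rewrite wG'; apply: (AScl_sub HC); [|apply: (AScl_scale HC)].
- by rewrite cG' //; apply: (AScl_sub HC); [exact: Cc|apply: (AScl_scale HC); exact: Cc].
(* All rows of G' vanish at e0, so a spanning element b with a nonzero coefficient at e0 can be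
   eliminated. *)
have [b bs be0] : exists2 b, b \in s & (b : glaurent k) e0 != 0.
  apply: contrapT => nb; case/eqP: Gx0; rewrite x0E -(window0E _ _ e01).
  have [c ->] := sG J0; rewrite gcoef_sum big1 // => i _; rewrite gcoefZ.
  have [->|bi] := eqVneq (s`_i e0) 0; first by rewrite mulr0.
  by case: nb; exists s`_i => //; apply: mem_nth.
case/splitPr: s / bs sn sG => s1 s2 sn sG; pose t := s1 ++ s2.
pose s' := [seq y - ((y : glaurent k) e0 / b e0) *: b | y : glaurent k <- t].
have s'0 (y : glaurent k) : inspan s' y -> y e0 = 0.
  move=> [c ->]; rewrite gcoef_sum big1 // => i _; rewrite gcoefZ.
  have : s'`_i \in s' by apply: mem_nth.
  by case/mapP => z _ ->; rewrite gcoefB gcoefZ divfK // subrr mulr0.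
have bt (y : glaurent k) : inspan (s1 ++ b :: s2) y -> exists a, inspan s' (y - a *: b).
  move=> [c ->]; elim/big_ind: _ => [|x y' [a xa] [a' ya']|i _].
  - by exists 0; rewrite scale0r subr0; apply: inspan0.
  - by exists (a + a'); rewrite scalerDl opprD addrACA; apply: inspanD.
  have : (s1 ++ b :: s2)`_i \in s1 ++ b :: s2 by apply: mem_nth.
  set z := _`_i => zs; have [->|zb] := eqVneq z b.
    by exists (c i); rewrite subrr; apply: inspan0.
  exists (c i * (z e0 / b e0)); rewrite -scalerA -scalerBr; apply: inspanZ; apply: mem_inspan.
  apply/mapP; exists z => //; move: zs.
  by rewrite /t !mem_cat inE (negPf zb).
exists s' => [|J].
  by move: sn; rewrite /s' /t size_map !size_cat /= addnS ltnS.
have wspan : inspan (s1 ++ b :: s2) (window p 0 J G').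
  by rewrite wG'; apply: inspanD => //; apply: inspanN; apply: inspanZ.
have [a ya] := bt _ wspan.
have we0 : window p 0 J G' e0 = 0.
  by rewrite window0E // G'E // -x0E -/g mulrCA mulVf ?mulr1 ?subrr.
have := s'0 _ ya; rewrite gcoefB gcoefZ we0 sub0r => /eqP.
rewrite oppr_eq0 mulf_eq0 (negPf be0) orbF => /eqP a0.
by move: ya; rewrite a0 scale0r subr0.
Qed.

End RankFactorization.

Theorem Ctilde_of_slim_relation F d A :
  A 0%N != 0 -> \sum_(i < d.+1) teval 1 (A i) * F ^+ (p ^ i) = 0 ->
  slim p (gsupp F) -> C F.
Proof.
move=> A0 rel Fs.
have [ys [ys1 ys2 ys3]] := window_states A0 rel.
have [bs [bs1 bs2 bs3]] := column_states A0 rel.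
apply: (@Ctilde_of_rows_columns (size ys)).
- by exists ys.
- by move=> J; apply: (zoom_orbit_Ctilde pchark kfin ys1 ys2).
- by move=> e; apply: (cartier_orbit_Ctilde kfin bs1 bs2 Fs bs3).
Qed.

End AutomaticTheorem.

(** * Sparse languages *)

Section PumpSets.
Variable p : nat.
Implicit Types (v x y : word p) (X Y : set (word p)).

(** Finite unions of pumped families, without the condition that the words are valid. They are
    stable under union, under a common prefix and under a starred nonempty prefix, which are the
    operations met along loops. *)
Inductive pumps : set (word p) -> Prop :=
| pumps0 : pumps set0
| pumps_add s u w X : (forall i, (i < s)%N -> w i != [::]) -> pumps X ->
    pumps (range (pump s u w) `|` X).

Lemma pumpsU X Y : pumps X -> pumps Y -> pumps (X `|` Y).
Proof.
move=> PX PY; elim: PX => [|s u w Z w0 _ IH]; first by rewrite set0U.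
by rewrite -setUA; apply: pumps_add.
Qed.

Lemma pump_shift s (u w : nat -> word p) n : pump s.+1 u w n =
  u 0%N ++ flatten (nseq (n 0%N) (w 0%N)) ++ pump s (u \o S) (w \o S) (n \o S).
Proof.
rewrite /pump /= -[in LHS]add1n iotaDl -map_comp -!catA; congr (_ ++ (_ ++ (flatten _ ++ _))).
Qed.

Lemma pump_cat s u w v n :
  pump s (fun i => if i is 0%N then v ++ u 0%N else u i) w n = v ++ pump s u w n.
Proof. by case: s => [|s]; rewrite ?pump_shift /= -?catA //. Qed.

Lemma pumps_cat v X : pumps X -> pumps [set v ++ x | x in X].
Proof.
elim=> [|s u w Z w0 _ IH]; first by rewrite image_set0; apply: pumps0.
rewrite image_setU (_ : image (range _) _ = range (pump s (fun i =>
  if i is 0%N then v ++ u 0%N else u i) w)); first exact: pumps_add.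
by apply/seteqP; split=> [_ [_ [n _ <-] <-]|_ [n _ <-]];
  [exists n|exists (pump s u w n); [exists n|]]; rewrite ?pump_cat.
Qed.

Lemma pumps_star v X : v != [::] -> pumps X ->
  pumps [set y | exists n, exists2 x, X x & y = flatten (nseq n v) ++ x].
Proof.
move=> v0; elim=> [|s u w Z w0 _ IH].
  by rewrite (_ : [set y | _] = set0) ?predeqE; [apply: pumps0|move=> y; split=> // -[n []]].
pose u' i := if i is i.+1 then u i else [::]; pose w' i := if i is i.+1 then w i else v.
rewrite (_ : [set y | _] = range (pump s.+1 u' w') `|`
  [set y | exists n, exists2 x, Z x & y = flatten (nseq n v) ++ x]).
  by apply: pumps_add => // -[].
apply/seteqP; split=> y.
  case=> m [x [[n _ <-]|Zx] ->]; last by right; exists m, x.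
  by left; exists (fun i => if i is i.+1 then n i else m); rewrite // pump_shift.
case=> [[n _ <-]|[m [x Zx ->]]]; last by exists m, x => //; right.
by rewrite pump_shift; exists (n 0%N); eexists; [left; exists (n \o S)|].
Qed.

Lemma pumps1 v : pumps [set v].
Proof.
rewrite (_ : [set v] = range (pump 0 (fun=> v) (fun=> [::])) `|` set0).
  by apply: pumps_add => //; exact: pumps0.
by rewrite setU0; apply/seteqP; split=> x => [->|[_ _ <-]] //; exists (fun=> 0%N).
Qed.

Lemma pumps_bigU (I : eqType) (s : seq I) (Z : I -> set (word p)) :
  (forall i, i \in s -> pumps (Z i)) -> pumps [set v | exists2 i, i \in s & Z i v].
Proof.
elim: s => [|i s IH] sP.
  by rewrite (_ : [set v | _] = set0) ?predeqE; [apply: pumps0|move=> y; split=> // -[]].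
rewrite (_ : [set v | _] = Z i `|` [set v | exists2 i, i \in s & Z i v]).
  apply: pumpsU; first by apply: sP; apply: mem_head.
  by apply: IH => j js; apply: sP; rewrite inE js orbT.
apply/seteqP; split=> y.
  by case=> j; rewrite inE => /orP[/eqP->|js] Zj; [left|right; exists j].
by case=> [Zi|[j js Zj]]; [exists i => //; exact: mem_head|exists j; rewrite // inE js orbT].
Qed.

Lemma sparse_pumps X : pumps X -> (forall v, X v -> valid_expansion v) ->
  (forall v, X v -> Sp p (expansion_value v)) -> sparse p [set expansion_value v | v in X].
Proof.
move=> PX Xv XS; split=> [_ [v Xv' <-]|]; first exact: XS.
elim: PX Xv {XS} => [|s u w Y w0 _ IH] Xv.
  exists 0%N, (fun=> set0); split=> [[]//|]; rewrite image_set0.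
  by apply/seteqP; split=> // x [[]].
have [|m [Z [Zs ZE]]] := IH; first by move=> v Yv; apply: Xv; right.
exists m.+1, (fun i => if unlift ord0 i is Some j then Z j
  else [set expansion_value v | v in range (pump s u w)]); split=> [i|].
  case: (unlift _ _) => // {i}; exists s, u, w; split=> // [n|]; last by rewrite image_comp.
  by apply: Xv; left; exists n.
rewrite image_setU ZE; apply/seteqP; split=> x.
  case=> [xP|[i _ Zi]]; first by exists ord0; rewrite // unlift_none.
  by exists (lift ord0 i); rewrite // liftK.
by case=> i _; case: unliftP => [j _ Zj|_ ?]; [right; exists j|left].
Qed.

End PumpSets.

(** * Base p expansions *)

Section ExpansionValue.
Variable p : nat.
Hypothesis p_gt1 : (1 < p)%N.
Implicit Types (d : seq 'I_p) (u v : word p).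

Let pr : rat := p%:R.
Let p_gt0 : (0 < p)%N. Proof. exact: ltnW. Qed.
Let pr_gt0 : 0 < pr. Proof. by rewrite ltr0n. Qed.
Let prX_gt0 n : 0 < pr ^+ n. Proof. exact: exprn_gt0. Qed.
Let prX_neq0 n : pr ^+ n != 0. Proof. by rewrite gt_eqF. Qed.

Definition radix_word d1 d2 : word p := map Some d1 ++ None :: map Some d2.

Lemma radix_wordP u : count_mem None u = 1%N -> exists d1 d2, u = radix_word d1 d2.
Proof.
have digits v : count_mem None v = 0%N -> exists d, v = map Some d.
  elim: v => [|[a|] v IH] //=; first by exists [::].
  by rewrite add0n => /IH[d ->]; exists (a :: d).
elim: u => [|[a|] u IH] //=; first by rewrite add0n => /IH[d1 [d2 ->]]; exists (a :: d1), d2.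
by rewrite add1n => -[] /digits[d ->]; exists [::], d.
Qed.

Lemma count_None_digits d : count_mem None (map Some d) = 0%N.
Proof. by rewrite count_map; apply/eqP; rewrite eqn0Ngt -has_count; apply/hasPn. Qed.

Lemma radix_word_cat d1 d2 d : radix_word d1 d2 ++ map Some d = radix_word d1 (d2 ++ d).
Proof. by rewrite /radix_word map_cat; elim: d1 => //= a d1 ->. Qed.

Lemma cat_radix_word d d1 d2 : map Some d ++ radix_word d1 d2 = radix_word (d ++ d1) d2.
Proof. by elim: d => //= a d ->. Qed.

Lemma index_radix_word d1 d2 : index None (radix_word d1 d2) = size d1.
Proof. by elim: d1 => //= a d1 ->. Qed.

Lemma count_radix_word d1 d2 : count_mem None (radix_word d1 d2) = 1%N.
Proof. by rewrite count_cat /= !count_None_digits. Qed.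

Lemma wval_sum d : (wval d)%:R =
  \sum_(0 <= i < size d) (digit (nth None (map Some d) i))%:R * pr ^+ (size d - 1 - i) :> rat.
Proof.
elim/last_ind: d => [|d a IH]; first by rewrite big_nil.
rewrite wval_rcons size_rcons big_nat_recr //= subSS subn0 subnn expr0 mulr1 natrD natrM IH.
rewrite map_rcons nth_rcons size_map ltnn eqxx /= mulr_suml; congr (_ + _).
apply: eq_big_nat => i /= id; rewrite nth_rcons size_map id -mulrA -exprSr -/pr.
by congr (_ * _ ^+ _); move: id; clear; lia.
Qed.

Lemma expansion_valueE d1 d2 :
  expansion_value (radix_word d1 d2) = (wval (d1 ++ d2))%:R / pr ^+ size d2.
Proof.
rewrite /expansion_value index_radix_word wval_cat natrD natrM natrX mulrDl mulfK //.
congr (_ + _).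
  rewrite wval_sum; apply: eq_big_nat => i /= id.
  by rewrite /radix_word nth_cat size_map id.
rewrite wval_sum mulr_suml size_cat /= !size_map addnS -addSn -{1}[(size d1).+1]add0n.
rewrite (addnC (size d1).+1 (size d2)) big_addn addnK; apply: eq_big_nat => i /= id.
rewrite /radix_word nth_cat size_map ifF; last by move: id; clear; lia.
rewrite (_ : (i + _ - _)%N = i.+1); last by clear; lia.
rewrite -mulrA; congr (_ * _); have dE : size d2 = ((size d2 - 1 - i) + i.+1)%N by move: id; clear; lia.
by rewrite [in _ ^- size d2]dE exprD invfM mulrA mulfV ?mul1r.
Qed.

Lemma Sp_expansion u : count_mem None u = 1%N -> Sp p (expansion_value u).
Proof.
by case/radix_wordP => d1 [d2 ->]; exists (wval (d1 ++ d2)), (size d2); rewrite expansion_valueE.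
Qed.

Lemma wval_digits n m : (m < p ^ n)%N -> exists2 d : seq 'I_p, size d = n & wval d = m.
Proof.
elim: n m => [|n IH] m mp; first by exists [::] => //; move: mp; case: m.
have [|d dn dv] := IH (m %/ p)%N; first by rewrite ltn_divLR // -expnSr.
exists (rcons d (Ordinal (ltn_pmod m p_gt0))); first by rewrite size_rcons dn.
by rewrite wval_rcons dv /= -divn_eq.
Qed.

(** The numerator m is written with m + n digits, enough because m < p^m, the last n of them after
    the radix point; zeros at both ends are then stripped, by induction on the length. *)
Lemma Sp_valid_expansion x : Sp p x -> exists2 u : word p, valid_expansion u & expansion_value u = x.
Proof.
move=> [m [n ->]]; have [u uc <-] : exists2 u : word p, count_mem None u = 1%N & expansion_value u = m%:R / pr ^+ n.
  have [|d dn dv] := @wval_digits (m + n) m.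
    by apply: leq_trans (ltn_expl _ p_gt1) _; rewrite leq_exp2l // leq_addr.
  exists (radix_word (take m d) (drop m d)); first exact: count_radix_word.
  by rewrite expansion_valueE cat_take_drop size_drop dn addKn dv.
have [l] := ubnP (size u); elim: l u uc => // l IH u uc ul.
have [d1 [d2 uE]] := radix_wordP uc; rewrite uE expansion_valueE.
have [h1|h1] := boolP (zero_digit (head None u)).
  case: d1 uE => [|a d1] uE; first by move: h1; rewrite uE.
  have a0 : a = 0%N :> nat by apply/eqP; move: h1; rewrite uE.
  have [||v vv vE] := IH (radix_word d1 d2); first exact: count_radix_word.
    by move: ul; rewrite uE /= ltnS.
  by exists v; rewrite // vE expansion_valueE /wval /= a0 mul0n.
have [h2|h2] := boolP (zero_digit (last None u)); last first.
  exists u; last by rewrite uE expansion_valueE.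
  by rewrite /valid_expansion h1 h2 uc.
case/lastP: d2 uE => [|d2 a] uE; first by move: h2; rewrite uE /radix_word last_cat.
have a0 : a = 0%N :> nat.
  by apply/eqP; move: h2; rewrite uE /radix_word last_cat /= map_rcons last_rcons.
have [||v vv vE] := IH (radix_word d1 d2); first exact: count_radix_word.
  by move: ul; rewrite uE /radix_word !size_cat /= !size_map size_rcons; lia.
exists v; rewrite // vE expansion_valueE -rcons_cat wval_rcons a0 addn0 size_rcons exprSr.
by rewrite natrM invfM [pr ^- _ * _]mulrC mulrA mulfK ?gt_eqF.
Qed.

End ExpansionValue.

(** * The growth of sparse sets *)

Section SparseSlim.
Variables (k : closedFieldType) (p : nat).
Hypothesis pchark : p \in [pchar k].
Let p_pr : prime p. Proof. exact: pcharf_prime pchark. Qed.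
Let p_gt1 : (1 < p)%N. Proof. exact: prime_gt1. Qed.
Let pr : rat := p%:R.
Let pr_gt0 : 0 < pr. Proof. by rewrite ltr0n prime_gt0. Qed.
Let pr_ge1 : 1 <= pr. Proof. by rewrite ler1n prime_gt0. Qed.
Let prX_gt0 n : 0 < pr ^+ n. Proof. exact: exprn_gt0. Qed.
Let prX_neq0 n : pr ^+ n != 0. Proof. by rewrite gt_eqF. Qed.

Definition few_prefixes (X : set (word p)) := exists2 f, poly_bounded f &
  forall M, exists2 P : seq (word p), (size P <= f M)%N & forall v, X v -> take M v \in P.

Lemma few_prefixes_cat u X : few_prefixes X -> few_prefixes [set u ++ x | x in X].
Proof.
move=> [f fb fP]; exists f => // M; have [P Pf PP] := fP M.
exists [seq take M (u ++ x) | x <- P]; first by rewrite size_map.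
move=> _ [x Xx <-]; apply/mapP; exists (take M x); first exact: PP.
rewrite !take_cat; case: ltnP => // uM; congr (_ ++ _).
by rewrite take_takel ?leq_subr.
Qed.

(** Beyond M + 1 repetitions of the nonempty word w the prefix of length M no longer changes. *)
Lemma few_prefixes_star w X : w != [::] -> few_prefixes X ->
  few_prefixes [set y | exists n, exists2 x, X x & y = flatten (nseq n w) ++ x].
Proof.
move=> w0 [f fb fP]; exists (fun M => (1 * M + 2) * f M)%N.
  by apply: poly_bounded_mul => //; apply: poly_bounded_linear.
move=> M; have [P Pf PP] := fP M.
exists [seq take M (flatten (nseq n w) ++ x) | n <- iota 0 M.+2, x <- P].
  by rewrite size_allpairs size_iota mul1n addn2 leq_mul2l Pf orbT.
have szw n : (n <= size (flatten (nseq n w)))%N.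
  by rewrite size_flatten /shape map_nseq sumn_nseq leq_pmull // lt0n size_eq0.
move=> _ [n [x Xx ->]]; apply/allpairsP.
have [nM|Mn] := leqP n M.+1.
  exists (n, take M x); split; [by rewrite mem_iota|exact: PP|].
  rewrite !take_cat /=; case: ltnP => // uM; congr (_ ++ _).
  by rewrite take_takel ?leq_subr.
exists (M.+1, take M x); split; [by rewrite mem_iota ltnSn|exact: PP|].
by rewrite -(subnKC (ltnW Mn)) nseqD flatten_cat -catA !take_cat /= szw.
Qed.

Lemma few_prefixes_pump s (u w : nat -> word p) : (forall i, (i < s)%N -> w i != [::]) ->
  few_prefixes (range (pump s u w)).
Proof.
elim: s u w => [|s IH] u w w0.
  exists (fun=> 1%N) => [|M]; first exact: poly_bounded_const.
  by exists [:: take M (u 0%N)] => // _ [n _ <-]; rewrite /pump mem_head.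
have IHs := IH (u \o S) (w \o S) (fun i => w0 i.+1).
have [f fb fP] := few_prefixes_cat (u 0%N) (few_prefixes_star (w0 0%N isT) IHs).
exists f => // M; have [P Pf PP] := fP M; exists P => // _ [n _ <-]; apply: PP.
rewrite pump_shift; eexists; last by [].
by exists (n 0%N); eexists; last by []; exists (n \o S).
Qed.

(** A nonzero leading digit and a value up to p^M leave at most M + 1 digits before the radix point.
    A prefix of length 2 M + 2 therefore retains at least M digits after it, or is the whole
    word. *)
Lemma slim_few_prefixes X : (forall v, X v -> valid_expansion v) -> few_prefixes X ->
  slim p [set expansion_value v | v in X].
Proof.
move=> Xv [f fb fP]; exists (fun M => f (2 * M + 2)%N); first exact: poly_bounded_affine.
move=> M; have [P Pf PP] := fP (2 * M + 2)%N.
exists [seq expansion_value v | v <- P]; first by rewrite size_map.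
move=> _ [v Xv' <-] vM; set N := (2 * M + 2)%N in Pf PP *.
exists (expansion_value (take N v)); first by apply: map_f; apply: PP.
have /and3P[hv _ /eqP/radix_wordP[d1 [d2 vE]]] := Xv _ Xv'.
rewrite vE expansion_valueE // in vM *.
have d1M : (size d1 <= M.+1)%N.
  case: d1 vE vM => [|a d1] // vE vM.
  have a0 : (0 < a)%N by rewrite lt0n; move: hv; rewrite vE.
  have : p%:R ^+ size d1 <= pr ^+ M.
    apply: le_trans vM; rewrite ler_pdivlMr // -!natrX -natrM ler_nat -expnD.
    rewrite -(cat1s a) -catA wval_cat size_cat /wval /= add0n.
    by apply: leq_trans (leq_addr _ _); rewrite leq_pmull.
  by rewrite -!natrX ler_nat leq_exp2l.
have [szN|szN] := leqP (size (radix_word d1 d2)) N.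
  by rewrite take_oversize // expansion_valueE // subrr normr0 invr_ge0 ltW.
set l := (N - (size d1).+1)%N.
have lM : (M <= l)%N by rewrite /l /N; move: d1M; clear; lia.
have -> : take N (radix_word d1 d2) = radix_word d1 (take l d2).
  rewrite /radix_word take_cat size_map ltnNge (leq_trans d1M) /=; last by rewrite /N; clear; lia.
  have -> : (N - size d1 = l.+1)%N by rewrite /l /N; move: d1M; clear; lia.
  by rewrite /= map_take.
have l2 : (l <= size d2)%N.
  by move: szN; rewrite size_cat /= !size_map /l; clear; lia.
rewrite expansion_valueE // size_takel // -{1}(cat_take_drop l d2) catA wval_cat.
have {1}-> : size d2 = (l + size (drop l d2))%N by rewrite size_drop subnKC.
rewrite exprD natrD natrM natrX -/pr; set a := (wval _)%:R; set b := (wval _)%:R.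
have bP : 0 <= b < pr ^+ size (drop l d2).
  by rewrite ler0n /= -natrX ltr_nat wval_lt.
set D := pr ^+ size (drop l d2); have D0 : 0 < D by exact: prX_gt0.
have -> : (a * D + b) / (pr ^+ l * D) - a / pr ^+ l = b / D / pr ^+ l.
  by field; rewrite prX_neq0 gt_eqF.
case/andP: bP => b0 bD; rewrite ger0_norm; last by rewrite !divr_ge0 // ltW.
apply: le_trans (_ : 1 / pr ^+ l <= _).
  by rewrite ler_pM2r ?invr_gt0 // ler_pdivrMr // mul1r ltW.
by rewrite mul1r lef_pV2 ?posrE // ler_eXn2l // ltr1n.
Qed.

Lemma sparse_slim S : sparse p S -> slim p S.
Proof.
move=> [_ [m [Y [Ys ->]]]]; elim: m Y Ys => [|m IH] Y Ys.
  by apply: slim_sub (slim0 pchark) => x [[]].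
apply: (@slim_sub p _ (Y ord0 `|` \bigcup_i Y (lift ord0 i))).
  move=> x [i _ Yi]; case: (unliftP ord0 i) Yi => [j ->|->] Yi; last by left.
  by right; exists j.
apply: slimU; last exact: IH.
have [s [u [w [w0 valid ->]]]] := Ys ord0.
rewrite -(image_comp (pump s u w) (@expansion_value p)); apply: slim_few_prefixes.
  by move=> _ [n _ <-].
exact: few_prefixes_pump.
Qed.

End SparseSlim.

(** * Languages with finitely many residuals *)

Definition finite_range (A : Type) (T : eqType) (f : A -> T) := exists s : seq T, forall a, f a \in s.

Lemma finite_range_factor (A : Type) (T U : eqType) (f : A -> T) (g : A -> U) :
  finite_range f -> (forall a b, f a = f b -> g a = g b) -> finite_range g.
Proof.
move=> [s fs] fg; pose h x : option U :=
  if pselect (exists a, f a = x) is left e then Some (g (projT1 (cid e))) else None.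
exists (pmap h s) => a; rewrite mem_pmap; apply/mapP; exists (f a) => //.
rewrite /h; case: pselect => [e|[]]; last by exists a.
by case: (cid e) => b /= fb; congr Some; apply: fg.
Qed.

Lemma finite_range_pair (A : Type) (T U : eqType) (f : A -> T) (g : A -> U) :
  finite_range f -> finite_range g -> finite_range (fun a => (f a, g a)).
Proof. by move=> [s fs] [t gt]; exists [seq (x, y) | x <- s, y <- t] => a; apply: allpairs_f. Qed.

Lemma finite_range_fin (A : Type) (T : finType) (f : A -> T) : finite_range f.
Proof. by exists (enum T) => a; rewrite mem_enum. Qed.

Lemma finite_range_if (A : Type) (T : eqType) (c : A -> bool) (f g : A -> T) :
  finite_range f -> finite_range g -> finite_range (fun a => if c a then f a else g a).
Proof.
by move=> [s fs] [t gt]; exists (s ++ t) => a; rewrite mem_cat; case: (c a); rewrite ?fs ?gt ?orbT.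
Qed.

Lemma finite_range_map (A : Type) (T U : eqType) (f : T -> A -> U) (bs : seq T) :
  (forall b, b \in bs -> finite_range (f b)) -> finite_range (fun a => [seq f b a | b <- bs]).
Proof.
elim: bs => [|b bs IH] bsP; first by exists [:: [::]].
have [|s sP] := IH; first by move=> c cs; apply: bsP; rewrite inE cs orbT.
have [t tP] := bsP b (mem_head _ _).
by exists [seq x :: y | x <- t, y <- s] => a; exact: (allpairs_f (fun x y => x :: y) (tP a) (sP a)).
Qed.

Section RegularLanguage.
Variable p : nat.

Definition language := word p -> bool.
HB.instance Definition _ := gen_eqMixin language.
Implicit Types (L q : language) (u v w x y : word p) (a b : option 'I_p).

Definition residual L u : language := fun v => L (u ++ v).

Let delta q a : language := fun v => q (a :: v).

Let run_delta q u v : run delta q u v = q (u ++ v).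
Proof. by elim: u q v => //= a u IH q v; rewrite IH. Qed.

Lemma not_prefix w x : (forall y, x <> w ++ y) ->
  (exists2 i, (i < size w)%N & x = take i w) \/
  exists w1 a w2 b y, [/\ w = w1 ++ a :: w2, b != a & x = w1 ++ b :: y].
Proof.
elim: w x => [|a w IH] [|b x] nx; first by case: (nx [::]).
- by case: (nx (b :: x)).
- by left; exists 0%N.
- have [ba|ba] := eqVneq b a; last by right; exists [::], a, w, b, x.
  subst b; have [y xy|[i iw ->]|[w1 [c [w2 [b [y [-> bc ->]]]]]]] := IH x.
  + by apply: (nx y); rewrite xy.
  + by left; exists i.+1.
  + by right; exists (a :: w1), c, w2, b, y.
Qed.

Lemma star_decomp q w v : w != [::] -> (forall y, q (w ++ y) = q y) -> q v ->
  exists n x, [/\ q x, forall y, x <> w ++ y & v = flatten (nseq n w) ++ x].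
Proof.
move=> w0 qw; have [n] := ubnP (size v); elim: n v => // n IH v; rewrite ltnS => vn qv.
have [[y vE]|ny] := pselect (exists y, v = w ++ y); last first.
  by exists 0%N, v; split=> // y vE; apply: ny; exists y.
have [||m [x [qx xw yE]]] := IH y.
- apply: leq_trans vn; rewrite vE size_cat -[X in (X < _)%N]add0n ltn_add2r.
  by rewrite lt0n size_eq0.
- by rewrite -qw -vE.
- by exists m.+1, x; split=> //; rewrite /= -catA -yE.
Qed.

(** Loop induction on the residuals. At a loop w the words of q are w^n x, with x not beginning with
    w; such an x is a proper prefix of w or departs from w at some letter, and in the second case
    the induction covers the rest. *)
Lemma pumps_residual L : finite_range (residual L) ->
  (forall u v w w', L (u ++ v) -> size w = size w' -> residual L (u ++ w) = residual L u ->
     residual L (u ++ w') = residual L u -> w = w') ->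
  pumps [set v | L v].
Proof.
move=> [Q QP] simple.
pose Q' := [seq q <- Q | `[< exists u, q = residual L u >]].
have Q'E q : q \in Q' <-> exists u, q = residual L u.
  by rewrite mem_filter; split=> [/andP[/asboolP]|[u ->]] //; rewrite QP andbT; apply/asboolP; exists u.
have runE u w : run delta (residual L u) w = residual L (u ++ w).
  by apply: funext => v; rewrite run_delta /residual catA.
apply: (@loop_induction _ _ delta Q' (fun q => exists v, q v) (fun q => pumps [set v | q v]) _ _ _ _ _ L).
- move=> q a /Q'E[u ->]; apply/Q'E; exists (rcons u a).
  by apply: funext => v; rewrite /residual cat_rcons.
- move=> q w w' /Q'E[u ->] [v Luv] sw; rewrite !runE; exact: simple Luv sw.
- move=> q _ qdead; rewrite (_ : [set v | q v] = set0); first exact: pumps0.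
  by apply/seteqP; split=> // v qv; case: qdead; exists v.
- move=> q _ _ Pq; rewrite (_ : [set v | q v] = (if q [::] then [set [::]] else set0) `|`
    [set v | exists2 a, a \in enum {: option 'I_p} & [set [:: a] ++ x | x in [set v | delta q a v]] v]).
    apply: pumpsU; first by case: (q [::]); [exact: pumps1|exact: pumps0].
    by apply: pumps_bigU => a _; apply: pumps_cat; apply: Pq.
  apply/seteqP; split=> [[|a v] qv|v].
  + by left; move: qv => /= ->.
  + by right; exists a; rewrite ?mem_enum //; exists v.
  + by case: ifP => q0 [|[a _ [x qx <-]]] //= ->.
- move=> q w _ _ w0 qw Pq.
  have qwy y : q (w ++ y) = q y by rewrite -run_delta qw.
  (* [X i] holds the proper prefix of w of length i when q accepts it. [Y (i, a, b)] holds the words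
     that follow w for i letters and then have b where w has a. *)
  pose X i := if q (take i w) then [set take i w] else set0.
  pose Y (iab : nat * option 'I_p * option 'I_p) : set (word p) :=
    let: (i, a, b) := iab in
    if drop i w == a :: drop i.+1 w then if b != a then
      [set rcons (take i w) b ++ x | x in [set v | run delta q (rcons (take i w) b) v]] else set0 else set0.
  pose E := enum {: option 'I_p}.
  pose IJ := [seq (ia, b) | ia <- [seq (i, a) | i <- iota 0 (size w), a <- E], b <- E].
  rewrite (_ : [set v | q v] = [set y | exists n, exists2 x,
    ([set x | exists2 i, i \in iota 0 (size w) & X i x] `|` [set x | exists2 iab, iab \in IJ & Y iab x]) x &
    y = flatten (nseq n w) ++ x]).
    apply: pumps_star => //; apply: pumpsU; first apply: pumps_bigU => i _.
      by rewrite /X; case: ifP => _; [exact: pumps1|exact: pumps0].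
    apply: pumps_bigU => -[[i a] b] _; rewrite /Y; case: eqP => [dw|_]; last exact: pumps0.
    case: ifP => ba; last exact: pumps0.
    by apply: pumps_cat; apply: (Pq _ a (drop i.+1 w)); rewrite // -dw cat_take_drop.
  apply/seteqP; split=> v.
    case/(star_decomp w0 qwy) => n [x [qx /not_prefix xw ->]]; exists n, x => //.
    case: xw => [[i iw xE]|[w1 [a [w2 [b [y [wE ba xE]]]]]]]; [left|right].
      by exists i; rewrite ?mem_iota // /X -xE qx.
    have tw : take (size w1) w = w1 by rewrite wE take_size_cat.
    exists (size w1, a, b).
      apply: allpairs_f; last by rewrite mem_enum.
      apply: allpairs_f; last by rewrite mem_enum.
      by rewrite mem_iota leq0n add0n wE size_cat addnS ltnS leq_addr.
    rewrite /Y tw ba wE drop_size_cat // -cat_rcons drop_size_cat ?size_rcons // eqxx.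
    by exists y; rewrite /= ?run_delta cat_rcons -xE.
  case=> n [x xP ->].
  suff: q x by elim: n => //= n IH qx; rewrite -catA qwy; apply: IH.
  case: xP => [[i _]|[[[i a] b] _]]; first by rewrite /X; case: ifP => // qi ->.
  by rewrite /Y; case: eqP => // _; case: ifP => // _ [y /=]; rewrite run_delta => qy <-.
by apply/Q'E; exists [::].
Qed.

End RegularLanguage.

(** * The language of the expansions of support points *)

Section SupportLanguage.
Variables (k : closedFieldType) (p : nat).
Hypothesis pchark : p \in [pchar k].
Hypothesis kfin : forall x : k, exists r, (0 < r)%N /\ x ^+ (p ^ r) = x.

Let p_pr : prime p. Proof. exact: pcharf_prime pchark. Qed.
Let p_gt1 : (1 < p)%N. Proof. exact: prime_gt1. Qed.
Let p_gt0 : (0 < p)%N. Proof. exact: prime_gt0. Qed.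
Let pr : rat := p%:R.
Let pr_gt0 : 0 < pr. Proof. by rewrite ltr0n. Qed.
Let prX_gt0 n : 0 < pr ^+ n. Proof. exact: exprn_gt0. Qed.
Let prX_neq0 n : pr ^+ n != 0. Proof. by rewrite gt_eqF. Qed.
Let dz (z : glaurent k) (a : 'I_p) := zoom p a z.
Let dc (z : glaurent k) (a : 'I_p) := cartier pchark a z.

Section Columns.
Variable bs : seq (glaurent k).
Hypothesis bs_int : forall z, z \in bs -> gmask intset z = z.
Hypothesis bs_cartier : forall (j : 'I_p) z, z \in bs -> inspan bs (cartier pchark j z).

Lemma inspan_cartier z (j : 'I_p) : inspan bs z -> inspan bs (cartier pchark j z).
Proof.
move=> [c ->]; rewrite cartier_sum; apply: inspan_sum => i _; rewrite cartierZ; apply: inspanZ.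
exact/bs_cartier/mem_nth.
Qed.

Lemma inspan_int z : inspan bs z -> gmask intset z = z.
Proof.
move=> [c ->]; elim/big_ind: _ => [|x y xE yE|i _]; first exact: gmask0.
  by rewrite gmaskD xE yE.
by rewrite gmaskZ bs_int ?mem_nth.
Qed.

Lemma cartier_run_nat z n (d : seq 'I_p) : inspan bs z ->
  z (n * p ^ size d + wval d)%:R = run dc z (rev d) n%:R ^+ (p ^ size d).
Proof.
move=> /inspan_int zE; have := cartier_run pchark (rev d) n%:Z zE.
by rewrite revK size_rev -pmulrn natrD natrM natrX => ->.
Qed.

(** The value at n is a Frobenius power of the constant coefficient of the state reached on the
    digits of n. All these states are combinations of [bs] over one finite field, chosen to contain
    the constant coefficients of [bs]. *)
Lemma nat_values_finite b : b \in bs -> finite_range (fun n : nat => b n%:R).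
Proof.
move=> bbs; have [x xbs|r [Q [r0 [csr bsQ] QP _ Qc]]] :=
  @cartier_orbit_finite _ _ pchark kfin bs bs_int bs_cartier bs [seq (z : glaurent k) 0 | z : glaurent k <- bs].
  exact: mem_inspan.
have [s sP] := frob_fixed_finite pchark r0; exists s => n; apply: sP.
have [|d dn dv] := @wval_digits p p_gt1 n n; first exact: ltn_expl.
have := cartier_run_nat 0 d (mem_inspan bbs); rewrite mul0n add0n dv => ->.
apply: frob_fixedX; have : run dc b (rev d) \in Q.
  elim/last_ind: (rev d) => [|w a IH]; first exact: bsQ.
  by rewrite run_rcons; apply: Qc.
move/QP => [c [cr ->]]; rewrite gcoef_sum; apply: (frob_fixed_sum pchark) => i _.
rewrite gcoefZ; apply: frob_fixed_mul => //; apply: csr; apply/mapP.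
by exists bs`_i => //; apply: mem_nth.
Qed.

(** Consuming the appended digits turns z into another combination of [bs], evaluated at the leading
    part. The vector of the values of [bs] at m is thus a state for reading digits from the most
    significant one. *)
Lemma nat_values_extend z m n (d : seq 'I_p) : inspan bs z ->
  (forall b, b \in bs -> (b : glaurent k) m%:R = b n%:R) ->
  z (m * p ^ size d + wval d)%:R = z (n * p ^ size d + wval d)%:R.
Proof.
move=> zs mn; rewrite !cartier_run_nat //; congr (_ ^+ _).
have : inspan bs (run dc z (rev d)).
  elim/last_ind: (rev d) => [|w a IH] //; rewrite run_rcons; exact: inspan_cartier.
move=> [c ->]; rewrite !gcoef_sum; apply: eq_bigr => i _.
by rewrite !gcoefZ mn // mem_nth.
Qed.

End Columns.

Section Language.
Variables (F : glaurent k) (ys bs : seq (glaurent k)).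
Hypothesis ys_unit : forall z, z \in ys -> gmask unit_interval z = z.
Hypothesis ys_zoom : forall (j : 'I_p) z, z \in ys -> inspan ys (zoom p j z).
Hypothesis F_window : forall m J, inspan ys (window p m J F).
Hypothesis bs_int : forall z, z \in bs -> gmask intset z = z.
Hypothesis bs_cartier : forall (j : 'I_p) z, z \in bs -> inspan bs (cartier pchark j z).
Hypothesis F_column : forall e, 0 <= e < 1 -> inspan bs (column e F).
Hypothesis F_slim : slim p (gsupp F).

Definition supp_language : language p :=
  fun u => valid_expansion u && (F (expansion_value u) != 0).

Let digits (u : word p) : seq 'I_p := pmap id u.
Let ipart (u : word p) := digits (take (index None u) u).
Let fpart (u : word p) := digits (drop (index None u).+1 u).
Let digitsK d : digits (map Some d) = d. Proof. by elim: d => //= a d ->. Qed.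
Let ipart_radix d1 d2 : ipart (radix_word d1 d2) = d1.
Proof. by rewrite /ipart index_radix_word take_size_cat ?size_map // digitsK. Qed.
Let fpart_radix d1 d2 : fpart (radix_word d1 d2) = d2.
Proof.
rewrite /fpart index_radix_word /radix_word -cat_rcons drop_size_cat ?digitsK //.
by rewrite size_rcons size_map.
Qed.

Let vec n := [seq (b : glaurent k) n%:R | b : glaurent k <- bs].
(** The components of [key] decide which continuations of u are expansions of support points. [key0]
    controls validity, with the radix points counted up to 2. Before the radix point the values of
    [bs] at the integer read so far suffice, after it the zoomed window does. *)
Let key0 (u : word p) := (minn (count_mem None u) 2, (u == [::], (zero_digit (head None u), zero_digit (last None u)))).
Let key1 (u : word p) := if count_mem None u == 0%N then vec (wval (digits u)) else [::].
Let win n := window p 0 n%:Z F.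
Let key2 (u : word p) := if count_mem None u == 1%N then run dz (win (wval (ipart u))) (fpart u) else 0.
Let key u := (key0 u, (key1 u, key2 u)).

Let vec_finite : finite_range vec.
Proof. by apply: finite_range_map => b; apply: nat_values_finite. Qed.

Lemma vecP m n : vec m = vec n -> forall b, b \in bs -> (b : glaurent k) m%:R = b n%:R.
Proof. by move/eq_in_map. Qed.

Let FE n (e : rat) : 0 <= e < 1 -> F (n%:R + e) = column e F n%:R.
Proof. by move=> e01; rewrite columnE asboolT //; exists n%:Z; rewrite -pmulrn. Qed.

Let win_finite : finite_range win.
Proof.
apply: finite_range_factor vec_finite _ => m n mn; apply: glaurentP => e.
have [e01|e01] := boolP (0 <= e < 1); last by rewrite /win !(windowE pchark) (negPf e01).
rewrite /win !(window0E pchark) // -!pmulrn !FE //.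
have := nat_values_extend bs_int bs_cartier [::] (F_column e01) (vecP mn).
by rewrite /= /wval /= !addn0 !muln1.
Qed.

Let key_finite : finite_range key.
Proof.
apply: finite_range_pair; [apply: finite_range_pair; last exact: finite_range_fin|].
  by exists (iota 0 3) => u; rewrite mem_iota leq0n add0n ltnS geq_minr.
apply: finite_range_pair.
  apply: finite_range_if; last by exists [:: [::]].
  by have [s sP] := vec_finite; exists s => u; apply: sP.
apply: finite_range_if; last by exists [:: 0] => u; rewrite mem_head.
have [Ws WsP] := win_finite; pose Ws' := [seq w <- Ws | `[< exists n, w = win n >]].
have [z|Q [WsQ _ Qz]] := @zoom_orbit_finite _ _ pchark kfin ys ys_unit ys_zoom Ws'.
  by rewrite mem_filter => /andP[/asboolP[n ->] _]; apply: F_window.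
exists Q => u; elim/last_ind: (fpart u) => [|w a IH]; last by rewrite run_rcons; apply: Qz.
by apply: WsQ; rewrite mem_filter WsP andbT; apply/asboolP; eexists.
Qed.

Let frac01 (d : seq 'I_p) : 0 <= (wval d)%:R / pr ^+ size d < 1.
Proof. by rewrite divr_ge0 ?ler0n ?ltW //= ltr_pdivrMr // mul1r -natrX ltr_nat wval_lt. Qed.

Let F_ipart (d1 d2 : seq 'I_p) : F (expansion_value (radix_word d1 d2)) =
  column ((wval d2)%:R / pr ^+ size d2) F (wval d1)%:R.
Proof.
rewrite -FE ?frac01 //.
by rewrite expansion_valueE // wval_cat natrD natrM natrX mulrDl mulfK.
Qed.

Let F_fpart (d1 d2 d : seq 'I_p) : (F (expansion_value (radix_word d1 (d2 ++ d))) != 0) =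
  (run dz (win (wval d1)) d2 ((wval d)%:R / pr ^+ size d) != 0).
Proof.
rewrite F_ipart -FE ?frac01 //; set e := _ / _; set y := (wval d)%:R / _.
have -> : run dz (win (wval d1)) d2 y = win (wval d1) ((y + (wval d2)%:R) / pr ^+ size d2) ^+ (p ^ size d2).
  rewrite (zoom_run pchark) ?frac01 //; case: d2 {e} => //.
  by rewrite /wval /= addr0 divr1 expr1.
have -> : (y + (wval d2)%:R) / pr ^+ size d2 = e.
  rewrite /e /y wval_cat size_cat exprD natrD natrM natrX -/pr.
  by field; rewrite !prX_neq0.
by rewrite /win (window0E pchark) ?frac01 // -pmulrn expf_eq0 expn_gt0 p_gt0.
Qed.

Lemma residual_finite : finite_range (residual supp_language).
Proof.
apply: finite_range_factor key_finite _ => u v uv; apply: funext => w.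
have [[cE eE hE lE] k1 k2] : [/\ key0 u = key0 v, key1 u = key1 v & key2 u = key2 v].
  by case: uv => c1 c2 c3 c4 c5 c6; rewrite /key0 c1 c2 c3 c4.
move: cE eE hE lE => cE eE hE lE.
rewrite /residual /supp_language; have <- : valid_expansion (u ++ w) = valid_expansion (v ++ w).
  rewrite /valid_expansion !count_cat; congr [&& _, _ & _].
  - by congr (~~ _); move: eE hE; case: (u) (v) => [|a u'] [|b v'].
  - congr (~~ _); rewrite !last_cat; case: w => //.
  - move: cE; move: (count_mem None u) (count_mem None v) (count_mem None w) => a b c; clear => E.
    by apply/eqP/eqP; lia.
have [valid|//] := boolP (valid_expansion _); rewrite /=.
have uw : (count_mem None u + count_mem None w = 1)%N.
  by have /and3P[_ _ /eqP] := valid; rewrite count_cat.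
have digits0 x : count_mem None x = 0%N -> x = map Some (digits x).
  by elim: x => //= -[a|] x IH //=; rewrite add0n => /IH {1}->.
have [cu|cu] := eqVneq (count_mem None u) 0%N.
  have cv : count_mem None v = 0%N by move: cE; rewrite cu; move: (count_mem None v) => [] // [] // b; clear; lia.
  have /radix_wordP[d1 [d2 ->]] : count_mem None w = 1%N by rewrite -uw cu.
  move: k1; rewrite /key1 cu cv eqxx => /vecP k1.
  rewrite (digits0 _ cu) (digits0 _ cv) !cat_radix_word !F_ipart !wval_cat.
  by rewrite (nat_values_extend bs_int bs_cartier d1 (F_column (frac01 _)) k1).
have {}cu : count_mem None u = 1%N by move: uw cu; clear; lia.
have cv : count_mem None v = 1%N by move: cE; rewrite cu; move: (count_mem None v) => b; clear; lia.
have cw : count_mem None w = 0%N by move: uw; rewrite cu; clear; lia.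
move: k2; rewrite /key2 cu cv eqxx (digits0 _ cw).
have [d1 [d2 ->]] := radix_wordP cu; have [d3 [d4 ->]] := radix_wordP cv.
rewrite !ipart_radix !fpart_radix => k2.
by rewrite !radix_word_cat !F_fpart k2.
Qed.

(** When the varying part consists of digits, the value is that of a digit string with fixed ends,
    divided by a power of p. Its length enters the exponent when it stands after the radix point,
    with g = 1, and not before it, with g = 0. *)
Lemma loop_values u v : count_mem None (u ++ v) = 1%N -> exists A B f g,
  [/\ (size A + size B <= size (u ++ v))%N, (f <= size (u ++ v))%N, (g <= 1)%N &
   forall d : seq 'I_p, expansion_value (u ++ map Some d ++ v) =
     (wval (A ++ d ++ B))%:R / pr ^+ (f + g * size d)].
Proof.
rewrite count_cat => uv.
have digits0 x : count_mem None x = 0%N -> x = map Some (digits x).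
  by elim: x => //= -[a|] x IH //=; rewrite add0n => /IH {1}->.
have [cu|cu] := eqVneq (count_mem None u) 0%N.
  have /radix_wordP[d1 [d2 ->]] : count_mem None v = 1%N by rewrite -uv cu.
  rewrite (digits0 _ cu); exists (digits u), (d1 ++ d2), (size d2), 0%N; split=> // [||d].
  - by rewrite !size_cat /= !size_map; clear; lia.
  - by rewrite !size_cat /= !size_map; clear; lia.
  by rewrite !cat_radix_word expansion_valueE // mul0n addn0 -!catA.
have {}cu : count_mem None u = 1%N by move: uv cu; clear; lia.
have cv : count_mem None v = 0%N by move: uv; rewrite cu; clear; lia.
rewrite (digits0 _ cv); have [d1 [d2 ->]] := radix_wordP cu.
exists (d1 ++ d2), (digits v), (size d2 + size (digits v))%N, 1%N; split=> // [||d].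
- by rewrite !size_cat /= !size_map; clear; lia.
- by rewrite !size_cat /= !size_map; clear; lia.
rewrite -map_cat radix_word_cat expansion_valueE // !size_cat mul1n -!catA.
by congr (_ / _ ^+ _); clear; lia.
Qed.

(** Loops contain no radix point, since the pumped words have exactly one. Two loops of equal length
    would give 2^n support points of size at most p^(c (n + 1)) and at mutual distance at least
    p^-(c (n + 1)). *)
Lemma supp_language_simple_loops u v w w' : supp_language (u ++ v) -> size w = size w' ->
  residual supp_language (u ++ w) = residual supp_language u ->
  residual supp_language (u ++ w') = residual supp_language u -> w = w'.
Proof.
move=> Luv szw uw uw'; apply/eqP; apply: contraT => ww'; exfalso.
have loops n x : x \in loop_words w w' n -> supp_language (u ++ x ++ v).
  elim: n x => [|n IH] x /=; first by rewrite inE => /eqP ->.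
  rewrite mem_cat => /orP[] /mapP[y /IH yL ->].
    by have := congr1 (fun q => q (y ++ v)) uw; rewrite /residual !catA => ->; rewrite -catA.
  by have := congr1 (fun q => q (y ++ v)) uw'; rewrite /residual !catA => ->; rewrite -catA.
have cuv : count_mem None (u ++ v) = 1%N by have /andP[/and3P[_ _ /eqP]] := Luv.
have loopd n x : x \in loop_words w w' n -> x = map Some (digits x).
  move=> /loops/andP[/and3P[_ _ /eqP xc] _].
  have : count_mem None x = 0%N by move: xc cuv; rewrite !count_cat; clear; lia.
  by elim: (x) => //= -[a|] y IH //=; rewrite add0n => /IH {1}->.
have [A [B [f [g [AB fs g1 val]]]]] := loop_values cuv.
pose c := (size (u ++ v) + size w)%N.
have szd n x : x \in loop_words w w' n -> size (digits x) = (n * size w)%N.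
  by move=> xL; rewrite -(loop_words_size szw xL) {2}(loopd _ _ xL) size_map.
apply: (slim_loops pchark szw ww' F_slim (c := c) (phi := fun n x => expansion_value (u ++ x ++ v))).
  move=> n x xL; split; first by have /andP[] := loops _ _ xL.
  rewrite (loopd _ _ xL) val; apply: le_trans (_ : (wval (A ++ digits x ++ B))%:R <= _).
    by rewrite ler_pdivrMr // ler_peMr // exprn_ege1 // ltW // ltr1n.
  rewrite -natrX ler_nat; apply: leq_trans (ltnW (wval_lt _)) _; rewrite leq_exp2l // !size_cat.
  rewrite (szd _ _ xL) /c; apply: leq_trans (_ : size (u ++ v) + n * size w <= _)%N.
    move: AB; rewrite size_cat; move: (size A) (size B) (n * size w)%N (size u + size v)%N; clear.
    by move=> *; lia.
  by move: (size (u ++ v)) (size w); clear => *; nia.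
move=> n x y xL yL xy; rewrite (loopd _ _ xL) (loopd _ _ yL) !val (szd _ _ xL) (szd _ _ yL) -mulrBl.
rewrite normrM normfV (ger0_norm (ltW (prX_gt0 _))).
apply: le_trans (_ : 1 / pr ^+ (f + g * (n * size w)) <= _).
  rewrite mul1r lef_pV2 ?posrE // ler_eXn2l ?ltr1n // /c.
  apply: leq_trans (_ : size (u ++ v) + 1 * (n * size w) <= _)%N; first by rewrite leq_add // leq_mul2r g1 orbT.
  by move: (size (u ++ v)) (size w); clear => *; nia.
rewrite ler_pM2r ?invr_gt0 //; set a := wval _; set b := wval _.
have : a <> b.
  move/(wval_inj p_gt1); rewrite !size_cat (szd _ _ xL) (szd _ _ yL) => /(_ erefl)/eqP.
  rewrite eqseq_cat // eqxx /= eqseq_cat ?(szd _ _ xL) ?(szd _ _ yL) // => /andP[/eqP dd _].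
  by case/eqP: xy; rewrite (loopd _ _ xL) (loopd _ _ yL) dd.
move=> ab; rewrite -[X in X <= _]/(1%:~R) !pmulrn -intrB -intr_norm ler_int.
by move: ab; clear; lia.
Qed.

End Language.
End SupportLanguage.

(** * Sparse algebraic series and C *)

Section AlgebraicOver.
Variables (M : fieldType) (X : set M).
Let alg := algebraicOver (val : subfield_of X -> M).

Lemma algebraic_gen_subfield x : gen_subfield X x -> alg x.
Proof.
move=> /mem_set xX.
exact: (algebraic_id (val : {rmorphism subfield_of X -> M}) (Sub x xX : subfield_of X)).
Qed.

Lemma algebraic_root (f : {poly M}) x : f != 0 -> (forall i, alg f`_i) -> root f x -> alg x.
Proof.
move=> f0 falg fx; pose V := (val : {rmorphism subfield_of X -> M}).
apply/(integral_algebraic V); apply: (@integral_root_monic _ _ V x ((lead_coef f)^-1 *: f)).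
- by rewrite monicE lead_coefZ mulVf // lead_coef_eq0.
- by rewrite rootZ // invr_eq0 lead_coef_eq0.
apply/integral_poly => i; apply/(integral_algebraic V); rewrite coefZ.
apply: (algebraic_mul (FtoE := V)); last exact: falg.
by apply: (@algebraic_inv _ _ V); rewrite lead_coefE; apply: falg.
Qed.

Lemma algebraic_closed : divring_closed (mem (alg : set M)).
Proof.
split=> [|x y /set_mem xa /set_mem ya|x y /set_mem xa /set_mem ya]; apply/mem_set.
- exact: (algebraic1 (val : {rmorphism subfield_of X -> M})).
- exact: (algebraic_sub xa ya).
- exact: (algebraic_div xa ya).
Qed.

(** The map [s] need not preserve the base field, as t may go to t^c; it makes the coefficients of
    an annihilating polynomial algebraic, which suffices by [algebraic_root]. *)
Lemma algebraic_endo (s : M -> M) x : (forall x y, s (x + y) = s x + s y) ->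
  (forall x y, s (x * y) = s x * s y) -> s 1 = 1 -> (forall y, X y -> alg (s y)) ->
  alg x -> alg (s x).
Proof.
move=> sD sM s1 sX [f f0 fx].
have s0 : s 0 = 0 by apply: (addrI (s 0)); rewrite -sD !addr0.
have sN y : s (- y) = - s y by apply: (addrI (s y)); rewrite -sD !subrr.
have sV y : s y^-1 = (s y)^-1.
  have [->|y0] := eqVneq y 0; first by rewrite invr0 s0 invr0.
  have sy0 : s y != 0.
    by apply/eqP => sy; have /eqP := s1; rewrite -{1}(mulfV y0) sM sy mul0r eq_sym oner_eq0.
  by apply: (mulfI sy0); rewrite -sM !mulfV.
have sK y : gen_subfield X y -> alg (s y).
  apply: (@gen_subfield_min _ _ (alg \o s)) => // {y}.
  have [_ aB aV] := algebraic_closed.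
  split=> [|y z /set_mem ya /set_mem za|y z /set_mem ya /set_mem za]; apply/mem_set.
  - by rewrite /= s1; exact: (algebraic1 (val : {rmorphism subfield_of X -> M})).
  - by rewrite /= sD sN; apply/set_mem/aB; apply/mem_set.
  - by rewrite /= sM sV; apply/set_mem/aV; apply/mem_set.
pose g := \poly_(i < size f) s (val f`_i).
apply: (@algebraic_root g).
- apply/eqP => /polyP/(_ (size f).-1); rewrite coef_poly coef0.
  have f1 : (0 < size f)%N by rewrite size_poly_gt0.
  rewrite prednK // leqnn => s_lead.
  have : val f`_(size f).-1 != 0 by rewrite fmorph_eq0 -lead_coefE lead_coef_eq0.
  move=> l0; have /eqP := s1; rewrite -{1}(mulfV l0) sM s_lead mul0r.
  by rewrite eq_sym oner_eq0.
- move=> i; rewrite coef_poly; case: ifP => _; last exact: (algebraic0 (val : {rmorphism subfield_of X -> M})).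
  by apply: sK; apply: set_mem; apply: (valP f`_i).
- move: fx; rewrite !rootE => /eqP; rewrite horner_coef size_map_poly => fx.
  rewrite horner_poly; apply/eqP; apply: (etrans _ (etrans (congr1 s fx) s0)).
  rewrite (big_morph s sD s0); apply: eq_bigr => i _.
  rewrite sM coef_map; congr (_ * _).
  by elim: (i : nat) => [|n IH]; rewrite ?expr0 // !exprS sM IH.
Qed.

End AlgebraicOver.

Section SparseIsCtilde.
Variables (k : closedFieldType) (p : nat).
Hypothesis pchark : p \in [pchar k].
Hypothesis kfin : forall x : k, exists r, (0 < r)%N /\ x ^+ (p ^ r) = x.
Implicit Types (F G : glaurent k) (e q : rat).

Let p_pr : prime p. Proof. exact: pcharf_prime pchark. Qed.
Let p_gt1 : (1 < p)%N. Proof. exact: prime_gt1. Qed.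
Let p_gt0 : (0 < p)%N. Proof. exact: prime_gt0. Qed.
Let pr : rat := p%:R.
Let pr_gt0 : 0 < pr. Proof. by rewrite ltr0n. Qed.
Let prX_gt0 n : 0 < pr ^+ n. Proof. exact: exprn_gt0. Qed.
Let prX_neq0 n : pr ^+ n != 0. Proof. by rewrite gt_eqF. Qed.
Let C := Ctilde p k.
Let HC : nontrivial_AS_closed_subalg p C. Proof. exact: Ctilde_closed. Qed.
Let alg := algebraicOver (val : subfield_of (kt_gens (k:=k)) -> glaurent k).
Let V := (val : {rmorphism subfield_of (kt_gens (k:=k)) -> glaurent k}).

Lemma sparse_of_slim_relation F d A :
  A 0%N != 0 -> \sum_(i < d.+1) teval 1 (A i) * F ^+ (p ^ i) = 0 ->
  slim p (gsupp F) -> gsupp F `<=` Sp p -> sparse p (gsupp F).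
Proof.
move=> A0 rel Fs FSp.
have [ys [ys1 ys2 ys3]] := window_states pchark A0 rel.
have [bs [bs1 bs2 bs3]] := column_states pchark A0 rel.
rewrite (_ : gsupp F = [set expansion_value v | v in [set v : word p | supp_language F v]]).
  apply: sparse_pumps => [|v /andP[]//|v /andP[/and3P[_ _ /eqP vc] _]]; last exact: Sp_expansion.
  apply: pumps_residual; first exact: (residual_finite kfin ys1 ys2 ys3 bs1 bs2 bs3).
  exact: (supp_language_simple_loops pchark Fs).
apply/seteqP; split=> [e Fe|_ [v /andP[_ Fv] <-] //].
have [v vv ve] := Sp_valid_expansion p_gt1 (FSp _ Fe); exists v => //.
by rewrite /= /supp_language vv ve.
Qed.

Lemma gsuppE F q : gsupp F q = (F q != 0). Proof. by []. Qed.

Let Zp : set rat := [set q | exists (z : int) n, q = z%:~R / pr ^+ n].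

Let ZpD x y : Zp x -> Zp y -> Zp (x + y).
Proof.
move=> [z [n ->]] [w [m ->]]; exists (z * p%:Z ^+ m + w * p%:Z ^+ n), (n + m)%N.
by rewrite intrD !intrM !rmorphXn /= -!pmulrn -/pr exprD; field; rewrite !prX_neq0.
Qed.

Let ZpM (m : nat) x : Zp x -> Zp (m%:R * x).
Proof. by move=> [z [n ->]]; exists (m%:Z * z), n; rewrite intrM -pmulrn mulrA. Qed.

Let Zpint (z : int) : Zp z%:~R.
Proof. by exists z, 0%N; rewrite expr0 divr1. Qed.

Let Zp_div n x : Zp x -> Zp (x / pr ^+ n).
Proof.
by move=> [z [m ->]]; exists z, (m + n)%N; rewrite exprD invfM mulrA.
Qed.

Let Zp_mul n x : Zp x -> Zp (x * pr ^+ n).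
Proof. by move=> xZ; rewrite mulrC -natrX; apply: ZpM. Qed.

(** Together with algebraicity and slimness this is inherited by all of C. It bounds the prime-to-p
    parts of the denominators of the exponents, and supplies the factor that brings the support into
    Z[1/p]. *)
Let bounded_denominators F := exists2 a : nat, (0 < a)%N & forall e, F e != 0 -> Zp (a%:R * e).
Let D := [set F | [/\ alg F, slim p (gsupp F) & bounded_denominators F]].

Let algebraic_const a : alg (a%:A : glaurent k).
Proof. by apply: algebraic_gen_subfield; apply: gen_subfield_sub; left; exists a. Qed.

Let algebraic_tpow d : alg (tpow k d).
Proof.
suff pos (q : rat) : 0 <= q -> alg (tpow k q).
  have [d0|d0] := leP 0 d; first exact: pos.
  by rewrite -[d]opprK tpowN; apply: (@algebraic_inv _ _ V); apply: pos; rewrite oppr_ge0 ltW.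
move=> q0; have t1 : alg (tpow k 1) by apply: algebraic_gen_subfield; apply: gen_subfield_sub; right.
have dn : (0 < `|denq q|)%N by rewrite absz_gt0 denq_eq0.
have E : tpow k q ^+ `|denq q| = tpow k 1 ^+ `|numq q|.
  rewrite !tpowX; congr (tpow k _); rewrite -[LHS]mulr_natr -[RHS]mulr_natr mul1r.
  have := denq_gt0 q; have := q0; rewrite -numq_ge0; have := numqE q.
  case: (denq q) => [d'|d'] //; by case: (numq q) => [n|n] //= E _ _.
have tX n : alg (tpow k 1 ^+ n).
  elim: n => [|n IH]; first exact: (algebraic1 V).
  by rewrite exprS; apply: (algebraic_mul (FtoE := V)).
apply: (@algebraic_root _ _ ('X^`|denq q| - (tpow k 1 ^+ `|numq q|)%:P)).
- by rewrite -size_poly_eq0 size_XnsubC.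
- move=> i; rewrite coefB coefXn coefC; apply: (algebraic_sub (FtoE := V)).
    by case: eqP => _; [exact: (algebraic1 V)|exact: (algebraic0 V)].
  by case: eqP => _; [exact: tX|exact: (algebraic0 V)].
- by rewrite rootE !hornerE E subrr.
Qed.

Let algebraic_gsubst F (c d : rat) : 0 < c -> alg F -> alg (tpow k d * gsubst c F).
Proof.
move=> c0 Falg; apply: (algebraic_mul (FtoE := V)); first exact: algebraic_tpow.
apply: (@algebraic_endo _ _ (gsubst c)) Falg => [x y|x y||y].
- exact: gsubstD.
- exact: gsubstM.
- exact: gsubst1.
- case=> [[a _ <-]|->]; first by rewrite gsubstZ gsubst1 //; apply: algebraic_const.
  by rewrite /tpow gsubst_mono //; apply: algebraic_tpow.
Qed.

Let D_AS_closed : nontrivial_AS_closed_subalg p D.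
Proof.
have supp_const (a : k) e : (a *: (1 : glaurent k)) e != 0 -> e = 0.
  by rewrite gcoefZ gcoef1; case: (e =P 0) => // _; rewrite mulr0 eqxx.
have Dconst (a : k) : D (a *: 1).
  split; first exact: algebraic_const.
    by apply: slim_sub (slim1 pchark 0) => e; apply: supp_const.
  by exists 1%N => // e /supp_const ->; rewrite mulr0; apply: (Zpint 0).
have DD F G : D F -> D G -> D (F + G).
  move=> [Fa Fs [a a0 aF]] [Ga Gs [b b0 bG]]; split; first exact: (algebraic_add (FtoE := V)).
    apply: slim_sub (slimU Fs Gs) => e; rewrite gsuppE gcoefD.
    by have [->|?] := eqVneq (F e) 0; [rewrite add0r; right|left].
  exists (a * b)%N => [|e]; first by rewrite muln_gt0 a0.
  rewrite gcoefD natrM; have [->|Fe _] := eqVneq (F e) 0.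
    by rewrite add0r -mulrA => /bG /(ZpM a).
  by rewrite mulrAC mulrC; apply/ZpM/aF.
have DM F G : D F -> D G -> D (F * G).
  move=> [Fa Fs [a a0 aF]] [Ga Gs [b b0 bG]]; split; first exact: (algebraic_mul (FtoE := V)).
    apply: slim_sub (slimD pchark (gsupp_wo F) (gsupp_wo G) Fs Gs) => e.
    by rewrite /mkset ?gsuppE => /conv_neq0[r Fr Gr]; exists r => //; exists (e - r); rewrite // addrC subrK.
  exists (a * b)%N => [|e]; first by rewrite muln_gt0 a0.
  rewrite gcoefM => /conv_neq0[r Fr Gr]; have -> : (a * b)%:R * e = b%:R * (a%:R * r) + a%:R * (b%:R * (e - r)).
    by rewrite natrM; ring.
  by apply: ZpD; apply: ZpM; [apply: aF|apply: bG].
apply: AS_closed_nontrivial.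
- split=> [|a x y /set_mem Dx /set_mem Dy|x y /set_mem Dx /set_mem Dy]; apply/mem_set.
  + by rewrite -[1]scale1r.
  + by apply: DD => //; rewrite -[x]mul1r scalerAl; apply: DM.
  + exact: DM.
- move=> F G [Fa Fs [a a0 aF]] FG; split.
  + apply: (@algebraic_root _ _ ('X^p - 'X + F%:P)).
    * rewrite -addrA -size_poly_eq0 size_polyDl size_polyXn //.
      apply: leq_ltn_trans (size_polyD _ _) _; rewrite gtn_max size_polyN size_polyX ltnS p_gt1 /=.
      by apply: leq_ltn_trans (size_polyC_leq1 _) _; rewrite ltnS p_gt0.
    * move=> i; rewrite !coefD coefN coefXn coefX coefC.
      have b01 (b : bool) : alg b%:R by case: b; [exact: (algebraic1 V)|exact: (algebraic0 V)].
      apply: (algebraic_add (FtoE := V)); first by apply: (algebraic_sub (FtoE := V)); apply: b01.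
      by case: eqP => // _; exact: (algebraic0 V).
    * by rewrite rootE !hornerE FG.
  + apply: (slim_AS pchark (gsupp_wo F) Fs) => e; exact: (AS_supp pchark FG).
  + exists a => // e /(AS_supp pchark FG) [->|[_ [n /aF aFe]]|[_ [n /aF aFe]]].
    * by rewrite mulr0; apply: (Zpint 0).
    * have -> : a%:R * e = a%:R * (e / pr ^+ n) * pr ^+ n by rewrite -mulrA divfK.
      exact: Zp_mul.
    * have -> : a%:R * e = a%:R * (e * pr ^+ n.+1) / pr ^+ n.+1 by rewrite mulrA mulfK.
      exact: Zp_div.
- move=> F alpha chi [Fa Fs [a a0 aF]] al0 [ch1 chD]; split.
  + have al0' : chi 1 != 0 by rewrite ch1.
    apply: (@algebraic_endo _ _ (gtwist chi)) Fa => [x y|x y||y].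
    * exact: gtwistD.
    * exact: (gtwistM chD).
    * exact: (gtwist1 chD al0').
    * case=> [[b _ <-]|->]; first by rewrite gtwistZ (gtwist1 chD al0'); apply: algebraic_const.
      rewrite /tpow gtwist_mono mul1r (_ : gmono 1 (chi 1) = (chi 1)%:A * tpow k 1).
        by apply: (algebraic_mul (FtoE := V)); [exact: algebraic_const|exact: algebraic_tpow].
      by apply: glaurentP => q; rewrite mulr_algl gcoefZ !gmonoE; case: ifP; rewrite ?mulr1 ?mulr0.
  + by apply: slim_sub Fs => e; rewrite /mkset ?gsuppE mulf_eq0 negb_or => /andP[].
  + by exists a => // e; rewrite gtwistE mulf_eq0 negb_or => /andP[/aF].
- move=> F c d [Fa Fs [a a0 aF]] c0; split; first exact: algebraic_gsubst.
  + have Fcwo : wo [set e | gsupp F (e / c)].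
      apply: wo_sub (gsupp_wo (gsubst c F)) => e; rewrite /mkset ?gsuppE => Fe.
      by rewrite gsubstE.
    apply: slim_sub (slimD pchark (@wo1 d) Fcwo (slim1 pchark d) (slim_scale pchark c0 Fs)).
    move=> e; rewrite /mkset ?gsuppE tpowM gsubstE // => Fe.
    by exists d => //; exists (e - d); rewrite // addrC subrK.
  + have [m m0 [u cE]] : exists2 m : nat, (0 < m)%N & exists u : nat, m%:R * c = u%:R.
      exists `|denq c|%N; first by rewrite absz_gt0 denq_eq0.
      exists `|numq c|%N; have := ltW c0; rewrite -numq_ge0; have := numqE c; have := denq_gt0 c.
      by case: (denq c) => // d' _; case: (numq c) => // n E _; rewrite mulrC -[RHS]/(n%:~R) E.
    pose v := `|denq d|%N; have v0 : (0 < v)%N by rewrite absz_gt0 denq_eq0.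
    have [w dE] : exists w : int, v%:R * d = w%:~R.
      exists (numq d); rewrite mulrC numqE /v; have := denq_gt0 d.
      by case: (denq d).
    exists (a * m * v)%N => [|e]; first by rewrite !muln_gt0 a0 m0.
    rewrite tpowM gsubstE // => /aF ae.
    have -> : (a * m * v)%:R * e = (v * u)%:R * (a%:R * ((e - d) / c)) + (a * m)%:R * w%:~R.
      rewrite -dE !natrM -cE; field; exact: lt0r_neq0.
    by apply: ZpD; apply: ZpM.
Qed.

Theorem sparse_algebraicE : sparse_algebraic p k = C.
Proof.
apply/seteqP; split=> F.
  move=> [Fa [a [b [a0 Fsp]]]].
  pose G := tpow k b%:~R * gsubst a%:~R F; have a0' : (0 : rat) < a%:~R by rewrite ltr0z.
  have Ga : alg G by apply: algebraic_gsubst.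
  have Gs : slim p (gsupp G).
    apply: slim_sub (sparse_slim pchark Fsp) => e; rewrite /mkset ?gsuppE tpowM gsubstE // => Fe.
    by eexists; first exact: Fe; rewrite mulrC divfK ?subrK // gt_eqF.
  have [j [d [A [A0 rel]]]] := Ore_relation_normalized pchark Ga.
  have pj : 0 < (p ^ j)%:R :> rat by rewrite ltr0n expn_gt0 p_gt0.
  have CG : C (gsubst (p ^ j)%:R G).
    apply: (Ctilde_of_slim_relation pchark kfin A0 rel); apply: slim_sub (slim_scale pchark pj Gs) => e.
    by rewrite /mkset ?gsuppE gsubstE.
  have {}CG : C G.
    have -> : G = gsubst (p ^ j)%:R^-1 (gsubst (p ^ j)%:R G).
      by rewrite gsubst_comp ?invr_gt0 // mulVf ?gsubst_id // gt_eqF.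
    by apply: (AScl_gsubst HC); rewrite ?invr_gt0.
  have -> : F = gsubst a%:~R^-1 (gsubst a%:~R F).
    by rewrite gsubst_comp ?invr_gt0 // mulVf ?gsubst_id // gt_eqF.
  by apply: (AScl_gsubst HC); rewrite ?invr_gt0 //; apply/(AScl_shift HC b%:~R).
move=> CF; have [Fa Fs [a a0 aF]] := Ctilde_min D_AS_closed CF.
have [B BP] := supp_lower_bound F.
have a0' : (0 : rat) < a%:R by rewrite ltr0n.
(* The shift by a B makes all exponents nonnegative, hence elements of S_p. The substitution t ->
   t^(p^j) that normalizes the relation is absorbed into both integers. *)
pose b : rat := (a * B)%:R; pose G := tpow k b * gsubst a%:R F.
have CG : C G by apply: (AScl_subst HC).
have [Ga Gs _] := Ctilde_min D_AS_closed CG.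
have [j [d [A [A0 rel]]]] := Ore_relation_normalized pchark Ga.
have pj : 0 < (p ^ j)%:R :> rat by rewrite ltr0n expn_gt0 p_gt0.
have [_ Hs _] : D (gsubst (p ^ j)%:R G) by apply: (Ctilde_min D_AS_closed); apply: (AScl_gsubst HC).
split=> //; exists (p ^ j * a)%N%:Z, (p ^ j * (a * B))%N%:Z; split.
  by rewrite ltz_nat muln_gt0 expn_gt0 p_gt0.
rewrite (_ : [set _ | _ in _] = gsupp (gsubst (p ^ j)%:R G)).
  apply: (sparse_of_slim_relation A0 rel Hs) => e.
  rewrite /mkset ?gsuppE gsubstE // tpowM gsubstE // => Fe.
  have -> : e = (p ^ j)%:R * (b + a%:R * ((e / (p ^ j)%:R - b) / a%:R)).
    by rewrite mulrCA divff ?gt_eqF // mulr1 addrC subrK mulrCA divff ?mulr1 ?gt_eqF.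
  have [z [n zE]] := aF _ Fe; have := BP _ Fe; set r := _ / a%:R in zE *.
  move=> rB; have : 0 <= b + a%:R * r.
    rewrite /b natrM -mulrDr mulr_ge0 ?ler0n // addrC; lra.
  rewrite zE; have -> : b + z%:~R / pr ^+ n = ((a * B * p ^ n)%N%:Z + z)%:~R / pr ^+ n.
    by rewrite intrD -pmulrn !natrM natrX -/pr mulrDl mulfK // /b natrM.
  case: (_ + z) => [m|m] m0; last first.
    move: m0; rewrite NegzE mulrNz mulNr oppr_ge0 => m0.
    have := lt_le_trans (divr_gt0 (ltr0Sn rat m) (prX_gt0 n)) m0.
    by rewrite ltxx.
  by exists (p ^ j * m)%N, n; rewrite natrM mulrA.
apply/seteqP; split=> [_ [q Fq <-]|e]; rewrite /mkset ?gsuppE gsubstE // tpowM gsubstE //.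
  rewrite (_ : (_ / _ - b) / _ = q) // -!pmulrn !natrM /b natrM.
  by field; rewrite !gt_eqF.
move=> Fe; exists ((e / (p ^ j)%:R - b) / a%:R) => //.
rewrite -!pmulrn !natrM /b natrM; field; by rewrite !gt_eqF.
Qed.

End SparseIsCtilde.

(** * Artin-Schreier towers and their places *)

Section ArtinSchreierPoly.
Variables (T M : fieldType) (v : {rmorphism T -> M}) (p : nat).
Hypothesis pcharM : p \in [pchar M].
Variables (f : T) (y : M).
Hypothesis yf : y ^+ p - y = v f.
Hypothesis nvy : forall z, v z != y.

Let p_pr : prime p. Proof. exact: pcharf_prime pcharM. Qed.
Let p_gt1 : (1 < p)%N. Proof. exact: prime_gt1. Qed.
Let p_gt0 : (0 < p)%N. Proof. exact: prime_gt0. Qed.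

Definition AS_poly (R : comNzRingType) (a : R) : {poly R} := 'X^p - 'X - a%:P.

Lemma size_AS_poly (R : comNzRingType) (a : R) : size (AS_poly a) = p.+1.
Proof.
rewrite /AS_poly -addrA -opprD size_polyDl size_polyXn // size_polyN.
apply: leq_ltn_trans (size_polyD _ _) _; rewrite gtn_max size_polyX ltnS p_gt1 /=.
by apply: leq_ltn_trans (size_polyC_leq1 _) _; rewrite ltnS p_gt0.
Qed.

Lemma map_AS_poly (R S : comNzRingType) (s : {rmorphism R -> S}) a :
  map_poly s (AS_poly a) = AS_poly (s a).
Proof. by rewrite /AS_poly !rmorphB /= map_polyC map_polyXn map_polyX. Qed.

Lemma root_AS_poly (R : comNzRingType) (a x : R) : root (AS_poly a) x = (x ^+ p - x == a).
Proof. by rewrite rootE !hornerE subr_eq0. Qed.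

Lemma natr_inj_pchar (i j : nat) : (i < p)%N -> (j < p)%N -> i%:R = j%:R :> M -> i = j.
Proof.
wlog ij : i j / (i <= j)%N.
  move=> H ip jp E; have [ij|/ltnW ij] := leqP i j; first exact: H.
  by apply/esym/H.
move=> ip jp E; apply/eqP; rewrite eqn_leq ij /= -subn_eq0.
have : (j - i)%:R == 0 :> M by rewrite natrB // E subrr.
rewrite -(dvdn_pcharf pcharM); case: (j - i)%N (leq_subr i j) => // d dj.
by move/dvdn_leq => /(_ isT) pd; have := leq_trans (leq_trans pd dj) (ltnW jp); have := leq_ltn_trans (leq_trans pd dj) jp; rewrite ltnn.
Qed.

Lemma natr_frob (i : nat) : i%:R ^+ p = i%:R :> M.
Proof. by rewrite -(pFrobenius_autE pcharM) pFrobenius_aut_nat. Qed.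

Lemma AS_poly_roots : map_poly v (AS_poly f) = \prod_(z <- [seq y + i%:R | i <- iota 0 p]) ('X - z%:P).
Proof.
rewrite map_AS_poly; have mon : lead_coef (AS_poly (v f)) = 1.
  rewrite lead_coefE size_AS_poly /AS_poly !coefB coefXn coefX coefC eqxx.
  by rewrite !gtn_eqF // !subr0.
have := @all_roots_prod_XsubC _ (AS_poly (v f)) [seq y + i%:R | i <- iota 0 p].
rewrite mon scale1r; apply.
- by rewrite size_AS_poly size_map size_iota.
- apply/allP => _ /mapP[i _ ->]; rewrite root_AS_poly -yf.
  by rewrite -(pFrobenius_autE pcharM) pFrobenius_autD_comm ?pFrobenius_aut_nat; [rewrite pFrobenius_autE; apply/eqP; ring|exact: mulrC].
- rewrite uniq_rootsE map_inj_in_uniq ?iota_uniq // => i j; rewrite !mem_iota => /andP[_ ip] /andP[_ jp].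
  by move/addrI; apply: natr_inj_pchar.
Qed.

(** The roots in M are the y + i. The second coefficient of a monic factor with 0 < r < p roots is
    -(r y + e) with e a natural number; as r is invertible, y would lie in T. *)
Lemma AS_irreducible : irreducible_poly (AS_poly f).
Proof.
split=> [|q q1 qP]; first by rewrite size_AS_poly ltnS ltnW.
have q0 : q != 0.
  by apply: contraTneq qP => ->; rewrite dvd0p -size_poly_eq0 size_AS_poly.
pose q' := (lead_coef q)^-1 *: q; have lq : lead_coef q != 0 by rewrite lead_coef_eq0.
have qq' : q' %= q by rewrite eqp_scale // invr_eq0.
have q'm : q' \is monic by rewrite monicE lead_coefZ mulVf.
have : map_poly v q' %| map_poly v (AS_poly f) by rewrite dvdp_map (eqp_dvdl _ qq').
rewrite AS_poly_roots => /dvdp_prod_XsubC[m]; set rs := mask _ _ => q'E.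
have {}q'E : map_poly v q' = \prod_(z <- rs) ('X - z%:P).
  by apply/eqP; rewrite -eqp_monic ?monic_map ?monic_prod_XsubC.
have szq : size q = (size rs).+1.
  by rewrite -(eqp_size qq') -(size_map_poly v) q'E size_prod_XsubC.
have rsp : (size rs <= p)%N.
  by apply: leq_trans (size_subseq (mask_subseq _ _)) _; rewrite size_map size_iota.
have [rsE|rsltp] := eqVneq (size rs) p.
  by rewrite -dvdp_size_eqp // szq size_AS_poly rsE.
have rs0 : (0 < size rs)%N by rewrite lt0n; apply: contra_neq q1 => rs0; rewrite szq rs0.
have [e eE] : exists e : nat, \sum_(z <- rs) z = y *+ size rs + e%:R.
  have : all [pred z | [exists i : 'I_p, z == y + i%:R]] rs.
    apply/allP => z /mem_mask /mapP[i]; rewrite mem_iota => /andP[_ ip] ->.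
    by apply/existsP; exists (Ordinal ip).
  elim: (rs) => [|z s IH]; first by exists 0%N; rewrite big_nil addr0.
  move=> /= /andP[/existsP[i /eqP ->] /IH[e E]]; exists (i + e)%N.
  by rewrite big_cons E mulrS natrD; ring.
have := coefPn_prod_XsubC (lt0n_neq0 rs0); rewrite -q'E coef_map /= eE => /(congr1 -%R); rewrite opprK => cE.
have n0 : (size rs)%:R != 0 :> M.
  rewrite -(dvdn_pcharf pcharM); apply/negP => /(dvdn_leq rs0).
  by rewrite leqNgt ltn_neqAle rsltp rsp.
case/eqP: (nvy ((- q'`_(size rs).-1 - e%:R) / (size rs)%:R)).
by rewrite fmorph_div rmorphB rmorphN /= !rmorph_nat cE addrK -[y *+ _]mulr_natr mulfK.
Qed.

Lemma AS_dvd (h : {poly T}) : root (map_poly v h) y -> AS_poly f %| h.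
Proof.
move=> hy; have [ir1 ir] := AS_irreducible.
have gy : root (map_poly v (gcdp (AS_poly f) h)) y.
  by rewrite gcdp_map root_gcd hy map_AS_poly root_AS_poly yf eqxx.
have /ir := dvdp_gcdl (AS_poly f) h; case: eqVneq => [/eqP/size_poly1P[c c0 gE] _|_ /(_ isT) gE].
  by move: gy; rewrite gE map_polyC rootC fmorph_eq0 (negPf c0).
by rewrite -(eqp_dvdl _ gE) dvdp_gcdr.
Qed.

End ArtinSchreierPoly.

(** * Homomorphisms of subfields of M *)

Definition subfield_set (M : fieldType) (E : set M) := divring_closed (mem E).

Definition adjoin (M : fieldType) (E : set M) y := gen_subfield (E `|` [set y]).

(** A homomorphism is a total map whose values outside [E] are irrelevant, so that restriction and
    extension along towers need no change of type. *)
Definition hom_on (M : fieldType) (E : set M) (s : M -> M) :=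
  [/\ s 1 = 1, forall x y, E x -> E y -> s (x + y) = s x + s y &
      forall x y, E x -> E y -> s (x * y) = s x * s y].

Lemma gen_subfield_id (M : fieldType) (E : set M) : subfield_set E -> gen_subfield E = E.
Proof. by move=> Es; apply/seteqP; split; [apply: gen_subfield_min|apply: gen_subfield_sub]. Qed.

Section HomOn.
Variables (M : fieldType) (E : set M) (s : M -> M).
Hypothesis Es : subfield_set E.
Hypothesis Hs : hom_on E s.

Let Ege : gen_subfield E = E := gen_subfield_id Es.

Lemma hom_on0 : s 0 = 0.
Proof.
have [_ sD _] := Hs; apply: (addrI (s 0)).
by rewrite -sD ?addr0 // -Ege; apply: gsf0.
Qed.
Lemma hom_onN x : E x -> s (- x) = - s x.
Proof.
have [_ sD _] := Hs => Ex; apply: (addrI (s x)); rewrite -sD // ?subrr ?hom_on0 //.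
by rewrite -Ege; apply: gsfN; rewrite Ege.
Qed.
Lemma hom_onB x y : E x -> E y -> s (x - y) = s x - s y.
Proof.
have [_ sD _] := Hs => Ex Ey; rewrite sD ?hom_onN // -Ege; apply: gsfN; rewrite Ege //.
Qed.
Lemma hom_onX x n : E x -> s (x ^+ n) = s x ^+ n.
Proof.
have [s1 _ sM] := Hs => Ex; elim: n => [|n IH]; rewrite ?expr0 // !exprS sM ?IH //.
by rewrite -Ege; apply: gsfX; rewrite Ege.
Qed.
Lemma hom_on_sum I (r : seq I) (P : pred I) (F : I -> M) : (forall i, P i -> E (F i)) ->
  s (\sum_(i <- r | P i) F i) = \sum_(i <- r | P i) s (F i).
Proof.
move=> EF; have [_ sD _] := Hs.
suff [_ ->] : E (\sum_(i <- r | P i) F i) /\ s (\sum_(i <- r | P i) F i) = \sum_(i <- r | P i) s (F i) by [].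
elim/big_rec2: _ => [|i x y Pi [Ey <-]]; first by rewrite hom_on0 -{1}Ege; split=> //; apply: gsf0.
split; last by rewrite sD //; apply: EF.
by rewrite -Ege; apply: gsfD; rewrite Ege //; apply: EF.
Qed.
Lemma hom_on_neq0 x : E x -> x != 0 -> s x != 0.
Proof.
have [s1 _ sM] := Hs => Ex x0; apply/eqP => sx; have /eqP := s1.
rewrite -{1}(mulfV x0) sM // ?sx ?mul0r; first by rewrite eq_sym oner_eq0.
by rewrite -Ege; apply: gsfV; rewrite Ege.
Qed.
Lemma hom_onV x : E x -> s x^-1 = (s x)^-1.
Proof.
have [s1 _ sM] := Hs => Ex; have [->|x0] := eqVneq x 0; first by rewrite invr0 hom_on0 invr0.
apply: (mulfI (hom_on_neq0 Ex x0)); rewrite -sM ?mulfV ?hom_on_neq0 //.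
by rewrite -Ege; apply: gsfV; rewrite Ege.
Qed.
Lemma hom_on_div x y : E x -> E y -> s (x / y) = s x / s y.
Proof.
have [s1 _ sM] := Hs => Ex Ey; rewrite sM ?hom_onV // -Ege; apply: gsfV; rewrite Ege //.
Qed.

Lemma hom_on_sub (E' : set M) : E' `<=` E -> hom_on E' s.
Proof. by have [s1 sD sM] := Hs => EE; split=> // x y /EE Ex /EE Ey; [apply: sD|apply: sM]. Qed.

End HomOn.

Section Adjoin.
Variables (M : fieldType) (p : nat).
Hypothesis pcharM : p \in [pchar M].
Variables (E : set M) (y : M).
Hypothesis Es : subfield_set E.
Hypothesis Ef : E (y ^+ p - y).
Hypothesis nEy : ~ E y.

Let p_pr : prime p. Proof. exact: pcharf_prime pcharM. Qed.
Let p_gt1 : (1 < p)%N. Proof. exact: prime_gt1. Qed.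
Let p_gt0 : (0 < p)%N. Proof. exact: prime_gt0. Qed.
Let Ege : gen_subfield E = E := gen_subfield_id Es.
Let T := subfield_of E.
Let v : {rmorphism T -> M} := val.
Let ofE x (Ex : E x) : T := Sub x (mem_set (eq_ind_r (fun S => S x) Ex Ege)).
Let vE z : E (v z).
Proof. exact: (gen_subfield_min Es (@subset_refl _ E) (set_mem (valP z))). Qed.
Let f : T := ofE Ef.
Let yf : y ^+ p - y = v f. Proof. by []. Qed.
Let nvy z : v z != y. Proof. by apply/eqP => zy; apply: nEy; rewrite -zy; apply: vE. Qed.
Let P := AS_poly p f.
Let rPy : root (map_poly v P) y.
Proof. by rewrite map_AS_poly root_AS_poly yf. Qed.
Let P_dvd h : root (map_poly v h) y -> P %| h. Proof. exact: (AS_dvd pcharM yf nvy). Qed.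

Let adjoin_poly x : adjoin E y x <-> exists h : {poly T}, x = (map_poly v h).[y].
Proof.
split=> [|[h ->]]; last first.
  rewrite horner_coef; apply: gsf_sum => i _; apply: gsfM; last apply: gsfX.
    by apply: gen_subfield_sub; left; rewrite coef_map; apply: vE.
  by apply: gen_subfield_sub; right.
pose S := [set x | exists h : {poly T}, x = (map_poly v h).[y]].
apply: (@gen_subfield_min _ _ S) => {x}; last first.
  move=> x [Ex|->]; last by exists 'X; rewrite map_polyX hornerX.
  by exists (ofE Ex)%:P; rewrite map_polyC hornerC.
split=> [|_ _ /set_mem[h ->] /set_mem[g ->]|_ _ /set_mem[h ->] /set_mem[g ->]]; apply/mem_set.
- by exists 1; rewrite rmorph1 hornerC.
- by exists (h - g); rewrite rmorphB !hornerE.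
have [g0|g0] := eqVneq (map_poly v g).[y] 0; first by exists 0; rewrite g0 invr0 mulr0 rmorph0 horner0.
have cop : coprimep P g.
  have [_ ir] := AS_irreducible pcharM yf nvy.
  have /ir := dvdp_gcdl P g; rewrite /coprimep; case: eqVneq => // _ /(_ isT) gE.
  have Pg : P %| g by rewrite -(eqp_dvdl _ gE) dvdp_gcdr.
  case/eqP: g0; apply/eqP; rewrite -rootE; case/dvdpP: Pg => q ->.
  by rewrite rmorphM /= rootM rPy orbT.
have /Bezout_eq1_coprimepP[[a b] /= ab] := cop.
exists (h * b); rewrite rmorphM hornerM; congr (_ * _).
apply: (mulIf g0); rewrite mulVf // -hornerM -rmorphM /=.
have := congr1 (fun q => (map_poly v q).[y]) ab; rewrite rmorphD rmorph1 hornerD hornerC.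
by rewrite rmorphM hornerM /= (eqP rPy) mulr0 add0r.
Qed.

Lemma adjoinP x : adjoin E y x <-> exists2 g : nat -> M, (forall i, E (g i)) & x = \sum_(i < p) g i * y ^+ i.
Proof.
split=> [/adjoin_poly[h ->]|[g gE ->]]; last first.
  apply: gsf_sum => i _; apply: gsfM; last apply: gsfX; apply: gen_subfield_sub; first by left.
  by right.
exists (fun i => v (h %% P)`_i) => [i|]; first exact: vE.
have hP : (size (map_poly v (h %% P)) <= p)%N.
  by rewrite size_map_poly -ltnS -(size_AS_poly pcharM f) ltn_modp -size_poly_eq0 (size_AS_poly pcharM).
have -> : (map_poly v h).[y] = (map_poly v (h %% P)).[y].
  rewrite {1}(divp_eq h P) rmorphD rmorphM hornerD hornerM /=.
  by rewrite (eqP rPy) mulr0 add0r.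
by rewrite (horner_coef_wide _ hP); apply: eq_bigr => i _; rewrite coef_map.
Qed.

Lemma hom_adjoin s eta : hom_on E s -> eta ^+ p - eta = s (y ^+ p - y) ->
  exists s', [/\ hom_on (adjoin E y) s', forall x, E x -> s' x = s x & s' y = eta].
Proof.
move=> Hs etaE; have [s1 sD sM] := Hs.
pose r (x : T) : M := s (v x).
have rB : zmod_morphism r by move=> a b; rewrite /r rmorphB /= (hom_onB Es Hs) //; apply: vE.
have rM : monoid_morphism r by split=> [|a b]; rewrite /r ?rmorph1 // rmorphM /= sM //; apply: vE.
pose R : {rmorphism T -> M} := HB.pack r (GRing.isZmodMorphism.Build _ _ r rB)
  (GRing.isMonoidMorphism.Build _ _ r rM).
pose ev (h : {poly T}) := (map_poly R h).[eta].
have ev_wd h h' : (map_poly v h).[y] = (map_poly v h').[y] -> ev h = ev h'.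
  move=> hh; apply/eqP; rewrite -subr_eq0 /ev -hornerN -hornerD -rmorphB /=.
  have /dvdpP[q ->] : P %| h - h' by apply: P_dvd; rewrite rootE rmorphB !hornerE /= hh subrr.
  have -> : map_poly R (q * P) = map_poly R q * map_poly R P by exact: rmorphM.
  by rewrite -rootE rootM map_AS_poly root_AS_poly etaE eqxx orbT.
pose s' x := if pselect (exists h : {poly T}, x = (map_poly v h).[y]) is left H then ev (projT1 (cid H)) else 0.
have s'E h : s' (map_poly v h).[y] = ev h.
  rewrite /s'; case: pselect => [H|[]]; last by exists h.
  by apply: ev_wd; case: (cid H).
exists s'; split.
- split=> [|_ _ /adjoin_poly[h ->] /adjoin_poly[g ->]|_ _ /adjoin_poly[h ->] /adjoin_poly[g ->]].
  + by have := s'E 1; rewrite /ev !rmorph1 !hornerC.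
  + by rewrite -hornerD -rmorphD /= !s'E /ev rmorphD hornerD.
  + by rewrite -hornerM -rmorphM /= !s'E /ev rmorphM hornerM.
- by move=> x Ex; have := s'E (ofE Ex)%:P; rewrite /ev !map_polyC !hornerC.
- by have := s'E 'X; rewrite /ev !map_polyX !hornerX.
Qed.

End Adjoin.

(** * Coefficients of polynomials recovered from their values *)

Definition additive_set (V : zmodType) (Z : set V) := Z 0 /\ forall x y, Z x -> Z y -> Z (x - y).

Section FiniteDifferences.
Variables (M : fieldType) (p : nat).
Hypothesis pcharM : p \in [pchar M].
Variable Z : set M.
Hypothesis Zadd : additive_set Z.

Let ZN x : Z x -> Z (- x).
Proof. by move=> Zx; rewrite -sub0r; apply: Zadd.2 => //; exact: Zadd.1. Qed.
Let ZD x y : Z x -> Z y -> Z (x + y).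
Proof. by move=> Zx Zy; rewrite -[y]opprK; apply: Zadd.2 => //; apply: ZN. Qed.
Let Zn x n : Z x -> Z (x *+ n).
Proof. by move=> Zx; elim: n => [|n IH]; [exact: Zadd.1|rewrite mulrS; apply: ZD]. Qed.

Lemma additive_set_div_nat x n : (0 < n < p)%N -> Z (x *+ n) -> Z x.
Proof.
move=> /andP[n0 np] Zx.
have cop : coprime n p.
  rewrite coprime_sym prime_coprime ?(pcharf_prime pcharM) //; apply/negP => /(dvdn_leq n0).
  by rewrite leqNgt np.
have [a b E _] := egcdnP p n0; move: E; rewrite (eqP cop) => E.
have -> : x = x *+ n *+ a; last exact: Zn.
rewrite -mulrnA mulnC E mulrnDr mulr1n mulnC mulrnA -[x *+ p]mulr_natr (pcharf0 pcharM).
by rewrite mulr0 mul0rn add0r.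
Qed.

Lemma coef_comp_XaddC (P : {poly M}) a j n : (size P <= n)%N ->
  (P \Po ('X + a%:P))`_j = \sum_(i < n) P`_i * a ^+ (i - j) *+ 'C(i, j).
Proof.
move=> Pn; have XaddC i : (('X + a%:P) ^+ i : {poly M})`_j = a ^+ (i - j) *+ 'C(i, j).
  elim: i j => [|i IH] j; first by rewrite expr0 coef1 bin0n; case: j => [|j] //=.
  rewrite exprS mulrDl coefD coefXM coefCM; case: j => [|j] /=.
    by rewrite IH !bin0 !subn0 exprS add0r.
  rewrite !IH binS mulrnDr addrC subSS; congr (_ + _).
  have [ij|ij] := ltnP j i; last by rewrite bin_small // !mulr0n mulr0.
  by rewrite mulrnAr -exprS subnSK.
rewrite comp_polyE coef_sum -(subnKC Pn) big_split_ord /= [X in _ = _ + X]big1 ?addr0 => [|i _].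
  by apply: eq_bigr => i _; rewrite coefZ XaddC mulrnAr.
by rewrite nth_default ?leq_addr // mul0r mul0rn.
Qed.

(** The difference Q(X + 1) - Q has smaller degree, and its coefficient in degree deg Q - 1 is deg Q
    times the leading coefficient of Q. Division by a positive number below p stays inside Z, since
    p annihilates M; then the leading term is removed and the induction applies again. *)
Lemma coef_from_values (Q : {poly M}) : (size Q <= p)%N -> (forall c : nat, Z Q.[c%:R]) ->
  forall i, Z Q`_i.
Proof.
have [n] := ubnP (size Q); elim: n Q => // n IH Q; rewrite ltnS => Qn Qp QZ.
have [->|Q0] := eqVneq Q 0; first by move=> i; rewrite coef0; exact: Zadd.1.
have sz0 : (0 < size Q)%N by rewrite size_poly_gt0.
case E : (size Q) sz0 => [|[|m]] // _.
  have /size_poly1P[c _ QE] : size Q == 1%N by rewrite E.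
  move=> i; rewrite QE coefC; case: eqP => _; last exact: Zadd.1.
  by have := QZ 0%N; rewrite QE hornerC.
pose D := Q \Po ('X + 1%:P) - Q.
have Dc j : D`_j = \sum_(i < m.+2) Q`_i *+ 'C(i, j) - Q`_j.
  rewrite coefB (@coef_comp_XaddC Q 1 j m.+2) ?E //; congr (_ - _).
  by apply: eq_bigr => i _; rewrite expr1n mulr1.
have szD : (size D <= m.+1)%N.
  apply/leq_sizeP => j mj; rewrite Dc; have [<-|jm] := eqVneq m.+1 j.
    rewrite big_ord_recr /= binn mulr1n big1 ?add0r ?subrr // => i _.
    by rewrite bin_small.
  rewrite big1 ?add0r => [|i _]; last first.
    by rewrite bin_small // (leq_trans (ltn_ord i)) // ltn_neqAle jm.
  by rewrite nth_default ?oppr0 // E ltn_neqAle jm.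
have Dv c : Z D.[c%:R].
  by rewrite hornerD hornerN horner_comp !hornerE natr1; apply: Zadd.2.
have DZ := IH D (leq_ltn_trans szD _) (leq_trans szD _) Dv m.
have {}DZ : Z (Q`_m.+1 *+ m.+1).
  have := DZ _ _; rewrite Dc !big_ord_recr /= big1 => [|i _]; last by rewrite bin_small.
  rewrite add0r binn mulr1n binSn (addrC Q`_m) addrK; apply.
    by move: Qn; rewrite E; clear; lia.
  by move: Qp; rewrite E; clear; lia.
have Ztop : Z Q`_m.+1.
  by apply: additive_set_div_nat DZ => /=; move: Qp; rewrite E; clear; lia.
pose Q' := Q - Q`_m.+1 *: 'X^(m.+1).
have Q'sz : (size Q' <= m.+1)%N.
  apply/leq_sizeP => j mj; rewrite coefB coefZ coefXn; have [->|jm] := eqVneq j m.+1.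
    by rewrite mulr1 subrr.
  by rewrite mulr0 subr0 nth_default // E ltn_neqAle eq_sym jm.
have Q'Z := IH Q' _ _ _; move=> i; rewrite -(subrK (Q`_m.+1 *: 'X^(m.+1)) Q) -/Q' coefD coefZ coefXn.
apply: ZD; last first.
  case: eqP => _; rewrite ?mulr1 ?mulr0 //; exact: Zadd.1.
apply: Q'Z => [||c].
- by apply: leq_ltn_trans Q'sz _; move: Qn; rewrite E; clear; lia.
- by apply: leq_trans Q'sz _; move: Qp; rewrite E; clear; lia.
- rewrite hornerD hornerN hornerZ hornerXn; apply: Zadd.2 => //.
  by rewrite -natrX mulr_natr; apply: Zn.
Qed.

Lemma coef_shift_from_values (P : {poly M}) a : (size P <= p)%N ->
  (forall c : nat, Z P.[a + c%:R]) -> forall i, Z (P \Po ('X + a%:P))`_i.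
Proof.
move=> Pp PZ; apply: coef_from_values => [|c].
  by rewrite size_comp_poly2 // size_XaddC.
by rewrite horner_comp !hornerE addrC.
Qed.

End FiniteDifferences.

Definition subring_set (R : comNzRingType) (Z : set R) :=
  [/\ Z 1, forall x y, Z x -> Z y -> Z (x - y) & forall x y, Z x -> Z y -> Z (x * y)].

Section SubringSet.
Variables (R : comNzRingType) (Z : set R).
Hypothesis Zr : subring_set Z.

Lemma sring0 : Z 0. Proof. by have [Z1 ZB _] := Zr; rewrite -(subrr 1); apply: ZB. Qed.
Lemma sringN x : Z x -> Z (- x).
Proof. by have [Z1 ZB _] := Zr => Zx; rewrite -sub0r; apply: ZB => //; exact: sring0. Qed.
Lemma sringD x y : Z x -> Z y -> Z (x + y).
Proof. by have [_ ZB _] := Zr => Zx Zy; rewrite -[y]opprK; apply: ZB => //; apply: sringN. Qed.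
Lemma sringX x n : Z x -> Z (x ^+ n).
Proof. by have [Z1 _ ZM] := Zr => Zx; elim: n => [|n IH]; rewrite ?exprS; [|apply: ZM]. Qed.
Lemma sring_sum I (r : seq I) (P : pred I) (F : I -> R) : (forall i, P i -> Z (F i)) ->
  Z (\sum_(i <- r | P i) F i).
Proof. by move=> ZF; elim/big_ind: _ => //; [exact: sring0|exact: sringD]. Qed.
Lemma sring_prod I (r : seq I) (P : pred I) (F : I -> R) : (forall i, P i -> Z (F i)) ->
  Z (\prod_(i <- r | P i) F i).
Proof. by have [Z1 _ ZM] := Zr; move=> ZF; elim/big_ind: _. Qed.
Lemma sring_nat n x : Z x -> Z (x *+ n).
Proof. by move=> Zx; elim: n => [|n IH]; [exact: sring0|rewrite mulrS; apply: sringD]. Qed.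
Lemma sring_additive : additive_set Z.
Proof. by have [_ ZB _] := Zr; split; [exact: sring0|]. Qed.

End SubringSet.

Lemma subfield_subring (M : fieldType) (E : set M) : subfield_set E -> subring_set E.
Proof.
move=> /gen_subfield_id <-; split=> [|x y|x y]; [exact: gsf1|exact: gsfB|exact: gsfM].
Qed.

Lemma subfieldV (M : fieldType) (E : set M) x : subfield_set E -> E x -> E x^-1.
Proof. by move=> /gen_subfield_id <-; apply: gsfV. Qed.

(** * Towers and their images at the places *)

Section Towers.
Variables (k : closedFieldType) (p : nat).
Hypothesis pchark : p \in [pchar k].
Notation M := (glaurent k).
Implicit Types (E : set M) (x y : M) (s : M -> M) (lambda : k).

Let p_pr : prime p. Proof. exact: pcharf_prime pchark. Qed.
Let p_gt1 : (1 < p)%N. Proof. exact: prime_gt1. Qed.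
Let p_gt0 : (0 < p)%N. Proof. exact: prime_gt0. Qed.
Let pcharM : p \in [pchar M]. Proof. exact: pchar_glaurent. Qed.
Let K : set M := K_set p (k:=k).

(** The generators are taken from [Y], which will be everything or the ring O. Adjoining an element
    that is already present is allowed, so the steps have degree p or 1. *)
Inductive tower (Y : set M) : set M -> Prop :=
| tower0 : tower Y K
| tower_adjoin E y : tower Y E -> Y y -> E (y ^+ p - y) -> tower Y (adjoin E y).

Lemma tower_subfield Y E : tower Y E -> subfield_set E.
Proof. by case=> [|E' y _ _ _]; exact: gen_subfield_closed. Qed.

Lemma adjoin_sub E y : E `<=` adjoin E y.
Proof. by move=> x Ex; apply: gen_subfield_sub; left. Qed.

Lemma adjoin_gen E y : adjoin E y y.
Proof. by apply: gen_subfield_sub; right. Qed.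

Lemma adjoin_min E E' y : subfield_set E' -> E `<=` E' -> E' y -> adjoin E y `<=` E'.
Proof. by move=> E's EE Ey; apply: gen_subfield_min => // x [/EE|->]. Qed.

Lemma tower_K Y E : tower Y E -> K `<=` E.
Proof. by elim=> // E' y _ IH _ _ x /IH; apply: adjoin_sub. Qed.

Lemma tower_mono Y Y' E : Y `<=` Y' -> tower Y E -> tower Y' E.
Proof. by move=> YY; elim=> [|E' y _ IH /YY]; [exact: tower0|exact: tower_adjoin]. Qed.

(* The places above t = lambda; the uniformizer t / lambda - 1 is sent to t. *)
Definition hom_at lambda E s :=
  [/\ hom_on E s, forall a : k, s (a%:A) = a%:A & s (tpow k 1) = lambda *: (1 + tpow k 1)].

Lemma hom_at_sub lambda E E' s : E' `<=` E -> hom_at lambda E s -> hom_at lambda E' s.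
Proof. by move=> EE [/hom_on_sub Hs sa st]; split=> //; apply: Hs. Qed.

Lemma AS_root_pos (F : M) : exists eta : M, eta ^+ p - eta = F.
Proof.
have [eta E] := exists_AS_root pchark (- F); exists eta.
by apply/eqP; rewrite -subr_eq0 E.
Qed.

Lemma hom_at_adjoin lambda E y s eta : subfield_set E -> K `<=` E -> E (y ^+ p - y) -> ~ E y ->
  hom_at lambda E s -> eta ^+ p - eta = s (y ^+ p - y) ->
  exists s', [/\ hom_at lambda (adjoin E y) s', forall x, E x -> s' x = s x & s' y = eta].
Proof.
move=> Es KE Ef nEy [Hs sa st] etaE.
have [s' [Hs' s'E s'y]] := hom_adjoin pcharM Es Ef nEy Hs etaE; exists s'; split=> //; split=> //.
  by move=> a; rewrite s'E //; apply: KE; apply: gen_subfield_sub; left; exists a.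
rewrite s'E //; apply: KE; apply: gen_subfield_sub; right; exists 1%N; last by rewrite invr1.
by split=> //; rewrite dvdn1 gtn_eqF.
Qed.

(** The generators of E are adjoined to E1 one by one. A homomorphism follows because the
    transported Artin-Schreier equation has a root in M. *)
Lemma tower_join Y E1 E : tower Y E1 -> tower Y E -> exists E2, [/\ tower Y E2, E1 `<=` E2, E `<=` E2 &
  forall lambda s, hom_at lambda E1 s -> exists2 s2, hom_at lambda E2 s2 & forall x, E1 x -> s2 x = s x].
Proof.
move=> E1t; elim=> [|{}E y Et [E2 [E2t E12 EE2 ext]] Yy Ef].
  by exists E1; split=> //; [exact: tower_K E1t|move=> lambda s Hs; exists s].
have E2s := tower_subfield E2t.
have [E2y|nE2y] := pselect (E2 y).
  by exists E2; split=> //; apply: adjoin_min.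
exists (adjoin E2 y); split.
- by apply: tower_adjoin => //; apply: EE2.
- by move=> x /E12; apply: adjoin_sub.
- apply: adjoin_min; [exact: gen_subfield_closed| |exact: adjoin_gen].
  by move=> x /EE2; apply: adjoin_sub.
move=> lambda s /ext[s2 Hs2 s2E]; have [eta etaE] := AS_root_pos (s2 (y ^+ p - y)).
have [s' [Hs' s'E _]] := hom_at_adjoin E2s (tower_K E2t) (EE2 _ Ef) nE2y Hs2 etaE.
by exists s' => // x E1x; rewrite s'E ?s2E //; apply: E12.
Qed.

(* The elements whose images under the homomorphisms above all places t = lambda lie in Z. *)
Definition everywhere (Z : set M) x := exists2 E, tower setT E &
  E x /\ forall lambda s, lambda != 0 -> hom_at lambda E s -> Z (s x).

(** Independence of the tower: the given homomorphism is extended to a common tower and restricted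
    to the one where the condition is known. *)
Lemma everywhere_all Z x lambda E s : everywhere Z x -> tower setT E -> E x -> lambda != 0 ->
  hom_at lambda E s -> Z (s x).
Proof.
move=> [E1 E1t [E1x ZE1]] Et Ex l0 Hs; have [E2 [_ EE2 E1E2 ext]] := tower_join Et E1t.
have [s2 Hs2 s2E] := ext _ _ Hs; rewrite -s2E //; apply: (ZE1 lambda) => //.
exact: hom_at_sub Hs2.
Qed.

Lemma everywhere_subring Z : subring_set Z -> subring_set (everywhere Z).
Proof.
move=> Zr; have [Z1 ZB ZM] := Zr; split=> [|x y xZ yZ|x y xZ yZ].
- exists K; first exact: tower0; split=> [|lambda s _ [[-> _ _] _ _] //]; exact: gsf1.
- have [E1 E1t [E1x xP]] := xZ; have [E2 E2t [E2y yP]] := yZ.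
  have [E3 [E3t E13 E23 _]] := tower_join E1t E2t; have E3s := tower_subfield E3t.
  exists E3 => //; split=> [|lambda s l0 Hs].
    by have [_ EB _] := subfield_subring E3s; apply: EB; [exact: E13|exact: E23].
  have [Hs' _ _] := Hs; rewrite (hom_onB E3s Hs') ?[E3 _]E13 ?[E3 _]E23 //; first apply: ZB.
  + by apply: (xP lambda) => //; apply: hom_at_sub Hs.
  + by apply: (yP lambda) => //; apply: hom_at_sub Hs.
  + exact: E13.
  + exact: E23.
- have [E1 E1t [E1x xP]] := xZ; have [E2 E2t [E2y yP]] := yZ.
  have [E3 [E3t E13 E23 _]] := tower_join E1t E2t; have E3s := tower_subfield E3t.
  exists E3 => //; split=> [|lambda s l0 Hs].
    by have [_ _ EM] := subfield_subring E3s; apply: EM; [exact: E13|exact: E23].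
  have [[_ _ sM] _ _] := Hs; rewrite sM; [|exact: E13|exact: E23]; apply: ZM.
  + by apply: (xP lambda) => //; apply: hom_at_sub Hs.
  + by apply: (yP lambda) => //; apply: hom_at_sub Hs.
Qed.

Lemma everywhereV Z x : (forall z, Z z -> Z z^-1) -> everywhere Z x -> everywhere Z x^-1.
Proof.
move=> ZV [E Et [Ex xP]]; have Es := tower_subfield Et; exists E => //; split=> [|lambda s l0 Hs].
  exact: subfieldV.
by have [Hs' _ _] := Hs; rewrite (hom_onV Es Hs') //; apply: ZV; apply: (xP lambda).
Qed.

Lemma everywhere_AS Z y : (forall eta, Z (eta ^+ p - eta) -> Z eta) ->
  everywhere Z (y ^+ p - y) -> everywhere Z y.
Proof.
move=> ZAS fZ; have [E Et [Ef _]] := fZ.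
have At : tower setT (adjoin E y) by apply: tower_adjoin.
have As := tower_subfield At; have Ay := @adjoin_gen E y.
exists (adjoin E y) => //; split=> // lambda s l0 Hs; apply: ZAS.
have [Hs' _ _] := Hs; rewrite -(hom_onX As Hs') // -(hom_onB As Hs') //; last first.
  exact: (sringX (subfield_subring As)).
by apply: (everywhere_all fZ At _ l0 Hs); apply: adjoin_sub.
Qed.

Section Coefficients.
Variables (E : set M) (y : M) (Z : set M).
Hypothesis Et : tower setT E.
Hypothesis Ef : E (y ^+ p - y).
Hypothesis nEy : ~ E y.
Hypothesis Zr : subring_set Z.
Variable g : nat -> M.
Hypothesis gE : forall i, E (g i).
Let x := \sum_(i < p) g i * y ^+ i.
Hypothesis xZ : everywhere Z x.

Let At : tower setT (adjoin E y). Proof. exact: tower_adjoin. Qed.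
Let Es := tower_subfield Et.
Let As := tower_subfield At.
Let Ay : adjoin E y y := @adjoin_gen E y.
Let AyX i : adjoin E y (y ^+ i).
Proof. exact: (sringX (subfield_subring As)). Qed.
Let Ag i : adjoin E y (g i). Proof. exact: adjoin_sub. Qed.
Let Agy i : adjoin E y (g i * y ^+ i).
Proof. by have [_ _ AM] := subfield_subring As; apply: AM. Qed.
Let Ax : adjoin E y x. Proof. by apply/(adjoinP pcharM Es Ef nEy); exists g. Qed.

(** The extensions of s to E(y) send y to eta + c with c in the prime field. The values at these
    points of the polynomial with coefficients s(g_i) are therefore images of x, and finite
    differences give the coefficients of its expansion around eta. *)
Lemma everywhere_shifted_coef lambda s eta l : lambda != 0 -> hom_at lambda E s ->
  eta ^+ p - eta = s (y ^+ p - y) -> Z ((\poly_(i < p) s (g i)) \Po ('X + eta%:P))`_l.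
Proof.
move=> l0 Hs etaE.
apply: (coef_shift_from_values pcharM (sring_additive Zr)); first exact: size_poly.
move=> c; have [|s' [Hs' s'E s'y]] := @hom_at_adjoin lambda E y s (eta + c%:R) Es (tower_K Et) Ef nEy Hs.
  rewrite -etaE -(pFrobenius_autE pcharM) pFrobenius_autD_comm ?pFrobenius_aut_nat; last exact: mulrC.
  by rewrite pFrobenius_autE; ring.
suff -> : (\poly_(i < p) s (g i)).[eta + c%:R] = s' x by have := everywhere_all xZ At Ax l0 Hs'.
have [Hs'' _ _] := Hs'; have [_ _ s'M] := Hs''.
rewrite horner_poly (hom_on_sum As Hs'') //; apply: eq_bigr => i _.
by rewrite s'M // s'E // (hom_onX As Hs'') // s'y.
Qed.

Lemma everywhere_coef i : everywhere Z y -> (i < p)%N -> everywhere Z (g i).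
Proof.
move=> yZ ip; exists E => //; split=> // lambda s l0 Hs.
have [eta etaE] := AS_root_pos (s (y ^+ p - y)).
have Zeta : Z eta.
  have [s' [Hs' s'E <-]] := hom_at_adjoin Es (tower_K Et) Ef nEy Hs etaE.
  exact: (everywhere_all yZ At Ay l0 Hs').
pose P := \poly_(i < p) s (g i); pose Q := P \Po ('X + eta%:P).
have QZ l : Z Q`_l by exact: (everywhere_shifted_coef l l0 Hs etaE).
have -> : s (g i) = (Q \Po ('X - eta%:P))`_i.
  rewrite /Q -comp_polyA (_ : ('X + _) \Po _ = 'X); last first.
    by rewrite comp_polyD comp_polyX comp_polyC subrK.
  by rewrite comp_polyXr coef_poly ip.
have [_ ZB ZM] := Zr; rewrite -polyCN (@coef_comp_XaddC _ Q (- eta) i (size Q)) //.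
apply: (sring_sum Zr) => j _; apply: (sring_nat Zr); apply: ZM => //.
by apply: (sringX Zr); apply: (sringN Zr).
Qed.

Lemma everywhere_top d : (d < p)%N -> (forall i, (d < i)%N -> g i = 0) -> everywhere Z (g d).
Proof.
move=> dp g0; exists E => //; split=> // lambda s l0 Hs.
have [eta etaE] := AS_root_pos (s (y ^+ p - y)); have [Hs' _ _] := Hs.
have := everywhere_shifted_coef d l0 Hs etaE.
rewrite (@coef_comp_XaddC _ _ _ _ p) ?size_poly // (bigD1 (Ordinal dp)) //= big1 => [|i id].
  by rewrite coef_poly dp subnn mulr1 binn addr0.
rewrite coef_poly ltn_ord; case: (ltngtP i d) => [lt|lt|E'].
- by rewrite bin_small // mulr0n.
- by rewrite g0 // (hom_on0 Es Hs') mul0r mul0rn.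
- by case/eqP: id; apply: val_inj.
Qed.

(** The coefficient of degree d in the expansion around the image of y is the image of g_d + (d + 1)
    g_(d+1) y. After division by the leading coefficient it leads to a generator y + g_d / ((d + 1)
    g_(d+1)) whose images are under control. *)
Lemma everywhere_next d : (d.+1 < p)%N -> (forall i, (d.+1 < i)%N -> g i = 0) ->
  everywhere Z (g d + g d.+1 * y *+ d.+1).
Proof.
move=> dp g0; exists (adjoin E y) => //; have dp' := ltnW dp; split=> [|lambda s l0 Hs].
  have Ar := subfield_subring As; apply: (sringD Ar) => //; apply: (sring_nat Ar).
  by have [_ _ AM] := Ar; apply: AM.
have [Hs' _ _] := Hs; have [_ sD sM] := Hs'; have HsE := hom_at_sub (@adjoin_sub E y) Hs.
have etaE : s y ^+ p - s y = s (y ^+ p - y) by rewrite (hom_onB As Hs') // (hom_onX As Hs').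
have [HsE' _ _] := HsE.
have Ady n : adjoin E y (g d.+1 * y *+ n).
  have Ar := subfield_subring As; apply: (sring_nat Ar).
  by have [_ _ AM] := Ar; apply: AM.
have := everywhere_shifted_coef d l0 HsE etaE.
rewrite (@coef_comp_XaddC _ _ _ _ p) ?size_poly //.
rewrite (bigD1 (Ordinal dp')) //= (bigD1 (Ordinal dp)) //=; last by rewrite -val_eqE /= gtn_eqF.
rewrite big1 => [|i /andP[id id']].
  rewrite !coef_poly dp dp' subnn mulr1 binn addr0 subSnn expr1 binSn mulr1n.
  congr (Z _); rewrite sD //; congr (_ + _).
  have sn n : s (g d.+1 * y *+ n) = s (g d.+1) * s y *+ n.
    elim: n => [|n IH]; first by rewrite mulr0n (hom_on0 As Hs').
    by rewrite !mulrS sD // ?IH ?sM //; have := Ady 1%N; rewrite mulr1n.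
  by rewrite sn.
rewrite coef_poly ltn_ord; case: (ltngtP i d) => [lt|lt|E'].
- by rewrite bin_small // mulr0n.
- rewrite g0 ?(hom_on0 Es HsE') ?mul0r ?mul0rn //.
  by rewrite ltn_neqAle lt andbT; apply: contra_neq id' => iE; apply: val_inj.
- by case/eqP: id; apply: val_inj.
Qed.

End Coefficients.
End Towers.

(** * Laurent series, power series and the roots of 1 + t *)

Section Series.
Variables (k : closedFieldType) (p : nat).
Hypothesis pchark : p \in [pchar k].
Notation M := (glaurent k).
Implicit Types (F G : M).

Let p_pr : prime p. Proof. exact: pcharf_prime pchark. Qed.
Let p_gt1 : (1 < p)%N. Proof. exact: prime_gt1. Qed.
Let p_gt0 : (0 < p)%N. Proof. exact: prime_gt0. Qed.

Definition laurent_series : set M := [set F | forall e, F e != 0 -> intset e].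
Definition power_series : set M := [set F | forall e, F e != 0 -> exists n : nat, e = n%:R].

Lemma power_laurent : power_series `<=` laurent_series.
Proof. by move=> F Fp e /Fp[n ->]; exists n%:Z; rewrite -pmulrn. Qed.

Lemma laurent_subring : subring_set laurent_series.
Proof.
split=> [e|F G FS GS e|F G FS GS e].
- by rewrite gcoef1; case: (e =P 0) => [->|_]; [exists 0|rewrite eqxx].
- rewrite gcoefB; have [->|/FS //] := eqVneq (F e) 0.
  by rewrite sub0r oppr_eq0 => /GS.
- rewrite gcoefM => /conv_neq0[r /FS[z rE] /GS[w wE]]; exists (z + w).
  by rewrite intrD -rE -wE addrC subrK.
Qed.

Lemma power_subring : subring_set power_series.
Proof.
split=> [e|F G FS GS e|F G FS GS e].
- by rewrite gcoef1; case: (e =P 0) => [->|_]; [exists 0%N|rewrite eqxx].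
- rewrite gcoefB; have [->|/FS //] := eqVneq (F e) 0.
  by rewrite sub0r oppr_eq0 => /GS.
- rewrite gcoefM => /conv_neq0[r /FS[z rE] /GS[w wE]]; exists (z + w)%N.
  by rewrite natrD -rE -wE addrC subrK.
Qed.

Lemma power_const a : power_series (a%:A).
Proof.
move=> e; rewrite gcoefZ gcoef1; case: (e =P 0) => [->|_]; last by rewrite mulr0 eqxx.
by exists 0%N.
Qed.

Lemma power_tpow1 : power_series (tpow k 1).
Proof. by move=> e; rewrite gmonoE; case: (e =P 1) => [->|_]; [exists 1%N|rewrite eqxx]. Qed.

Lemma power_coef0M F G : power_series F -> power_series G -> (F * G) 0 = F 0 * G 0.
Proof.
move=> FS GS; rewrite gcoefM (convE (s := [:: 0])) //; first by rewrite big_seq1 subr0.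
move=> r /FS[n rE] /GS[m]; rewrite rE inE => /eqP; rewrite sub0r eqr_oppLR => /eqP E.
have /eqP : (n + m)%:R = 0 :> rat by rewrite natrD E addNr.
by rewrite pnatr_eq0 addn_eq0 => /andP[/eqP -> _].
Qed.

Lemma power_coef1M F G : power_series F -> power_series G -> (F * G) 1 = F 0 * G 1 + F 1 * G 0.
Proof.
move=> FS GS; rewrite gcoefM (convE (s := [:: 0; 1])) //.
  by rewrite !big_cons big_nil subr0 subrr addr0.
move=> r /FS[n rE] /GS[m]; rewrite rE !inE => /eqP; rewrite subr_eq => /eqP E.
have /eqP : (1%:R : rat) = (m + n)%:R by rewrite natrD -E.
by rewrite eqr_nat; case: n {rE E} => [|[|n]] //; rewrite !addnS.
Qed.

Lemma power_coef0X F n : power_series F -> (F ^+ n) 0 = F 0 ^+ n.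
Proof.
move=> FS; elim: n => [|n IH]; first by rewrite !expr0 gcoef1 eqxx.
by rewrite !exprS power_coef0M // ?IH //; apply: (sringX power_subring).
Qed.

(** Let G1 be the part of F^-1 on Z. The product F (F^-1 - G1) = 1 - F G1 has integral exponents
    only, while the product of F and a series without integral exponents has none of them; so it
    vanishes. *)
Lemma laurent_inv F : laurent_series F -> laurent_series F^-1.
Proof.
move=> FS; have [->|F0] := eqVneq F 0; first by rewrite invr0; exact: (sring0 laurent_subring).
have [_ SB SM] := laurent_subring; pose G1 := gmask intset F^-1; pose G2 := F^-1 - G1.
have G1S : laurent_series G1.
  by move=> e; rewrite gmaskE; case: asboolP => //; rewrite eqxx.
suff G20 : F * G2 = 0.
  move: G20 => /eqP; rewrite mulf_eq0 (negPf F0) /= subr_eq0 => /eqP ->; exact: G1S.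
apply: glaurentP => e; rewrite gcoef0; apply/eqP; apply: contraT => He.
have eS : laurent_series (F * G2).
  by rewrite /G2 mulrBr mulfV //; apply: SB; [have [] := laurent_subring|apply: SM].
have : intset e by apply: eS.
move: He; rewrite gcoefM => /conv_neq0[r /FS[z rE]]; rewrite rE /G2 gcoefB gmaskE.
case: asboolP => [|nint]; first by rewrite subrr eqxx.
by move=> _ [w eE]; case: nint; exists (w - z); rewrite eE intrB.
Qed.

Lemma power_inv F : power_series F -> F 0 != 0 -> power_series F^-1.
Proof.
move=> FP F0 e He; have [z ez] := laurent_inv (power_laurent FP) He; subst e.
case: z He => [j _|j He]; first by exists j.
exfalso; have [|m Hm mmin] := @gsupp_wo _ F^-1 _ (@subset_refl _ _); first by exists (Negz j)%:~R.
have m0 : m < 0 by apply: le_lt_trans (mmin _ He) _; rewrite NegzE mulrNz oppr_lt0 ltr0z.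
have : (F * F^-1) m = F 0 * F^-1 m.
  rewrite gcoefM (convE (s := [:: 0])) //; first by rewrite big_seq1 subr0.
  move=> r /FP[i ->]; rewrite inE => /mmin; rewrite lerBrDl gerDr.
  by rewrite (lern0) => /eqP ->.
have Fn0 : F != 0 by apply: contra_neq F0 => ->.
rewrite mulfV // gcoef1 lt_eqF // => /esym/eqP; rewrite mulf_eq0 (negPf F0) /= => E.
by move: Hm; rewrite /gsupp /mkset E.
Qed.

Lemma power_inv_coef0 F : power_series F -> F 0 != 0 -> F^-1 0 != 0.
Proof.
move=> FP F0; have Fn0 : F != 0 by apply: contra_neq F0 => ->.
have := power_coef0M FP (power_inv FP F0); rewrite mulfV // gcoef1 eqxx => E.
by apply/eqP => V0; move/eqP: E; rewrite V0 mulr0 oner_eq0.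
Qed.

Lemma power_shift F : power_series F -> F 0 = 0 -> power_series (tpow k (-1) * F).
Proof.
move=> FP F0 e; rewrite tpowM opprK => He; have [[|n] nE] := FP _ He.
  by move: He; rewrite nE F0 eqxx.
by exists n; apply: (addIr 1); rewrite nE natr1.
Qed.

Lemma power_AS F : power_series (F ^+ p - F) -> power_series F.
Proof.
set f := F ^+ p - F => fS e Fe; have E : F ^+ p - F + - f = 0 by rewrite subrr.
have nf x : (- f) x != 0 -> exists n : nat, x = n%:R by rewrite gcoefN oppr_eq0 => /fS.
have pX n : p%:R ^+ n != 0 :> rat by rewrite expf_neq0 // pnatr_eq0 -lt0n.
have [->|[e0 [n /nf[m eE]]]|[e0 [n /nf[m eE]]]] := AS_supp pchark E Fe.
- by exists 0%N.
- by exists (m * p ^ n)%N; rewrite natrM natrX -eE divfK.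
- have : 0 <= e * p%:R ^+ n.+1 by rewrite eE ler0n.
  by rewrite pmulr_lge0 ?leNgt ?e0 // exprn_gt0 // ltr0n.
Qed.

(** A nonzero coefficient of F at -e would force one of F^p - F at some - e p^(n + 1), below the
    lowest exponent. The leading term thus comes from F^p, whose exponents are multiples of p. *)
Lemma laurent_AS_pole F (e : nat) : laurent_series F -> (0 < e)%N ->
  (F ^+ p - F) (- e%:R) != 0 -> (forall x, (F ^+ p - F) x != 0 -> - e%:R <= x) -> (p %| e)%N.
Proof.
set f := F ^+ p - F => FS e0 fe fge; have E : F ^+ p - F + - f = 0 by rewrite subrr.
have p0 : p%:R != 0 :> rat by rewrite pnatr_eq0 -lt0n.
have Fe0 : F (- e%:R) = 0.
  apply/eqP; apply: contraT => Fe; have [/eqP|[h _]|[_ [n]]] := AS_supp pchark E Fe.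
  - by rewrite oppr_eq0 pnatr_eq0 gtn_eqF.
  - by move: h; rewrite oppr_gt0 ltrn0.
  - rewrite gcoefN oppr_eq0 => /fge; rewrite mulNr lerN2 -natrX -natrM ler_nat => h.
    have := leq_trans (ltn_Pmulr _ e0) h; rewrite ltnn; apply.
    by rewrite -(expn0 p) ltn_exp2l.
move: fe; rewrite /f gcoefB Fe0 subr0 -[X in F ^+ X](expn1 p) (gfrobXE pchark) expn1.
rewrite expf_eq0 p_gt0 /= => /FS[z zE].
have : - (e%:Z)%:~R = (z * p%:Z)%:~R :> rat by rewrite intrM -zE -!pmulrn divfK.
move=> /eqP; rewrite -rmorphN eqr_int => /eqP zE'.
by have : (p %| `|- e%:Z|)%N; [rewrite zE' abszM dvdn_mull|rewrite abszN].
Qed.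

Lemma const_of_power (z : M) a n : (0 < n)%N -> z ^+ n = a%:A -> exists b : k, z = b%:A.
Proof.
move=> n0 zE; have [rs rsE] := closed_field_poly_normal ('X^n - a%:P : {poly k}).
move: rsE; rewrite lead_coefDl ?lead_coefXn ?scale1r; last first.
  by rewrite size_polyN size_polyXn; apply: leq_ltn_trans (size_polyC_leq1 _) _.
move=> /(congr1 (fun P => (map_poly (in_alg M) P).[z])).
rewrite rmorphB /= map_polyXn map_polyC hornerD hornerN hornerXn hornerC /= zE subrr.
rewrite rmorph_prod horner_prod => /esym/eqP; rewrite prodf_seq_eq0 => /hasP[b _ /=].
rewrite rmorphB /= map_polyX map_polyC hornerD hornerN hornerX hornerC subr_eq0 => /eqP ->.
by exists b.
Qed.

Section Gamma.
Variable q : nat.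
Hypothesis q_gt1 : (1 < q)%N.

(* Whether the base-q digits of j are all 0 or 1. The sum gamma of t^j over these j
   satisfies gamma = (1 + t) gamma^q, hence gives the (q - 1)-th roots of 1 + t. *)
Fixpoint gamma_rec n j := if n is n'.+1 then (j %% q <= 1)%N && gamma_rec n' (j %/ q)%N else j == 0%N.
Definition gamma_nat j := gamma_rec j j.

Lemma gamma_rec_stable n j : (j <= n)%N -> gamma_rec n j = gamma_nat j.
Proof.
have aux m i : (i <= m)%N -> gamma_rec m i = gamma_rec m.+1 i.
  elim: m i => [|m IH] i; first by rewrite leqn0 => /eqP -> /=; rewrite mod0n div0n.
  move=> im; rewrite [LHS]/= [RHS]/=; case: leqP => //= _; apply: IH.
  case: i im => [|i]; first by rewrite div0n.
  by rewrite ltnS => im; apply: leq_trans im; rewrite -ltnS; apply: ltn_Pdiv.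
move=> jn; rewrite /gamma_nat -(subnK jn); elim: (n - j)%N => // m IH.
by rewrite addSn -aux // leq_addl.
Qed.

Lemma gamma_natE j : gamma_nat j = (j %% q <= 1)%N && gamma_nat (j %/ q)%N.
Proof.
rewrite -(@gamma_rec_stable j.+1 j) //= gamma_rec_stable // leq_div //.
Qed.

Fact gamma_subproof : wo [set e : rat |
  (if `[< exists j : nat, e = j%:R >] then (gamma_nat `|Num.floor e|)%:R else 0 : k) != 0].
Proof.
have natwo : wo [set e : rat | exists j : nat, e = j%:R].
  move=> T TN [x Tx]; have [n xE] := TN _ Tx.
  have ex : exists m, `[< T m%:R >] by exists n; apply/asboolP; rewrite -xE.
  case: (ex_minnP ex) => m /asboolP Tm mmin; exists m%:R => // y Ty.
  have [l yE] := TN _ Ty; rewrite yE ler_nat; apply: mmin; apply/asboolP; rewrite -yE //.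
by apply: wo_sub natwo => e /=; case: asboolP => //; rewrite eqxx.
Qed.
Definition gamma : M := mkglaurent gamma_subproof.

Lemma gamma_coef (j : nat) : gamma j%:R = (gamma_nat j)%:R.
Proof.
rewrite /= asboolT; last by exists j.
by rewrite -[j%:R]/((j%:Z)%:~R) intrKfloor.
Qed.

Lemma gamma_power : power_series gamma.
Proof. by move=> e /=; case: asboolP => //; rewrite eqxx. Qed.

(** As the coefficients are 0 and 1, gamma^q = gamma(t^q); the factors 1 and t account for the last
    digit 0 or 1 of j. *)
Lemma gamma_rel r : (0 < r)%N -> q = (p ^ r)%N -> gamma = (1 + tpow k 1) * gamma ^+ q.
Proof.
move=> r0 qE; have q0 : q%:R != 0 :> rat by rewrite pnatr_eq0 gtn_eqF // ltnW.
have gq : gamma ^+ q = gsubst q%:R gamma.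
  apply: glaurentP => e; rewrite [in LHS]qE (gfrobXE pchark) gsubstE ?ltr0n ?(ltnW q_gt1) // qE natrX.
  move: (e / _) => x; have [gx0|/gamma_power[j ->]] := eqVneq (gamma x) 0.
    by rewrite gx0 (expr0pn pchark).
  rewrite gamma_coef; case: (gamma_nat j); rewrite ?expr1n //; exact: (expr0pn pchark).
have [_ _ SM] := power_subring.
have oneP : power_series (1 + tpow k 1).
  by apply: (sringD power_subring); [have [] := power_subring|exact: power_tpow1].
apply: glaurentP => e; have [[j ->]|ne] := pselect (exists j : nat, e = j%:R); last first.
  have z0 F : power_series F -> F e = 0 by move=> FS; apply/eqP; apply: contra_notT ne => /FS.
  rewrite !z0 //; try exact: gamma_power.
  by apply: SM => //; apply: (sringX power_subring); exact: gamma_power.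
rewrite mulrDl mul1r gcoefD tpowM gq !gsubstE ?ltr0n ?(ltnW q_gt1) // gamma_coef gamma_natE.
have dv (i : nat) : gamma (i%:R / q%:R) = if (q %| i)%N then (gamma_nat (i %/ q)%N)%:R else 0.
  case: ifP => [/dvdnP[m ->]|nd]; first by rewrite natrM mulfK // mulnK ?gamma_coef // ltnW.
  apply/eqP; apply: contraFT nd => /gamma_power[m mE]; apply/dvdnP; exists m.
  by apply/eqP; rewrite -(eqr_nat rat) natrM -mE divfK.
rewrite dv; case: j => [|j].
  rewrite mod0n div0n dvdn0 sub0r (_ : gamma (- 1 / q%:R) = 0) ?addr0 //; apply/eqP; apply: contraT.
  move/gamma_power => [m /eqP]; rewrite mulNr mul1r eqr_oppLR => /eqP E.
  have : (0 : rat) < q%:R^-1 by rewrite invr_gt0 ltr0n ltnW.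
  by rewrite E oppr_gt0 ltrn0.
rewrite -natr1 addrK dv.
have [qj|nqj] := boolP (q %| j.+1)%N.
  have nq : (q %| j)%N = false.
    by apply/negP => qj'; move: qj; rewrite -addn1 dvdn_addr // dvdn1 gtn_eqF.
  by rewrite nq addr0; move: qj; rewrite /dvdn => /eqP ->.
have [qj|nqj'] := boolP (q %| j)%N.
  have /dvdnP[m jE] := qj; rewrite add0r jE mulnK ?(ltnW q_gt1) // -addn1.
  by rewrite divnMDl ?(ltnW q_gt1) // modnMDl divn_small // modn_small // addn0.
rewrite addr0 (_ : (_ <= 1)%N = false) //; apply/negP; rewrite leq_eqVlt ltnS leqn0 => /orP[/eqP m1|].
  case/negP: nqj'; have := divn_eq j.+1 q; rewrite m1 addn1 => -[->]; exact: dvdn_mull.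
by move/eqP => m0; case/negP: nqj; rewrite /dvdn m0.
Qed.

End Gamma.

(** By Euler, n divides q - 1 for a power q of p. From (1 + t) gamma^(q-1) = 1 the series h = (1 +
    t) gamma^(q-2) is the inverse of gamma, and h^((q-1)/n) is the root. *)
Lemma exists_unit_root n : prime_to_p p n -> exists beta : M,
  [/\ power_series beta, beta 0 = 1 & beta ^+ n = 1 + tpow k 1].
Proof.
move=> [n0 pn].
have [r r0 nr] : exists2 r, (0 < r)%N & (n %| (p ^ r).-1)%N.
  exists (totient n); first by rewrite totient_gt0.
  have cop : coprime p n by rewrite prime_coprime.
  by rewrite -subn1 -eqn_mod_dvd ?expn_gt0 ?p_gt0 //; apply/eqP/Euler_exp_totient.
pose q := (p ^ r)%N; have q_gt1 : (1 < q)%N by rewrite -{1}(expn0 p) ltn_exp2l.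
pose g := gamma q; have gP : power_series g by exact: gamma_power.
have grel : g = (1 + tpow k 1) * g ^+ q by apply: (gamma_rel q_gt1 r0).
have g00 : g 0 = 1 by rewrite /g -[0]/(0%:R) gamma_coef.
have g0 : g != 0 by apply/eqP => g0; move: g00; rewrite g0 => /esym/eqP; rewrite oner_eq0.
have q2 : q = (q - 2).+2 by move: q_gt1; clear; lia.
pose h := (1 + tpow k 1) * g ^+ (q - 2).
have hg : h * g = 1.
  by apply: (mulIf g0); rewrite /h mul1r [RHS]grel q2 !exprS; rewrite -q2; ring.
have oneP : power_series (1 + tpow k 1).
  by apply: (sringD power_subring); [have [] := power_subring|exact: power_tpow1].
have hP : power_series h.
  by have [_ _ SM] := power_subring; apply: SM => //; apply: (sringX power_subring).
exists (h ^+ ((p ^ r).-1 %/ n)%N); split.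
- exact: (sringX power_subring).
- rewrite power_coef0X // (_ : h 0 = 1) ?expr1n //.
  have := congr1 (fun F : M => F 0) hg; rewrite /= -/(_ * _) => E.
  by have := power_coef0M hP gP; rewrite hg gcoef1 eqxx g00 mulr1.
- rewrite -exprM divnK //; apply: (mulIf (expf_neq0 q g0)).
  rewrite -grel -(prednK (ltnW q_gt1)) exprS mulrCA -exprMn hg expr1n mulr1 //.
Qed.

(** Elements r_m with r_0 = a and r_(m+1)^(m+1) = r_m make r_m an m!-th root of a. The power a^q is
    r_m^(q m!) for any m such that q m! is an integer, and the denominator of q is such an m. *)
Lemma exists_rat_power (a : k) : a != 0 -> exists2 chi, rat_power a chi & forall q, chi q != 0.
Proof.
move=> a0.
have root_ex (m : nat) (x : k) : exists y, y ^+ m.+1 = x.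
  have [y] := @solve_monicpoly k m.+1 (fun i => if i == 0%N then x else 0) isT.
  rewrite big_ord_recl /= mulr1 big1 ?addr0 => [yE|i _]; first by exists y.
  by rewrite mul0r.
pose rt m x := projT1 (cid (root_ex m x)).
have rtE m x : rt m x ^+ m.+1 = x by rewrite /rt; case: cid.
pose r := fix r m := if m is m'.+1 then rt m' (r m') else a.
have rE m : r m.+1 ^+ m.+1 = r m by exact: rtE.
have r0 m : r m != 0.
  elim: m => [//|m IH]; apply: contra_neq IH => r0.
  by rewrite -rE r0 expr0n.
have factd m n : (m <= n)%N -> (m`! %| n`!)%N.
  by move=> mn; rewrite -(bin_fact mn) dvdn_mull // dvdn_mulr.
have rM m j : r (m + j)%N ^+ ((m + j)`! %/ m`!)%N = r m.
  elim: j => [|j IH]; first by rewrite addn0 divnn fact_gt0.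
  have -> : ((m + j.+1)`! %/ m`! = (m + j).+1 * ((m + j)`! %/ m`!))%N.
    by rewrite addnS factS muln_divA // factd // leq_addr.
  by rewrite addnS exprM rE.
pose chi q : k := r `|denq q|%N ^ (numq (q * (`|denq q|%N)`!%:R)).
have chiE q m z : q * m`!%:R = z%:~R -> chi q = r m ^ z.
  move=> qm; rewrite /chi; set d := `|denq q|%N.
  have dE : (d%:R : rat) = (denq q)%:~R by rewrite /d; have := denq_gt0 q; case: (denq q).
  have dn : (0 < d)%N by rewrite /d absz_gt0 denq_eq0.
  have [w wE] : exists w : int, q * d`!%:R = w%:~R.
    exists (numq q * (d.-1)`!%:Z); rewrite intrM numqE -dE -pmulrn.
    by rewrite -{1}(prednK dn) factS prednK // natrM; ring.
  have -> : numq (q * d`!%:R) = w by rewrite wE numq_int.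
  have lift m1 m2 z1 z2 : (m1 <= m2)%N -> q * m1`!%:R = z1%:~R -> q * m2`!%:R = z2%:~R ->
      r m1 ^ z1 = r m2 ^ z2.
    move=> m12 E1 E2; rewrite -(rM m1 (m2 - m1)%N) subnKC // exprnP exprz_exp; congr (_ ^ _).
    by apply: (@intr_inj rat); rewrite intrM -E1 -pmulrn -E2 mulrCA -natrM divnK // factd.
  by have [dm|/ltnW md] := leqP d m; [exact: lift wE qm|symmetry; exact: lift qm wE].
exists chi => [|q]; last by rewrite expfz_neq0.
split; first by rewrite (chiE 1 0%N 1) ?mulr1.
have common (q : rat) (d : nat) : (`|denq q| <= d)%N -> exists z : int, q * d`!%:R = z%:~R.
  move=> qd; have : (`|denq q| %| d`!)%N.
    by apply: dvdn_fact; rewrite qd absz_gt0 denq_eq0.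
  case/dvdnP => c ->; exists (numq q * c%:Z); rewrite intrM numqE -pmulrn natrM.
  have -> : (denq q)%:~R = (`|denq q|%N)%:R :> rat by have := denq_gt0 q; case: (denq q).
  by ring.
move=> x y; pose d := maxn `|denq x| `|denq y|.
have [z zE] := common x d (leq_maxl _ _); have [w wE] := common y d (leq_maxr _ _).
rewrite (chiE _ _ _ zE) (chiE _ _ _ wE) (chiE _ d (z + w)) ?expfzDr //.
by rewrite mulrDl zE wE intrD.
Qed.

End Series.

(** * The field K and its homomorphisms *)

Section BaseField.
Variables (k : closedFieldType) (p : nat).
Hypothesis pchark : p \in [pchar k].
Notation M := (glaurent k).
Implicit Types (x y : M) (E : set M) (s : M -> M) (lambda : k) (n : nat).

Let p_pr : prime p. Proof. exact: pcharf_prime pchark. Qed.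
Let p_gt1 : (1 < p)%N. Proof. exact: prime_gt1. Qed.
Let p_gt0 : (0 < p)%N. Proof. exact: prime_gt0. Qed.
Let K : set M := K_set p (k:=k).
Let inv_neq0 n : prime_to_p p n -> n%:R^-1 != 0 :> rat.
Proof. by move=> [n0 _]; rewrite invr_eq0 pnatr_eq0 -lt0n. Qed.

Lemma prime_to_pM m n : prime_to_p p m -> prime_to_p p n -> prime_to_p p (m * n).
Proof. by move=> [m0 pm] [n0 pn]; split; rewrite ?muln_gt0 ?m0 // Euclid_dvdM // negb_or pm. Qed.

Lemma prime_to_p1 : prime_to_p p 1.
Proof. by split=> //; rewrite dvdn1 gtn_eqF. Qed.

Lemma K_const (a : k) : K (a%:A).
Proof. by apply: gen_subfield_sub; left; exists a. Qed.

Lemma K_root n : prime_to_p p n -> K (tpow k n%:R^-1).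
Proof. by move=> np; apply: gen_subfield_sub; right; exists n. Qed.

Lemma K_teval n f : prime_to_p p n -> K (teval n%:R^-1 f).
Proof.
move=> np; rewrite tevalE; apply: gsf_sum => i _; rewrite -mulr_algl -tpowX.
by apply: gsfM; [exact: K_const|apply: gsfX; exact: K_root].
Qed.

Let teval1 (d : rat) : teval d 1 = 1 :> M. Proof. exact: (rmorph1 (teval d)). Qed.

Lemma teval_lift m n f : (0 < m)%N -> teval n%:R^-1 f = teval (n * m)%:R^-1 (f \Po 'X^m) :> M.
Proof.
move=> m0; rewrite teval_comp; congr (teval _ f).
by rewrite -[RHS]mulr_natr natrM invfM mulfVK // pnatr_eq0 -lt0n.
Qed.

Lemma K_fraction x : K x <-> exists n f g, [/\ prime_to_p p n, g != 0 &
  x = teval n%:R^-1 f / teval n%:R^-1 g].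
Proof.
split=> [|[n [f [g [np g0 ->]]]]]; last by apply: gsf_div; apply: K_teval.
pose S := [set x : M | exists2 n, prime_to_p p n & fraction_set n%:R^-1 x].
suff KS : K `<=` S by move=> /KS[n np [f [g [g0 ->]]]]; exists n, f, g.
have lift m n (z : M) : prime_to_p p m -> fraction_set n%:R^-1 z -> fraction_set (n * m)%:R^-1 z.
  move=> [m0 _] [f [g [g0 ->]]]; exists (f \Po 'X^m), (g \Po 'X^m).
  by rewrite -!teval_lift // comp_poly_eq0 ?size_polyXn ?ltnS.
have common (z w : M) : S z -> S w -> exists n, [/\ prime_to_p p n, fraction_set n%:R^-1 z & fraction_set n%:R^-1 w].
  move=> [m mp zm] [n np wn]; exists (m * n)%N; split; [exact: prime_to_pM|exact: lift|].
  by rewrite mulnC; apply: lift.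
apply: gen_subfield_min => [|z [[a _ <-]|[n np <-]]]; last 2 first.
- exists 1%N; first exact: prime_to_p1.
  by exists a%:P, 1; rewrite oner_neq0 teval1 divr1 tevalC.
- by exists n => //; exists 'X, 1; rewrite oner_neq0 teval1 divr1 tevalX.
split=> [|z w /set_mem zS /set_mem wS|z w /set_mem zS /set_mem wS]; apply/mem_set.
- by exists 1%N; [exact: prime_to_p1|exists 1, 1; rewrite oner_neq0 teval1 divr1].
- have [n [np zn wn]] := common _ _ zS wS; exists n => //.
  have [_ FB _] := fraction_set_closed k (inv_neq0 np).
  by apply: set_mem; apply: FB; apply: mem_set.
- have [n [np zn wn]] := common _ _ zS wS; exists n => //.
  have [_ _ FV] := fraction_set_closed k (inv_neq0 np).
  by apply: set_mem; apply: FV; apply: mem_set.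
Qed.

Let root1 n := if pselect (prime_to_p p n) is left np then projT1 (cid (exists_unit_root pchark np)) else 1.
Let root1P n : prime_to_p p n ->
  [/\ power_series (root1 n), root1 n 0 = 1 & root1 n ^+ n = 1 + tpow k 1].
Proof. by move=> np; rewrite /root1; case: pselect => // np'; case: cid. Qed.

(** The quotient is a root of unity, hence a constant, and the constant coefficients identify it as
    1. This makes the roots of 1 + t compatible for different n, so that t -> 1 + t extends to K. *)
Lemma unit_root_unique n (x y : M) : (0 < n)%N -> y != 0 -> power_series x -> power_series y ->
  x 0 = 1 -> y 0 = 1 -> x ^+ n = y ^+ n -> x = y.
Proof.
move=> n0 y0 xP yP x1 y1 xy; have [|b bE] := @const_of_power k (x / y) 1 n n0.
  by rewrite expr_div_n xy divff ?expf_neq0 // scale1r.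
have xE : x = b%:A * y by rewrite -bE divfK.
have := congr1 (fun F : M => F 0) xE; rewrite x1 mulr_algl gcoefZ y1 mulr1 => b1.
by rewrite xE -b1 scale1r mul1r.
Qed.

Let root1_neq0 n : prime_to_p p n -> root1 n != 0.
Proof.
by move=> /root1P[_ r1 _]; apply/eqP => r0; move: r1; rewrite r0 => /esym/eqP; rewrite oner_eq0.
Qed.

Let root1M m n : prime_to_p p m -> prime_to_p p n -> root1 (m * n) ^+ n = root1 m.
Proof.
move=> mp np; have [rP r1 rE] := root1P (prime_to_pM mp np); have [rP' r1' rE'] := root1P mp.
apply: (@unit_root_unique m) => //; first by case: mp.
- exact: root1_neq0.
- exact: (sringX (power_subring k)).
- by rewrite power_coef0X // r1 expr1n.
- by rewrite -exprM [(n * m)%N]mulnC rE rE'.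
Qed.

Let ev n (f : {poly k}) : M := horner_alg (root1 n) f.

Let evE n f : ev n f = (map_poly (in_alg M) f).[root1 n]. Proof. by []. Qed.

Let ev_lift m n f : prime_to_p p m -> prime_to_p p n -> ev m f = ev (m * n) (f \Po 'X^n).
Proof.
move=> mp np; rewrite /ev -(root1M mp np) comp_polyE rmorph_sum /= /horner_alg /horner_morph.
rewrite horner_coef size_map_poly; apply: eq_bigr => i _.
rewrite coef_map /= -mul_polyC rmorphM /= map_polyC hornerM hornerC; congr (_ * _).
by rewrite -!exprM map_polyXn hornerXn.
Qed.

Let ev_neq0 n f : prime_to_p p n -> f != 0 -> ev n f != 0.
Proof.
move=> np f0; rewrite evE; have [rs ->] := closed_field_poly_normal f.
rewrite map_polyZ /= hornerZ mulf_neq0 //.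
  by rewrite scaler_eq0 lead_coef_eq0 (negPf f0) oner_eq0.
rewrite rmorph_prod horner_prod prodf_seq_neq0; apply/allP => b _ /=.
rewrite rmorphB /= map_polyX map_polyC hornerD hornerN hornerX hornerC subr_eq0.
apply/eqP => rb; have [_ _ rE] := root1P np.
have bE : (b ^+ n)%:A = 1 + tpow k 1 :> M by rewrite -rE rb -rmorphXn.
have : ((b ^+ n)%:A : M) 1 = 1 by rewrite bE gcoefD gcoef1 gmonoE eqxx oner_eq0 add0r.
by rewrite gcoefZ gcoef1 oner_eq0 mulr0 => /esym/eqP; rewrite oner_eq0.
Qed.

Let ev_frac n m f g f' g' : prime_to_p p n -> prime_to_p p m -> g != 0 -> g' != 0 ->
  teval n%:R^-1 f / teval n%:R^-1 g = teval m%:R^-1 f' / teval m%:R^-1 g' :> M ->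
  ev n f / ev n g = ev m f' / ev m g'.
Proof.
move=> np mp g0 g'0; have [n0 _] := np; have [m0 _] := mp.
have nm0 := inv_neq0 (prime_to_pM np mp).
rewrite !(@teval_lift m n) // !(@teval_lift n m) // (mulnC m n).
have lg : g \Po 'X^m != 0 by rewrite comp_poly_eq0 // size_polyXn ltnS.
have lg' : g' \Po 'X^n != 0 by rewrite comp_poly_eq0 // size_polyXn ltnS.
move=> /eqP; rewrite eqr_div ?teval_eq0 // -!rmorphM /= -subr_eq0 -rmorphB teval_eq0 // subr_eq0 => /eqP E.
rewrite (ev_lift f np mp) (ev_lift g np mp) (ev_lift f' mp np) (ev_lift g' mp np) (mulnC m n).
have nmp := prime_to_pM np mp.
by apply/eqP; rewrite eqr_div ?ev_neq0 // /ev -!rmorphM /= E.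
Qed.

Let image_of x y := exists n f g, [/\ prime_to_p p n, g != 0,
  x = teval n%:R^-1 f / teval n%:R^-1 g & y = ev n f / ev n g].
Let s1 x := if pselect (exists y, image_of x y) is left H then projT1 (cid H) else 0.

Let s1E n f g : prime_to_p p n -> g != 0 ->
  s1 (teval n%:R^-1 f / teval n%:R^-1 g) = ev n f / ev n g.
Proof.
move=> np g0; rewrite /s1; case: pselect => [H|[]]; last by exists (ev n f / ev n g), n, f, g.
by case: (cid H) => y [n' [f' [g' [n'p g'0 E yE]]]] /=; rewrite yE; symmetry; apply: ev_frac E.
Qed.

Let s1_hom : hom_on K s1.
Proof.
have common x y : K x -> K y -> exists n f g f' g', [/\ prime_to_p p n, g != 0, g' != 0,
    x = teval n%:R^-1 f / teval n%:R^-1 g & y = teval n%:R^-1 f' / teval n%:R^-1 g'].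
  move=> /K_fraction[m [f [g [mp g0 ->]]]] /K_fraction[n [f' [g' [np g'0 ->]]]].
  have [m0 _] := mp; have [n0 _] := np.
  exists (m * n)%N, (f \Po 'X^n), (g \Po 'X^n), (f' \Po 'X^m), (g' \Po 'X^m).
  split; rewrite ?comp_poly_eq0 ?size_polyXn ?ltnS //; first exact: prime_to_pM.
    by rewrite -!teval_lift.
  by rewrite mulnC -!teval_lift.
split=> [|x y|x y].
- by have := s1E 1 prime_to_p1 (oner_neq0 _); rewrite !teval1 /ev !(rmorph1 (horner_alg _)) !divr1.
- move=> Kx Ky; have [n [f [g [f' [g' [np g0 g'0 -> ->]]]]]] := common _ _ Kx Ky.
  rewrite addf_div ?teval_eq0 ?(inv_neq0 np) // -!rmorphM -rmorphD /= !s1E ?mulf_neq0 //.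
  by rewrite addf_div ?ev_neq0 // /ev -!rmorphM -rmorphD.
- move=> Kx Ky; have [n [f [g [f' [g' [np g0 g'0 -> ->]]]]]] := common _ _ Kx Ky.
  rewrite mulf_div -!rmorphM /= !s1E ?mulf_neq0 //.
  by rewrite mulf_div /ev -!rmorphM.
Qed.

(** The homomorphism with t -> 1 + t is preceded by the twist of t^q by chi(q) = chi'(n q), where
    chi' is a system of powers of a; thus t^(1/n) is twisted by a, and lambda = chi(1). *)
Lemma exists_hom_at n (a : k) : prime_to_p p n -> a != 0 ->
  exists lambda s (beta : M), [/\ lambda != 0, hom_at lambda K s, power_series beta, beta 0 = 1 &
    s (tpow k n%:R^-1) = a *: beta].
Proof.
move=> np a0; have [chi' [chi'1 chi'D] chi'0] := exists_rat_power a0.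
pose chi q := chi' (n%:R * q); have chiD (q r : rat) : chi (q + r) = chi q * chi r by rewrite /chi mulrDr chi'D.
have chi0 q : chi q != 0 by exact: chi'0.
have n0 : n%:R != 0 :> rat by rewrite -invr_eq0 inv_neq0.
pose tw : M -> M := gtwist chi.
have Ktw x : K x -> K (tw x).
  apply: (@gen_subfield_min _ _ (K \o tw)) => {x}; last first.
    move=> x [[b _ <-]|[m mp <-]] /=; first by rewrite /tw gtwistZ (gtwist1 chiD) //; exact: K_const.
    rewrite /tw /tpow gtwist_mono mul1r (_ : gmono _ _ = (chi m%:R^-1)%:A * tpow k m%:R^-1).
      by apply: gsfM; [exact: K_const|exact: K_root].
    by apply: glaurentP => e; rewrite mulr_algl gcoefZ !gmonoE; case: (e =P _); rewrite ?mulr1 ?mulr0.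
  have twN x : tw (- x) = - tw x by apply: glaurentP => e; rewrite gcoefN !gtwistE gcoefN mulNr.
  split=> [|x y /set_mem xK /set_mem yK|x y /set_mem xK /set_mem yK]; apply/mem_set; rewrite /=.
  - by rewrite /tw (gtwist1 chiD) //; exact: gsf1.
  - by rewrite /tw gtwistD -/tw twN; apply: gsfB.
  - by rewrite /tw (gtwistM chiD) (gtwistV chiD) //; apply: gsf_div.
have [rP r1 rE] := root1P np; have [s11 s1D s1M] := s1_hom.
have s1c (b : k) : s1 (b%:A) = b%:A.
  have := s1E b%:P prime_to_p1 (oner_neq0 _); rewrite ?teval1 /ev ?(rmorph1 (horner_alg _)) !divr1 tevalC => ->.
  exact: horner_algC.
have s1r m : prime_to_p p m -> s1 (tpow k m%:R^-1) = root1 m.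
  move=> mp; have := s1E 'X mp (oner_neq0 _); rewrite ?teval1 /ev ?(rmorph1 (horner_alg _)) !divr1 tevalX => ->.
  exact: horner_algX.
have twr m : prime_to_p p m -> s1 (tw (tpow k m%:R^-1)) = chi m%:R^-1 *: root1 m.
  move=> mp; rewrite /tw /tpow gtwist_mono mul1r (_ : gmono _ _ = (chi m%:R^-1)%:A * tpow k m%:R^-1).
    by rewrite s1M ?s1c ?s1r // ?mulr_algl //; [exact: K_const|exact: K_root].
  by apply: glaurentP => e; rewrite mulr_algl gcoefZ !gmonoE; case: (e =P _); rewrite ?mulr1 ?mulr0.
exists (chi 1), (s1 \o tw), (root1 n); split=> //; last first.
  by rewrite /= twr // /chi mulfV // chi'1.
split=> [|b|] /=.
- split=> [|x y Kx Ky|x y Kx Ky] /=.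
  + by rewrite /tw (gtwist1 chiD).
  + by rewrite /tw gtwistD s1D //; apply: Ktw.
  + by rewrite /tw (gtwistM chiD) s1M //; apply: Ktw.
- by rewrite /tw gtwistZ (gtwist1 chiD) // s1c.
- have := twr 1%N prime_to_p1; rewrite invr1 => ->; congr (_ *: _).
  by have [_ _ <-] := root1P prime_to_p1; rewrite expr1.
Qed.

Lemma horner_alg_coef0 (a : k) (beta : M) f : power_series beta -> beta 0 = 1 ->
  (horner_alg (a *: beta) f : M) 0 = f.[a].
Proof.
move=> bP b1; have aP : power_series (a *: beta).
  by rewrite -mulr_algl; have [_ _ SM] := power_subring k; apply: SM => //; exact: power_const.
have -> : horner_alg (a *: beta) f = \sum_(i < size f) f`_i *: (a *: beta) ^+ i.
  rewrite /horner_alg /horner_morph horner_coef size_map_poly; apply: eq_bigr => i _.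
  by rewrite coef_map /= mulr_algl.
rewrite gcoef_sum horner_coef; apply: eq_bigr => i _.
by rewrite gcoefZ power_coef0X // gcoefZ b1 mulr1.
Qed.

Section Images.
Variables (E : set M) (s : M -> M) (lambda : k).
Hypothesis KE : K `<=` E.
Hypothesis Es : subfield_set E.
Hypothesis Hs : hom_at lambda E s.
Hypothesis l0 : lambda != 0.

Lemma hom_at_root n : prime_to_p p n -> exists a (beta : M),
  [/\ a != 0, power_series beta, beta 0 = 1 & s (tpow k n%:R^-1) = a *: beta].
Proof.
move=> np; have [rP r1 rE] := root1P np; have [Hs' _ st] := Hs; have [n0 _] := np.
have Er : E (tpow k n%:R^-1) by apply: KE; exact: K_root.
have sn : s (tpow k n%:R^-1) ^+ n = lambda *: root1 n ^+ n.
  rewrite rE -st -(hom_onX Es Hs') // tpowX -[_ *+ n]mulr_natr mulVf // pnatr_eq0 -lt0n //.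
have [|a aE] := @const_of_power k (s (tpow k n%:R^-1) / root1 n) lambda n n0.
  by rewrite expr_div_n sn -scalerAl divff // expf_neq0 // root1_neq0.
exists a, (root1 n); split=> //; last by rewrite -mulr_algl -aE divfK // root1_neq0.
apply: contra_neq l0 => a0; move: aE; rewrite a0 scale0r => /eqP.
rewrite mulf_eq0 invr_eq0 (negPf (root1_neq0 np)) orbF => /eqP s0; move: sn.
rewrite s0 expr0n gtn_eqF //= => /esym/eqP; rewrite scaler_eq0 expf_eq0 (negPf (root1_neq0 np)) andbF orbF.
by move/eqP.
Qed.

Lemma hom_at_teval n f : prime_to_p p n -> s (teval n%:R^-1 f) = horner_alg (s (tpow k n%:R^-1)) f.
Proof.
move=> np; have [Hs' sa _] := Hs; have [_ _ sM] := Hs'.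
have Er : E (tpow k n%:R^-1) by apply: KE; exact: K_root.
have Ea (b : k) : E (b%:A) by apply: KE; exact: K_const.
have EM : forall x y, E x -> E y -> E (x * y) by have [] := subfield_subring Es.
have EX i : E (tpow k n%:R^-1 ^+ i) by apply: (sringX (subfield_subring Es)).
rewrite /teval /horner_alg /horner_morph !horner_coef !size_map_poly (hom_on_sum Es Hs').
  by apply: eq_bigr => i _; rewrite coef_map /= sM // sa (hom_onX Es Hs').
by move=> i _; rewrite coef_map /=; apply: EM.
Qed.

(** The image is a (beta - 1). Its coefficient at t is not 0, because a^n beta^n = lambda (1 + t)
    has a nonzero coefficient there. *)
Lemma hom_at_uniformizer n a (beta : M) : prime_to_p p n -> a != 0 -> power_series beta -> beta 0 = 1 ->
  s (tpow k n%:R^-1) = a *: beta ->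
  exists v, [/\ power_series v, v 0 != 0 & s (teval n%:R^-1 ('X - a%:P)) = tpow k 1 * v].
Proof.
move=> np a0 bP b1 sE; have [P1 PB PM] := power_subring k.
have [Hs' _ st] := Hs; have [n0 pn] := np.
have -> : s (teval n%:R^-1 ('X - a%:P)) = a *: (beta - 1).
  rewrite hom_at_teval // sE rmorphB /= /horner_alg /horner_morph map_polyX map_polyC hornerX hornerC.
  by rewrite scalerBr.
pose v := a *: (tpow k (-1) * (beta - 1)); exists v; split.
- rewrite /v -mulr_algl; apply: PM; first exact: power_const.
  by apply: power_shift; [exact: PB|rewrite gcoefB b1 gcoef1 eqxx subrr].
- rewrite /v gcoefZ mulf_neq0 // tpowM sub0r opprK gcoefB gcoef1 oner_eq0 subr0.
  apply: contra_neq l0 => b10.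
  have Er : E (tpow k n%:R^-1) by apply: KE; exact: K_root.
  have := hom_onX Es Hs' n Er; rewrite tpowX -[_ *+ n]mulr_natr mulVf ?pnatr_eq0 -?lt0n // st sE exprZn => E1.
  have : (lambda *: (1 + tpow k 1)) 1 = (a ^+ n *: beta ^+ n) 1 by rewrite E1.
  rewrite !gcoefZ gcoefD gcoef1 oner_eq0 gmonoE eqxx add0r mulr1 => ->.
  suff -> : (beta ^+ n) 1 = 0 by rewrite mulr0.
  elim: (n) => [|m IH]; first by rewrite expr0 gcoef1 oner_eq0.
  rewrite exprS power_coef1M //; last exact: (sringX (power_subring k)).
  by rewrite IH b10 mulr0 mul0r addr0.
- by rewrite /v -scalerAr mulrA -tpowD subrr tpow0 mul1r.
Qed.

Lemma power_horner_alg (x : M) f : power_series x -> power_series (horner_alg x f).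
Proof.
move=> xP; rewrite /horner_alg /horner_morph horner_coef size_map_poly.
apply: (sring_sum (power_subring k)) => i _; rewrite coef_map /=.
have [_ _ SM] := power_subring k; apply: SM; first exact: power_const.
exact: (sringX (power_subring k)).
Qed.

Lemma hom_at_teval_power n f : prime_to_p p n -> power_series (s (teval n%:R^-1 f)).
Proof.
move=> np; rewrite hom_at_teval //; apply: power_horner_alg.
have [a [beta [_ bP _ ->]]] := hom_at_root np; rewrite -mulr_algl.
have [_ _ SM] := power_subring k; apply: SM => //; exact: power_const.
Qed.

Lemma hom_at_K x : K x -> laurent_series (s x).
Proof.
move=> /K_fraction[n [f [g [np g0 ->]]]]; have [Hs' _ _] := Hs.
rewrite (hom_on_div Es Hs'); try by apply: KE; exact: K_teval.
have [_ _ LM] := laurent_subring k; apply: LM; first exact/power_laurent/hom_at_teval_power.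
by apply: laurent_inv; exact/power_laurent/hom_at_teval_power.
Qed.

Lemma hom_at_tpow d : ~~ (p %| `|denq d|)%N -> power_series (s (tpow k d)).
Proof.
move=> pd; have np : prime_to_p p `|denq d|%N by split; rewrite // absz_gt0 denq_eq0.
have [a [beta [a0 bP b1 sE]]] := hom_at_root np; have [[s1' _ sM] _ _] := Hs; have [Hs' _ _] := Hs.
have b0 : beta != 0 by apply/eqP => b0; move: b1; rewrite b0 => /esym/eqP; rewrite oner_eq0.
have Er : E (tpow k (`|denq d|%N)%:R^-1) by apply: KE; exact: K_root.
have dn : (`|denq d|%N)%:R = (denq d)%:~R :> rat by have := denq_gt0 d; case: (denq d).
have bV : power_series beta^-1 by apply: power_inv; rewrite // b1 oner_neq0.
have : tpow k d = tpow k (`|denq d|%N)%:R^-1 ^ numq d.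
  case: (numqE d) => /esym; rewrite -dn => numE.
  have dE : d = (`|denq d|%N)%:R^-1 * (numq d)%:~R.
    by rewrite -numE mulrC mulfK // pnatr_eq0 -lt0n; case: np.
  rewrite {1}dE; case: (numq d) => j.
    by rewrite -exprnP tpowX; congr (tpow k _); rewrite -pmulrn mulr_natr.
  rewrite -[RHS]/((tpow k _ ^+ j.+1)^-1) tpowX -tpowN; congr (tpow k _).
  by rewrite NegzE mulrNz mulrN -pmulrn mulr_natr.
move=> ->; case: (numq d) => j.
  rewrite -exprnP (hom_onX Es Hs') // sE exprZn -mulr_algl; have [_ _ SM] := power_subring k.
  by apply: SM; [exact: power_const|exact: (sringX (power_subring k))].
rewrite -[_ ^ _]/((tpow k _ ^+ j.+1)^-1) (hom_onV Es Hs'); last by apply: (sringX (subfield_subring Es)).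
rewrite (hom_onX Es Hs') // sE exprZn invrZ ?unitfE ?expf_neq0 // -exprVn -mulr_algl -[(beta ^+ _)^-1]exprVn.
have [_ _ SM] := power_subring k.
by apply: SM; [exact: power_const|exact: (sringX (power_subring k))].
Qed.

End Images.

(** In lowest terms, a nonzero root a of the denominator would give a pole under a homomorphism that
    sends t^(1/n) to a power series with constant coefficient a. The denominator is therefore a
    constant times a power of t^(1/n). *)
Lemma K_regular x : K x -> everywhere p (@power_series k) x -> exists n f (m : nat),
  prime_to_p p n /\ x = tpow k (- (n%:R^-1 *+ m)) * teval n%:R^-1 f.
Proof.
move=> Kx xP; have [n [f [g [np g0 xE]]]] := (K_fraction x).1 Kx.
pose d := gcdp f g; have d0 : d != 0 by rewrite gcdp_eq0 negb_and g0 orbT.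
pose f1 := f %/ d; pose g1 := g %/ d.
have fE : f = f1 * d by rewrite divpK ?dvdp_gcdl.
have gE : g = g1 * d by rewrite divpK ?dvdp_gcdr.
have g10 : g1 != 0 by apply: contra_neq g0 => g10; rewrite gE g10 mul0r.
have cop : coprimep f1 g1 by rewrite coprimep_div_gcd // g0 orbT.
have {}xE : x = teval n%:R^-1 f1 / teval n%:R^-1 g1.
  by rewrite xE fE gE !rmorphM /= -mulf_div divff ?mulr1 // teval_eq0 ?inv_neq0.
have noroot a : a != 0 -> ~~ root g1 a.
  move=> a0; apply/negP => ga; have [lambda [s [beta [l0 Hs bP b1 st]]]] := exists_hom_at np a0.
  have Ks : subfield_set K := @gen_subfield_closed _ _.
  have [Hs' _ _] := Hs; have [_ _ sM] := Hs'.
  have sxP : power_series (s x) by apply: (everywhere_all pchark xP _ Kx l0 Hs); exact: tower0.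
  have aP : power_series (a *: beta).
    by rewrite -mulr_algl; have [_ _ SM] := power_subring k; apply: SM => //; exact: power_const.
  have ev0 h : (horner_alg (a *: beta) h : M) 0 = h.[a] by exact: horner_alg_coef0.
  have : s x * s (teval n%:R^-1 g1) = s (teval n%:R^-1 f1).
    rewrite -sM //; last exact: K_teval.
    by rewrite xE divfK // teval_eq0 ?inv_neq0.
  rewrite !(hom_at_teval (@subset_refl _ K) Ks Hs) // st => E2.
  have : (s x * horner_alg (a *: beta) g1) 0 = (horner_alg (a *: beta) f1) 0 by rewrite E2.
  rewrite power_coef0M ?ev0 //; last exact: power_horner_alg.
  rewrite (eqP ga) mulr0 => /esym/eqP fa.
  by have := coprimep_root cop (fa : root f1 a); rewrite -[_ == 0]/(root g1 a) ga.
have [rs gr] := closed_field_poly_normal g1.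
have rs0 a : a \in rs -> a = 0.
  move=> ars; apply/eqP; apply: contraT => /noroot; rewrite gr rootZ ?lead_coef_eq0 //.
  by rewrite root_prod_XsubC ars.
have gX : g1 = lead_coef g1 *: 'X^(size rs).
  rewrite [LHS]gr; congr (_ *: _); elim: (rs) rs0 => [|a s IH] sr; first by rewrite big_nil.
  rewrite big_cons IH => [|b bs]; last by apply: sr; rewrite inE bs orbT.
  by rewrite (sr a) ?mem_head // subr0 -exprS.
exists n, ((lead_coef g1)^-1 *: f1), (size rs); split=> //.
rewrite xE gX linearZ /= rmorphXn /= tevalX tpowX linearZ /= lead_coefZ lead_coefXn mulr1.
have -> : (lead_coef g1)^-1%:A = (lead_coef g1)%:A^-1 :> M by exact: (fmorphV (in_alg M)).
by rewrite invfM tpowN; ring.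
Qed.

End BaseField.

(** * Artin-Schreier integers *)

Section ASIntegers.
Variables (k : closedFieldType) (p : nat).
Hypothesis pchark : p \in [pchar k].
Notation M := (glaurent k).
Implicit Types (x y g h : M) (E : set M) (s : M -> M) (lambda : k) (n m : nat) (f : {poly k}).

Let p_pr : prime p. Proof. exact: pcharf_prime pchark. Qed.
Let p_gt1 : (1 < p)%N. Proof. exact: prime_gt1. Qed.
Let p_gt0 : (0 < p)%N. Proof. exact: prime_gt0. Qed.
Let pcharM : p \in [pchar M]. Proof. exact: pchar_glaurent. Qed.
Let K : set M := K_set p (k:=k).
Let Ks : subfield_set K. Proof. exact: gen_subfield_closed. Qed.
Let Pr := power_subring k.
Let Lr := laurent_subring k.
Let frobMD x y : (x + y) ^+ p = x ^+ p + y ^+ p.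
Proof. by rewrite -[X in _ ^+ X](expn1 p) (gfrobD pchark). Qed.
Let frobMB x y : (x - y) ^+ p = x ^+ p - y ^+ p.
Proof. by rewrite -[X in _ ^+ X](expn1 p) (gfrobB pchark). Qed.
Let inv_neq0 n : prime_to_p p n -> n%:R^-1 != 0 :> rat.
Proof. by move=> [n0 _]; rewrite invr_eq0 pnatr_eq0 -lt0n. Qed.

Let constX (c : k) m : (c%:A : M) ^+ m = (c ^+ m)%:A.
Proof. by rewrite exprZn expr1n. Qed.

Definition AS_ring_closed (S : set M) := [/\ subring_set S, forall a : k, S (a%:A),
  forall d : rat, ~~ (p %| `|denq d|)%N -> S (tpow k d) & forall y, S (y ^+ p - y) -> S y].

Definition AS_integers : set M := [set x | forall S, AS_ring_closed S -> S x].
Let O := AS_integers.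

Lemma AS_integers_closed : AS_ring_closed O.
Proof.
split=> [|a S [_ Sa _ _]|d pd S [_ _ Sd _]|y Oy S SC]; [|exact: Sa|exact: Sd|].
  split=> [S|x y Ox Oy S|x y Ox Oy S] SC; have [[S1 SB SM] _ _ _] := SC => //.
    by apply: SB; [exact: Ox|exact: Oy].
  by apply: SM; [exact: Ox|exact: Oy].
by have [_ _ _ SA] := SC; apply: SA; exact: Oy.
Qed.

Lemma AS_integers_min S : AS_ring_closed S -> O `<=` S.
Proof. by move=> SC x; apply. Qed.

Let Or : subring_set O. Proof. by have [] := AS_integers_closed. Qed.
Let OM x y : O x -> O y -> O (x * y). Proof. by have [_ _ OM] := Or; apply: OM. Qed.
Let OB x y : O x -> O y -> O (x - y). Proof. by have [_ OB _] := Or; apply: OB. Qed.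
Let OD x y : O x -> O y -> O (x + y). Proof. exact: sringD. Qed.
Let OX x n : O x -> O (x ^+ n). Proof. exact: sringX. Qed.
Let O1 : O 1. Proof. by have [] := Or. Qed.
Let Oc (a : k) : O (a%:A). Proof. by have [_ Oa _ _] := AS_integers_closed; apply: Oa. Qed.
Let Ot d : ~~ (p %| `|denq d|)%N -> O (tpow k d).
Proof. by have [_ _ Od _] := AS_integers_closed; apply: Od. Qed.
Let OAS y : O (y ^+ p - y) -> O y. Proof. by have [_ _ _ OA] := AS_integers_closed; apply: OA. Qed.

Lemma denq_prime_to_p (z : int) n : prime_to_p p n -> ~~ (p %| `|denq (z%:~R / n%:R)|)%N.
Proof.
move=> [n0 pn]; apply: contra pn => pd; apply: dvdn_trans pd _.
set q := z%:~R / n%:R : rat; have nn : n%:R != 0 :> rat by rewrite pnatr_eq0 -lt0n.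
have E : numq q * n%:Z = z * denq q.
  apply/(@intr_inj rat); rewrite !intrM numqE -pmulrn mulrAC /q divfK //.
have cop := coprime_num_den q; rewrite coprime_sym in cop.
have : (`|denq q| %| `|numq q| * n)%N by rewrite -[n]/(`|n%:Z|%N) -abszM E abszM dvdn_mull.
by rewrite Gauss_dvdr.
Qed.

Let Oroot n (j : int) : prime_to_p p n -> O (tpow k (j%:~R / n%:R)).
Proof. by move=> np; apply: Ot; apply: denq_prime_to_p. Qed.

Lemma AS_integers_teval n f : prime_to_p p n -> O (teval n%:R^-1 f).
Proof.
move=> np; rewrite tevalE; apply: (sring_sum Or) => i _; rewrite -mulr_algl; apply: OM => //.
by have := Oroot i%:Z np; rewrite -pmulrn mulrC mulr_natr.
Qed.

Lemma K_tpow d : ~~ (p %| `|denq d|)%N -> K (tpow k d).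
Proof.
move=> pd; have np : prime_to_p p `|denq d|%N by split; rewrite // absz_gt0 denq_eq0.
have dn : (`|denq d|%N)%:R = (denq d)%:~R :> rat by have := denq_gt0 d; case: (denq d).
have dn0 : (`|denq d|%N)%:R != 0 :> rat by rewrite pnatr_eq0 -lt0n; case: np.
have dE : d = (numq d)%:~R / (`|denq d|%N)%:R by rewrite numqE -dn mulfK.
have KX j : K (tpow k (j%:R / (`|denq d|%N)%:R)).
  by rewrite mulrC mulr_natr -tpowX; apply: gsfX; exact: K_root.
rewrite dE; case: (numq d) => j; first exact: KX.
by rewrite NegzE mulrNz mulNr tpowN; apply: gsfV; exact: KX.
Qed.

Lemma AS_integers_everywhere : O `<=` everywhere p (@power_series k).
Proof.
apply: AS_integers_min; split=> [|a|d pd|y].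
- exact: everywhere_subring.
- exists K; first exact: tower0; split=> [|lambda s _ [_ -> _]]; [exact: K_const|exact: power_const].
- exists K; first exact: tower0; split=> [|lambda s l0 Hs]; first exact: K_tpow.
  exact: (hom_at_tpow pchark (@subset_refl _ K) Ks Hs).
- by apply: everywhere_AS => // eta; exact: power_AS.
Qed.

Lemma AS_integers_tower x : O x -> exists2 E, tower p O E & E x.
Proof.
pose S := [set x | O x /\ exists2 E, tower p O E & E x]; suff OS : O `<=` S by move=> /OS[].
apply: AS_integers_min; split=> [|a|d pd|y [Oy [E Et Ey]]].
- have op (f : M -> M -> M) : (forall x y, O x -> O y -> O (f x y)) ->
      (forall E x y, subfield_set E -> E x -> E y -> E (f x y)) -> forall x y, S x -> S y -> S (f x y).
    move=> fO fE {}x y [Ox [E1 E1t E1x]] [Oy [E2 E2t E2y]]; split; first exact: fO.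
    have [E [Et EE1 EE2 _]] := tower_join pchark E1t E2t; exists E => //.
    by apply: fE; [exact: tower_subfield Et|exact: EE1|exact: EE2].
  split.
  + by split=> //; exists K; [exact: tower0|exact: gsf1].
  + by apply: op => [//|E z y /subfield_subring[_ EB _]]; exact: EB.
  + by apply: op => [//|E z y /subfield_subring[_ _ EM]]; exact: EM.
- by split=> //; exists K; [exact: tower0|exact: K_const].
- by split; [exact: Ot|exists K; [exact: tower0|exact: K_tpow]].
- have Oy' := OAS Oy; split=> //; exists (adjoin E y); last exact: adjoin_gen.
  exact: tower_adjoin.
Qed.

(** Descent along a tower whose generators lie in O. The images of a generator y are power series,
    so [everywhere_coef] makes those of the coefficients of x in powers of y power series as
    well. *)
Lemma AS_tower_regular E x : tower p O E -> E x -> everywhere p (@power_series k) x -> O x.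
Proof.
move=> Et; elim: Et x => [x Kx xP|{}E y Et IH Oy Ef x Ax xP].
  have [n [f [m [np ->]]]] := K_regular pchark Kx xP; apply: OM; last exact: AS_integers_teval.
  by have := Oroot (- m%:Z) np; rewrite mulrNz mulNr -pmulrn mulrC mulr_natr.
have [Ey|nEy] := pselect (E y).
  by apply: IH => //; apply: (adjoin_min (tower_subfield Et) (@subset_refl _ E) Ey).
have Et' : tower p setT E by apply: tower_mono Et.
have [g gE xE] := (adjoinP pcharM (tower_subfield Et) Ef nEy x).1 Ax.
rewrite xE; apply: (sring_sum Or) => i _; apply: OM; last exact: OX.
apply: IH => //; apply: (everywhere_coef pchark Et' Ef nEy Pr gE) => //; first by rewrite -xE.
exact: AS_integers_everywhere.
Qed.

(** The localization of O at the nonzero polynomials in the t^(1/n), a ring that contains both K and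
    O. *)
Definition AS_fractions := [set x | exists n f, [/\ prime_to_p p n, f != 0 & O (x * teval n%:R^-1 f)]].
Let U := AS_fractions.

Lemma AS_fractions_subring : subring_set U.
Proof.
have common x y : U x -> U y -> exists n f, [/\ prime_to_p p n, f != 0, O (x * teval n%:R^-1 f) & O (y * teval n%:R^-1 f)].
  move=> [m [f [[m0 pm] f0 Ox]]] [n [g [[n0 pn] g0 Oy]]].
  exists (m * n)%N, ((f \Po 'X^n) * (g \Po 'X^m)); split; first by apply: (prime_to_pM pchark); split.
  - by rewrite mulf_neq0 // comp_poly_eq0 // size_polyXn ltnS.
  - rewrite rmorphM /= -teval_lift // mulrA [(m * n)%N]mulnC -teval_lift //.
    by apply: OM => //; apply: AS_integers_teval.
  - rewrite rmorphM /= -teval_lift // mulrCA mulrC [(m * n)%N]mulnC -teval_lift //.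
    by apply: OM => //; apply: AS_integers_teval.
split=> [|x y /common cx /cx[n [f [np f0 Ox Oy]]]|x y /common cx /cx[n [f [np f0 Ox Oy]]]].
- by exists 1%N, 1; rewrite oner_neq0 rmorph1 mulr1; split=> //; exact: prime_to_p1 pchark.
- by exists n, f; split=> //; rewrite mulrBl; apply: OB.
- exists n, (f * f); split=> //; first by rewrite mulf_neq0.
  by rewrite rmorphM /= mulrACA; apply: OM.
Qed.

Lemma AS_integers_fractions : O `<=` U.
Proof.
move=> x Ox; exists 1%N, 1; rewrite oner_neq0 rmorph1 mulr1; split=> //; exact: prime_to_p1 pchark.
Qed.

Lemma K_fractions : K `<=` U.
Proof.
move=> x /(K_fraction pchark)[n [f [g [np g0 ->]]]]; exists n, g; split=> //.
by rewrite divfK ?teval_eq0 ?inv_neq0 //; apply: AS_integers_teval.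
Qed.

Lemma AS_fractions_regular x : U x -> everywhere p (@power_series k) x -> O x.
Proof.
move=> [n [f [np f0 Ox]]] xP; have [E Et Ex] := AS_integers_tower Ox.
have [_ _ EM] := subfield_subring (tower_subfield Et); apply: (AS_tower_regular Et) => //.
have Ef : E (teval n%:R^-1 f) by apply: (tower_K Et); exact: K_teval.
rewrite -(mulfK (_ : teval n%:R^-1 f != 0) x); last by rewrite teval_eq0 ?inv_neq0.
by apply: EM => //; apply: subfieldV => //; exact: tower_subfield Et.
Qed.

(* A point of the curve t^(1/n) = a where g does not vanish, if t^(1/n) - a does not divide g. *)
Lemma AS_nullstellensatz n (a : k) g : prime_to_p p n -> a != 0 -> O g ->
  ~ O (g / teval n%:R^-1 ('X - a%:P)) ->
  exists lambda E s (beta : M), [/\ lambda != 0, tower p O E /\ E g, hom_at lambda E s /\ power_series beta,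
    beta 0 = 1 /\ s (tpow k n%:R^-1) = a *: beta & power_series (s g) /\ s g 0 != 0].
Proof.
move=> np a0 Og nOg; set u := teval _ _ in nOg; have [E Et Eg] := AS_integers_tower Og.
have Es := tower_subfield Et; have Et' : tower p setT E by apply: tower_mono Et.
have KE := tower_K Et; have Eu : E u by apply: KE; exact: K_teval.
have Egu : E (g / u) by have [_ _ EM] := subfield_subring Es; apply: EM => //; exact: subfieldV.
have [lambda [s [l0 Hs nP]]] : exists lambda s, [/\ lambda != 0, hom_at lambda E s & ~ power_series (s (g / u))].
  apply: contrapT => nex; apply: nOg; apply: (AS_tower_regular Et) => //; exists E => //; split=> // lambda s l0 Hs.
  by apply: contrapT => nP; apply: nex; exists lambda, s.
have [a' [beta [a'0 bP b1 sE]]] := hom_at_root pchark KE Es Hs l0 np.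
have gP : power_series (s g) := everywhere_all pchark (AS_integers_everywhere Og) Et' Eg l0 Hs.
have [Hs' sc _] := Hs; have [_ sD sM] := Hs'.
have su : s u = a' *: beta - a%:A.
  rewrite /u (hom_at_teval KE Es Hs _ np) sE rmorphB /= /horner_alg /horner_morph.
  by rewrite map_polyX map_polyC hornerX hornerC.
have uP : power_series (s u).
  have [_ PB PM] := Pr; rewrite su; apply: PB; last exact: power_const.
  by rewrite -mulr_algl; apply: PM => //; exact: power_const.
have sgu : s (g / u) = s g / s u by rewrite (hom_on_div Es Hs').
have su0 : (s u) 0 = a' - a by rewrite su gcoefB !gcoefZ b1 gcoef1 eqxx !mulr1.
have aa' : a' = a.
  apply: contrapT => /eqP aa'; apply: nP; rewrite sgu; have [_ _ PM] := Pr; apply: PM => //.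
  by apply: power_inv => //; rewrite su0 subr_eq0.
exists lambda, E, s, beta; split=> //; first by rewrite sE aa'.
split=> //; apply/eqP => g0; apply: nP; rewrite sgu.
have [v [vP v0]] := hom_at_uniformizer KE Es Hs l0 np a0 bP b1 (etrans sE (congr1 (fun b => b *: beta) aa')).
rewrite -/u => ->; rewrite invfM mulrA -tpowN; have [_ _ PM] := Pr.
by apply: PM; [rewrite mulrC; exact: power_shift|exact: power_inv].
Qed.

(** The elements congruent to p-th powers modulo u are stable under the operations that generate O.
    A monomial t^d is a p-th power times some t^l, and t is congruent to the constant a^n. If y^p -
    y = h^p + u r, then y = (y - h)^p - u r. *)
Lemma AS_integers_perfect n (a : k) g : prime_to_p p n -> a != 0 -> O g ->
  exists h r, [/\ O h, O r & g = h ^+ p + teval n%:R^-1 ('X - a%:P) * r].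
Proof.
move=> np a0; set u := teval _ _.
pose S := [set g | O g /\ exists h r, [/\ O h, O r & g = h ^+ p + u * r]].
suff OS : O `<=` S by move=> /OS[].
have Ou : O u by apply: AS_integers_teval.
apply: AS_integers_min; split.
- split=> [|x y [Ox [h [r [Oh O_r xE]]]] [Oy [h' [r' [Oh' O_r' yE]]]]|
    x y [Ox [h [r [Oh O_r xE]]]] [Oy [h' [r' [Oh' O_r' yE]]]]].
  + by split=> //; exists 1, 0; split; [|exact: (sring0 Or)|rewrite expr1n mulr0 addr0].
  + split; first exact: OB; exists (h - h'), (r - r'); split; [exact: OB|exact: OB|].
    by rewrite xE yE frobMB; ring.
  + split; first exact: OM; exists (h * h'), (h ^+ p * r' + r * (h' ^+ p + u * r')); split.
    * exact: OM.
    * by apply: OD; apply: OM => //; [exact: OX|rewrite -yE].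
    * by rewrite xE yE exprMn; ring.
- move=> b; split=> //; exists ((proot pchark 1 b)%:A), 0; split=> //; first exact: (sring0 Or).
  by rewrite mulr0 addr0 constX -[X in _ ^+ X](expn1 p) prootK.
- move=> d pd; split; first exact: Ot.
  have mp : prime_to_p p `|denq d|%N by split; rewrite // absz_gt0 denq_eq0.
  set m := `|denq d|%N in pd mp; have [m0 _] := mp.
  have dn : m%:R = (denq d)%:~R :> rat by rewrite /m; have := denq_gt0 d; case: (denq d).
  have mn0 : m%:R != 0 :> rat by rewrite pnatr_eq0 -lt0n.
  have dE : d = (numq d)%:~R / m%:R by rewrite numqE -dn mulfK.
  (* The denominator m being prime to p, the numerator is l m + p w; reduction modulo p keeps l
     natural. *)
  have [l [w lE]] : exists (l : nat) (w : int), numq d = l%:Z * m%:Z + p%:Z * w.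
    have cop : coprime m p by rewrite coprime_sym prime_coprime.
    have [i j ij _] := egcdnP p m0; move: ij; rewrite (eqP cop) => ij.
    pose z := numq d; pose b := (z %% p%:Z)%Z; have b0 : 0 <= b by rewrite modz_ge0 // gt_eqF // ltz_nat.
    exists (i * `|b|)%N, ((z %/ p%:Z)%Z - j%:Z * b).
    have bE : (`|b|%N : int) = b by rewrite gez0_abs.
    rewrite PoszM bE /z; have ijz : i%:Z * m%:Z = j%:Z * p%:Z + 1 by rewrite -!PoszM ij PoszD.
    rewrite [LHS](divz_eq _ p%:Z) -/z -/b.
    have -> : i%:Z * b * m%:Z = b * (i%:Z * m%:Z) by ring.
    by rewrite ijz; ring.
  have tE : tpow k d = tpow k (w%:~R / m%:R) ^+ p * tpow k 1 ^+ l :> M.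
    rewrite !tpowX -tpowD; congr (tpow k _); rewrite {1}dE lE intrD !intrM -!pmulrn.
    by rewrite -[w%:~R / m%:R *+ p]mulr_natr; field.
  have [r O_r tl] : exists2 r, O r & tpow k 1 ^+ l = (a ^+ (n * l))%:A + u * r.
    have [n0 _] := np; have t1 : tpow k 1 = teval n%:R^-1 'X ^+ n :> M.
      by rewrite tevalX tpowX -[_ *+ n]mulr_natr mulVf // pnatr_eq0 -lt0n.
    exists (teval n%:R^-1 (\sum_(i < n * l) 'X^(n * l - 1 - i) * a%:P ^+ i)).
      exact: AS_integers_teval.
    rewrite t1 -exprM -rmorphXn /u -rmorphM /= -(tevalC n%:R^-1) -rmorphD /=; congr (teval _ _).
    have := subrXX ('X : {poly k}) a%:P (n * l); rewrite polyC_exp => E.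
    rewrite -[LHS](subrK (a%:P ^+ (n * l))) E addrC; congr (_ + _ * _).
    by apply: eq_bigr => i _; rewrite -subn1.
  pose c := proot pchark 1 (a ^+ (n * l)).
  exists (c%:A * tpow k (w%:~R / m%:R)), (tpow k (w%:~R / m%:R) ^+ p * r); split.
  + by apply: OM => //; exact: Oroot.
  + by apply: OM => //; apply: OX; exact: Oroot.
  + rewrite tE tl exprMn constX -[X in c ^+ X](expn1 p) prootK.
    by ring.
- move=> y [Oy [h [r [Oh O_r yE]]]]; have Oy' := OAS Oy; split=> //.
  exists (y - h), (- r); split; [exact: OB|exact: (sringN Or)|].
  by rewrite frobMB mulrN; rewrite -[LHS](subKr (y ^+ p)) yE; ring.
Qed.

Lemma everywhere_mono (Z Z' : set M) : Z `<=` Z' -> everywhere p Z `<=` everywhere p Z'.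
Proof. by move=> ZZ x [E Et [Ex xZ]]; exists E => //; split=> // lambda s l0 /(xZ _ _ l0)/ZZ. Qed.

Lemma AS_integers_laurent : O `<=` everywhere p (@laurent_series k).
Proof. by move=> x /AS_integers_everywhere; apply: everywhere_mono; exact: power_laurent. Qed.

(* O is perfect modulo u = t^(1/n) - a. If y^p - y has a pole of order p e along u then its
   leading coefficient is h^p modulo u for some h in O, and y - h / u^e has a smaller pole. *)
Lemma pole_reduction n f y : prime_to_p p n -> f != 0 -> everywhere p (@laurent_series k) y ->
  O ((y ^+ p - y) * teval n%:R^-1 f) -> U y.
Proof.
move=> np; have [N] := ubnP (size f); elim: N f y => // N IH f y; rewrite ltnS => fN f0 yL Oyf.
have Lev : subring_set (everywhere p (@laurent_series k)) by apply: everywhere_subring.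
have [_ LB LM] := Lev; have [_ UB UM] := AS_fractions_subring.
have [noroot|] := pselect (forall a, a != 0 -> ~~ root f a).
  (* Without nonzero roots f is a constant times a power of X, so its value at t^(1/n) is invertible
     in O. *)
  apply: AS_integers_fractions; apply: OAS.
  have [rs fr] := closed_field_poly_normal f.
  have rs0 a : a \in rs -> a = 0.
    move=> ars; apply/eqP; apply: contraT => /noroot; rewrite fr rootZ ?lead_coef_eq0 //.
    by rewrite root_prod_XsubC ars.
  have fX : f = lead_coef f *: 'X^(size rs).
    rewrite [LHS]fr; congr (_ *: _); elim: (rs) rs0 => [|a s' IHs] sr; first by rewrite big_nil.
    rewrite big_cons IHs => [|b bs]; last by apply: sr; rewrite inE bs orbT.
    by rewrite (sr a) ?mem_head // subr0 -exprS.
  have := OM Oyf (OM (Oc (lead_coef f)^-1) (Oroot (- (size rs)%:Z) np)).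
  congr (O _); rewrite {1}fX -mul_polyC rmorphM /= tevalC rmorphXn /= tevalX tpowX.
  rewrite mulrACA -!mulrA [X in _ * X](_ : _ = 1) ?mulr1 //.
  have cc : (lead_coef f)%:A * (lead_coef f)^-1%:A = 1 :> M.
    by rewrite mulr_algl scalerA mulfV ?scale1r // lead_coef_eq0.
  rewrite mulrA [_^-1%:A * _]mulrC cc mul1r -tpowD mulrNz mulNr -pmulrn -[_ *+ _]mulr_natr mulrC subrr tpow0 //.
move=> /existsNP[a /not_implyP[a0 /negP/negPn fa]].
have [e [f1]] := multiplicity_XsubC f a; rewrite f0 /= => f1a fE.
have e0 : (0 < e)%N.
  by rewrite lt0n; apply: contraTneq fa => e0; rewrite fE e0 expr0 mulr1.
have f10 : f1 != 0 by apply: contraNneq f1a => ->; rewrite root0.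
set u := teval n%:R^-1 ('X - a%:P); set w1 := teval n%:R^-1 f1.
have u0 : u != 0 by rewrite teval_eq0 ?inv_neq0 // polyXsubC_eq0.
have w10 : w1 != 0 by rewrite teval_eq0 ?inv_neq0.
have uE : teval n%:R^-1 f = w1 * u ^+ e by rewrite fE rmorphM rmorphXn.
pose f' := f1 * ('X - a%:P) ^+ e.-1.
have f'0 : f' != 0 by rewrite mulf_neq0 // expf_neq0 // polyXsubC_eq0.
have f'N : (size f' < N)%N.
  apply: leq_trans fN; rewrite fE /f' !size_mul ?expf_neq0 ?polyXsubC_eq0 // !size_exp_XsubC.
  by rewrite -(prednK e0) /= !addnS.
have u'E : teval n%:R^-1 f' = w1 * u ^+ e.-1 by rewrite /f' rmorphM rmorphXn.
set g := (y ^+ p - y) * _ in Oyf.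
have [Ogu|nOgu] := pselect (O (g / u)).
  apply: (IH f') => //; rewrite u'E; congr (O _): Ogu.
  rewrite /g uE; have -> : u ^+ e = u * u ^+ e.-1 by rewrite -exprS prednK.
  by rewrite [w1 * _]mulrCA [_ * (u * _)]mulrCA mulrAC divff // mul1r.
have [lambda [E [s [beta [l0 [Et Eg] [Hs bP] [b1 sE] [sgP sg0]]]]]] := AS_nullstellensatz np a0 Oyf nOgu.
have [Ey Eyt [Eyy _]] := yL; have Et' : tower p setT E by apply: tower_mono Et.
have [E2 [E2t EE2 EyE2 ext]] := tower_join pchark Et' Eyt; have [s2 Hs2 s2E] := ext _ _ Hs.
have E2s := tower_subfield E2t; have KE2 := tower_K E2t; have [Hs2' _ _] := Hs2.
have E2y := EyE2 _ Eyy; have [_ E2B E2M] := subfield_subring E2s.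
have E2yp : E2 (y ^+ p - y) by apply: E2B => //; exact: (sringX (subfield_subring E2s)).
have etaL : laurent_series (s2 y) := everywhere_all pchark yL E2t E2y l0 Hs2.
have s2r : s2 (tpow k n%:R^-1) = a *: beta.
  by rewrite s2E //; apply: (tower_K Et); exact: K_root.
have [v [vP v0 vE]] := hom_at_uniformizer KE2 E2s Hs2 l0 np a0 bP b1 s2r.
have w'E : s2 w1 = horner_alg (a *: beta) f1 by rewrite (hom_at_teval KE2 E2s Hs2 _ np) s2r.
have w'P : power_series (s2 w1) by apply: (hom_at_teval_power pchark KE2 E2s Hs2 l0).
have w'0 : s2 w1 0 != 0 by rewrite w'E horner_alg_coef0.
have [_ _ PM] := Pr; have veP : power_series (v ^+ e) := sringX Pr e vP.
have D0 : (s2 w1 * v ^+ e) 0 != 0 by rewrite power_coef0M // power_coef0X // mulf_neq0 // expf_neq0.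
have DP : power_series (s2 w1 * v ^+ e) by apply: PM.
pose F0 := s g / (s2 w1 * v ^+ e).
have F0P : power_series F0 by apply: PM => //; exact: power_inv.
have F00 : F0 0 != 0 by rewrite power_coef0M ?mulf_neq0 //; [exact: power_inv_coef0|exact: power_inv].
have E2w : E2 w1 by apply: KE2; exact: K_teval.
have E2u : E2 u by apply: KE2; exact: K_teval.
have etaE : s2 y ^+ p - s2 y = tpow k (- e%:R) * F0.
  rewrite -(hom_onX E2s Hs2') // -(hom_onB E2s Hs2') //; last exact: (sringX (subfield_subring E2s)).
  have -> : y ^+ p - y = g / (w1 * u ^+ e) by rewrite /g uE mulfK // mulf_neq0 // expf_neq0.
  have E2ue : E2 (u ^+ e) by exact: (sringX (subfield_subring E2s)).
  have [_ _ s2M] := Hs2'; have E2g : E2 g := EE2 _ Eg.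
  have E2wu : E2 (w1 * u ^+ e) by exact: E2M E2w E2ue.
  rewrite (hom_on_div E2s Hs2' E2g E2wu) (s2M _ _ E2w E2ue) (hom_onX E2s Hs2') // vE (s2E _ Eg) /F0 exprMn tpowX tpowN; have t0 := tpow_neq0 k e%:R.
  by rewrite (mulrCA (s2 w1)) [in LHS]invfM mulrCA.
(* At this place g does not vanish and w1 is a unit, so y^p - y has a pole of order exactly e. *)
have pe : (p %| e)%N.
  apply: (laurent_AS_pole pchark etaL e0); rewrite etaE.
    by rewrite tpowM subrr.
  by move=> x; rewrite tpowM opprK => /F0P[j xE]; rewrite -subr_ge0 opprK xE ler0n.
have [e1 eE] := dvdnP pe; have e10 : (0 < e1)%N by move: e0; rewrite eE; case: (e1).
have e1e : (e1 <= e.-1)%N.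
  rewrite -ltnS (prednK e0) eE -{1}[e1]muln1 ltn_pmul2l //.
(* c is the residue of w1 modulo u. When g / c is congruent to h^p, the p-th power of h / u^(e/p)
   has the same leading term along u as y^p - y = g / (w1 u^e). *)
pose c := f1.[a]; have c0 : c != 0 by [].
have Ogc : O (g * (c^-1)%:A) by apply: OM.
have [h [r [Oh O_r hE]]] := AS_integers_perfect np a0 Ogc; rewrite -/u in hE.
have [q qE] : exists q, f1 - c%:P = q * ('X - a%:P).
  by apply/factor_theorem; rewrite rootE !hornerE /c subrr.
have w1E : w1 = c%:A + teval n%:R^-1 q * u.
  have f1E : f1 = q * ('X - a%:P) + c%:P by rewrite -qE subrK.
  by rewrite /w1 f1E rmorphD rmorphM /= tevalC addrC.
have gE : g = c%:A * (h ^+ p + u * r).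
  by rewrite -hE mulrCA mulr_algl scalerA mulfV // scale1r mulr1.
set X := u ^+ (e.-1 - e1); set Y := u ^+ e1.
have X0 : X != 0 by exact: expf_neq0.
have Y0 : Y != 0 by exact: expf_neq0.
have YX : u ^+ e.-1 = Y * X by rewrite /Y /X -exprD subnKC.
have uYX : u ^+ e = u * (Y * X) by rewrite -YX -exprS prednK.
have OhY : everywhere p (@laurent_series k) (h / Y).
  apply: LM; first exact: AS_integers_laurent.
  apply: everywhereV => [z|]; first exact: laurent_inv.
  by apply: AS_integers_laurent; apply: OX; apply: AS_integers_teval.
have Uy' : U (y - h / Y).
  apply: (IH f') => //; first exact: LB.
  rewrite u'E frobMB expr_div_n -exprM -eE -/Y.
  suff -> : (y ^+ p - h ^+ p / u ^+ e - (y - h / Y)) * (w1 * u ^+ e.-1) =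
      c%:A * r - teval n%:R^-1 q * h ^+ p + h * X * w1.
    apply: OD; [apply: OB; apply: OM => //|apply: OM; last exact: AS_integers_teval].
    + by apply: AS_integers_teval.
    + exact: OX.
    + by apply: OM => //; apply: OX; apply: AS_integers_teval.
  have DE : y ^+ p - y = c%:A * (h ^+ p + u * r) / (w1 * (u * (Y * X))).
    by rewrite -gE /g uE -uYX mulfK // mulf_neq0 // expf_neq0.
  rewrite YX uYX (_ : _ - _ - _ = (y ^+ p - y) - h ^+ p / (u * (Y * X)) + h / Y); last by ring.
  apply: (mulfI u0); rewrite DE.
  have -> : c%:A = w1 - teval n%:R^-1 q * u by rewrite w1E addrK.
  have idn (w q' z h' r' X' Y' : M) : w != 0 -> z != 0 -> X' != 0 -> Y' != 0 ->
      z * (((w - q' * z) * (h' ^+ p + z * r') / (w * (z * (Y' * X'))) -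
        h' ^+ p / (z * (Y' * X')) + h' / Y') * (w * (Y' * X'))) =
      z * ((w - q' * z) * r' - q' * h' ^+ p + h' * X' * w).
    by move=> *; field; do ?[apply/andP; split].
  exact: idn.
rewrite -(subrK (h / Y) y); apply: (sringD AS_fractions_subring) => //.
exists n, (('X - a%:P) ^+ e1); rewrite expf_neq0 ?polyXsubC_eq0 //; split=> //.
by rewrite rmorphXn /= -/u divfK.
Qed.

(** Descent along the tower. If x has degree d + 1 > 0 in y, the generator is changed to y' = y +
    g_d / ((d + 1) g_(d+1)), whose images are Laurent series by [everywhere_top] and
    [everywhere_next]. Then y'^p - y' is covered by the induction and [pole_reduction] applies to
    y'; the coefficients of x in powers of y' have Laurent images too, and the induction covers
    them. *)
Lemma laurent_fractions E x : tower p setT E -> E x -> everywhere p (@laurent_series k) x -> U x.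
Proof.
move=> Et; elim: Et x => [x Kx _|{}E y Et IH _ Ef x Ax xL]; first exact: K_fractions.
have Es := tower_subfield Et; have [Ur1 UB UM] := AS_fractions_subring.
have Lev : subring_set (everywhere p (@laurent_series k)) by apply: everywhere_subring.
have [_ LB LM] := Lev; have [E1 EB EM] := subfield_subring Es.
have LV z : everywhere p (@laurent_series k) z -> everywhere p (@laurent_series k) z^-1.
  by apply: everywhereV; exact: laurent_inv.
have [Ey|nEy] := pselect (E y).
  by apply: IH => //; apply: (adjoin_min Es (@subset_refl _ E) Ey).
have [g' g'E xE'] := (adjoinP pcharM Es Ef nEy x).1 Ax.
pose g i := if (i < p)%N then g' i else 0.
have gE i : E (g i) by rewrite /g; case: ifP => // _; exact: (sring0 (subfield_subring Es)).
have xE : x = \sum_(i < p) g i * y ^+ i.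
  by rewrite xE'; apply: eq_bigr => i _; rewrite /g ltn_ord.
have gp i : (p <= i)%N -> g i = 0 by rewrite leqNgt /g => /negPf ->.
have xL' : everywhere p (@laurent_series k) (\sum_(i < p) g i * y ^+ i) by rewrite -xE.
have [[d [d0 gd gmax]]|nd] := pselect (exists d, [/\ (0 < d)%N, g d != 0 & forall i, (d < i)%N -> g i = 0]); last first.
  apply: IH => //; rewrite xE.
  have ex0 i : (0 < i)%N -> g i = 0.
    move=> i0; apply/eqP; apply: contra_notT nd => gi.
    have ex : exists i, (0 < i)%N && (g i != 0) by exists i; rewrite i0.
    have ub j : (0 < j)%N && (g j != 0) -> (j <= p)%N.
      by move=> /andP[_]; apply: contraNT; rewrite -ltnNge => /ltnW/gp ->.
    case: (ex_maxnP ex ub) => d /andP[d0 gd] dmax; exists d; split=> // j dj.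
    apply/eqP; apply: contraTT dj => gj; rewrite -leqNgt.
    by case: j gj => // j gj; apply: dmax.
  rewrite -(prednK p_gt0) big_ord_recl big1 ?addr0 => [|i _]; last by rewrite ex0 // mul0r.
  by rewrite expr0 mulr1.
case: d d0 gd gmax => // d _ gd gmax.
have dp : (d.+1 < p)%N by rewrite ltnNge; apply: contra gd => /gp ->.
have topL := everywhere_top pchark Et Ef nEy Lr gE xL' dp gmax.
have nextL := everywhere_next pchark Et Ef nEy Lr gE xL' dp gmax.
have d1 : d.+1%:R != 0 :> M.
  by rewrite -(dvdn_pcharf pcharM); apply/negP => /(dvdn_leq (ltn0Sn d)); rewrite leqNgt dp.
have Lnat m : everywhere p (@laurent_series k) m%:R.
  by apply: (sring_nat Lev); have [] := Lev.
have Enat m : E m%:R by apply: (sring_nat (subfield_subring Es)).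
pose h := g d / (g d.+1 * d.+1%:R); pose y' := y + h.
have Egd : E (g d.+1 * d.+1%:R) by exact: EM (gE _) (Enat _).
have Eh : E h by exact: EM (gE _) (subfieldV Es Egd).
have y'E : y' = (g d + g d.+1 * y *+ d.+1) / (g d.+1 * d.+1%:R).
  have -> : g d.+1 * y *+ d.+1 = y * (g d.+1 * d.+1%:R) by rewrite -[_ *+ _]mulr_natr; ring.
  by rewrite mulrDl mulfK ?mulf_neq0 // /y' /h addrC.
have y'L : everywhere p (@laurent_series k) y'.
  by rewrite y'E; exact: LM _ _ nextL (LV _ (LM _ _ topL (Lnat _))).
have y'f : y' ^+ p - y' = (y ^+ p - y) + (h ^+ p - h) by rewrite /y' frobMD; ring.
have Ef' : E (y' ^+ p - y').
  rewrite y'f; apply: (sringD (subfield_subring Es)) => //; apply: EB => //; exact: (sringX (subfield_subring Es)).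
have fL : everywhere p (@laurent_series k) (y' ^+ p - y') by exact: LB (sringX Lev p y'L) y'L.
have [n [f [np f0 Oyf]]] := IH _ Ef' fL.
have Uy' := pole_reduction np f0 y'L Oyf.
have nEy' : ~ E y' by move=> Ey'; apply: nEy; rewrite -(addrK h y); apply: EB.
have Ax' : adjoin E y' x.
  apply: (adjoin_min _ _ _ Ax); [exact: gen_subfield_closed|exact: adjoin_sub|].
  have [_ AB _] := subfield_subring (@gen_subfield_closed _ (E `|` [set y'])).
  by rewrite -(addrK h y); apply: AB; [exact: adjoin_gen|exact: adjoin_sub].
have [gg ggE xE2] := (adjoinP pcharM Es Ef' nEy' x).1 Ax'.
have xL2 : everywhere p (@laurent_series k) (\sum_(i < p) gg i * y' ^+ i) by rewrite -xE2.
rewrite xE2; apply: (sring_sum AS_fractions_subring) => i _; apply: UM.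
  by apply: IH => //; apply: (everywhere_coef pchark Et Ef' nEy' Lr ggE xL2).
exact: (sringX AS_fractions_subring).
Qed.

Theorem everywhere_power_series : everywhere p (@power_series k) = O.
Proof.
apply/seteqP; split=> x; last exact: AS_integers_everywhere.
move=> xP; apply: AS_fractions_regular => //; have [E Et [Ex _]] := xP.
apply: laurent_fractions Et Ex _; exact: everywhere_mono (@power_laurent k) _ xP.
Qed.

End ASIntegers.

(** * The comparison of C and O *)

Section CtildeIntegers.
Variables (k : closedFieldType) (p : nat).
Hypothesis pchark : p \in [pchar k].
Notation M := (glaurent k).
Implicit Types (F G : M) (c d q : rat).

Let p_pr : prime p. Proof. exact: pcharf_prime pchark. Qed.
Let p_gt1 : (1 < p)%N. Proof. exact: prime_gt1. Qed.
Let p_gt0 : (0 < p)%N. Proof. exact: prime_gt0. Qed.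
Let O : set M := AS_integers p (k:=k).
Let zp q := ~~ (p %| `|denq q|)%N.
Let HO : AS_ring_closed p O. Proof. exact: AS_integers_closed. Qed.
Let pX_gt0 j : 0 < (p ^ j)%:R :> rat. Proof. by rewrite ltr0n expn_gt0 p_gt0. Qed.
Let HC : nontrivial_AS_closed_subalg p (Ctilde p k). Proof. exact: Ctilde_closed. Qed.

Let zp_fraction q : exists2 n, (0 < n)%N & q = (numq q)%:~R / n%:R /\ n = `|denq q|%N.
Proof.
exists `|denq q|%N; first by rewrite absz_gt0 denq_eq0.
split=> //; have -> : (`|denq q|%N)%:R = (denq q)%:~R :> rat by have := denq_gt0 q; case: (denq q).
by rewrite numqE mulfK // intr_eq0 denq_eq0.
Qed.

Let zpM c d : zp c -> zp d -> zp (c * d).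
Proof.
have [m m0 [cE mE]] := zp_fraction c; have [n n0 [dE nE]] := zp_fraction d.
rewrite {1}/zp -mE {1}/zp -nE => pm pn; rewrite cE dE mulf_div -intrM -natrM.
by rewrite /zp; apply: denq_prime_to_p; apply: (prime_to_pM pchark); split.
Qed.

Let zp_pX j : zp (p ^ j)%:R.
Proof. by rewrite /zp -[(p ^ j)%:R]/((p ^ j)%N%:Z%:~R) denq_int dvdn1 gtn_eqF. Qed.

Let zp_scaled q : exists j0, forall j, (j0 <= j)%N -> zp ((p ^ j)%:R * q).
Proof.
have [n n0 [-> _]] := zp_fraction q; have [m pm nE] := pfactor_coprime p_pr n0.
set l := logn p n in nE; exists l => j lj.
have m0 : (0 < m)%N by move: n0; rewrite nE muln_gt0 => /andP[].
have -> : (p ^ j)%:R * ((numq q)%:~R / n%:R) = ((p ^ (j - l))%N%:Z * numq q)%:~R / m%:R :> rat.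
  rewrite nE intrM -pmulrn -{1}(subnK lj) expnD !natrM; field.
  by rewrite !pnatr_eq0 -!lt0n m0 expn_gt0 p_gt0.
by rewrite /zp; apply: denq_prime_to_p; split=> //; rewrite -prime_coprime.
Qed.

Lemma AS_integers_gsubst c F : 0 < c -> zp c -> O F -> O (gsubst c F).
Proof.
move=> c0 cz; have [[O1 OB OM] Oa Od OA] := HO.
apply: (@AS_integers_min k p [set F | O (gsubst c F)]); split.
- split=> [|x y xO yO|x y xO yO]; rewrite /mkset.
  + by rewrite gsubst1.
  + by rewrite gsubstD gsubstN; apply: OB.
  + by rewrite gsubstM //; apply: OM.
- by move=> a; rewrite /mkset gsubstZ gsubst1.
- by move=> d dz; rewrite /mkset /tpow gsubst_mono //; apply: Od; apply: zpM.
- by move=> y; rewrite /mkset gsubstD gsubstN gsubstX // => /OA.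
Qed.

Lemma AS_integers_gtwist chi F : (forall q r, chi (q + r) = chi q * chi r) -> chi 1 != 0 ->
  O F -> O (gtwist chi F).
Proof.
move=> chiD chi1; have [[O1 OB OM] Oa Od OA] := HO.
have twN x : gtwist chi (- x) = - gtwist chi x.
  by apply: glaurentP => e; rewrite gcoefN !gtwistE gcoefN mulNr.
apply: (@AS_integers_min k p [set F | O (gtwist chi F)]); split.
- split=> [|x y xO yO|x y xO yO]; rewrite /mkset.
  + by rewrite gtwist1.
  + by rewrite gtwistD twN; apply: OB.
  + by rewrite gtwistM //; apply: OM.
- by move=> a; rewrite /mkset gtwistZ gtwist1.
- move=> d dz; rewrite /mkset /tpow gtwist_mono mul1r (_ : gmono d (chi d) = (chi d)%:A * tpow k d).
    by apply: OM; [exact: Oa|exact: Od].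
  by apply: glaurentP => e; rewrite mulr_algl gcoefZ !gmonoE; case: (e =P d); rewrite ?mulr1 ?mulr0.
- by move=> y; rewrite /mkset gtwistD twN gtwistX // => /OA.
Qed.

Let lift F j J : (j <= J)%N -> O (gsubst (p ^ j)%:R F) -> O (gsubst (p ^ J)%:R F).
Proof.
move=> jJ OF; have -> : gsubst (p ^ J)%:R F = gsubst (p ^ (J - j))%:R (gsubst (p ^ j)%:R F).
  by rewrite gsubst_comp // -natrM -expnD subnK.
exact: AS_integers_gsubst.
Qed.

(** A monomial whose exponent has p in its denominator enters O after some t -> t^(p^j), and with
    this freedom the right-hand side is Artin-Schreier closed. Conversely O is generated by
    operations under which C is stable. *)
Theorem Ctilde_integers : Ctilde p k = [set F | exists j : nat, O (gsubst (p ^ j)%:R F)].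
Proof.
have [[O1 OB OM] Oa Od OA] := HO; apply/seteqP; split=> F; last first.
  move=> [j OF]; have OC : O `<=` Ctilde p k.
    apply: AS_integers_min; split=> [|a|d _|y yC].
    - split=> [|x y|x y]; [exact: (AScl1 HC)|exact: (AScl_sub HC)|exact: (AScl_mul HC)].
    - by apply: (AScl_scale HC); exact: (AScl1 HC).
    - exact: (AScl_tpow HC).
    - by apply: (AScl_AS HC (AScl_opp HC yC)); rewrite subrr.
  rewrite -[F]gsubst_id -(mulVf (lt0r_neq0 (pX_gt0 j))) -gsubst_comp ?invr_gt0 //.
  by apply: (AScl_gsubst HC); rewrite ?invr_gt0 //; apply: OC.
apply: Ctilde_min; apply: AS_closed_nontrivial.
- have common x y : (exists j, O (gsubst (p ^ j)%:R x)) -> (exists j, O (gsubst (p ^ j)%:R y)) ->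
      exists j, O (gsubst (p ^ j)%:R x) /\ O (gsubst (p ^ j)%:R y).
    move=> [i xO] [j yO]; exists (maxn i j); split; [apply: lift xO|apply: lift yO].
      exact: leq_maxl.
    exact: leq_maxr.
  split=> [|a x y /set_mem xS /set_mem yS|x y /set_mem xS /set_mem yS]; apply/mem_set.
  + by exists 0%N; rewrite gsubst1.
  + have [j [xO yO]] := common _ _ xS yS; exists j; rewrite gsubstD gsubstZ.
    apply: (sringD (And3 O1 OB OM)) => //; rewrite -mulr_algl; exact: OM.
  + by have [j [xO yO]] := common _ _ xS yS; exists j; rewrite gsubstM //; apply: OM.
- move=> F' G [j OF] FG; exists j; apply: OA.
  have -> : gsubst (p ^ j)%:R G ^+ p - gsubst (p ^ j)%:R G = - gsubst (p ^ j)%:R F'.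
    apply/eqP; rewrite -addr_eq0; apply/eqP.
    by rewrite -gsubstX // -gsubstN -!gsubstD FG gsubst0.
  exact: (sringN (And3 O1 OB OM)).
- move=> F' alpha chi [j OF] al0 [chi1 chiD]; exists j.
  pose chi' q := chi (q / (p ^ j)%:R).
  have -> : gsubst (p ^ j)%:R (gtwist chi F') = gtwist chi' (gsubst (p ^ j)%:R F').
    by apply: glaurentP => e; rewrite gsubstE // !gtwistE gsubstE.
  apply: AS_integers_gtwist => // [q r|]; first by rewrite /chi' mulrDl chiD.
  have chin (q : rat) n : chi (q *+ n.+1) = chi q ^+ n.+1.
    by elim: n => [|n IH]; rewrite ?mulr1n ?expr1 // mulrS chiD IH -exprS.
  apply: contra_neq al0 => chi'0; rewrite -chi1 -[1](divfK (lt0r_neq0 (pX_gt0 j))) mulr_natr.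
  have pj : (0 < p ^ j)%N by rewrite expn_gt0 p_gt0.
  by move: chi'0; rewrite /chi'; move: (1 / _) => x x0; rewrite -(prednK pj) chin x0 expr0n.
- move=> F' c d [j OF] c0.
  have [j1 dz] := zp_scaled d; have [j2 cz] := zp_scaled c.
  (* p^J clears p from the denominator of d and p^(J - j) from that of c; the latter is the
     multiplier applied to the element of O at hand. *)
  pose J := (maxn j1 (j2 + j))%N; exists J.
  have j1J : (j1 <= J)%N by rewrite leq_maxl.
  have j2J : (j2 <= J - j)%N by rewrite leq_subRL ?(addnC j) ?leq_maxr // (leq_trans _ (leq_maxr _ _)) // leq_addl.
  have jJ : (j <= J)%N by rewrite (leq_trans _ (leq_maxr _ _)) // leq_addl.
  rewrite gsubstM // /tpow gsubst_mono // -/(tpow k _); apply: OM; first by apply: Od; exact: dz.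
  have -> : gsubst (p ^ J)%:R (gsubst c F') = gsubst ((p ^ (J - j))%:R * c) (gsubst (p ^ j)%:R F').
    rewrite !gsubst_comp // ?mulr_gt0 //; congr (gsubst _ F').
    by rewrite mulrAC -natrM -expnD subnK.
  by apply: AS_integers_gsubst; rewrite ?mulr_gt0 //; exact: cz.
Qed.

End CtildeIntegers.

(** * Galois p-extensions *)

Section AdditiveHilbert90.
Variables (F0 : fieldType) (N : splittingFieldType F0) (p : nat).
Hypothesis pcharN : p \in [pchar N].

Let p_pr : prime p. Proof. exact: pcharf_prime pcharN. Qed.
Let p_gt1 : (1 < p)%N. Proof. exact: prime_gt1. Qed.

(* If phi : G -> F_p is a nonzero homomorphism and c is the trace of a, then *)
(* y = sum_g phi(g) g(a) / c satisfies h(y) = y - phi(h) for all h in G. *)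
Lemma AS_generator (F : {subfield N}) : galois F {:N} -> (p.-group 'Gal({:N} / F))%g ->
  'Gal({:N} / F)%g != 1%g -> exists2 y : N, y \notin F & y ^+ p - y \in F.
Proof.
set G := ('Gal({:N} / F))%g => galN pG Gn1.
(* A maximal subgroup of a p-group is normal of index p; the quotient by it is the cyclic group that
   defines phi. *)
have [G1|[H maxH _]] := maximal_exists (sub1G G); first by case/eqP: Gn1; exact: (esym G1).
have nHG : (H <| G)%g := p_maximal_normal pG maxH.
have oGH : #|(G / H)%g| = p by rewrite card_quotient ?normal_norm // (p_maximal_index pG maxH).
have /cyclicP[x GHx] : cyclic (G / H)%g by rewrite prime_cyclic // oGH.
have ox : #[x]%g = p by rewrite orderE -GHx oGH.
have [phi phiE] : exists phi : gal_of {:N} -> nat, forall g, g \in G -> coset H g = (x ^+ phi g)%g.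
  suff /choice[phi phiP] : forall g, exists i, g \in G -> coset H g = (x ^+ i)%g by exists phi.
  move=> g; have [gG|] := boolP (g \in G); last by exists 0%N.
  have : coset H g \in <[x]>%g by rewrite -GHx mem_quotient.
  by case/cycleP => i ->; exists i.
have phiM g h : g \in G -> h \in G -> (phi (g * h)%g)%:R = (phi g)%:R + (phi h)%:R :> N.
  move=> gG hG; have nG := fintype.subsetP (normal_norm nHG).
  have /eqP : (x ^+ phi (g * h))%g = (x ^+ (phi g + phi h))%g.
    by rewrite -phiE ?groupM // morphM ?nG //= !phiE // expgD.
  rewrite eq_expg_mod_order ox => /eqP E; rewrite -natrD.
  have natmod m : (m %% p)%:R = m%:R :> N.
    by rewrite {2}(divn_eq m p) natrD natrM (pcharf0 pcharN) mulr0 add0r.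
  by rewrite -natmod E natmod.
have [h0 h0G phi0] : exists2 h, h \in G & (phi h)%:R != 0 :> N.
  have : x \in (G / H)%g by rewrite GHx cycle_id.
  case/morphimP => h _ hG xE; exists h => //; apply/eqP => ph; have := phiE h hG.
  rewrite -xE => /eqP; rewrite -{1}[x]expg1 eq_expg_mod_order ox modn_small //.
  by move: ph => /eqP; rewrite -(dvdn_pcharf pcharN) => /eqP ->.
(* The independence of automorphisms provides an element a of nonzero trace. *)
have [a _ c0] := @gal_independent_contra _ _ {:N} (mem G) (fun _ => 1) 1%g (group1 G) (oner_neq0 N).
set c := \sum_(g | _) _ in c0; have cE : c = \sum_(g in G) g a.
  by apply: eq_bigr => g _; rewrite mul1r.
have fixG z : (forall h, h \in G -> h z = z) -> z \in F.
  move=> zG; move: galN => /galois_fixedField <-.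
  by apply/fixedFieldP; rewrite ?memvf.
have gc h : h \in G -> h c = c.
  move=> hG; rewrite cE rmorph_sum /= [RHS](reindex_inj (mulIg h)) /=.
  rewrite [RHS](eq_bigl (mem G)) => [|g]; last by rewrite /= groupMr.
  by apply: eq_bigr => g gG; rewrite galM ?memvf.
pose y := (\sum_(g in G) (phi g)%:R * g a) / c.
have gy h : h \in G -> h y = y - (phi h)%:R.
  move=> hG; apply/eqP; rewrite eq_sym subr_eq; apply/eqP.
  rewrite {1}/y (reindex_inj (mulIg h)) /= (eq_bigl (mem G)) => [|g]; last by rewrite /= groupMr.
  rewrite /y fmorph_div /= (gc _ hG) -[X in _ + X](mulfK c0) -mulrDl; congr (_ / _).
  rewrite -[X in _ = _ + _ * X](gc _ hG) cE !rmorph_sum mulr_sumr -big_split; apply: eq_bigr => g gG /=.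
  by rewrite phiM // galM ?memvf // rmorphM rmorph_nat mulrDl.
exists y.
  apply: contra phi0 => yF; have := gy _ h0G; rewrite (fixed_gal _ h0G yF) ?subvf //.
  by move/eqP; rewrite eq_sym subr_eq addrC -subr_eq subrr eq_sym.
apply: fixG => h hG; rewrite rmorphB rmorphXn /= gy //.
rewrite -!(pFrobenius_autE pcharN) pFrobenius_autB_comm ?pFrobenius_aut_nat; last exact: mulrC.
by ring.
Qed.

(** Induction on the order of the Galois group over F. An Artin-Schreier generator makes it smaller,
    and its image lies in X because X is closed under Artin-Schreier roots. *)
Lemma galois_p_sub (M : fieldType) (j : {rmorphism N -> M}) (X : set M) n :
  galois 1 {:N} -> \dim {:N} = (p ^ n)%N -> subring_set X -> (forall y, X (y ^+ p - y) -> X y) ->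
  (forall a, X (j a%:A)) -> forall x, X (j x).
Proof.
move=> galN dimN Xr XAS X1.
have cardG : #|'Gal({:N} / 1%VS)%g| = (p ^ n)%N.
  by rewrite -(galois_dim galN) dimv1 divn1.
suff main m (F : {subfield N}) : (#|'Gal({:N} / F)%g| < m)%N -> (forall x, x \in F -> X (j x)) -> forall x, X (j x).
  apply: (main _.+1 1%AS (ltnSn _)) => x /vlineP[a ->]; exact: X1.
elim: m F => // m IH F; rewrite ltnS => Gm XF x.
have galF : galois F {:N} by apply: galoisS galN; rewrite sub1v subvf.
have pG : (p.-group 'Gal({:N} / F))%g.
  apply: (pgroupS (galS _ (sub1v F))); rewrite /pgroup cardG pnatX pnat_id //.
have [G1|Gn1] := eqVneq 'Gal({:N} / F)%g 1%g.
  have := galois_fixedField galF; rewrite G1 => FE; apply: XF; rewrite -FE.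
  by apply/fixedFieldP => [|g]; rewrite ?memvf // => /set1P ->; rewrite gal_id.
have [y nyF yF] := AS_generator galF pG Gn1.
have galF2 : galois <<F; y>>%AS {:N} by apply: galoisS galN; rewrite sub1v subvf.
have sub : ('Gal({:N} / <<F; y>>) \subset 'Gal({:N} / F))%g by apply: galS; exact: subv_adjoin.
apply: (IH <<F; y>>%AS).
  apply: leq_trans Gm; apply: proper_card; rewrite finset.properEneq sub andbT.
  apply: contra nyF => /eqP GE; rewrite -(galois_fixedField galF) -GE (galois_fixedField galF2).
  exact: memv_adjoin.
have [_ XB XM] := Xr; have Xy : X (j y).
  by apply: XAS; rewrite -rmorphXn -rmorphB; apply: XF.
move=> z /Fadjoin_polyP[P PF ->]; rewrite -horner_map horner_coef size_map_poly.
apply: (sring_sum Xr) => i _; rewrite coef_map; apply: XM; last exact: sringX.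
by apply: XF; exact: (polyOverP PF).
Qed.

End AdditiveHilbert90.

(** * Subfields of M with a finite basis as extension types *)

Section ExtensionType.
Variables (M : fieldType) (X E : set M).
Local Notation T := (subfield_of X).

(* The phantom argument carries the inclusion that defines the scalar multiplication. *)
Definition extension of gen_subfield X `<=` gen_subfield E := subfield_of E.

Variable XE : gen_subfield X `<=` gen_subfield E.
Local Notation L := (extension XE).

HB.instance Definition _ := GRing.Field.copy L (subfield_of E).

Definition extension_val (x : L) : M := val (x : subfield_of E).

Fact extension_val_zmod : zmod_morphism extension_val.
Proof. by move=> x y; exact: (rmorphB (val : {rmorphism subfield_of E -> M})). Qed.
Fact extension_val_monoid : monoid_morphism extension_val.
Proof. by split=> [|x y]; [exact: (rmorph1 (val : {rmorphism subfield_of E -> M}))|exact: (rmorphM (val : {rmorphism subfield_of E -> M}))]. Qed.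
HB.instance Definition _ := GRing.isZmodMorphism.Build L M extension_val extension_val_zmod.
HB.instance Definition _ := GRing.isMonoidMorphism.Build L M extension_val extension_val_monoid.

Lemma extension_val_inj : injective extension_val. Proof. exact: val_inj. Qed.

Definition extension_scale (a : T) (x : L) : L :=
  (Sub (val a) (mem_set (XE (set_mem (valP a)))) : subfield_of E) * x.

Lemma extension_scaleE a x : extension_val (extension_scale a x) = val a * extension_val x.
Proof. by rewrite /extension_scale rmorphM; congr (_ * _); rewrite /extension_val SubK. Qed.

Fact extension_scaleA a b x : extension_scale a (extension_scale b x) = extension_scale (a * b) x.
Proof. by apply: extension_val_inj; rewrite !extension_scaleE rmorphM mulrA. Qed.
Fact extension_scale1 : left_id 1 extension_scale.
Proof. by move=> x; apply: extension_val_inj; rewrite extension_scaleE rmorph1 mul1r. Qed.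
Fact extension_scaleDr : right_distributive extension_scale +%R.
Proof. by move=> a x y; apply: extension_val_inj; rewrite !(extension_scaleE, rmorphD) mulrDr. Qed.
Fact extension_scaleDl x : {morph extension_scale^~ x : a b / a + b}.
Proof. by move=> a b; apply: extension_val_inj; rewrite !(extension_scaleE, rmorphD) /= mulrDl. Qed.
HB.instance Definition _ := GRing.Zmodule_isLmodule.Build T L
  extension_scaleA extension_scale1 extension_scaleDr extension_scaleDl.

Lemma extension_valZ a (x : L) : extension_val (a *: x) = val a * extension_val x.
Proof. exact: extension_scaleE. Qed.

Fact extension_scaleAl a (x y : L) : a *: (x * y) = (a *: x) * y.
Proof. exact: (mulrA (_ : subfield_of E)). Qed.
HB.instance Definition _ := GRing.Lmodule_isLalgebra.Build T L extension_scaleAl.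
Fact extension_scaleAr a (x y : L) : a *: (x * y) = x * (a *: y).
Proof. by rewrite mulrC extension_scaleAl mulrC. Qed.
HB.instance Definition _ := GRing.Lalgebra_isAlgebra.Build T L extension_scaleAr.

Definition set_basis (I : finType) (b : I -> M) :=
  [/\ forall c : {ffun I -> T}, gen_subfield E (\sum_i val (c i) * b i),
      forall x, gen_subfield E x -> exists c : {ffun I -> T}, x = \sum_i val (c i) * b i &
      forall c : {ffun I -> T}, \sum_i val (c i) * b i = 0 -> c = 0].

Lemma extension_vect (I : finType) (b : I -> M) : set_basis b -> Vector.axiom #|I| L.
Proof.
move=> [bE bgen bfree].
have /choice[co coP] : forall x : L, exists c : {ffun I -> T}, extension_val x = \sum_i val (c i) * b i.
  by move=> x; apply: bgen; exact: (set_mem (valP (x : subfield_of E))).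
have co_uniq (c : {ffun I -> T}) x : extension_val x = \sum_i val (c i) * b i -> co x = c.
  move=> xE; apply/eqP; rewrite -subr_eq0; apply/eqP/bfree.
  rewrite -[RHS](subrr (extension_val x)) {1}coP xE -sumrB; apply: eq_bigr => i _.
  by rewrite !ffunE rmorphB mulrBl.
pose f (x : L) : 'rV[T]_#|I| := \row_i co x (enum_val i).
exists f.
  move=> a x y; apply/rowP => i; rewrite !mxE.
  suff -> : co (a *: x + y) = [ffun i => a * co x i + co y i] by rewrite ffunE.
  apply: co_uniq; rewrite rmorphD /= extension_valZ !coP mulr_sumr -big_split.
  apply: eq_bigr => l _; transitivity (val (a * co x l + co y l) * b l); last by rewrite ffunE.
  by rewrite (rmorphD (val : {rmorphism T -> M})) (rmorphM (val : {rmorphism T -> M})) mulrDl mulrA.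
pose c (r : 'rV[T]_#|I|) := [ffun i => r 0 (enum_rank i)].
pose g (r : 'rV[T]_#|I|) : L := (Sub (\sum_i val (c r i) * b i) (mem_set (bE (c r))) : subfield_of E).
exists g => [x|r].
  apply: extension_val_inj; rewrite [RHS]coP /g /extension_val SubK.
  by apply: eq_bigr => i _; rewrite ffunE mxE enum_rankK.
by apply/rowP => i; rewrite mxE (co_uniq (c r)) ?ffunE ?enum_valK.
Qed.

Lemma set_extension (I : finType) (b : I -> M) : set_basis b ->
  exists (N : fieldExtType T) (j : {rmorphism N -> M}),
    [/\ forall a, j a%:A = val a, \dim {:N} = #|I| & range j = gen_subfield E].
Proof.
move=> /extension_vect ax.
pose N : fieldExtType T := HB.pack L (Lmodule_hasFinDim.Build T L ax).
exists N, (extension_val : {rmorphism L -> M}); split.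
- by move=> a; rewrite [LHS]extension_scaleE rmorph1 mulr1.
- by rewrite dimvf.
- apply/seteqP; split=> [_ [x _ <-]|x Ex]; first exact: (set_mem (valP (x : subfield_of E))).
  by exists (Sub x (mem_set Ex) : subfield_of E) => //; rewrite /extension_val SubK.
Qed.

End ExtensionType.

Lemma bounded_enum (T : eqType) (C : set T) N :
  (forall s, uniq s -> (forall x, x \in s -> C x) -> (size s <= N)%N) ->
  exists2 s, uniq s & forall x, x \in s <-> C x.
Proof.
move=> CN; pose P n := `[< exists s, [/\ uniq s, forall x, x \in s -> C x & size s = n] >].
have exP : exists n, P n by exists 0%N; apply/asboolP; exists [::].
have PN n : P n -> (n <= N)%N by move/asboolP => [s [us sC <-]]; apply: CN.
case: (ex_maxnP exP PN) => n /asboolP[s [us sC sn]] nmax; exists s => // x; split=> [/sC //|Cx].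
apply: contrapT => /negP nsx; have : P n.+1.
  apply/asboolP; exists (x :: s); split=> [|z|] /=; [by rewrite nsx| |by rewrite sn].
  by rewrite inE => /orP[/eqP->|/sC].
by move/nmax; rewrite ltnn.
Qed.

Lemma AS_root_diff (M : fieldType) p (y z : M) : p \in [pchar M] -> y ^+ p - y = z ^+ p - z ->
  exists i : nat, y = z + i%:R.
Proof.
move=> pM yz; have p_pr := pcharf_prime pM.
set w := y - z; have wE : w ^+ p - w = 0.
  rewrite /w -!(pFrobenius_autE pM) pFrobenius_autB_comm; last exact: mulrC.
  have yE : y ^+ p = z ^+ p - z + y by rewrite -yz subrK.
  by rewrite !pFrobenius_autE yE; ring.
apply: contrapT => nyz.
have := @max_poly_roots _ (AS_poly p (0 : M)) (w :: [seq i%:R | i <- iota 0 p]).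
rewrite -size_poly_eq0 (size_AS_poly pM) /= size_map size_iota ltnn => H.
suff: false by []; apply: H => //.
  rewrite root_AS_poly wE eqxx; apply/allP => _ /mapP[i _ ->].
  by rewrite root_AS_poly (natr_frob pM) subrr.
apply/andP; split; first apply/mapP => [[i _ wi]].
  by apply: nyz; exists i; rewrite -wi /w addrC subrK.
rewrite map_inj_in_uniq ?iota_uniq // => i j; rewrite !mem_iota !add0n => /andP[_ ip] /andP[_ jp].
exact: (natr_inj_pchar pM ip jp).
Qed.

(** * Normal towers *)

Section AdjoinFree.
Variables (M : fieldType) (p : nat).
Hypothesis pcharM : p \in [pchar M].

Lemma adjoin_free (E : set M) y (g : nat -> M) : subfield_set E -> E (y ^+ p - y) -> ~ E y ->
  (forall i, E (g i)) -> \sum_(i < p) g i * y ^+ i = 0 -> forall i, (i < p)%N -> g i = 0.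
Proof.
move=> Es Ef nEy gE g0; have Ege := gen_subfield_id Es.
pose v : {rmorphism subfield_of E -> M} := val.
pose ofE x (Ex : E x) : subfield_of E := Sub x (mem_set (eq_ind_r (fun S => S x) Ex Ege)).
have vof x (Ex : E x) : v (ofE x Ex) = x by exact: SubK.
have yf : y ^+ p - y = v (ofE _ Ef) by rewrite vof.
have nvy z : v z != y.
  apply/eqP => zy; apply: nEy; rewrite -zy.
  exact: (gen_subfield_min Es (@subset_refl _ E) (set_mem (valP z))).
pose h : {poly subfield_of E} := \poly_(i < p) ofE _ (gE i).
have hy : root (map_poly v h) y.
  rewrite rootE (horner_coef_wide _ (n := p)) ?size_map_poly ?size_poly // -[X in _ == X]g0.
  by apply/eqP/eq_bigr => i _; rewrite coef_map coef_poly ltn_ord; congr (_ * _); exact: vof.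
have /dvdp_leq := AS_dvd pcharM yf nvy hy.
rewrite (size_AS_poly pcharM) => hP; have h0 : h = 0.
  apply: contrapT => /eqP /hP ph; have : (p < p)%N by apply: leq_trans ph (size_poly _ _).
  by rewrite ltnn.
move=> i ip; have /(congr1 (fun P : {poly _} => v P`_i)) := h0; rewrite coef_poly ip coef0 rmorph0 => <-; exact/esym/vof.
Qed.

End AdjoinFree.

Section NormalTowers.
Variables (k : closedFieldType) (p : nat).
Hypothesis pchark : p \in [pchar k].
Local Notation M := (glaurent k).
Implicit Types (E : set M) (x y z : M) (s : M -> M).
Let p_pr : prime p. Proof. exact: pcharf_prime pchark. Qed.
Let p_gt1 : (1 < p)%N. Proof. exact: prime_gt1. Qed.
Let p_gt0 : (0 < p)%N. Proof. exact: prime_gt0. Qed.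
Let pcharM : p \in [pchar M]. Proof. exact: pchar_glaurent. Qed.
Let K : set M := K_set p (k:=k).
Let T := subfield_of (K_gens p (k:=k)).
Let Tval (a : T) : K (val a). Proof. exact: (set_mem (valP a)). Qed.
Let ofK x (Kx : K x) : T := Sub x (mem_set Kx).
Let ofKE x (Kx : K x) : val (ofK Kx) = x. Proof. by rewrite SubK. Qed.

Lemma tower_basis E : tower p setT E -> exists n (I : finType) (b : I -> M),
  #|I| = (p ^ n)%N /\ @set_basis _ (K_gens p (k:=k)) E I b.
Proof.
elim=> [|{}E y Et [n [I [b [cI [bE bgen bfree]]]]] _ Ef].
  exists 0%N, unit, (fun=> 1); rewrite card_unit expn0; split=> //.
  have Ks : gen_subfield (K_set p (k:=k)) = K := gen_subfield_id (@gen_subfield_closed _ _).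
  split=> [c|x|c]; rewrite ?Ks ?(big_pred1 tt) //=; try by case.
  - by rewrite mulr1; exact: Tval.
  - by move=> Kx; exists [ffun=> ofK Kx]; rewrite (big_pred1 tt) ?ffunE ?ofKE ?mulr1 //; case.
  - move=> c0; apply/ffunP => -[]; rewrite ffunE; apply: val_inj.
    by rewrite -[LHS]mulr1 [LHS]c0 rmorph0.
have Es := tower_subfield Et; have Ege := gen_subfield_id Es.
have As := tower_subfield (tower_adjoin Et Logic.I Ef); have Age := gen_subfield_id As.
have [Ey|nEy] := pselect (E y).
  exists n, I, b; split=> //; suff -> : adjoin E y = E by [].
  by apply/seteqP; split; [exact: adjoin_min|exact: adjoin_sub].
exists n.+1, (I * 'I_p)%type, (fun u : I * 'I_p => b u.1 * y ^+ u.2).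
rewrite card_prod card_ord cI expnSr; split=> //.
pose g (c : {ffun I * 'I_p -> T}) (j : nat) : M :=
  if insub j is Some j' then \sum_i val (c (i, j')) * b i else 0.
have gE c j : E (g c j).
  rewrite /g; case: insub => [j'|]; last exact: (sring0 (subfield_subring Es)).
  have := bE [ffun i => c (i, j')]; rewrite Ege.
  by under eq_bigr do rewrite ffunE.
have sumE (c : {ffun I * 'I_p -> T}) : \sum_u val (c u) * (b u.1 * y ^+ u.2) = \sum_(j < p) g c j * y ^+ j.
  rewrite (eq_bigr (fun u : I * 'I_p => val (c (u.1, u.2)) * (b u.1 * y ^+ u.2))) => [|[] //].
  rewrite -(pair_bigA _ (fun i j => val (c (i, j)) * (b i * y ^+ j))) exchange_big /=.
  by apply: eq_bigr => j _; rewrite /g valK mulr_suml; apply: eq_bigr => i _; rewrite mulrA.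
split=> [c|x|c].
- by rewrite Age sumE; apply/(adjoinP pcharM Es Ef nEy); exists (g c).
- rewrite Age => /(adjoinP pcharM Es Ef nEy)[h hE ->].
  have /choice[d dP] : forall j, exists c : {ffun I -> T}, h j = \sum_i val (c i) * b i.
    by move=> j; apply: bgen; rewrite Ege.
  exists [ffun u : I * 'I_p => d u.2 u.1]; rewrite sumE; apply: eq_bigr => j _; congr (_ * _).
  by rewrite dP /g valK; apply: eq_bigr => i _; rewrite ffunE.
- rewrite sumE => g0; have gj := adjoin_free pcharM Es Ef nEy (gE c) g0.
  apply/ffunP => -[i j]; have := gj j (ltn_ord j); rewrite /g valK => cj.
  have := bfree [ffun i => c (i, j)]; under eq_bigr do rewrite ffunE.
  by move=> /(_ cj) /ffunP/(_ i); rewrite !ffunE.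
Qed.

Definition hom_over E s := hom_on E s /\ forall x, K x -> s x = x.

Let algK x := algebraicOver (val : T -> M) x.

Lemma tower_algebraic E x : tower p setT E -> E x -> algK x.
Proof.
move=> Et; elim: Et x => [|{}E y Et IH _ Ef] x; first exact: algebraic_gen_subfield.
apply: adjoin_min; [exact: algebraic_closed|exact: IH|].
apply: (@algebraic_root _ _ (AS_poly p (y ^+ p - y))).
- by rewrite -size_poly_eq0 (size_AS_poly pcharM).
- have algr : subring_set algK by apply: subfield_subring; exact: algebraic_closed.
  have [a1 aB _] := algr; have a0 := sring0 algr.
  move=> i; rewrite /AS_poly !coefB coefXn coefX coefC.
  by apply: (aB); [apply: (aB); case: eqP => _|case: eqP => _ //; exact: IH].
- by rewrite root_AS_poly.
Qed.

Lemma conjugates E x : tower p setT E -> E x ->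
  exists2 cs : seq M, uniq cs & forall z, z \in cs <-> exists2 s, hom_over E s & z = s x.
Proof.
move=> Et Ex; have Es := tower_subfield Et; have [f f0 fx] := tower_algebraic Et Ex.
apply: (@bounded_enum _ [set z | exists2 s, hom_over E s & z = s x] (size f)) => cs ucs csC.
rewrite -(size_map_poly (val : {rmorphism T -> M})); apply/ltnW/max_poly_roots => //.
  by rewrite map_poly_eq0.
apply/allP => z /csC[s [Hs sK] ->].
have [_ _ sM] := Hs; have EX i : E (x ^+ i) by exact: (sringX (subfield_subring Es)).
have Ef i : E (val f`_i) by apply: (tower_K Et); exact: Tval.
have sumE u : (map_poly (val : {rmorphism T -> M}) f).[u] = \sum_(i < size f) val f`_i * u ^+ i.
  by rewrite horner_coef size_map_poly; apply: eq_bigr => i _; rewrite coef_map.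
have := congr1 s (eqP fx : (map_poly (val : {rmorphism T -> M}) f).[x] = 0).
rewrite sumE (hom_on0 Es Hs) (hom_on_sum Es Hs) => [s0|i _]; last first.
  by have [_ _ EM] := subfield_subring Es; apply: EM.
rewrite rootE sumE; apply/eqP; apply: etrans s0.
by apply: eq_bigr => i _; rewrite sM // (hom_onX Es Hs) // (sK _ (Tval f`_i)).
Qed.

Lemma hom_over_adjoin E y s : tower p setT E -> E (y ^+ p - y) -> hom_over E s ->
  exists2 s', hom_over (adjoin E y) s' & forall x, E x -> s' x = s x.
Proof.
move=> Et Ef [Hs sK]; have Es := tower_subfield Et; have [Ey|nEy] := pselect (E y).
  by exists s => //; split=> //; apply: (hom_on_sub Hs); exact: adjoin_min.
have [eta etaE] := AS_root_pos pchark (s (y ^+ p - y)).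
have [s' [Hs' s'E _]] := hom_adjoin pcharM Es Ef nEy Hs etaE.
by exists s' => //; split=> // x Kx; rewrite s'E ?sK //; exact: (tower_K Et).
Qed.

(** Write x as the sum of the g_i y^i with g_i in E. If x is fixed, the polynomial with coefficients
    g_i, minus x, vanishes at the p points y + c and has degree below p, so x = g_0 lies in E. *)
Lemma tower_fixed E x : tower p setT E -> E x -> (forall s, hom_over E s -> s x = x) -> K x.
Proof.
move=> Et; elim: Et x => [//|{}E y Et IH _ Ef] x Ax fixx.
have Es := tower_subfield Et; have As := tower_subfield (tower_adjoin Et I Ef).
suff Ex : E x.
  apply: IH => // s Hs; have [s' Hs' s'E] := hom_over_adjoin Et Ef Hs.
  by rewrite -s'E //; exact: fixx.
apply: contrapT => nEx; have [Ey|nEy] := pselect (E y).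
  by apply: nEx; apply: (@adjoin_min _ E) Ax.
have /(adjoinP pcharM Es Ef nEy)[g gE xE] := Ax.
have idE : hom_on E id by [].
pose P := \poly_(i < p) g i - x%:P.
have sP : (size P <= p)%N.
  rewrite (leq_trans (size_polyD _ _)) // geq_max size_poly size_polyN.
  by rewrite (leq_trans (size_polyC_leq1 _)).
have rP c : P.[y + c%:R] = 0.
  have etaE : (y + c%:R) ^+ p - (y + c%:R) = id (y ^+ p - y).
    have -> : (y + c%:R) ^+ p = y ^+ p + c%:R.
      rewrite -!(pFrobenius_autE pcharM) pFrobenius_autD_comm; last exact: mulrC.
      by rewrite pFrobenius_aut_nat.
    by rewrite opprD addrACA subrr addr0.
  have [s [Hs sE sy]] := hom_adjoin pcharM Es Ef nEy idE etaE.
  have Ay := @adjoin_gen _ E y; have AyX i : adjoin E y (y ^+ i) by exact: (sringX (subfield_subring As)).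
  have [_ _ sM] := Hs; have [_ _ AM] := subfield_subring As.
  have Ag i : adjoin E y (g i) by apply: adjoin_sub.
  have : s x = x by apply: fixx; split=> // z Kz; rewrite sE //; exact: (tower_K Et).
  rewrite {1}xE (hom_on_sum As Hs) => [|i _]; last exact: AM.
  move=> sx; rewrite hornerD hornerN hornerC horner_poly -[X in _ - X]sx; apply/eqP; rewrite subr_eq0.
  by apply/eqP/eq_bigr => i _; rewrite sM // (hom_onX As Hs) // sy sE.
have P0 : P = 0.
  apply: contrapT => /eqP P0.
  have := max_poly_roots (rs := [seq y + i%:R | i <- iota 0 p]) P0.
  rewrite size_map size_iota ltnNge sP => H; suff: false by []; apply: H.
    by apply/allP => _ /mapP[i _ ->]; rewrite rootE rP.
  rewrite map_inj_in_uniq ?iota_uniq // => i j; rewrite !mem_iota !add0n => /andP[_ ip] /andP[_ jp].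
  by move/addrI; exact: (natr_inj_pchar pcharM ip jp).
apply: nEx; have /(congr1 (fun Q : {poly M} => Q`_0)) := P0.
rewrite /P coefB coef_poly p_gt0 coefC coef0 => /eqP; rewrite subr_eq0 => /eqP <-; exact: gE.
Qed.

Definition normal_tower E :=
  tower p setT E /\ forall s, hom_over E s -> forall x, E x -> E (s x).

Let adjoin_AS_roots E (l : seq M) : tower p setT E -> (forall c, c \in l -> E c) ->
  exists E', [/\ tower p setT E', E `<=` E', forall c, c \in l -> forall z, z ^+ p - z = c -> E' z &
    forall S, subfield_set S -> E `<=` S -> (forall c, c \in l -> forall z, z ^+ p - z = c -> S z) -> E' `<=` S].
Proof.
move=> Et; elim: l => [|c l IH] lE; first by exists E; split.
have [d dl|E' [E't EE' E'l E'min]] := IH; first by apply: lE; rewrite inE dl orbT.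
have [eta etaE] := AS_root_pos pchark c.
have E'c : E' (eta ^+ p - eta) by rewrite etaE; apply: EE'; apply: lE; rewrite mem_head.
have At := tower_adjoin E't I E'c; exists (adjoin E' eta); split=> //.
- by move=> x /EE'; apply: adjoin_sub.
- move=> d; rewrite inE => /orP[/eqP-> z zc|dl z zd]; last by apply: adjoin_sub; apply: (E'l d).
  have [i ->] : exists i : nat, z = eta + i%:R by apply: (AS_root_diff pcharM); rewrite zc.
  have Ar := subfield_subring (tower_subfield At); have [A1 _ _] := Ar.
  by apply: (sringD Ar); [exact: adjoin_gen|exact: (sring_nat Ar)].
- move=> S Ss ES Sl; apply: adjoin_min => //; last by apply: (Sl c); rewrite ?mem_head.
  by apply: E'min => // d dl; apply: Sl; rewrite inE dl orbT.
Qed.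

(* The Artin-Schreier roots of all conjugates of y^p - y are adjoined along with y. *)
Lemma normal_closure E : tower p setT E -> exists2 E', normal_tower E' & E `<=` E'.
Proof.
elim=> [|{}E y Et [N [Nt Nn] EN] _ Ef].
  by exists K => //; split=> [|s [_ sK] x Kx]; [exact: tower0|rewrite sK].
have Nf := EN _ Ef; have Ns := tower_subfield Nt.
have [cs ucs csP] := conjugates Nt Nf.
have [c /csP[s Hs ->]|N' [N't NN' N'l N'min]] := adjoin_AS_roots Nt (l := cs); first exact: Nn.
have N's := tower_subfield N't; have N'r := subfield_subring N's.
exists N'; last first.
  apply: adjoin_min => // [x /EN|]; first exact: NN'.
  by apply: (N'l (y ^+ p - y)) => //; apply/csP; exists id.
split=> // s [Hs sK] x N'x; have [_ _ sM] := Hs.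
pose S := [set z | N' z /\ N' (s z)].
suff : S x by case.
apply: (N'min S) N'x => [|z Nz|c cl z zc].
- split=> [|u v /set_mem[Nu su] /set_mem[Nv sv]|u v /set_mem[Nu su] /set_mem[Nv sv]]; apply/mem_set.
  + by have [s1 _ _] := Hs; have [N1 _ _] := N'r; split; rewrite ?s1.
  + by have [_ NB _] := N'r; split; rewrite ?(hom_onB N's Hs) //; apply: NB.
  + have [_ _ NM] := N'r; have NV w : N' w -> N' w^-1 by exact: subfieldV.
    by split; rewrite ?(hom_on_div N's Hs) //; apply: NM => //; apply: NV.
- split; first exact: NN'.
  by apply: (NN'); apply: (Nn) => //; split=> //; exact: (hom_on_sub Hs NN').
- have N'z : N' z by apply: (N'l c).
  split=> //; have /csP[s0 [Hs0 s0K] cE] := cl.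
  apply: (N'l (s c)); last first.
    by rewrite -(hom_onX N's Hs) // -(hom_onB N's Hs) ?zc //; exact: sringX.
  apply/csP; exists (s \o s0); last by rewrite /= cE.
  have N0 u : N u -> N' (s0 u) by move=> Nu; apply: NN'; apply: Nn.
  split=> [|u Ku]; last by rewrite /= s0K ?sK.
  have [s01 s0D s0M] := Hs0; have [s1 sD _] := Hs.
  by split=> [|u v Nu Nv|u v Nu Nv] /=; rewrite ?s01 ?s0D ?s0M // ?sD ?sM //; exact: N0.
Qed.

Lemma conjugates_fixed E (cs : seq M) x i : normal_tower E -> E x -> uniq cs ->
  (forall z, z \in cs <-> exists2 s, hom_over E s & z = s x) ->
  K (\prod_(c <- cs) ('X - c%:P))`_i.
Proof.
move=> [Et En] Ex ucs csP; have Es := tower_subfield Et; have Er := subfield_subring Es.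
have Ecs c : c \in cs -> E c by move/csP => [s Hs ->]; apply: En.
have coefE (l : seq M) j : (forall c, c \in l -> E c) -> E (\prod_(c <- l) ('X - c%:P))`_j /\
    forall s, hom_over E s -> s (\prod_(c <- l) ('X - c%:P))`_j = (\prod_(c <- map s l) ('X - c%:P))`_j.
  elim: l j => [|c l IH] j lE.
    rewrite big_nil coef1; split; first by case: eqP => _; [have [] := Er|exact: sring0].
    by move=> s [Hs _]; case: eqP => _; [case: Hs|exact: (hom_on0 Es Hs)].
  have {}IH m := IH m (fun d dl => lE d (mem_behead (s := c :: l) dl)).
  have Ec : E c by apply: lE; rewrite mem_head.
  have [E1 EB EM] := Er; have E0 := sring0 Er.
  have EX m : E (if m == 0%N then 0 else (\prod_(c <- l) ('X - c%:P))`_m.-1).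
    by case: eqP => // _; have [] := IH m.-1.
  have [Ej _] := IH j.
  rewrite big_cons mulrC mulrBr coefB coefMX coefMC; split; first by apply: EB => //; apply: EM.
  move=> s Hos; have [Hs _] := Hos; have [_ _ sM] := Hs.
  rewrite /= big_cons [in RHS]mulrC mulrBr coefB coefMX coefMC (hom_onB Es Hs) ?sM //; last exact: EM.
  congr (_ - _ * _); last by have [_ ->] := IH j.
  by case: eqP => _; [exact: (hom_on0 Es Hs)|have [_ ->] := IH j.-1].
apply: (tower_fixed Et) => [|s Hos]; first by have [] := coefE cs i Ecs.
have [_ ->//] := coefE cs i Ecs; rewrite (perm_big cs) //.
have [Hs sK] := Hos; have us : uniq (map s cs).
  rewrite map_inj_in_uniq // => u v /Ecs Eu /Ecs Ev suv; apply/eqP; rewrite -subr_eq0.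
  apply: contraT => uv; have [_ EB _] := Er; have := hom_on_neq0 Es Hs (EB _ _ Eu Ev) uv.
  by rewrite (hom_onB Es Hs) // suv subrr eqxx.
have ss : {subset map s cs <= cs}.
  move=> _ /mapP[u /csP[s0 [Hs0 s0K] ->] ->]; apply/csP; exists (s \o s0) => //.
  have N0 w : E w -> E (s0 w) by exact: En.
  split=> [|w Kw]; last by rewrite /= s0K ?sK.
  have [s01 s0D s0M] := Hs0; have [s1 sD sM] := Hs.
  by split=> [|w v Nw Nv|w v Nw Nv] /=; rewrite ?s01 ?s0D ?s0M // ?sD ?sM //; exact: N0.
have [_ mem_s] := uniq_min_size us ss (eq_leq (esym (size_map s cs))).
by apply: uniq_perm.
Qed.

(** Over every intermediate field the minimal polynomial of x divides the product of the X - c over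
    the conjugates c of x. That product has coefficients in K and distinct roots, all in E, whence
    normality and separability. *)
Lemma normal_tower_galois E : normal_tower E -> galois_p_extension p E.
Proof.
move=> [Et En]; have Es := tower_subfield Et.
have [n [I [b [cI bE]]]] := tower_basis Et; have Ege := gen_subfield_id Es.
have KE : gen_subfield (K_gens p (k:=k)) `<=` gen_subfield E by rewrite Ege; exact: (tower_K Et).
have [L [j [jA dimL jE]]] := set_extension KE bE; rewrite Ege in jE.
have jin (z : L) : E (j z) by rewrite -jE; exists z.
have jout l : (forall c, c \in l -> E c) -> exists us : seq L, map j us = l.
  elim: l => [|c l IH] lE; first by exists [::].
  have [d dl|us usE] := IH; first by apply: lE; rewrite inE dl orbT.
  have : E c by apply: lE; rewrite mem_head.
  by rewrite -jE => -[u _ <-]; exists (u :: us); rewrite /= usE.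
have split_min (F : {subfield L}) (x : L) : exists2 r, uniq r & minPoly F x == \prod_(y <- r) ('X - y%:P).
  have [cs ucs csP] := conjugates Et (jin x).
  have [us usE] : exists us : seq L, map j us = cs by apply: jout => c /csP[s Hs ->]; apply: En.
  have uus : uniq us by rewrite -usE in ucs; exact: map_uniq ucs.
  pose Q := \prod_(u <- us) ('X - u%:P).
  have jQ : map_poly j Q = \prod_(c <- cs) ('X - c%:P).
    rewrite rmorph_prod -usE big_map; apply: eq_bigr => u _.
    by rewrite rmorphB /= map_polyX map_polyC.
  have Q1 : Q \is a polyOver 1%VS.
    apply/polyOverP => i; have := conjugates_fixed i (conj Et En) (jin x) ucs csP.
    rewrite -jQ coef_map /= => Ki; apply/vlineP; exists (ofK Ki).
    by apply: (fmorph_inj j); rewrite jA ofKE.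
  have Qx : root Q x.
    rewrite root_prod_XsubC; have : j x \in cs by apply/csP; exists id => //; split.
    by rewrite -usE => /mapP[u uus' /fmorph_inj ->].
  have : minPoly F x %| Q.
    apply: dvdp_trans (minPoly_dvdp Q1 Qx); exact: (minPolyS _ (sub1v F)).
  case/dvdp_prod_XsubC => m mE; exists (mask m us); first exact: mask_uniq.
  by rewrite -eqp_monic ?monic_minPoly ?monic_prod_XsubC.
have ax : SplittingField.axiom L.
  by apply: normal_field_splitting => F x; have [r _ rE] := split_min F x; exists r.
have sepL (x : L) : separable_element 1 x.
  apply/separable_elementP; exists (minPoly 1%AS x); have [r ur /eqP rE] := split_min 1%AS x.
  by rewrite minPolyOver root_minPoly rE separable_prod_XsubC.
pose N : splittingFieldType T := HB.pack L (FieldExt_isSplittingField.Build T L ax).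
exists N, j; split=> //; last by exists n; rewrite -cI.
apply/and3P; split; first exact: sub1v.
  by apply/separableP => x _; exact: sepL.
apply/normalFieldP => x _; have [r ur /eqP rE] := split_min 1%AS x; exists r => //.
by apply/allP => z _; rewrite memvf.
Qed.

Lemma tower_L E : tower p setT E -> E `<=` L_set p (k:=k).
Proof.
move=> /normal_closure[E' En EE'] x /EE' E'x; apply: gen_subfield_sub; right.
by exists E' => //; exact: normal_tower_galois.
Qed.

(** The union of all towers is a field closed under Artin-Schreier roots, so [galois_p_sub] puts
    every Galois p-extension inside it. *)
Lemma L_tower x : L_set p x -> exists2 E, tower p setT E & E x.
Proof.
pose S : set M := [set x | exists2 E : set M, tower p setT E & E x].
have Sf : subfield_set S.
  split=> [|u v /set_mem[E1 t1 E1u] /set_mem[E2 t2 E2v]|u v /set_mem[E1 t1 E1u] /set_mem[E2 t2 E2v]]; apply/mem_set.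
  - by exists K; [exact: tower0|exact: gsf1].
  - have [E [Et /(_ _ E1u) Eu /(_ _ E2v) Ev _]] := tower_join pchark t1 t2; exists E => //.
    by have [_ EB _] := subfield_subring (tower_subfield Et); apply: EB.
  - have [E [Et /(_ _ E1u) Eu /(_ _ E2v) Ev _]] := tower_join pchark t1 t2; exists E => //.
    by have Es := tower_subfield Et; have [_ _ EM] := subfield_subring Es; apply: EM => //; exact: subfieldV.
have KS z : K z -> S z by exists K; [exact: tower0|].
apply: (gen_subfield_min Sf) => z [/KS //|[E [N [j [jA galN [n dimN] ->]]] [u _ <-]]].
have pcharN : p \in [pchar N] by rewrite -(fmorph_pchar j).
apply: (galois_p_sub pcharN (X := S) galN dimN) => [|y [E' E't E'y]|a].
- exact: subfield_subring.
- by exists (adjoin E' y); [exact: tower_adjoin|exact: adjoin_gen].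
- by rewrite jA; apply: KS; exact: Tval.
Qed.

End NormalTowers.

(** * Valuations *)

Section Valuations.
Variables (M : fieldType) (S : set M) (w : M -> rat).
Hypotheses (Ss : subfield_set S) (wS : valuation_on S w).
Implicit Types (x y z : M) (c d : rat).

Let Sr : subring_set S. Proof. exact: subfield_subring. Qed.
Let S1 : S 1. Proof. by have [] := Sr. Qed.
Let SB x y : S x -> S y -> S (x - y). Proof. by have [_ SB _] := Sr; exact: SB. Qed.
Let SM x y : S x -> S y -> S (x * y). Proof. by have [_ _ SM] := Sr; exact: SM. Qed.
Let SX x n : S x -> S (x ^+ n). Proof. exact: sringX. Qed.
Let SN x : S x -> S (- x). Proof. exact: sringN. Qed.
Let SV x : S x -> S x^-1. Proof. exact: subfieldV. Qed.

Lemma valuationM x y : S x -> S y -> x != 0 -> y != 0 -> w (x * y) = w x + w y.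
Proof. by have [wM _] := wS; exact: wM. Qed.

Lemma valuation1 : w 1 = 0.
Proof. by have := valuationM S1 S1 (oner_neq0 M) (oner_neq0 M); rewrite mulr1; lra. Qed.

Lemma valuationX x n : S x -> x != 0 -> w (x ^+ n) = n%:R * w x.
Proof.
move=> Sx x0; elim: n => [|n IH]; first by rewrite expr0 valuation1 mul0r.
rewrite exprS valuationM ?expf_neq0 ?IH //; last exact: SX.
by rewrite -[n.+1]addn1 natrD; lra.
Qed.

Lemma valuationV x : S x -> x != 0 -> w x^-1 = - w x.
Proof.
move=> Sx x0; have := valuationM Sx (SV Sx) x0; rewrite invr_eq0 mulfV // valuation1 => /(_ x0); lra.
Qed.

Lemma valuationN x : S x -> x != 0 -> w (- x) = w x.
Proof.
move=> Sx x0; have N1 : -1 != 0 :> M by rewrite oppr_eq0 oner_neq0.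
have w1 : w (-1) = 0.
  by have := valuationM (SN S1) (SN S1) N1 N1; rewrite mulrNN mulr1 valuation1; lra.
by rewrite -mulN1r valuationM ?w1 ?add0r //; exact: SN.
Qed.

(** The elements of value at least c. The clause [x != 0] admits 0 whatever the meaningless number
    [w 0] is. *)
Definition vge c : set M := [set x | S x /\ (x != 0 -> c <= w x)].

Lemma vge0 c : vge c 0. Proof. by split; [exact: sring0|rewrite eqxx]. Qed.

Lemma vgeN c x : vge c x -> vge c (- x).
Proof. by move=> [Sx cx]; split; [exact: SN|rewrite oppr_eq0 => x0; rewrite valuationN // cx]. Qed.

Lemma vgeD c x y : vge c x -> vge c y -> vge c (x + y).
Proof.
move=> [Sx cx] [Sy cy]; split=> [|xy0]; first exact: sringD.
have [x0|x0] := eqVneq x 0; first by move: xy0; rewrite x0 add0r; exact: cy.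
have [y0|y0] := eqVneq y 0; first by move: xy0; rewrite y0 addr0; exact: cx.
have [_ wD] := wS; apply: le_trans (wD _ _ Sx Sy x0 y0 xy0).
by rewrite le_min cx // cy.
Qed.

Lemma vgeB c x y : vge c x -> vge c y -> vge c (x - y).
Proof. by move=> cx cy; apply: vgeD => //; exact: vgeN. Qed.

Lemma vgeM c d x y : vge c x -> vge d y -> vge (c + d) (x * y).
Proof.
move=> [Sx cx] [Sy cy]; split=> [|]; first exact: SM.
by rewrite mulf_eq0 negb_or => /andP[x0 y0]; rewrite valuationM // lerD ?cx ?cy.
Qed.

Lemma vge_le c d x : d <= c -> vge c x -> vge d x.
Proof. by move=> dc [Sx cx]; split=> // x0; apply: le_trans dc _; exact: cx. Qed.

Lemma vge_subring : subring_set (vge 0).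
Proof.
split=> [|x y|x y]; [|exact: vgeB|].
- by split=> //; rewrite valuation1.
- by move=> x0 y0; rewrite -[0]addr0; exact: vgeM.
Qed.

(** The ultrametric inequality: an element nearer to z than z is to 0 has the value of z. *)
Lemma val_close z a : S z -> S a -> z != 0 -> (z - a != 0 -> w z < w (z - a)) ->
  a != 0 /\ w a = w z.
Proof.
move=> Sz Sa z0 za; have [a0|a0] := eqVneq a 0.
  by move: za; rewrite a0 subr0 z0 => /(_ isT); rewrite ltxx.
split=> //; have [E|d0] := eqVneq (z - a) 0; first by move/eqP: E; rewrite subr_eq0 => /eqP ->.
have d1 := za d0; have Sd := SB Sz Sa; have [_ wD] := wS.
have le1 : w z <= w a.
  have [] : vge (w z) (z - (z - a)) by apply: vgeB; split=> // _; exact: ltW.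
  by rewrite opprB addrC subrK => _; apply.
apply/eqP; rewrite eq_le le1 andbT.
have := wD _ _ Sa Sd a0 d0; rewrite addrC subrK => /(_ z0).
by rewrite ge_min => /orP[//|]; rewrite leNgt d1.
Qed.

(** Otherwise x^-1 has positive value, and the equation divided by x^n writes -1 as a sum of terms
    of positive value. *)
Lemma val_integral (f : {poly M}) x : S x -> f \is monic -> (forall i, vge 0 f`_i) -> root f x ->
  vge 0 x.
Proof.
move=> Sx fm f0 fx; split=> // x0; rewrite leNgt; apply/negP => wx.
have y0 : x^-1 != 0 by rewrite invr_eq0.
have Sy := SV Sx; have wy := valuationV Sx x0.
have fs : size f = (size f).-1.+1 by rewrite prednK // lt0n size_poly_eq0 monic_neq0.
move: fx; rewrite rootE horner_coef fs big_ord_recr /= -lead_coefE (monicP fm) mul1r.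
set n := (size f).-1; move/eqP => E.
have : vge (w x^-1) (- 1).
  have -> : - 1 = \sum_(i < n) f`_i * (x ^+ i * x^-1 ^+ n).
    have -> : \sum_(i < n) f`_i * (x ^+ i * x^-1 ^+ n) = (\sum_(i < n) f`_i * x ^+ i) * x^-1 ^+ n.
      by rewrite mulr_suml; apply: eq_bigr => i _; rewrite mulrA.
    by move/eqP: E; rewrite addr_eq0 => /eqP ->; rewrite mulNr exprVn mulfV // expf_neq0.
  elim/big_ind: _ => [|u v|i _]; [exact: vge0|exact: vgeD|].
  rewrite -[w _]add0r; apply: vgeM; first exact: f0.
  split=> [|_]; first by apply: SM; apply: SX.
  rewrite valuationM ?expf_neq0 ?valuationX //; [|exact: SX|exact: SX].
  have := ltn_ord i; rewrite -(ler_nat rat) -[i.+1]addn1 natrD wy => lin.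
  have : (i%:R + 1 - n%:R) * w x >= 0 by rewrite mulr_le0 // ?subr_le0 // ltW.
  by rewrite !mulrDl mulNr; lra.
by move=> [_ /(_ _)]; rewrite oppr_eq0 oner_neq0 valuationN ?oner_neq0 // valuation1 => /(_ isT); rewrite wy; lra.
Qed.

End Valuations.

(** * The valuations of K above lambda *)

Section BaseValuations.
Variables (k : closedFieldType) (p : nat).
Hypothesis pchark : p \in [pchar k].
Local Notation M := (glaurent k).
Implicit Types (x y z : M) (n : nat) (c mu lambda : k) (f g : {poly k}).
Let p_pr : prime p. Proof. exact: pcharf_prime pchark. Qed.
Let K : set M := K_set p (k:=k).
Let Ks : subfield_set K. Proof. exact: gen_subfield_closed. Qed.
Let inv_neq0 n : prime_to_p p n -> n%:R^-1 != 0 :> rat.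
Proof. by move=> [n0 _]; rewrite invr_eq0 pnatr_eq0 -lt0n. Qed.
Let tpow_neq0 d : tpow k d != 0.
Proof. by apply/eqP => /(congr1 (fun F : M => F d)) /eqP; rewrite gmonoE eqxx oner_eq0. Qed.
Let const_neq0 c : c != 0 -> c%:A != 0 :> M.
Proof. by move=> c0; rewrite scaler_eq0 negb_or c0 oner_neq0. Qed.

Section Nu.
Variables (lambda : k) (v : M -> rat).
Hypothesis l0 : lambda != 0.
Hypothesis nuv : nu p lambda v.

Let vK : valuation_on K v. Proof. by have [] := nuv. Qed.

Lemma nu_horner f : f != 0 -> v (horner_alg (tpow k 1) f) = (mup lambda f)%:R.
Proof.
move=> f0; have [_ vfg _] := nuv; have := vfg _ _ f0 (oner_neq0 _).
by rewrite rmorph1 divr1 (mupNroot (q := 1)) ?subr0 // root1.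
Qed.

Lemma nu_const c : c != 0 -> v (c%:A) = 0.
Proof.
move=> c0; have := @nu_horner c%:P; rewrite polyC_eq0 horner_algC => /(_ c0) ->.
by rewrite mupNroot // rootC.
Qed.

Lemma nu_tpow n : prime_to_p p n -> v (tpow k n%:R^-1) = 0.
Proof.
move=> np; have := valuationX Ks vK n (K_root np) (tpow_neq0 _).
rewrite tpowX -[_ *+ n]mulr_natr mulVf ?pnatr_eq0 -?lt0n; last by case: np.
have := @nu_horner 'X; rewrite polyX_eq0 horner_algX => /(_ isT) ->.
rewrite mupNroot ?rootX // => /esym/eqP; rewrite mulf_eq0 pnatr_eq0.
by case/orP => /eqP // n0; case: np; rewrite n0.
Qed.

Lemma nu_uniformizer : v (tpow k 1 - lambda%:A) = 1.
Proof.
have := @nu_horner ('X - lambda%:P); rewrite polyXsubC_eq0 rmorphB /= horner_algX horner_algC => /(_ isT) ->.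
by have := mup_XsubCX 1 lambda lambda; rewrite expr1 eqxx => ->.
Qed.

Lemma nu_int x : K x -> x != 0 -> exists z : int, v x = z%:~R.
Proof.
move=> Kx x0; have [_ _ vZ] := nuv; have : value_group K v (v x) by exists x.
by rewrite vZ => -[z _ <-]; exists z.
Qed.

Lemma nu_R_ring x : gen_subring (R_gens p (k:=k)) x -> vge K v 0 x.
Proof.
apply; split; first by have [a b c] := vge_subring Ks vK; split=> [|u w /set_mem uS /set_mem wS|u w /set_mem uS /set_mem wS]; apply/mem_set; [exact: a|exact: b|exact: c].
move=> _ [[n np <-]|[n np <-]]; first by split=> [|_]; [exact: K_root|rewrite nu_tpow].
rewrite tpowN; split=> [|_]; first exact: (subfieldV Ks (K_root np)).
by rewrite (valuationV Ks vK) ?nu_tpow ?oppr0 //; exact: K_root.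
Qed.

Lemma nu_teval n f : prime_to_p p n -> vge K v 0 (teval n%:R^-1 f).
Proof.
move=> np; rewrite /teval /horner_alg /horner_morph horner_coef size_map_poly.
have Vr := vge_subring Ks vK; have [_ _ VM] := Vr.
apply: (sring_sum Vr) => i _; rewrite coef_map /=; apply: VM.
  split=> [|a0]; first exact: K_const.
  rewrite nu_const //; apply: contra_neq a0 => ->; exact: scale0r.
by apply: (sringX Vr); split=> [|_]; [exact: K_root|rewrite nu_tpow].
Qed.

(** t - lambda, of value 1, is the product of the t^(1/n) - z over the n-th roots z of lambda, so
    some factor has positive value. *)
Lemma nu_root n : prime_to_p p n -> exists mu, 0 < v (teval n%:R^-1 ('X - mu%:P)).
Proof.
move=> np; apply: contrapT => no.
have le0 mu : v (teval n%:R^-1 ('X - mu%:P)) <= 0.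
  by rewrite leNgt; apply/negP => gt0; apply: no; exists mu.
have [r rE] := closed_field_poly_normal ('X^n - lambda%:P).
have n0 : (0 < n)%N by case: np.
have : v (teval n%:R^-1 (\prod_(z <- r) ('X - z%:P))) <= 0.
  elim: (r) => [|z l IH]; first by rewrite big_nil rmorph1 (valuation1 Ks vK).
  rewrite big_cons rmorphM (valuationM vK) ?teval_eq0 ?inv_neq0 ?polyXsubC_eq0 //.
  - by have := le0 z; move: IH; lra.
  - exact: K_teval.
  - exact: K_teval.
  - exact/monic_neq0/monic_prod_XsubC.
move: rE; rewrite lead_coefXnsubC // scale1r => <-.
rewrite rmorphB rmorphXn /= /teval horner_algX horner_algC tpowX -[_ *+ n]mulr_natr mulVf; last first.
  by rewrite pnatr_eq0 -lt0n.
by rewrite nu_uniformizer.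
Qed.

Lemma nu_unit n mu g : prime_to_p p n -> 0 < v (teval n%:R^-1 ('X - mu%:P)) -> g.[mu] != 0 ->
  v (teval n%:R^-1 g) = 0.
Proof.
move=> np vmu gmu; have [q qE] : exists q, g.[mu]%:P - g = q * ('X - mu%:P).
  by apply/factor_theorem; rewrite rootE !hornerE subrr.
have cK : K (g.[mu]%:A) by exact: K_const.
have [_ ->] : teval n%:R^-1 g != 0 /\ v (teval n%:R^-1 g) = v (g.[mu]%:A); last exact: nu_const.
apply: (val_close Ks vK) => //; [exact: K_teval|exact: const_neq0|].
have -> : g.[mu]%:A - teval n%:R^-1 g = teval n%:R^-1 q * teval n%:R^-1 ('X - mu%:P).
  by rewrite -rmorphM -qE rmorphB /= /teval horner_algC.
rewrite mulf_eq0 negb_or => /andP[q0 m0]; rewrite nu_const // (valuationM vK) //; try exact: K_teval.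
by have [_ /(_ q0)] := nu_teval q np; move: vmu; lra.
Qed.

Lemma nu_fraction x : K x -> x != 0 -> 0 <= v x -> exists n mu f g,
  [/\ prime_to_p p n, 0 < v (teval n%:R^-1 ('X - mu%:P)), g.[mu] != 0 &
      x = teval n%:R^-1 f / teval n%:R^-1 g].
Proof.
move=> /(K_fraction pchark)[n [f [g [np g0 xE]]]] x0 vx.
have f0 : f != 0 by apply: contra_neq x0 => f0; rewrite xE f0 rmorph0 mul0r.
have [mu vmu] := nu_root np.
have [a [f1 f1mu fE]] := multiplicity_XsubC f mu; have [b [g1 g1mu gE]] := multiplicity_XsubC g mu.
rewrite f0 /= in f1mu; rewrite g0 /= in g1mu.
set T := teval n%:R^-1 in xE vmu *.
have T0 h : h != 0 -> T h != 0 by rewrite /T teval_eq0 // inv_neq0.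
have TK h : K (T h) by exact: K_teval.
have X0 : T ('X - mu%:P) != 0 by apply: T0; rewrite polyXsubC_eq0.
have nz h : ~~ root h mu -> h != 0 by apply: contraNneq => ->; exact: root0.
have vT h (c : nat) h1 : ~~ root h1 mu -> h = h1 * ('X - mu%:P) ^+ c -> v (T h) = c%:R * v (T ('X - mu%:P)).
  move=> h1mu ->; rewrite /T rmorphM rmorphXn -/T (valuationM vK) ?expf_neq0 //; last first.
  - by apply: T0; exact: nz.
  - exact: (sringX (subfield_subring Ks)).
  by rewrite (valuationX Ks vK) // (nu_unit np vmu) // add0r.
have ba : (b <= a)%N.
  move: vx; rewrite xE (valuationM vK) ?(valuationV Ks vK) ?invr_eq0 ?T0 //; last exact: (subfieldV Ks).
  by rewrite (vT _ _ _ f1mu fE) (vT _ _ _ g1mu gE) -mulrBl pmulr_lge0 // subr_ge0 ler_nat.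
exists n, mu, (f1 * ('X - mu%:P) ^+ (a - b)), g1; split=> //.
rewrite xE fE gE /T -[in LHS](subnK ba) exprD !rmorphM /= !rmorphXn /= -/T.
have Xb : T ('X - mu%:P) ^+ b != 0 by rewrite expf_neq0.
by have := T0 _ (nz _ g1mu); move: (T f1) (T g1) (T _ ^+ (a - b)) Xb => A B C Xb B0; field; rewrite Xb B0.
Qed.

(** After cancellation the fraction is regular at mu, and c is its value there. As the values are
    integers, a positive one is at least 1. *)
Lemma nu_residue x : vge K v 0 x -> exists c, vge K v 1 (x - c%:A).
Proof.
move=> [Kx vx]; have [->|x0] := eqVneq x 0; first by exists 0; rewrite scale0r subr0; exact: vge0.
have [n [mu [f [g [np vmu gmu xE]]]]] := nu_fraction Kx x0 (vx x0).
exists (f.[mu] / g.[mu]); set c := _ / _; split=> [|d0].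
  by have [_ KB _] := subfield_subring Ks; apply: KB => //; exact: K_const.
have [q qE] : exists q, f - c%:P * g = q * ('X - mu%:P).
  by apply/factor_theorem; rewrite rootE !hornerE /c divfK // subrr.
have g0 : teval n%:R^-1 g != 0 :> M.
  by rewrite teval_eq0 ?inv_neq0 //; apply: contraNneq gmu => ->; rewrite horner0.
have dE : x - c%:A = teval n%:R^-1 q * teval n%:R^-1 ('X - mu%:P) / teval n%:R^-1 g.
  rewrite -rmorphM -qE rmorphB rmorphM /= xE mulrBl; congr (_ - _).
  have -> : teval n%:R^-1 c%:P = c%:A :> M by exact: horner_algC.
  by rewrite mulfK.
have Kd : K (x - c%:A) by have [_ KB _] := subfield_subring Ks; apply: KB => //; exact: K_const.
have [z zE] := nu_int Kd d0; rewrite zE -[1]/(1%:~R) ler_int -gtz0_ge1 -(ltr0z rat) -zE.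
rewrite dE in d0 *.
have q0 : teval n%:R^-1 q != 0 :> M by apply: contraNneq d0 => ->; rewrite !mul0r.
have X0 : teval n%:R^-1 ('X - mu%:P) != 0 :> M by apply: contraNneq d0 => ->; rewrite mulr0 mul0r.
have gV0 : (teval n%:R^-1 g)^-1 != 0 :> M by rewrite invr_eq0.
have KT h : K (teval n%:R^-1 h) by exact: K_teval.
rewrite (valuationM vK) ?(valuationV Ks vK) ?(nu_unit np vmu gmu) ?mulf_neq0 //; last first.
- exact: (subfieldV Ks).
- by have [_ _ KM] := subfield_subring Ks; apply: KM.
rewrite oppr0 addr0 (valuationM vK) //.
by have [_ /(_ q0)] := nu_teval q np; move: vmu; lra.
Qed.

End Nu.
End BaseValuations.

(** * The order of a series, and the images of unramified integral elements *)

Section Order.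
Variable k : fieldType.
Local Notation M := (glaurent k).
Implicit Types (F G : M) (q r : rat).

Definition gord F : rat :=
  if pselect (exists q, F q != 0 /\ forall r, F r != 0 -> q <= r) is left H then projT1 (cid H) else 0.

Lemma gordP F : F != 0 -> F (gord F) != 0 /\ forall r, F r != 0 -> gord F <= r.
Proof.
move=> F0; rewrite /gord; case: pselect => [H|[]]; first by case: (cid H).
have [|v Fv vmin] := @gsupp_wo _ _ _ (@subset_refl _ (gsupp F)); last by exists v.
apply: contrapT => nF; case/eqP: F0; apply: glaurentP => q.
by apply/eqP; apply: contrapT => /negP Fq; apply: nF; exists q.
Qed.

Lemma coef_neq0 F q : F q != 0 -> F != 0.
Proof. by apply: contraNneq => ->; rewrite gcoef0. Qed.

Lemma gord_unique F q : F q != 0 -> (forall r, F r != 0 -> q <= r) -> gord F = q.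
Proof.
move=> Fq qmin; have [Fo omin] := gordP (coef_neq0 Fq).
by apply/eqP; rewrite eq_le omin // qmin.
Qed.

Lemma gordM F G : F != 0 -> G != 0 -> gord (F * G) = gord F + gord G.
Proof.
move=> /gordP[Fa Fmin] /gordP[Gb Gmin]; apply: gord_unique => [|r].
  rewrite gcoefM (convE (s := [:: gord F])) // ?big_seq1.
    by rewrite [_ + gord G]addrC addrK mulf_neq0.
  move=> r /Fmin rF /Gmin rG; rewrite inE eq_le rF andbT; move: rG; lra.
by rewrite gcoefM => /conv_neq0[q /Fmin qF /Gmin qG]; move: qF qG; lra.
Qed.

Lemma gordD F G : F != 0 -> G != 0 -> F + G != 0 -> Num.min (gord F) (gord G) <= gord (F + G).
Proof.
move=> /gordP[_ Fmin] /gordP[_ Gmin] /gordP[FG _]; rewrite ge_min.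
have [F0|F0] := eqVneq (F (gord (F + G))) 0; last by rewrite Fmin.
by move: FG; rewrite gcoefD F0 add0r => /Gmin ->; rewrite orbT.
Qed.

End Order.

Arguments gord {k} F.

Section Completion.
Variables (k : closedFieldType) (p : nat).
Hypothesis pchark : p \in [pchar k].
Local Notation M := (glaurent k).
Let p_pr : prime p. Proof. exact: pcharf_prime pchark. Qed.
Let K : set M := K_set p (k:=k).

Section HomValuation.
Variables (E : set M) (s : M -> M) (lambda : k).
Hypothesis KE : K `<=` E.
Hypothesis Es : subfield_set E.
Hypothesis Hs : hom_at lambda E s.
Hypothesis l0 : lambda != 0.

Let Hs' : hom_on E s. Proof. by case: Hs. Qed.
Let sM x y : E x -> E y -> s (x * y) = s x * s y. Proof. by have [_ _] := Hs'; apply. Qed.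

Lemma hom_valuation : valuation_on E (gord \o s).
Proof.
have [_ sD _] := Hs'; split=> x y Ex Ey x0 y0 /=.
  by rewrite sM // gordM // (hom_on_neq0 Es Hs').
move=> xy0; have Exy : E (x + y) by apply: (sringD (subfield_subring Es)).
rewrite sD //; apply: gordD; try exact: (hom_on_neq0 Es Hs').
by rewrite -sD //; exact: (hom_on_neq0 Es Hs').
Qed.

Let Kt : K (tpow k 1). Proof. by have := K_root (k := k) (prime_to_p1 pchark); rewrite invr1. Qed.

Let s_uniformizer : s (tpow k 1 - lambda%:A) = lambda *: tpow k 1.
Proof.
have [_ sa st] := Hs; rewrite (hom_onB Es Hs') ?st ?sa; [|exact: KE|by apply: KE; exact: K_const].
by rewrite scalerDr addrC addKr.
Qed.

(** t is the image of t / lambda - 1, so every leading monomial with integral exponent can be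
    removed by an element of K. *)
Lemma hom_tpow (z : int) : exists2 e, K e & s e = tpow k z%:~R.
Proof.
have Ks : subfield_set K by exact: gen_subfield_closed.
have Kr := subfield_subring Ks; have [_ KB KM] := Kr.
have lK : K (lambda%:A) by exact: K_const.
pose u := (tpow k 1 - lambda%:A) / lambda%:A.
have Kd : K (tpow k 1 - lambda%:A) by exact: KB.
have Ku : K u by apply: KM => //; exact: (subfieldV Ks).
have su : s u = tpow k 1.
  have [_ sa _] := Hs; rewrite /u (hom_on_div Es Hs') ?s_uniformizer ?sa; [|exact: KE|exact: KE].
  by rewrite -[lambda *: tpow k 1]mulr_algl mulrAC mulfV ?mul1r // scaler_eq0 negb_or l0 oner_neq0.
case: z => n.
  exists (u ^+ n); first exact: (sringX Kr).
  by rewrite (hom_onX Es Hs') ?su ?tpowX -?pmulrn //; exact: KE.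
exists (u ^+ n.+1)^-1; first by apply: (subfieldV Ks); exact: (sringX Kr).
rewrite (hom_onV Es Hs') ?(hom_onX Es Hs') ?su ?tpowX -?tpowN ?NegzE ?mulrNz -?pmulrn //; first exact: KE.
by apply: KE; exact: (sringX Kr).
Qed.

Lemma hom_nu : nu p lambda (gord \o s).
Proof.
have [vM vD] := hom_valuation; have np1 := prime_to_p1 pchark.
have ET f : E (teval 1%:R^-1 f) by apply: KE; exact: K_teval.
have n0 : 1%:R^-1 != 0 :> rat by rewrite invr_eq0 oner_neq0.
have T0 f : (teval 1%:R^-1 f == 0 :> M) = (f == 0) by exact: teval_eq0.
have Es1 := hom_valuation.
have gordT f : f != 0 -> gord (s (teval 1%:R^-1 f)) = (mup lambda f)%:R.
  move=> f0; have [m [q qr fE]] := multiplicity_XsubC f lambda.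
  rewrite f0 /= in qr; have q0 : q != 0 by apply: contraNneq qr => ->; exact: root0.
  have X0 : 'X - lambda%:P != 0 by rewrite polyXsubC_eq0.
  have mf : mup lambda f = m by rewrite fE mupMr // mup_XsubCX eqxx.
  have EXm : E (teval 1%:R^-1 ('X - lambda%:P) ^+ m).
    by apply: (sringX (subfield_subring Es)); exact: ET.
  have ->: gord (s (teval 1%:R^-1 f)) = (gord \o s) (teval 1%:R^-1 f) by [].
  rewrite fE rmorphM rmorphXn vM ?T0 ?expf_neq0 ?T0 //; last exact: ET.
  rewrite (valuationX Es Es1) ?T0 //; last exact: ET.
  have -> : (gord \o s) (teval 1%:R^-1 ('X - lambda%:P)) = 1.
    rewrite /= /teval rmorphB /= horner_algX horner_algC invr1 s_uniformizer.
    apply: gord_unique => [|r]; first by rewrite gcoefZ gmonoE eqxx mulr1.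
    by rewrite gcoefZ gmonoE; case: (r =P 1) => [->//|_]; rewrite mulr0 eqxx.
  have -> : (gord \o s) (teval 1%:R^-1 q) = 0.
    have qP : power_series (s (teval 1%:R^-1 q)) by exact: (hom_at_teval_power pchark KE Es Hs l0).
    apply: gord_unique => [|r /qP[n ->]]; last exact: ler0n.
    have [_ _ st] := Hs; rewrite (hom_at_teval KE Es Hs) // invr1 st horner_alg_coef0 //.
    - apply: (sringD (power_subring k)); [by have [] := power_subring k|exact: power_tpow1].
    - by rewrite gcoefD gcoef1 eqxx gmonoE addr0.
  by rewrite mulr1 add0r -fE mf.
split.
- by split=> x y /KE Ex /KE Ey; [exact: vM|exact: vD].
- move=> f g f0 g0; have hT h : horner_alg (tpow k 1) h = teval 1%:R^-1 h by rewrite invr1.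
  have Ef := ET f; have Eg := ET g; have EVg := subfieldV Es Eg.
  by rewrite !hT vM ?invr_eq0 ?T0 // (valuationV Es Es1) ?T0 //= !gordT.
- apply/seteqP; split=> [_ [x [Kx x0] <-]|_ [z _ <-]].
    have sx0 := hom_on_neq0 Es Hs' (KE Kx) x0; have [so _] := gordP sx0.
    by have [z zE] := hom_at_K pchark KE Es Hs l0 Kx so; exists z.
  have [e Ke sE] := hom_tpow z; exists e; last first.
    rewrite /= sE; apply: gord_unique => [|r]; first by rewrite gmonoE eqxx oner_neq0.
    by rewrite gmonoE; case: (r =P z%:~R) => [->//|_]; rewrite eqxx.
  split=> //; apply/eqP => e0; move: sE; rewrite e0 (hom_on0 Es Hs') => /(congr1 (fun F : M => F z%:~R)).
  by rewrite gmonoE eqxx gcoef0 => /esym/eqP; rewrite oner_eq0.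
Qed.

End HomValuation.

(** Unramifiedness gives all elements of K(G) images of integral order, and from this the exponents
    of the image of G itself are integral; integrality over R, whose elements have nonnegative
    value, excludes poles. *)
Lemma L0_integral G : L0 p G ->
  integralOver (val : subring_of (R_gens p (k:=k)) -> M) G -> AS_integers p G.
Proof.
move=> [LG unr] [f fm fG]; rewrite -(everywhere_power_series pchark).
have [E Et EG] := L_tower pchark LG; exists E => //; split=> // lambda s l0 Hs.
have Es := tower_subfield Et; have KE := tower_K Et; have [Hs' sa _] := Hs.
set S := gen_subfield _ in unr.
have Ss : subfield_set S by exact: gen_subfield_closed.
have SE : S `<=` E by apply: gen_subfield_min => // x [/KE|->].
have KS : K `<=` S by move=> x Kx; apply: gen_subfield_sub; left.
have wE := hom_valuation Es Hs; have nuw := hom_nu KE Es Hs l0.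
have wS : valuation_on S (gord \o s).
  by have [vM vD] := wE; split=> x y /SE Ex /SE Ey; [exact: vM|exact: vD].
have vg := unr lambda _ _ l0 nuw wS (fun _ _ _ => erefl).
have sG : laurent_series (s G).
  move=> q0 Gq0; apply: contrapT => nq0.
  (* Subtracting the leading monomial, an image from K, keeps x in K(G) and leaves the coefficient
     at the nonintegral q0 untouched. As the orders are integers, each step raises the order by at
     least 1, so it finally passes q0. *)
  have step N : exists x, [/\ S x, s x q0 != 0 & forall q, s x q != 0 -> gord (s G) + N%:R <= q].
    elim: N => [|N [x [Sx xq0 xN]]].
      exists G; split=> //; first by apply: gen_subfield_sub; right.
      by move=> q Gq; rewrite addr0; have [_] := gordP (coef_neq0 Gq0); apply.
    have intv y : S y -> s y q0 != 0 -> exists z : int, gord (s y) = z%:~R.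
      move=> Sy yq; have : value_group S (gord \o s) (gord (s y)).
        exists y => //; split=> //; apply: contraNneq yq => ->.
        by rewrite (hom_on0 Es Hs') gcoef0.
      by rewrite vg => -[z _ <-]; exists z.
    have [z zE] := intv x Sx xq0; have [e Ke se] := hom_tpow KE Es Hs l0 z.
    have [sxz xmin] := gordP (coef_neq0 xq0); rewrite zE in sxz xmin.
    pose c := s x z%:~R; have Kc : K (c%:A) by exact: K_const.
    have [_ SB SM] := subfield_subring Ss.
    pose x' := x - c%:A * e; have Sx' : S x' by apply: SB => //; apply: SM; exact: KS.
    have sx' : s x' = s x - c *: tpow k z%:~R.
      have [_ _ sM] := Hs'; have Ece : E (c%:A * e) by exact: SE _ (SM _ _ (KS _ Kc) (KS _ Ke)).
      by rewrite /x' (hom_onB Es Hs' (SE _ Sx) Ece) (sM _ _ (KE _ Kc) (KE _ Ke)) sa se mulr_algl.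
    have x'q0 : s x' q0 != 0.
      rewrite sx' gcoefB gcoefZ gmonoE; case: (q0 =P z%:~R) => [E0|_]; last by rewrite mulr0 subr0.
      by case: nq0; exists z.
    exists x'; split=> // q x'q; have [z' z'E] := intv x' Sx' x'q0.
    have [sx'o x'min] := gordP (coef_neq0 x'q0).
    have zz' : z%:~R < z'%:~R :> rat.
      rewrite -z'E lt_neqAle; apply/andP; split.
        apply: contraNneq sx'o => <-; rewrite sx' gcoefB gcoefZ gmonoE eqxx mulr1 subrr //.
      move: sx'o; move: (gord (s x')) => o; rewrite sx' gcoefB gcoefZ gmonoE; case: (o =P z%:~R) => [->//|_].
      by rewrite mulr0 subr0 => /xmin.
    have := x'min _ x'q; rewrite z'E; have := xN _ sxz.
    move: zz'; rewrite ltr_int -lezD1 -(ler_int rat) intrD -[N.+1]addn1 natrD; lra.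
  have [N qN] := archi_mulrn (q0 - gord (s G)) (@ltr01 rat).
  by have [x [_ xq0 /(_ _ xq0)]] := step N; move: qN; lra.
have [_ wG] : vge E (gord \o s) 0 G.
  apply: (val_integral Es wE EG (f := map_poly (val : {rmorphism subring_of (R_gens p (k:=k)) -> M}) f)).
  - exact: monic_map.
  - move=> i; rewrite coef_map; have [Kc cP] := nu_R_ring l0 nuw (set_mem (valP f`_i)).
    by split; [exact: KE|exact: cP].
  - exact: fG.
move=> e Ge; have [z zE] := sG _ Ge; exists `|z|%N.
have sG0 := coef_neq0 Ge; have G0 : G != 0.
  by apply: contraNneq sG0 => ->; rewrite (hom_on0 Es Hs').
have := wG G0; have [_ /(_ _ Ge)] := gordP sG0; rewrite /= zE => h1 h2.
have : 0 <= z%:~R :> rat by apply: le_trans h1.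
by rewrite ler0z => z0; rewrite -[in LHS](gez0_abs z0) -pmulrn.
Qed.

End Completion.

(** * Products in ideals, and integrality over R *)

(** Modulo y each F_i is a multiple of x_i, so the product of the F_i is a multiple of the product
    of the x_i. *)
Lemma prod_sum_ideal (M : fieldType) (W : set M) (I : eqType) (l : seq I) (F x : I -> M) y : subring_set W ->
  W y -> (forall i, i \in l -> W (x i)) ->
  (forall i, i \in l -> exists a b, [/\ W a, W b & F i = x i * a + y * b]) ->
  exists c d, [/\ W c, W d & \prod_(i <- l) F i = (\prod_(i <- l) x i) * c + y * d].
Proof.
move=> Wr Wy; have [W1 _ WM] := Wr; elim: l => [|i l IH] Wx WF.
  by exists 1, 0; rewrite !big_nil mulr1 mulr0 addr0; split=> //; exact: sring0.
have [j jl|j jl|c [d [Wc Wd E]]] := IH; [by apply: Wx; rewrite inE jl orbT|by apply: WF; rewrite inE jl orbT|].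
have [a [b [Wa Wb FE]]] := WF i (mem_head i l); have Wi := Wx i (mem_head i l).
have WX : W (\prod_(j <- l) x j).
  by rewrite big_seq; apply: (sring_prod Wr) => j jl; apply: Wx; rewrite inE jl orbT.
exists (a * c), (x i * a * d + b * ((\prod_(j <- l) x j) * c + y * d)); split.
- exact: WM.
- apply: (sringD Wr); first by do 2?[apply: (WM)].
  by apply: (WM) => //; apply: (sringD Wr); apply: (WM).
- by rewrite !big_cons E FE; ring.
Qed.

Lemma prime_field_nat (p : nat) (A : nzRingType) (phi : {rmorphism 'F_p -> A}) (x : 'F_p) :
  phi x = (x : nat)%:R.
Proof. by rewrite -{1}[x]natr_Zp rmorph_nat. Qed.

Section Integrality.
Variables (k : closedFieldType) (p : nat) (phi : {rmorphism 'F_p -> k}).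
Hypothesis pchark : p \in [pchar k].
Hypothesis kalg : forall x : k, algebraicOver phi x.
Local Notation M := (glaurent k).
Let p_pr : prime p. Proof. exact: pcharf_prime pchark. Qed.
Let p_gt0 : (0 < p)%N. Proof. exact: prime_gt0. Qed.
Let pcharM : p \in [pchar M]. Proof. exact: pchar_glaurent. Qed.
Let R := gen_subring (R_gens p (k:=k)).
Let Rr : subring_set R.
Proof.
have [a b c] := @gen_subring_closed M (R_gens p (k:=k)); split=> [|x y Rx Ry|x y Rx Ry]; apply: set_mem; first exact: a.
  by apply: b; exact: mem_set.
by apply: c; exact: mem_set.
Qed.

Lemma R_tpow (d : rat) : ~~ (p %| `|denq d|)%N -> R (tpow k d).
Proof.
move=> pd; have np : prime_to_p p `|denq d|%N by split; rewrite // absz_gt0 denq_eq0.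
have dn : (`|denq d|%N)%:R = (denq d)%:~R :> rat by have := denq_gt0 d; case: (denq d).
have dE : d = (`|denq d|%N)%:R^-1 * (numq d)%:~R.
  by rewrite dn mulrC divq_num_den.
have gen x : R_gens p x -> R x by move=> Rx S [_]; exact.
rewrite dE; case: (numq d) => j.
  rewrite -pmulrn mulr_natr -tpowX; apply: (sringX Rr); apply: gen; left.
  by exists `|denq d|%N.
rewrite NegzE mulrNz mulrN -mulNr -pmulrn mulr_natr -tpowX; apply: (sringX Rr); apply: gen; right.
by exists `|denq d|%N.
Qed.

Let V := (val : {rmorphism subring_of (R_gens p (k:=k)) -> M}).

(** Constants are integral because they are algebraic over the prime field, whose elements are
    natural numbers in R; the other generators are units of R or roots of monic Artin-Schreier
    polynomials. *)
Lemma AS_integers_integral x : AS_integers p x -> integralOver V x.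
Proof.
apply: AS_integers_min => {x}; split=> [|a|d pd|y Iy].
- split=> [|x y|x y]; [exact: (integral1 V)|exact: integral_sub|exact: integral_mul].
- have /integral_algebraic[g gm ga] := kalg a.
  apply: (@integral_root_monic _ _ V _ (map_poly (in_alg M) (map_poly phi g))).
  + by rewrite !monic_map.
  + by rewrite rmorph_root.
  + apply/integral_poly => i; rewrite !coef_map /= prime_field_nat; move: (nat_of_ord _) => m.
    have -> : m%:R%:A = m%:R :> M by exact: (rmorph_nat (in_alg M)).
    exact: (integral_nat V).
- pose u : subring_of (R_gens p (k:=k)) := Sub (tpow k d) (mem_set (R_tpow pd)).
  by have := integral_id V u; rewrite [V u]SubK.
- apply: (@integral_root_monic _ _ V _ (AS_poly p (y ^+ p - y))).
  + by rewrite monicE lead_coefE (size_AS_poly pcharM) /AS_poly !coefB coefXn coefX coefC eqxx !gtn_eqF ?subr0 // prime_gt1.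
  + by rewrite root_AS_poly.
  + apply/integral_poly => i; rewrite /AS_poly !coefB coefXn coefX coefC.
    apply: integral_sub; first by apply: integral_sub; exact: integral_nat.
    by case: eqP => _ //; exact: (integral0 V).
Qed.

End Integrality.

(** * Ramification of Artin-Schreier integers *)

Section Unramified.
Variables (k : closedFieldType) (p : nat) (phi : {rmorphism 'F_p -> k}).
Hypothesis pchark : p \in [pchar k].
Hypothesis kalg : forall x : k, algebraicOver phi x.
Local Notation M := (glaurent k).
Implicit Types (x y z a b : M).
Let p_pr : prime p. Proof. exact: pcharf_prime pchark. Qed.
Let p_gt0 : (0 < p)%N. Proof. exact: prime_gt0. Qed.
Let p_gt1 : (1 < p)%N. Proof. exact: prime_gt1. Qed.
Let pcharM : p \in [pchar M]. Proof. exact: pchar_glaurent. Qed.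
Let K : set M := K_set p (k:=k).
Let Ks : subfield_set K. Proof. exact: gen_subfield_closed. Qed.
Let Kr := subfield_subring Ks.
Let O : set M := AS_integers p (k:=k).
Let HO : AS_ring_closed p O. Proof. exact: AS_integers_closed. Qed.
Let Or : subring_set O. Proof. by have [] := HO. Qed.
Let frobD x y : (x + y) ^+ p = x ^+ p + y ^+ p.
Proof. by rewrite -[X in _ ^+ X](expn1 p) (gfrobD pchark). Qed.

Section Place.
Variables (lambda : k) (v : M -> rat).
Hypothesis l0 : lambda != 0.
Hypothesis nuv : nu p lambda v.
Let vK : valuation_on K v. Proof. by have [] := nuv. Qed.
Let V0 := vge K v 0.
Let V0r : subring_set V0 := vge_subring Ks vK.
Let s : M := tpow k 1 - lambda%:A.
Let vs : v s = 1. Proof. exact: nu_uniformizer nuv. Qed.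
Let s0 : s != 0.
Proof.
have <- : teval 1%:R^-1 ('X - lambda%:P) = s.
  by rewrite /teval rmorphB /= horner_algX horner_algC invr1.
by rewrite teval_eq0 ?polyXsubC_eq0 // invr_eq0 oner_neq0.
Qed.
Let Ksx : K s.
Proof.
have [_ KB _] := Kr; apply: KB; last exact: K_const.
by have := K_root (k := k) (prime_to_p1 pchark); rewrite invr1.
Qed.
Let KX n : K (s ^+ n). Proof. exact: (sringX Kr). Qed.
Let sX0 n : s ^+ n != 0. Proof. exact: expf_neq0. Qed.

(* The localization of O at the place v. *)
Let W : set M := [set y | exists u, [/\ K u, u != 0, v u = 0, O u & O (u * y)]].

Let W_sub : O `<=` W.
Proof.
move=> x Ox; exists 1; rewrite oner_neq0 (valuation1 Ks vK) mul1r.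
by split=> //; [have [] := Kr|have [] := Or].
Qed.

Let Wr : subring_set W.
Proof.
have [O1 OB OM] := Or; have [_ _ KM] := Kr.
split=> [|x y [u [Ku u0 vu Ou Oux]] [w [Kw w0 vw Ow Owy]]|x y [u [Ku u0 vu Ou Oux]] [w [Kw w0 vw Ow Owy]]].
- exact: W_sub.
- exists (u * w); rewrite mulf_neq0 // (valuationM vK) // vu vw addr0; split=> //; [exact: KM|exact: OM|].
  have -> : u * w * (x - y) = w * (u * x) - u * (w * y) by ring.
  by apply: (OB); apply: (OM).
- exists (u * w); rewrite mulf_neq0 // (valuationM vK) // vu vw addr0; split=> //; [exact: KM|exact: OM|].
  have -> : u * w * (x * y) = (u * x) * (w * y) by ring.
  exact: OM.
Qed.

Let W_V0 : V0 `<=` W.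
Proof.
move=> x [Kx vx]; have [->|x0] := eqVneq x 0; first exact: (sring0 Wr).
have [n [mu [f [g [np vmu gmu xE]]]]] := nu_fraction pchark l0 nuv Kx x0 (vx x0).
have g0 : teval n%:R^-1 g != 0 :> M.
  have [n0 _] := np; rewrite teval_eq0 ?invr_eq0 ?pnatr_eq0 -?lt0n //.
  by apply: contraNneq gmu => ->; rewrite horner0.
exists (teval n%:R^-1 g); split=> //.
- exact: K_teval.
- exact: (nu_unit l0 nuv np vmu gmu).
- exact: AS_integers_teval.
- by rewrite xE mulrC divfK //; exact: AS_integers_teval.
Qed.

Let vge_div N x : vge K v N%:R x -> V0 (x / s ^+ N).
Proof.
move=> [Kx vx]; have [_ _ KM] := Kr; split=> [|]; first by apply: KM => //; exact: (subfieldV Ks).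
rewrite mulf_eq0 negb_or => /andP[x0 _].
rewrite (valuationM vK) ?invr_eq0 //; last exact: (subfieldV Ks).
by rewrite (valuationV Ks vK) // (valuationX Ks vK) // vs mulr1 subr_ge0 vx.
Qed.

(* If b solves the equation with error e then b + e solves it with error e^p. *)
Lemma AS_approx_root a (N : nat) : V0 a -> exists2 b, V0 b & vge K v N%:R (b ^+ p - b - a).
Proof.
move=> Va; elim: N => [|N [b Vb Ve]].
  exists 0; first exact: (sring0 V0r).
  by rewrite expr0n gtn_eqF //= subrr sub0r; apply: (sringN V0r).
case: N b Vb Ve => [|N] b Vb Ve.
  (* From precision 0 to precision 1 adding the error gains nothing; instead the equation is solved
     in the residue field [k]. *)
  have [c Vc] := nu_residue pchark l0 nuv Va.
  have [d dE] : exists d : k, d ^+ p - d = c.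
    have /closed_rootP[d] : size (AS_poly p c) != 1%N by rewrite (size_AS_poly pchark) eqSS gtn_eqF.
    by rewrite root_AS_poly => /eqP dE; exists d.
  exists (d%:A).
    split=> [|d0]; first exact: K_const.
    by rewrite (nu_const nuv) //; apply: contraNneq d0 => ->; rewrite scale0r.
  have -> : d%:A ^+ p - d%:A - a = - (a - c%:A) :> M.
    by rewrite exprZn expr1n -scalerBl dE opprB.
  exact: (vgeN Ks vK).
set e := b ^+ p - b - a in Ve; have Ve0 : V0 e by apply: vge_le Ve; exact: ler0n.
exists (b + e); first exact: (sringD V0r).
have -> : (b + e) ^+ p - (b + e) - a = e ^+ p by rewrite frobD /e; ring.
have [Ke ve] := Ve; split=> [|ep0]; first exact: (sringX Kr).
have e0 : e != 0 by apply: contraNneq ep0 => ->; rewrite expr0n gtn_eqF.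
rewrite (valuationX Ks vK) //; have := ve e0; have : 2 <= p%:R :> rat by rewrite ler_nat.
move=> p2 vN; apply: le_trans (_ : 2 * N.+1%:R <= _).
  by rewrite -natrM ler_nat; lia.
by apply: ler_pM => //; rewrite ler0n.
Qed.

(* In every extension of v, z is as close as desired to one of m elements of K. *)
Definition approximable z := exists m : nat, forall N : nat, exists l : seq M,
  [/\ size l = m, forall a, a \in l -> V0 a &
      exists2 d, W d & \prod_(a <- l) (z - a) = s ^+ N * d].

Let approx_V0 z : V0 z -> approximable z.
Proof.
move=> Vz; exists 1%N => N; exists [:: z]; split=> // [a|]; first by rewrite inE => /eqP ->.
by exists 0; [exact: (sring0 Wr)|rewrite big_seq1 subrr mulr0].
Qed.

Let approx_op z z' (op : M -> M -> M) : O z -> O z' -> approximable z -> approximable z' ->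
  (forall a b, V0 a -> V0 b -> V0 (op a b)) ->
  (forall a b, V0 a -> V0 b -> exists c d, [/\ W c, W d & op z z' - op a b = (z - a) * c + (z' - b) * d]) ->
  approximable (op z z').
Proof.
move=> Oz Oz' [m1 H1] [m2 H2] opV opE; have [_ WB WM] := Wr.
exists (m1 * m2)%N => N; have [l1 [s1 V1 [d1 Wd1 E1]]] := H1 N; have [l2 [s2 V2 [d2 Wd2 E2]]] := H2 N.
exists [seq op a b | a <- l1, b <- l2]; split; first by rewrite size_allpairs s1 s2.
  by move=> _ /allpairsP[[a b] /= [al bl ->]]; apply: opV; [exact: V1|exact: V2].
have Wz a : a \in l1 -> W (z - a) by move=> /V1 Va; apply: (WB); [exact: W_sub|exact: W_V0].
have Wz' b : b \in l2 -> W (z' - b) by move=> /V2 Vb; apply: (WB); [exact: W_sub|exact: W_V0].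
have WX : W (\prod_(b <- l2) (z' - b)) by rewrite big_seq; apply: (sring_prod Wr).
rewrite big_allpairs_dep.
have [a al|c [d [Wc Wd ->]]] := @prod_sum_ideal _ W _ l1
    (fun a => \prod_(b <- l2) (op z z' - op a b)) (fun a => z - a) (\prod_(b <- l2) (z' - b)) Wr WX Wz.
  have [b bl|c [d [Wc Wd ->]]] := @prod_sum_ideal _ W _ l2
      (fun b => op z z' - op a b) (fun b => z' - b) (z - a) Wr (Wz a al) Wz'.
    by have [c [d [Wc Wd ->]]] := opE a b (V1 _ al) (V2 _ bl); exists d, c; rewrite addrC.
  by exists d, c; rewrite addrC.
exists (d1 * c + d2 * d); first by apply: (sringD Wr); apply: (WM).
by rewrite E1 E2; ring.
Qed.

(** An approximant a of y^p - y yields the p approximants beta + i of y, where beta^p - beta is a up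
    to s^N: the product of the y - beta - i is y^p - y - (beta^p - beta). *)
Let approx_AS y : O y -> approximable (y ^+ p - y) -> approximable y.
Proof.
move=> Oy; set f := y ^+ p - y => -[m Hm]; have [_ WB _] := Wr.
have Of : O f by have [_ OB _] := Or; apply: OB => //; exact: (sringX Or).
exists (m * p)%N => N; have [l [sl Vl [d Wd E]]] := Hm N.
have /choice[beta betaP] : forall a, exists b, V0 a -> V0 b /\ vge K v N%:R (b ^+ p - b - a).
  move=> a; have [Va|nVa] := pselect (V0 a); last by exists 0.
  by have [b Vb eb] := AS_approx_root N Va; exists b.
exists [seq beta a + i%:R | a <- l, i <- iota 0 p]; split.
- by rewrite size_allpairs size_iota sl.
- move=> _ /allpairsP[[a i] /= [/Vl/betaP[Vb _] _ ->]].
  by apply: (sringD V0r) => //; apply: (sring_nat V0r); have [] := V0r.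
rewrite big_allpairs_dep.
have prodE a : \prod_(i <- iota 0 p) (y - (beta a + i%:R)) = f - (beta a ^+ p - beta a).
  have := AS_poly_roots pcharM (v := idfun) (erefl (beta a ^+ p - beta a)).
  move=> /(congr1 (fun Q : {poly M} => Q.[y])); rewrite map_poly_id // /AS_poly !hornerE -/f => ->.
  by rewrite big_map horner_prod; apply: eq_bigr => i _; rewrite !hornerE.
under eq_bigr do rewrite prodE.
have Wfa a : a \in l -> W (f - a) by move=> /Vl Va; apply: (WB); [exact: W_sub|exact: W_V0].
have WsN : W (s ^+ N).
  apply: W_V0; apply: (sringX V0r); split=> // _; rewrite vs; exact: ler01.
have [a al|c [d' [Wc Wd' ->]]] := @prod_sum_ideal _ W _ l
    (fun a => f - (beta a ^+ p - beta a)) (fun a => f - a) (s ^+ N) Wr WsN Wfa.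
  have [_ /vge_div/W_V0 We] := betaP a (Vl a al).
  exists 1, (- ((beta a ^+ p - beta a - a) / s ^+ N)); split; [by have [] := Wr|exact: (sringN Wr)|].
  by rewrite mulrN [s ^+ N * _]mulrC divfK //; ring.
have [_ _ WM] := Wr; exists (d * c + d'); first by apply: (sringD Wr) => //; apply: (WM).
by rewrite E; ring.
Qed.

Lemma AS_integers_approximable x : O x -> approximable x.
Proof.
suff sub : O `<=` [set x | O x /\ approximable x] by move=> /sub[].
clear x; have [_ OB OM] := Or; have [_ WB WM] := Wr; have [V1 VB VM] := V0r; have [_ Oa Od OA] := HO.
have W1 : W 1 by have [] := Wr.
apply: AS_integers_min; split=> [|a|d pd|y [Oy Ay]].
- split=> [|x y [Ox Ax] [Oy Ay]|x y [Ox Ax] [Oy Ay]].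
  + by split; [have [] := Or|exact: approx_V0].
  + split; first exact: OB.
    apply: (approx_op (op := fun a b => a - b)) => // a b Va Vb.
    by exists 1, (-1); split=> //; [exact: (sringN Wr)|ring].
  + split; first exact: OM.
    apply: (approx_op (op := fun a b => a * b)) => // a b Va Vb.
    exists y, a; split; [exact: W_sub|exact: W_V0|ring].
- split; first exact: Oa.
  apply: approx_V0; split=> [|a0]; first exact: K_const.
  by rewrite (nu_const nuv) //; apply: contraNneq a0 => ->; rewrite scale0r.
- by split; [exact: Od|apply: approx_V0; apply: (nu_R_ring l0 nuv); exact: R_tpow].
- by have Oy' := OA _ Oy; split=> //; exact: approx_AS.
Qed.

Section Extension.
Variables (E : set M) (w : M -> rat).
Hypotheses (Es : subfield_set E) (KE : K `<=` E).
Hypotheses (wE : valuation_on E w) (wv : extends_valuation K v w).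

Let integer_ge0 x : O x -> E x -> vge E w 0 x.
Proof.
move=> Ox Ex; have [f fm fx] := AS_integers_integral pchark kalg Ox.
apply: (val_integral Es wE Ex (f := map_poly (val : {rmorphism subring_of (R_gens p (k:=k)) -> M}) f)) => //.
  exact: monic_map.
move=> i; rewrite coef_map; have [Kc cP] := nu_R_ring l0 nuv (set_mem (valP f`_i)).
by split=> [|c0]; [exact: KE|rewrite wv // cP].
Qed.

Let local_ge0 x : W x -> E x -> x != 0 -> 0 <= w x.
Proof.
move=> [u [Ku u0 vu Ou Oux]] Ex x0; have Eu := KE Ku; have [_ _ EM] := subfield_subring Es.
have [_ /(_ (mulf_neq0 u0 x0))] := integer_ge0 Oux (EM _ _ Eu Ex).
by rewrite (valuationM wE) // wv // vu add0r.
Qed.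

(** If w(z - a) <= w(z) for all m approximants a, their product has value at most m w(z) < N,
    although it is s^N times an element of nonnegative value. So some a in K is close enough to z to
    share its value. *)
Let integer_value z : O z -> E z -> z != 0 -> exists a, [/\ K a, a != 0 & w z = v a].
Proof.
move=> Oz Ez z0; have [m Hm] := AS_integers_approximable Oz.
pose N := Num.bound `|m%:R * w z|.
have mN : m%:R * w z < N%:R by apply: le_lt_trans (ler_norm _) (archi_boundP (normr_ge0 _)).
have [l [sl Vl [d Wd E1]]] := Hm N; have [_ EB EM] := subfield_subring Es.
have Kl a : a \in l -> K a by move=> /Vl[].
have [zl|zl] := boolP (z \in l); first by exists z; split=> //; [exact: Kl|apply: wv => //; exact: Kl].
have Ea a : a \in l -> E a by move=> al; apply: KE; exact: Kl.
have za a : a \in l -> z - a != 0 by move=> al; rewrite subr_eq0; apply: contraNneq zl => ->.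
have [[a al wa]|no] := pselect (exists2 a, a \in l & w z < w (z - a)).
  have [a0 wE'] := val_close Es wE Ez (Ea a al) z0 (fun _ => wa).
  by exists a; split=> //; [exact: Kl|rewrite -wE' wv //; exact: Kl].
have Pz : \prod_(a <- l) (z - a) != 0.
  by rewrite prodf_seq_neq0; apply/allP => a al; apply/implyP => _; exact: za.
have EP : E (\prod_(a <- l) (z - a)).
  by rewrite big_seq; apply: (sring_prod (subfield_subring Es)) => a al; apply: EB => //; exact: Ea.
have step (r1 r2 : rat) (n : nat) : r1 <= w z -> r2 <= n%:R * w z -> r1 + r2 <= n.+1%:R * w z.
  by move=> ? ?; rewrite -[n.+1]addn1 natrD; lra.
have le1 : w (\prod_(a <- l) (z - a)) <= m%:R * w z.
  rewrite -sl; clear - wE Es EB EM Ez Ea za no step.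
  elim: l Ea za no => [|a l IH] Ea za no; first by rewrite big_nil (valuation1 Es wE) mul0r.
  have lS b : b \in l -> b \in a :: l by rewrite inE => ->; rewrite orbT.
  have Ea' b : b \in l -> E b by move/lS/Ea. have za' b : b \in l -> z - b != 0 by move/lS/za.
  rewrite big_cons (valuationM wE) /=.
  - have no' : ~ exists2 b, b \in l & w z < w (z - b).
      by move=> [b bl wb]; apply: no; exists b => //; exact: lS.
    apply: step; last exact: IH.
    by rewrite leNgt; apply/negP => wa; apply: no; exists a => //; exact: mem_head.
  - by apply: EB => //; apply: Ea; exact: mem_head.
  - rewrite big_seq; apply: (sring_prod (subfield_subring Es)) => b bl; apply: EB => //; exact: Ea'.
  - by apply: za; exact: mem_head.
  - by rewrite prodf_seq_neq0; apply/allP => b bl; apply/implyP => _; exact: za'.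
have d0 : d != 0 by apply: contraNneq Pz => d0; rewrite E1 d0 mulr0.
have EsN : E (s ^+ N) by exact: KE.
have Ed : E d.
  have -> : d = (\prod_(a <- l) (z - a)) / s ^+ N by rewrite E1 mulrC mulKf.
  by apply: EM => //; exact: (subfieldV Es).
move: le1; rewrite E1 (valuationM wE) // [w (s ^+ N)]wv // (valuationX Ks vK) // vs mulr1.
by have := local_ge0 Wd Ed d0; move: mN; lra.
Qed.

(** Every element of K(g) is a quotient of two elements of O in K(g), because the generators are;
    numerator and denominator have values of elements of K. *)
Lemma value_group_integers g : O g -> E = gen_subfield (K `|` [set g]) ->
  value_group E w = range (intr : int -> rat).
Proof.
move=> Og EE; have [_ _ vZ] := nuv; have [_ EB EM] := subfield_subring Es; have [_ OB OM] := Or.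
apply/seteqP; split=> [_ [x [Ex x0] <-]|t zr]; last first.
  by move: zr; rewrite -vZ => -[x [Kx x0] <-]; exists x; [split=> //; exact: KE|exact: wv].
pose D : set M := [set x | exists a b, [/\ O a /\ E a, O b /\ E b, b != 0 & x = a / b]].
have ED : E `<=` D.
  rewrite {1}EE; apply: gen_subfield_min => [|y].
    split=> [|u t /set_mem[a [b [[Oa Ea] [Ob Eb] b0 ->]]] /set_mem[c [d [[Oc Ec] [Od Ed] d0 ->]]]
      |u t /set_mem[a [b [[Oa Ea] [Ob Eb] b0 ->]]] /set_mem[c [d [[Oc Ec] [Od Ed] d0 ->]]]]; apply/mem_set.
    - by exists 1, 1; rewrite oner_neq0 divr1; split=> //; split; (have [] := Or) => // _ _ _; have [] := subfield_subring Es.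
    - exists (a * d - c * b), (b * d); rewrite mulf_neq0 //; split=> //.
      + by split; [apply: (OB); apply: (OM)|apply: (EB); apply: (EM)].
      + by split; [exact: OM|exact: EM].
      + by field; rewrite b0 d0.
    - have [->|c0] := eqVneq c 0.
        exists 0, 1; rewrite oner_neq0 !mul0r invr0 mulr0; split=> //.
          by split; [exact: (sring0 Or)|exact: (sring0 (subfield_subring Es))].
        by split; [have [] := Or|have [] := subfield_subring Es].
      exists (a * d), (b * c); rewrite mulf_neq0 //; split=> //.
      + by split; [exact: OM|exact: EM].
      + by split; [exact: OM|exact: EM].
      + by field; rewrite b0 c0 d0.
  case=> [Ky|->].
    have /(K_fraction pchark)[n [f [h [np h0 ->]]]] := Ky.
    exists (teval n%:R^-1 f), (teval n%:R^-1 h); split=> //.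
    - by split; [exact: AS_integers_teval|apply: KE; exact: K_teval].
    - by split; [exact: AS_integers_teval|apply: KE; exact: K_teval].
    - by have [n0 _] := np; rewrite teval_eq0 // invr_eq0 pnatr_eq0 -lt0n.
  exists g, 1; rewrite divr1 oner_neq0; split=> //.
    by split=> //; rewrite EE; apply: gen_subfield_sub; right.
  by split; [have [] := Or|have [] := subfield_subring Es].
have [a [b [[Oa Ea] [Ob Eb] b0 xE]]] := ED x Ex.
have a0 : a != 0 by apply: contraNneq x0 => a0; rewrite xE a0 mul0r.
have [a' [Ka' a'0 wa]] := integer_value Oa Ea a0.
have [b' [Kb' b'0 wb]] := integer_value Ob Eb b0.
have [za zaE] := nu_int nuv Ka' a'0; have [zb zbE] := nu_int nuv Kb' b'0.
exists (za - zb) => //; rewrite xE (valuationM wE) ?invr_eq0 //; last exact: (subfieldV Es).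
by rewrite (valuationV Es wE) // wa wb zaE zbE intrB.
Qed.

End Extension.
End Place.

Lemma AS_integers_L0 x : O x -> L0 p x.
Proof.
move=> Ox; split.
  have [E Et Ex] := AS_integers_tower pchark Ox.
  by apply: (tower_L pchark (E := E)) => //; apply: tower_mono Et.
move=> lambda v w l0 nuv wE wv.
have Es : subfield_set (gen_subfield (K `|` [set x])) by exact: gen_subfield_closed.
have KE : K `<=` gen_subfield (K `|` [set x]) by move=> y Ky; apply: gen_subfield_sub; left.
exact: (value_group_integers l0 nuv Es KE wE wv Ox erefl).
Qed.

End Unramified.

(** All x^(p^i) are roots of one polynomial over the prime field, so two of them coincide, and the
    Frobenius is injective. *)
Lemma algebraic_frob_fixed (p : nat) (k : fieldType) (phi : {rmorphism 'F_p -> k}) (x : k) :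
  p \in [pchar k] -> algebraicOver phi x -> exists r, (0 < r)%N /\ x ^+ (p ^ r) = x.
Proof.
move=> pchark [f f0 fx].
have mapE : map_poly (pFrobenius_aut pchark) (map_poly phi f) = map_poly phi f.
  by apply/polyP => i; rewrite !coef_map /= prime_field_nat pFrobenius_aut_nat.
have rootX i : root (map_poly phi f) (x ^+ (p ^ i)).
  elim: i => [|i IH]; first by rewrite expn0 expr1.
  by rewrite expnSr exprM -(pFrobenius_autE pchark) -mapE rmorph_root.
pose xs := [seq x ^+ (p ^ i) | i <- iota 0 (size f)].
have : ~~ uniq xs.
  apply/negP => uxs; have := max_poly_roots (p := map_poly phi f) (rs := xs).
  rewrite map_poly_eq0 f0 size_map size_iota size_map_poly ltnn => H.
  suff: false by []; apply: H => //; by apply/allP => _ /mapP[i _ ->].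
case/(uniqPn x) => i [j [ij]]; rewrite size_map size_iota => jf.
have iF := ltn_trans ij jf.
rewrite !(nth_map 0%N) ?size_iota // !nth_iota // !add0n => E.
exists (j - i)%N; rewrite subn_gt0; split=> //; apply: (frob_inj pchark (n := i)).
by rewrite /= -exprM -expnD subnK // ltnW.
Qed.

Theorem theorem4p2 (p : nat) (k : closedFieldType)
    (iota : {rmorphism 'F_p -> k}) :
  prime p ->
  (forall x : k, algebraicOver iota x) ->
  sparse_algebraic p k = Bset p k /\ Bset p k = Ctilde p k.
Proof.
move=> p_pr kalg; have pchark : p \in [pchar k] by rewrite (fmorph_pchar iota) pchar_Fp.
have kfin (x : k) : exists r, (0 < r)%N /\ x ^+ (p ^ r) = x by exact: (algebraic_frob_fixed pchark (kalg x)).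
suff BC : Bset p k = Ctilde p k by rewrite BC (sparse_algebraicE pchark kfin).
rewrite (Ctilde_integers pchark); apply/seteqP; split=> G [j].
  by move=> [LG intG]; exists j; exact: L0_integral.
move=> OG; exists j; split; first exact: (AS_integers_L0 pchark kalg).
exact: (AS_integers_integral pchark kalg).
Qed.
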